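(* Let $p$ be a prime, $0\le t<n$ and $h=n-t$. The complete $L_t$-algebra $B_t$ represents the functor $$\mathrm{Iso}_{\mathbb{G}_0/}(\mathbb{G}_0\oplus_{\mathbb{Z}_p^{h}}\mathbb{Q}_p^{h},\mathbb{G}):\ \text{Complete }L_t\text{-algebras}\to\text{Sets}$$ that sends $$S\mapsto\mathrm{Iso}_{\mathbb{G}_0/}\big(S\otimes_{L_t}\mathbb{G}_0\oplus_{\mathbb{Z}_p^{h}}\mathbb{Q}_p^{h},\ S\otimes\mathbb{G}\big).$$ Here an element of the value at $S$ is a homomorphism $\mathbb{Z}_p^h\to S\otimes\mathbb{G}_0$ together with an isomorphism, under $S\otimes\mathbb{G}_0$, from the resulting pushout $S\otimes\mathbb{G}_0\oplus_{\mathbb{Z}_p^h}\mathbb{Q}_p^h$ (along the inclusion $\mathbb{Z}_p^h\subset\mathbb{Q}_p^h$) to $S\otimes\mathbb{G}$.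
   Context: Setting. $E_n$ is a Morava $E$-theory of height $n$ over a perfect field $k$ of characteristic $p$, $E_n^0\cong W(k)[[u_1,\dots,u_{n-1}]]$; $\mathbb{G}_{E_n}$ is its formal group viewed as a $p$-divisible group with fixed coordinate $x$, $\mathcal{O}_{\mathbb{G}_{E_n}[p^j]}=E_n^0[[x]]/[p^j](x)$ ($[m]$ is the $m$-series). $L_t=L_{K(t)}E_n^0\cong W(k)[[u_1,\dots,u_{n-1}]][u_t^{-1}]^\wedge_{I_t}$, $I_t=(p,u_1,\dots,u_{t-1})$ ($u_0=p$, $I_0=(0)$). $\mathbb{G}=L_t\otimes_{E_n^0}\mathbb{G}_{E_n}$ has connected-étale sequence $0\to\mathbb{G}_0\to\mathbb{G}\to\mathbb{G}_{et}\to0$, with $\mathbb{G}_0$ the $p$-divisible group of the formal group of $L_{K(t)}E_n$ (height $t$), $\mathcal{O}_{\mathbb{G}_0[p^j]}=L_t[[x]]/[p^j](x)$. Complete $L_t$-algebras: $L_t$-algebras $S$ complete with respect to an ideal $J$ containing the image of $I_t$, with continuous $L_t$-algebra maps. Points: $\mathbb{G}(S)=\lim_m\operatorname{colim}_j\hom_{L_t}(\mathcal{O}_{\mathbb{G}[p^j]},S/J^m)$, similarly for $\mathbb{G}_0$; $p$-divisible groups, $\mathbb{Z}_p^h$ and $\mathbb{Q}_p^h$ (constant) are regarded as sheaves of $\mathbb{Z}_p$-modules in the fppf topology on complete algebras, and $\oplus_{\mathbb{Z}_p^h}$ denotes the pushout along $\mathbb{Z}_p^h$. The ring $B_t$. With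 $\bar q=\{q_1,\dots,q_h\}$, $\bar A=\{A_1,\dots,A_h\}$, $$B_t'=\Big(\operatorname{colim}_k L_t[[\bar q]]\otimes_{E_n^0[[\bar q]]}E_n^0[[\bar q,\bar A]]/([p^k](A_1)-q_1,\dots,[p^k](A_h)-q_h)\Big)^\wedge_{I_t+(\bar q)},$$ transition maps $A_j\mapsto[p](A_j)$; $A_j^{(k)}$ is the image of $A_j$ from stage $k$. For $t=0$, $L_t[[\bar q]]$ is replaced by $L_{K(0)}E_n^0(B(\mathbb{Q}_p/\mathbb{Z}_p)^h)=L_0$, i.e. $\bar q=0$. Over $B_t'$ there is $\mathbb{Q}_p^h\to\mathbb{G}$, $b_j/p^k\mapsto A_j^{(k)}$ ($b_j$ the standard basis), sending $b_j$ to $q_j\in\mathbb{G}_0$, hence $\phi:(\mathbb{Q}_p/\mathbb{Z}_p)^h\to\mathbb{G}_{et}$. Put $\Lambda_k=(\mathbb{Z}/p^k)^h$, $\mathcal{O}_{\mathbb{G}_{et}[p^k]}\cong L_t[y]/(j_k(y))$ with $y$ a generator vanishing at the zero section, $\phi_y(i)\in B_t'$ the image of $y$ under the point $\phi(i)$, $R=\{\phi_y(i):k\ge1,\,0\neq i\in\Lambda_k\}$, and $B_t=(R^{-1}B_t')^\wedge_{I_t+(\bar q)}$ (localization at the multiplicative set generated by $R$). $B_t$ is topologized by $I_t+(\bar q)$. *)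

(* Defs.v *)
From HB Require Import structures.
From mathcomp Require Import all_boot.
From mathcomp Require Import ssralg poly ssrint zmodp matrix.
From mathcomp Require Import boolp classical_sets.

Set Implicit Arguments.
Unset Strict Implicit.
Unset Printing Implicit Defensive.

Import GRing.Theory.
Local Open Scope ring_scope.

Notation monom X := {ffun X -> nat}.

(* Power series over R in variables indexed by X. *)
Record mps (X : finType) (R : comPzRingType) :=
  MPS { mcoef :> monom X -> R }.

Definition mdeg (X : finType) (m : monom X) : nat := (\sum_(x : X) m x)%N.

Definition box_mon (X : finType) (N : nat) (a : {ffun X -> 'I_N.+1}) : monom X :=
  [ffun x => nat_of_ord (a x)].

Section Ring.
Context (X : finType) (R : comPzRingType).
Implicit Types (f g h : mps X R) (m a b : monom X).

HB.instance Definition _ := gen_eqMixin (mps X R).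
HB.instance Definition _ := gen_choiceMixin (mps X R).

Lemma mpsP f g : (forall m, f m = g m) -> f = g.
Proof. by case: f g => [f] [g] /= fg; congr MPS; apply/funext. Qed.

Definition mps_add f g := MPS (fun m => f m + g m).
Definition mps_opp f := MPS (fun m => - f m).
Definition mps_zero : mps X R := MPS (fun=> 0).
Definition mps_const (c : R) : mps X R := MPS (fun m => if m == 0 then c else 0).
Definition mps_mul f g : mps X R := MPS (fun m =>
  \sum_(a : {ffun X -> 'I_(mdeg m).+1}) \sum_(b : {ffun X -> 'I_(mdeg m).+1})
    if box_mon a + box_mon b == m then f (box_mon a) * g (box_mon b) else 0).

Let S N (H : monom X -> R) := \sum_(a : {ffun X -> 'I_N.+1}) H (box_mon a).
Let inb N m := [forall x, (m x <= N)%N].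

Lemma inb_box N (a : {ffun X -> 'I_N.+1}) : inb N (box_mon a).
Proof. by apply/forallP => x; rewrite ffunE -ltnS. Qed.

Lemma inb_deg m : inb (mdeg m) m.
Proof. by apply/forallP => x; rewrite /mdeg (bigD1 x) //= leq_addr. Qed.

Lemma box_inj N : injective (@box_mon X N).
Proof.
move=> a b /ffunP ab; apply/ffunP => x; apply/val_inj.
by move: (ab x); rewrite !ffunE.
Qed.

Definition to_box N m : {ffun X -> 'I_N.+1} := [ffun x => inord (m x)].

Lemma to_boxK N m : inb N m -> box_mon (to_box N m) = m.
Proof. by move=> /forallP mN; apply/ffunP => x; rewrite !ffunE inordK ?ltnS. Qed.

Lemma S_single N m (H : monom X -> R) : inb N m ->
  S N (fun a => if a == m then H a else 0) = H m.
Proof.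
move=> mN; rewrite /S (bigD1 (to_box N m)) //= to_boxK // eqxx big1 ?addr0 //.
move=> a /eqP ab; case: eqP => // e; case: ab; apply: (@box_inj N).
by rewrite to_boxK.
Qed.

Lemma eq_S N (H H' : monom X -> R) :
  (forall a, inb N a -> H a = H' a) -> S N H = S N H'.
Proof. by move=> HH; apply: eq_bigr => a _; apply/HH/inb_box. Qed.

Lemma S_exch N M (H : monom X -> monom X -> R) :
  S N (fun a => S M (H a)) = S M (fun b => S N (H^~ b)).
Proof. exact: exchange_big. Qed.

Lemma S_shrink N M (H : monom X -> R) : (N <= M)%N ->
  (forall a, ~~ inb N a -> H a = 0) -> S M H = S N H.
Proof.
move=> NM H0.
have inbM a : inb N a -> inb M a.
  by move=> /forallP aN; apply/forallP => x; apply: leq_trans NM.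
transitivity (S M (fun a => S N (fun b => if b == a then H b else 0))).
  apply: eq_S => a aM; have [aN|aN] := boolP (inb N a); first by rewrite S_single.
  rewrite H0 // /S big1 // => b _; case: eqP => // ba.
  by rewrite -ba inb_box in aN.
rewrite S_exch; apply: eq_S => b bN.
transitivity (S M (fun a => if a == b then H b else 0)).
  by apply: eq_S => a _; rewrite eq_sym.
by rewrite (@S_single M b (fun=> H b)) // inbM.
Qed.

Lemma S0 N : S N (fun=> 0) = 0. Proof. exact: big1. Qed.

Lemma SD N (H H' : monom X -> R) : S N (fun a => H a + H' a) = S N H + S N H'.
Proof. exact: big_split. Qed.

Lemma S_if N (c : bool) (H : monom X -> R) :
  (if c then S N H else 0) = S N (fun a => if c then H a else 0).
Proof. by case: c; rewrite ?S0. Qed.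

Lemma S_distr N r (H : monom X -> R) : r * S N H = S N (fun a => r * H a).
Proof. exact: mulr_sumr. Qed.

Lemma S_distl N r (H : monom X -> R) : S N H * r = S N (fun a => H a * r).
Proof. exact: mulr_suml. Qed.

Lemma inb_addl N a b : inb N (a + b) -> inb N a.
Proof.
move=> /forallP ab; apply/forallP => x; apply: leq_trans (ab x).
by rewrite ffunE leq_addr.
Qed.

Lemma inb_addr N a b : inb N (a + b) -> inb N b.
Proof. by rewrite addrC => /inb_addl. Qed.

Lemma mulE N m f g : inb N m -> mps_mul f g m =
  S N (fun a => S N (fun b => if a + b == m then f a * g b else 0)).
Proof.
move=> mN.
pose H a b := if a + b == m then f a * g b else 0.
have SS M K : (M <= K)%N -> inb M m ->
    S K (fun a => S K (H a)) = S M (fun a => S M (H a)).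
  move=> MK mM; transitivity (S K (fun a => S M (H a))).
    apply: eq_S => a _; apply: S_shrink => // b bM; rewrite /H.
    by case: eqP => // e; move: mM; rewrite -e => /inb_addr; rewrite (negPf bM).
  apply: S_shrink => // a aM; rewrite /S big1 // => b _; rewrite /H.
  by case: eqP => // e; move: mM; rewrite -e => /inb_addl; rewrite (negPf aM).
rewrite -[RHS](SS N (N + mdeg m)%N) ?leq_addr //.
by rewrite (SS (mdeg m)) ?leq_addl ?inb_deg.
Qed.

Lemma mps_mulC : commutative mps_mul.
Proof.
move=> f g; apply: mpsP => m; rewrite !(@mulE (mdeg m)) ?inb_deg //.
rewrite S_exch; apply: eq_S => a _; apply: eq_S => b _.
by rewrite addrC mulrC.
Qed.

Lemma mps_mulDl : left_distributive mps_mul mps_add.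
Proof.
move=> f g h; apply: mpsP => m; rewrite /= -big_split; apply: eq_bigr => a _.
rewrite -big_split; apply: eq_bigr => b _ /=.
by case: ifP; rewrite ?addr0 // mulrDl.
Qed.

Lemma mps_mul1 : left_id (mps_const 1) mps_mul.
Proof.
move=> f; apply: mpsP => m; rewrite (@mulE (mdeg m)) ?inb_deg //.
transitivity (S (mdeg m) (fun a => if a == 0 then f m else 0)); last first.
  by rewrite (@S_single _ _ (fun=> f m)) //; apply/forallP => x; rewrite ffunE.
apply: eq_S => a _ /=; case: eqP => [->|_]; last first.
  by rewrite -[RHS](S0 (mdeg m)); apply: eq_S => b _; rewrite mul0r if_same.
rewrite -[RHS](@S_single (mdeg m) m f) ?inb_deg //.
by apply: eq_S => b _; rewrite add0r mul1r.
Qed.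

Lemma mps_mulA : associative mps_mul.
Proof.
move=> f g h; apply: mpsP => m; set N := mdeg m.
have mN : inb N m := inb_deg m.
pose T a b c := if a + b + c == m then f a * g b * h c else 0.
transitivity (S N (fun a => S N (fun b => S N (T a b)))).
  rewrite (@mulE N) //; apply: eq_S => a aN.
  transitivity (S N (fun e => S N (fun b => S N (fun c =>
     if b + c == e then T a b c else 0)))).
    apply: eq_S => e eN; rewrite (@mulE N) // S_distr S_if.
    apply: eq_S => b bN; rewrite S_distr S_if; apply: eq_S => c cN.
    rewrite /T -addrA; case: (b + c =P e) => [->|_]; last by rewrite mulr0 if_same.
    by rewrite mulrA.
  rewrite S_exch; apply: eq_S => b bN; rewrite S_exch; apply: eq_S => c cN.
  have [bcN|bcN] := boolP (inb N (b + c)).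
    rewrite -[RHS](@S_single N (b + c) (fun=> T a b c)) //.
    by apply: eq_S => e _; rewrite eq_sym.
  have -> : T a b c = 0.
    rewrite /T -addrA; case: eqP => // e; move: mN.
    by rewrite -e => /inb_addr; rewrite (negPf bcN).
  by rewrite -[RHS](S0 N); apply: eq_S => e _; rewrite if_same.
symmetry; rewrite (@mulE N) // S_exch.
transitivity (S N (fun c => S N (fun a => S N (fun b => T a b c)))); last first.
  by rewrite S_exch; apply: eq_S => a _; rewrite S_exch.
apply: eq_S => c cN.
transitivity (S N (fun e => S N (fun a => S N (fun b =>
   if a + b == e then T a b c else 0)))).
  apply: eq_S => e eN; rewrite (@mulE N) // S_distl S_if.
  apply: eq_S => a aN; rewrite S_distl S_if; apply: eq_S => b bN.
  by rewrite /T; case: (a + b =P e) => [->|_]; rewrite // mul0r if_same.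
rewrite S_exch; apply: eq_S => a aN; rewrite S_exch; apply: eq_S => b bN.
have [bcN|bcN] := boolP (inb N (a + b)).
  rewrite -[RHS](@S_single N (a + b) (fun=> T a b c)) //.
  by apply: eq_S => e _; rewrite eq_sym.
have -> : T a b c = 0.
  rewrite /T; case: eqP => // e; move: mN.
  by rewrite -e => /inb_addl; rewrite (negPf bcN).
by rewrite -[RHS](S0 N); apply: eq_S => e _; rewrite if_same.
Qed.

Lemma mps_addA : associative mps_add.
Proof. by move=> f g h; apply: mpsP => m; rewrite /= addrA. Qed.
Lemma mps_addC : commutative mps_add.
Proof. by move=> f g; apply: mpsP => m; rewrite /= addrC. Qed.
Lemma mps_add0 : left_id mps_zero mps_add.
Proof. by move=> f; apply: mpsP => m; rewrite /= add0r. Qed.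
Lemma mps_addN : left_inverse mps_zero mps_opp mps_add.
Proof. by move=> f; apply: mpsP => m; rewrite /= addNr. Qed.

HB.instance Definition _ := GRing.isZmodule.Build (mps X R)
  mps_addA mps_addC mps_add0 mps_addN.
HB.instance Definition _ := GRing.Zmodule_isComPzRing.Build (mps X R)
  mps_mulA mps_mulC mps_mul1 mps_mulDl.

End Ring.

Definition mps_var (X : finType) (R : comPzRingType) (x : X) : mps X R :=
  MPS (fun m => if m == [ffun y => nat_of_bool (y == x)] then 1 else 0).

Notation "''x_' i" := (mps_var _ i) (at level 8, i at level 2, format "''x_' i").

Definition map_mps (X : finType) (R R' : comPzRingType) (phi : R -> R')
  (f : mps X R) : mps X R' := MPS (fun m => phi (f m)).

Section MapMps.
Context (X : finType) (R R' : comPzRingType) (phi : {rmorphism R -> R'}).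

Lemma map_mps_zmod : zmod_morphism (@map_mps X _ _ phi).
Proof. by move=> f g; apply: mpsP => m; rewrite /= rmorphB. Qed.

Lemma map_mps_monoid : monoid_morphism (@map_mps X _ _ phi).
Proof.
split=> [|f g]; apply: mpsP => m /=; first by case: ifP; rewrite ?rmorph1 ?rmorph0.
rewrite rmorph_sum; apply: eq_bigr => a _; rewrite rmorph_sum; apply: eq_bigr => b _.
by case: ifP; rewrite ?rmorph0 // rmorphM.
Qed.

HB.instance Definition _ :=
  GRing.isZmodMorphism.Build (mps X R) (mps X R') (map_mps phi) map_mps_zmod.
HB.instance Definition _ :=
  GRing.isMonoidMorphism.Build (mps X R) (mps X R') (map_mps phi) map_mps_monoid.

Lemma map_mps_const c : map_mps phi (mps_const X c) = mps_const X (phi c).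
Proof. by apply: mpsP => m /=; case: ifP; rewrite ?rmorph0. Qed.

Lemma map_mps_var x : map_mps phi (@mps_var X R x) = 'x_x.
Proof. by apply: mpsP => m /=; case: ifP; rewrite ?rmorph0 ?rmorph1. Qed.
End MapMps.

(* The substitution f(g_x)_x, for g without constant terms: then the product of
   the g_x^(a_x) has no monomial of degree less than the sum of the a_x, so that
   only the exponents a that are enumerated contribute to the coefficient of m. *)
Definition msubst (X Y : finType) (R : comPzRingType)
    (f : mps X R) (g : X -> mps Y R) : mps Y R :=
  MPS (fun m => \sum_(a : {ffun X -> 'I_(mdeg m).+1})
    f (box_mon a) * mcoef (\prod_(x : X) g x ^+ a x) m).

Lemma map_msubst (X Y : finType) (R R' : comPzRingType) (phi : {rmorphism R -> R'})
    (f : mps X R) (g : X -> mps Y R) :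
  map_mps phi (msubst f g) = msubst (map_mps phi f) (fun x => map_mps phi (g x)).
Proof.
apply: mpsP => m /=; rewrite rmorph_sum; apply: eq_bigr => a _.
rewrite rmorphM; congr (_ * _).
rewrite -[LHS]/(mcoef (map_mps phi (\prod_x g x ^+ a x)) m) rmorph_prod.
by congr (mcoef _ m); apply: eq_bigr => x _; rewrite rmorphXn.
Qed.

Definition scomp (Y : finType) (R : comPzRingType) (h : mps unit R) (g : mps Y R) :
  mps Y R := msubst h (fun=> g).

Section FormalGroups.
Context (R : comPzRingType).

(* Two-variable series are indexed by bool: 'x_false comes first. *)
Definition fadd (Y : finType) (F : mps bool R) (f g : mps Y R) : mps Y R :=
  msubst F (fun b => if b then g else f).

Definition formal_group_law (F : mps bool R) : Prop :=
  [/\ fadd F 'x_tt 0 = 'x_tt :> mps unit R,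
      fadd F 0 'x_tt = 'x_tt :> mps unit R,
      fadd F 'x_false 'x_true = fadd F 'x_true 'x_false :> mps bool R
    & forall x y z : 'I_3,
      fadd F (fadd F 'x_x 'x_y) 'x_z = fadd F 'x_x (fadd F 'x_y 'x_z) :> mps 'I_3 R].

Definition nseries (F : mps bool R) (m : nat) : mps unit R :=
  iter m (fadd F 'x_tt) 0.

Definition coef1 (f : mps unit R) (i : nat) : R := f [ffun=> i].
End FormalGroups.

Lemma map_nseries (R R' : comPzRingType) (phi : {rmorphism R -> R'})
    (F : mps bool R) m :
  map_mps phi (nseries F m) = nseries (map_mps phi F) m.
Proof.
elim: m => [|m IHm]; first exact: rmorph0.
rewrite /= -/(nseries F m) -/(nseries (map_mps phi F) m) -IHm {1}/fadd map_msubst.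
by congr msubst; apply/funext => -[//|]; rewrite map_mps_var.
Qed.

Section Ideals.
Context (R : comPzRingType).
Implicit Types J X : set R.

Definition is_ideal J : Prop :=
  [/\ J 0, forall x y, J x -> J y -> J (x + y) & forall r x, J x -> J (r * x)].

Definition idl X : set R := fun x =>
  exists (N : nat) (r g : 'I_N -> R), (forall i, X (g i)) /\ x = \sum_i r i * g i.

Definition idl_pow J (m : nat) : set R :=
  idl (fun x => exists a : 'I_m -> R, (forall i, J (a i)) /\ x = \prod_i a i).

(* The canonical map from R to the limit of the R/J^m is bijective. *)
Definition adic_complete J : Prop :=
  (forall x, (forall m, idl_pow J m x) -> x = 0) /\
  (forall u : nat -> R, (forall m, idl_pow J m (u m.+1 - u m)) ->
     exists x, forall m, idl_pow J m (x - u m)).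

Lemma sub_idl X : (X `<=` idl X)%classic.
Proof.
move=> x Xx; exists 1%N, (fun=> 1), (fun=> x); split=> //.
by rewrite big_ord1 mul1r.
Qed.

Lemma idl_is_ideal X : is_ideal (idl X).
Proof.
split.
- by exists 0%N, (fun=> 0), (fun=> 0); split; [case|rewrite big_ord0].
- move=> x y [N [r [g [Xg ->]]]] [N' [r' [g' [Xg' ->]]]].
  pose G T (a : 'I_N -> T) (a' : 'I_N' -> T) (i : 'I_(N + N')) :=
    match split i with inl j => a j | inr j => a' j end.
  exists (N + N')%N, (G _ r r'), (G _ g g'); split.
    by move=> i; rewrite /G; case: split => j.
  rewrite big_split_ord /=; congr (_ + _); apply: eq_bigr => i _; rewrite /G.
    by rewrite (unsplitK (inl i)).
  by rewrite (unsplitK (inr i)).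
- move=> c x [N [r [g [Xg ->]]]]; exists N, (fun i => c * r i), g; split=> //.
  by rewrite mulr_sumr; apply: eq_bigr => i _; rewrite mulrA.
Qed.

Lemma idl_sub X J : is_ideal J -> (X `<=` J)%classic -> (idl X `<=` J)%classic.
Proof.
move=> [J0 JD JM] XJ x [N [r [g [Xg ->]]]].
by elim/big_ind: _ => // i _; apply/JM/XJ.
Qed.

Lemma idl_powS J m x y : J x -> idl_pow J m y -> idl_pow J m.+1 (x * y).
Proof.
move=> Jx [N [r [g [Jg ->]]]]; exists N, r, (fun i => x * g i); split.
  move=> i; have [a [Ja ->]] := Jg i.
  exists (fun j => oapp a x (unlift ord0 j)); split.
    by move=> j; case: unliftP => [j0|] _ /=.
  rewrite big_ord_recl unlift_none /=; congr (_ * _); apply: eq_bigr => j _.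
  by rewrite liftK.
by rewrite mulr_sumr; apply: eq_bigr => i _; rewrite mulrCA.
Qed.
End Ideals.

Lemma idl_pow_morph (R R' : comPzRingType) (f : {rmorphism R -> R'})
    (J : set R) (J' : set R') a m x :
  (forall y, idl_pow J a y -> J' (f y)) ->
  idl_pow J (a * m) x -> idl_pow J' m (f x).
Proof.
move=> fJ [N [r [g [Jg ->]]]]; rewrite rmorph_sum.
have [P0 PD PM] : is_ideal (idl_pow J' m) by apply: idl_is_ideal.
elim/big_ind: _ => // i _; rewrite rmorphM; apply: (PM).
have {Jg} [c [Jc ->]] := Jg i.
elim: m c Jc {P0 PD PM} => [|m IHm].
  rewrite muln0 => c _; rewrite big_ord0 rmorph1; apply: sub_idl.
  by exists (fun=> 0); split; [case|rewrite big_ord0].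
rewrite mulnS => c Jc; rewrite big_split_ord rmorphM /=.
apply: idl_powS; last exact: IHm.
by apply/fJ/sub_idl; exists (fun j => c (lshift _ j)).
Qed.

Section RingPredicates.
Context (R R' : comPzRingType).

(* R' is the localization of R at the multiplicative set generated by X. *)
Definition is_localization (X : set R) (f : R -> R') : Prop :=
  let M s := exists2 l : seq R, (forall x, x \in l -> X x) & s = \prod_(x <- l) x in
  [/\ forall s, M s -> exists v, f s * v = 1,
      forall z, exists r s, M s /\ z * f s = f r
    & forall r, f r = 0 <-> exists2 s, M s & s * r = 0].

(* R' is the completion of R at J, for J finitely generated: R' is complete at
   the ideal J R' and the maps R/J^m -> R'/J^m R' are bijective. *)
Definition is_completion (J : set R) (f : R -> R') : Prop :=
  let J' := idl (f @` J)%classic in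
  [/\ adic_complete J',
      forall m x, idl_pow J' m (f x) -> idl_pow J m x
    & forall m z, exists x, idl_pow J' m (z - f x)].

(* Flatness of R/J -> R'/J', by the equational criterion. *)
Definition flat_mod (J : set R) (J' : set R') (f : R -> R') : Prop :=
  forall N (a : 'I_N -> R) (b : 'I_N -> R'), J' (\sum_i f (a i) * b i) ->
  exists M (c : 'I_N -> 'I_M -> R) (d : 'I_M -> R'),
    (forall i, J' (b i - \sum_k f (c i k) * d k)) /\
    (forall k, J (\sum_i a i * c i k)).
End RingPredicates.

Definition noetherian (R : comPzRingType) : Prop :=
  forall J : set R, is_ideal J ->
  exists N (g : 'I_N -> R), J = idl (range g).

Definition eval_pol (R R' : comPzRingType) N (f : R -> R') (b : 'I_N -> R')
    (q : seq (R * {ffun 'I_N -> nat})) : R' :=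
  \sum_(t <- q) f t.1 * \prod_i b i ^+ t.2 i.

(* R'/J' is the R/J-algebra presented by finitely many generators b and finitely
   many relations rel. *)
Definition fin_pres_mod (R R' : comPzRingType) (J : set R) (J' : set R')
    (f : {rmorphism R -> R'}) : Prop :=
  exists N (b : 'I_N -> R') (rel : seq (seq (R * {ffun 'I_N -> nat}))),
  (forall q, q \in rel -> J' (eval_pol f b q)) /\
  forall (C : comPzRingType) (rho : {rmorphism R -> C}) (c : 'I_N -> C),
    (forall x, J x -> rho x = 0) ->
    (forall q, q \in rel -> eval_pol rho c q = 0) ->
    let P (chi : {rmorphism R' -> C}) :=
      [/\ forall x, J' x -> chi x = 0, forall r, chi (f r) = rho r
        & forall i, chi (b i) = c i] in
    exists2 chi, P chi & forall chi', P chi' -> chi' =1 chi.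

Section LubinTate.
Context (p n : nat) (k : fieldType) (W : comPzRingType) (pi : {rmorphism W -> k}).

Definition is_witt_ring : Prop :=
  [/\ forall a, exists w, pi w = a,
      forall w, pi w = 0 <-> exists v, w = p%:R * v,
      forall w : W, p%:R * w = 0 -> w = 0
    & adic_complete (idl [set (p%:R : W)]%classic)].

(* W(k)[[u_1, ..., u_{n-1}]]; the variable u_i has index i.-1 in 'I_n.-1. *)
Definition LTring : comPzRingType := mps 'I_n.-1 W.

(* u_0 = p and u_i = 1 for i >= n *)
Definition lt_u (i : nat) : LTring :=
  if i is j.+1 then oapp (@mps_var 'I_n.-1 W) 1 (insub j) else p%:R.

Definition lt_ideal (t : nat) : set LTring :=
  idl [set lt_u i | i in [set i | (i < t)%N]]%classic.

Definition lt_res (f : LTring) : k := pi (f 0).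

(* [p](x) = u_i x^(p^i) + higher terms modulo I_i, up to a unit factor; for
   i = n this says that the reduction of F to k has height n. *)
Definition adapted_coordinates (F : mps bool LTring) : Prop :=
  forall i, (i <= n)%N -> exists2 c : LTring, exists v, c * v = 1 &
  forall j, (j <= p ^ i)%N -> lt_ideal i
    (coef1 (nseries F p) j - (if j == (p ^ i)%N then c * lt_u i else 0)).

(* Lubin-Tate: over a complete local noetherian ring (A, ker rho), a deformation
   of the reduction of F along i : k -> A/m is star-isomorphic to the base change
   of F along a unique phi, by a unique star-isomorphism theta. *)
Definition universal_deformation (F : mps bool LTring) : Prop :=
  forall (A : comPzRingType) (K : fieldType) (rho : {rmorphism A -> K})
    (i : {rmorphism k -> K}) (G : mps bool A),
    noetherian A -> (forall a, exists x, rho x = a) ->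
    adic_complete (fun x => rho x = 0) -> formal_group_law G ->
    map_mps rho G = map_mps (i \o lt_res) F ->
    let P (phi : {rmorphism LTring -> A}) (theta : mps unit A) :=
      [/\ forall x, rho (phi x) = i (lt_res x),
          theta 0 = 0, map_mps rho theta = 'x_tt
        & scomp theta (map_mps phi F) =
          fadd G (scomp theta 'x_false) (scomp theta 'x_true)] in
    exists phi theta, P phi theta /\
      forall phi' theta', P phi' theta' -> phi' =1 phi /\ theta' = theta.

Record morava_E_theory (F : mps bool LTring) : Prop := {
  met_char : p \in [pchar k];
  met_perfect : forall a : k, exists b, b ^+ p = a;
  met_witt : is_witt_ring;
  met_fgl : formal_group_law F;
  met_coord : adapted_coordinates F;
  met_univ : universal_deformation F }.

(* L = (LTring[1/u_t])^_(I_t) *)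
Definition is_Lt (t : nat) (L : comPzRingType) (iota : LTring -> L) : Prop :=
  exists (U : comPzRingType) (e : {rmorphism LTring -> U}) (c : {rmorphism U -> L}),
  [/\ is_localization [set lt_u t]%classic e,
      is_completion (idl (e @` lt_ideal t)%classic) c
    & iota =1 c \o e].
End LubinTate.


Section CompleteAlgebras.
Context (L : comPzRingType) (I : set L).

Record calg := CAlg {
  ca_ring :> comPzRingType;
  ca_map : {rmorphism L -> ca_ring};
  ca_ideal : set ca_ring;
  ca_idealP : is_ideal ca_ideal;
  ca_sub : forall x, I x -> ca_ideal (ca_map x);
  ca_complete : adic_complete ca_ideal }.

Arguments ca_ideal : clear implicits.

Record chom (A B : calg) := CHom {
  ch_hom :> {rmorphism A -> B};
  ch_lin : forall c, ch_hom (ca_map A c) = ca_map B c;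
  ch_cont : exists a, forall x, idl_pow (ca_ideal A) a x -> ca_ideal B (ch_hom x) }.

Section Comp.
Context (A B C : calg) (g : chom B C) (f : chom A B).
Let gf : {rmorphism A -> C} := ch_hom g \o ch_hom f.
Lemma ch_comp_lin c : gf (ca_map A c) = ca_map C c.
Proof. by rewrite /= !ch_lin. Qed.
Lemma ch_comp_cont :
  exists a, forall x, idl_pow (ca_ideal A) a x -> ca_ideal C (gf x).
Proof.
have [a fa] := ch_cont f; have [b gb] := ch_cont g.
by exists (a * b)%N => x /(idl_pow_morph fa) /gb.
Qed.
Definition ch_comp := CHom ch_comp_lin ch_comp_cont.
End Comp.

(* Finite, possibly empty, families of adic maps A -> B_i that are flat and finitely presented
   modulo each J^m and jointly faithfully flat. *)
Definition fppf_cover (A : calg) N (B : 'I_N -> calg) (v : forall i, chom A (B i)) :=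
  let ext i m := idl (v i @` idl_pow (ca_ideal A) m)%classic in
  [/\ forall i, exists a, forall x, idl_pow (ca_ideal (B i)) a x -> ext i 1%N x,
      forall i m, flat_mod (idl_pow (ca_ideal A) m) (ext i m) (v i),
      forall i m, fin_pres_mod (idl_pow (ca_ideal A) m) (ext i m) (ch_hom (v i))
    & forall (P : set A) m, is_ideal P -> (idl_pow (ca_ideal A) m `<=` P)%classic ->
      ~ P 1 -> exists i, ~ idl (v i @` P)%classic 1].

Record over (S : calg) := Over { ov_alg :> calg; ov_map : chom S ov_alg }.

Record ohom (S : calg) (A B : over S) := OHom {
  oh_hom :> chom A B;
  oh_comm : forall s, oh_hom (ov_map A s) = ov_map B s }.

Definition push (S S' : calg) (psi : chom S S') (A : over S') : over S :=
  Over (ch_comp (ov_map A) psi).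

Section Sheaves.
Context (Zp : comPzRingType) (S : calg).

(* The data, without the axioms, of a presheaf of Zp-modules on the complete
   S-algebras. *)
Record psh := Psh {
  sec : over S -> Type;
  padd : forall A, sec A -> sec A -> sec A;
  pscale : forall A, Zp -> sec A -> sec A;
  pres : forall A B, ohom A B -> sec A -> sec B }.

Record pmor (P Q : psh) := PMor {
  pm :> forall A, sec P A -> sec Q A;
  pm_add : forall A x y, pm (padd x y) = padd (pm x) (pm y) :> sec Q A;
  pm_scale : forall A z x, pm (pscale z x) = pscale z (pm x) :> sec Q A;
  pm_res : forall A B (u : ohom A B) x, pm (pres u x) = pres u (pm x) }.

Record zp_sheaf := ZpSheaf {
  sh_mod : over S -> lmodType Zp;
  sh_res : forall A B, ohom A B -> {linear sh_mod A -> sh_mod B};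
  sh_id : forall A (u : ohom A A), u =1 id -> sh_res u =1 id;
  sh_comp : forall A B C (u : ohom A B) (v : ohom B C) (w : ohom A C),
    w =1 v \o u -> sh_res w =1 sh_res v \o sh_res u;
  sh_glue : forall (A : over S) N (B : 'I_N -> over S) (v : forall i, ohom A (B i)),
    fppf_cover v ->
    forall x : forall i, sh_mod (B i),
    (forall i j (C : over S) (g : ohom (B i) C) (h : ohom (B j) C),
       (forall a, g (v i a) = h (v j a)) -> sh_res g (x i) = sh_res h (x j)) ->
    exists! y : sh_mod A, forall i, sh_res (v i) y = x i }.

Definition sheaf_psh (T : zp_sheaf) : psh :=
  Psh (fun A (x y : sh_mod T A) => x + y) (fun A z (x : sh_mod T A) => z *: x)
      (fun A B (u : ohom A B) x => sh_res T u x).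

Definition const_psh (M : Type) (add : M -> M -> M) (scale : Zp -> M -> M) : psh :=
  @Psh (fun=> M) (fun=> add) (fun=> scale) (fun _ _ _ => id).

(* The square is cocartesian in fppf sheaves of Zp-modules. Since only maps to
   sheaves are tested, presheaves stand here for their associated sheaves; in
   particular constant presheaves stand for constant sheaves. *)
Definition sheaf_pushout (P0 P1 P2 P : psh) (f : pmor P0 P1) (g : pmor P2 P)
    (i : forall A, sec P0 A -> sec P2 A) (c : forall A, sec P1 A -> sec P A) : Prop :=
  (forall A x, c A (f A x) = g A (i A x)) /\
  forall (T : zp_sheaf) (a : pmor P1 (sheaf_psh T)) (b : pmor P2 (sheaf_psh T)),
    (forall A x, a A (f A x) = b A (i A x)) ->
    let Q (d : pmor P (sheaf_psh T)) :=
      (forall A x, d A (c A x) = a A x) /\ (forall A x, d A (g A x) = b A x) in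
    exists2 d, Q d & forall d', Q d' -> forall A x, d' A x = d A x.
End Sheaves.
End CompleteAlgebras.

(* R = P o Q for points P, Q, R of the formal group F in A, given by algebra maps
   K[[x]] -> A: the pair (P, Q) is a map K[[x,y]] -> A whose composite with
   h(x) |-> h(F(x,y)) is R. *)
Definition is_sum (K A : comPzRingType) (s : K -> A) (F : mps bool K)
    (P Q R : mps unit K -> A) : Prop :=
  exists Phi : {rmorphism mps bool K -> A}, (forall c, Phi (mps_const _ c) = s c) /\
  forall h, [/\ Phi (scomp h 'x_false) = P h, Phi (scomp h 'x_true) = Q h
              & Phi (scomp h F) = R h].

Arguments ca_ideal {L I} c _.

Section Points.
Context (p : nat) (Zp L : comPzRingType) (I : set L).
Context (K : comPzRingType) (kappa : {rmorphism K -> L}) (F : mps bool K).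

(* The points in S of the p-divisible group with O_[p^j] = L (x) K[[x]]/[p^j](x).
   As S is the limit of the S/J^m, and the maps O_[p^j+1] -> O_[p^j] are onto,
   lim_m colim_j hom_L(O_[p^j], S/J^m) is the set of K-algebra maps K[[x]] -> S
   that, modulo each J^m, kill some [p^j](x). *)
Record pt (A : calg I) := Pt {
  pt_hom :> {rmorphism mps unit K -> A};
  pt_lin : forall c, pt_hom (mps_const _ c) = ca_map A (kappa c);
  pt_tors : forall m, exists j,
    idl_pow (ca_ideal A) m (pt_hom (nseries F (p ^ j))) }.

HB.instance Definition _ A := gen_eqMixin (pt A).
HB.instance Definition _ A := gen_choiceMixin (pt A).

(* Sums and multiples exist and are unique because K[[x]]/[p^j](x) is finite free
   over K after base change to L; the default value is never used. *)
Definition pt_add (A : calg I) (P Q : pt A) : pt A :=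
  xget P [set R | is_sum (ca_map A \o kappa) F P Q R]%classic.

(* z P = a P modulo J^m whenever p^j P = 0 modulo J^m and z = a modulo p^j. *)
Definition pt_scale (A : calg I) (z : Zp) (P : pt A) : pt A :=
  xget P [set R : pt A | forall m j (a : nat),
    idl_pow (ca_ideal A) m (P (nseries F (p ^ j))) ->
    (exists w, z = a%:R + p%:R ^+ j * w) ->
    forall h, idl_pow (ca_ideal A) m (R h - P (scomp h (nseries F a)))]%classic.

Section Res.
Context (A B : calg I) (u : chom A B) (P : pt A).
Let uP : {rmorphism mps unit K -> B} := ch_hom u \o pt_hom P.
Lemma pt_res_lin c : uP (mps_const _ c) = ca_map B (kappa c).
Proof. by rewrite /= pt_lin ch_lin. Qed.
Lemma pt_res_tors m :
  exists j, idl_pow (ca_ideal B) m (uP (nseries F (p ^ j))).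
Proof.
have [a ua] := ch_cont u; have [j Pj] := pt_tors P (a * m).
by exists j; apply: (idl_pow_morph ua).
Qed.
Definition pt_res : pt B := Pt pt_res_lin pt_res_tors.
End Res.

Definition pt_psh (S : calg I) : psh Zp S :=
  @Psh _ _ Zp S (fun A => pt A) (fun A => @pt_add A) (fun A => @pt_scale A)
    (fun A B u => @pt_res A B u).
End Points.

(* The group GG has formal group F over E and GG_0 its base change along iota. *)
Section Iso.
Context (p : nat) (Zp Qp : comPzRingType) (iQ : {rmorphism Zp -> Qp}) (h : nat).
Context (E L : comPzRingType) (I : set L) (iota : {rmorphism E -> L}) (F : mps bool E).

Definition G_psh (S : calg I) : psh Zp S := pt_psh p Zp iota F S.
Definition G0_psh (S : calg I) : psh Zp S :=
  pt_psh p Zp (idfun : {rmorphism L -> L}) (map_mps iota F) S.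

Section Incl.
Context (A : calg I) (P : pt p (idfun : {rmorphism L -> L}) (map_mps iota F) A).
Let Pi : {rmorphism mps unit E -> A} := pt_hom P \o map_mps iota.
Lemma incl_lin c : Pi (mps_const _ c) = ca_map A (iota c).
Proof. by rewrite /= map_mps_const pt_lin. Qed.
Lemma incl_tors m : exists j, idl_pow (ca_ideal A) m (Pi (nseries F (p ^ j))).
Proof. by have [j] := pt_tors P m; exists j; rewrite /= map_nseries. Qed.
Definition G0_incl : pt p iota F A := Pt incl_lin incl_tors.
End Incl.

Definition ZpH_psh (S : calg I) : psh Zp S :=
  const_psh S (@GRing.add 'rV[Zp]_h) (fun z v => z *: v).
Definition QpH_psh (S : calg I) : psh Zp S :=
  const_psh S (@GRing.add 'rV[Qp]_h) (fun z v => iQ z *: v).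

(* An isomorphism theta under GG_0 from the pushout along f to GG amounts to its
   restriction g to Qp^h, for which GG has the universal property of the pushout. *)
Record iso_under (S : calg I) := IsoUnder {
  iu_f : pmor (ZpH_psh S) (G0_psh S);
  iu_g : pmor (QpH_psh S) (G_psh S);
  iu_pushout : sheaf_pushout iu_f iu_g (fun _ v => map_mx iQ v)
    (fun A => @G0_incl A) }.

(* theta' is the base change of theta along psi. *)
Definition base_change (S S' : calg I) (psi : chom S S')
    (theta : iso_under S) (theta' : iso_under S') : Prop :=
  forall A : over S', (iu_f theta' A =1 iu_f theta (push psi A)) /\
                      (iu_g theta' A =1 iu_g theta (push psi A)).

(* The last clause is the naturality of eta. As each eta S is onto, it includes that
   every element of iso_under S has a base change along psi. *)
Definition represents_iso (B : calg I) : Prop :=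
  exists eta : forall S : calg I, chom B S -> iso_under S,
  (forall S, bijective (eta S)) /\
  (forall S S' (psi : chom S S') (phi : chom B S),
     base_change psi (eta S phi) (eta S' (ch_comp psi phi))).

End Iso.

Section BRing.
Context (p n t : nat) (W : comPzRingType).
Notation E := (LTring n W).
Notation h := (n - t)%N.
Context (F : mps bool E) (L : comNzRingType) (iota : {rmorphism E -> L}).

(* O = L (x)_E E[[x]]/[p^j](x) *)
Definition is_torsion_ring (j : nat) (O : comPzRingType)
    (oL : {rmorphism L -> O}) (oE : {rmorphism mps unit E -> O}) : Prop :=
  let cond (A : comPzRingType) (a : L -> A) (P : mps unit E -> A) :=
    (forall c, P (mps_const _ c) = a (iota c)) /\ P (nseries F (p ^ j)) = 0 in
  cond O oL oE /\
  forall (A : comPzRingType) (a : {rmorphism L -> A}) (P : {rmorphism mps unit E -> A}),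
    cond A a P ->
    let Q (chi : {rmorphism O -> A}) := chi \o oL =1 a /\ chi \o oE =1 P in
    exists2 chi, Q chi & forall chi', Q chi' -> chi' =1 chi.

(* The functions on GG[p^j] invariant under translation by GG_0[p^j], that is,
   the functions on the quotient GG_et[p^j]. *)
Definition et_function (j : nat) (O : comPzRingType)
    (oL : {rmorphism L -> O}) (oE : {rmorphism mps unit E -> O}) (a : O) : Prop :=
  forall (A : comPzRingType) (s : {rmorphism L -> A}) (P R : {rmorphism O -> A})
    (Q : {rmorphism mps unit L -> A}),
    P \o oL =1 s -> R \o oL =1 s ->
    (forall c, Q (mps_const _ c) = s c) ->
    Q (nseries (map_mps iota F) (p ^ j)) = 0 ->
    is_sum (s \o iota) F (P \o oE) (Q \o map_mps iota) (R \o oE) ->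
    R a = P a.

Context (O : nat -> comPzRingType) (oL : forall j, {rmorphism L -> O j})
  (oE : forall j, {rmorphism mps unit E -> O j}).

(* y induces an isomorphism L[y]/(f) = O_{GG_et[p^j]} with f monic, and y = 0 on
   the zero section h(x) |-> h(0). *)
Definition et_generator (j : nat) (y : O j) : Prop :=
  let ev (r : {poly L}) := \sum_(i < size r) oL j r`_i * y ^+ i in
  [/\ forall a, et_function j (oL j) (oE j) a <-> exists r, a = ev r,
      exists2 f : {poly L}, f \is monic &
        forall r, ev r = 0 <-> exists s, r = s * f
    & forall z : {rmorphism O j -> L}, z \o oL j =1 id ->
        (forall f, z (oE j f) = iota (f 0)) -> z y = 0].

(* E[[q_1, ..., q_h, A_1, ..., A_h]] *)
Notation qA := ('I_h + 'I_h)%type.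
Notation EqA := (mps qA E).
Definition q_ (i : 'I_h) : EqA := mps_var E (inl i).
Definition A_ (i : 'I_h) : EqA := mps_var E (inr i).

(* Cocones under the tensor products
     L[[q]] (x)_(E[[q]]) E[[q,A]]/([p^m](A_j) - q_j)
   and the transition maps A_j |-> [p](A_j); alp m sends A_j to A_j^(m). For t = 0
   the ring L[[q]] is replaced by its quotient L. *)
Definition B_cocone (X : comPzRingType) (lam : mps 'I_h L -> X)
    (alp : nat -> EqA -> X) : Prop :=
  [/\ t = 0%N -> forall i, lam 'x_i = 0,
      forall m (f : mps 'I_h E), alp m (msubst f q_) = lam (map_mps iota f),
      forall m i, alp m (scomp (nseries F (p ^ m)) (A_ i)) = alp m (q_ i)
    & forall m f, alp m.+1 (msubst f (fun z => match z with
                    | inl i => q_ i | inr i => scomp (nseries F p) (A_ i) end))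
                  = alp m f].

Definition is_B_colim (X : comPzRingType) (lam : {rmorphism mps 'I_h L -> X})
    (alp : nat -> {rmorphism EqA -> X}) : Prop :=
  B_cocone lam alp /\
  forall (Y : comPzRingType) (lam' : {rmorphism mps 'I_h L -> Y})
    (alp' : nat -> {rmorphism EqA -> Y}), B_cocone lam' alp' ->
    let Q (chi : {rmorphism X -> Y}) :=
      chi \o lam =1 lam' /\ forall m, chi \o alp m =1 alp' m in
    exists2 chi, Q chi & forall chi', Q chi' -> chi' =1 chi.

Definition Lt_ideal : set L := idl (iota @` lt_ideal p t)%classic.

(* I_t + (q) *)
Definition Iq_ideal : set (mps 'I_h L) :=
  idl ((fun f => exists2 c, Lt_ideal c & f = mps_const _ c) `|`
       (fun f => exists i, f = 'x_i))%classic.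

(* the formal sum of the [c_i](A_i) *)
Definition A_sum (c : 'I_h -> nat) : EqA :=
  \big[fadd F/0]_(i < h) scomp (nseries F (c i)) (A_ i).

(* b is the value y(phi(c/p^j)) in a ring B' complete at J, with structure maps lam
   and alp. The point P = sum_i c_i A_i^(j) of GG is a lift of phi(c/p^j). Modulo
   J^m it is killed by some p^(j+l), so that y(P) is computed by any extension
   of y to a function on GG_et[p^(j+l)], here written as a sum of the d_i (x) f_i. *)
Definition et_value (B' : comPzRingType) (J : set B') (lam : mps 'I_h L -> B')
    (alp : nat -> EqA -> B') (j : nat) (y : O j) (c : 'I_h -> nat) (b : B') : Prop :=
  let P (f : mps unit E) := alp j (scomp f (A_sum c)) in
  forall m, exists l N (d : 'I_N -> L) (f : 'I_N -> mps unit E),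
  [/\ idl_pow J m (P (nseries F (p ^ (j + l)))),
      et_function (j + l) (oL (j + l)) (oE (j + l))
        (\sum_i oL (j + l) (d i) * oE (j + l) (f i)),
      \sum_i oL j (d i) * oE j (f i) = y
    & idl_pow J m (b - \sum_i lam (mps_const _ (d i)) * P (f i))].

(* B' is the completion of the colimit X, and B that of the localization M of B'. *)
Definition is_Bt (y : forall j, O j) (B : calg Lt_ideal) : Prop :=
  exists (X B' M : comPzRingType) (lam : {rmorphism mps 'I_h L -> X})
    (alp : nat -> {rmorphism EqA -> X}) (cX : {rmorphism X -> B'})
    (e : {rmorphism B' -> M}) (cM : {rmorphism M -> B}),
  let JX := idl (lam @` Iq_ideal)%classic in
  let J' := idl (cX @` JX)%classic in
  let JM := idl (e @` J')%classic in
  let R : set B' := fun b =>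
    exists j (c : 'I_h -> 'I_(p ^ j)), [/\ (0 < j)%N, exists i, c i != 0%N :> nat
      & et_value J' (cX \o lam) (fun m => cX \o alp m) (y j) c b] in
  [/\ is_B_colim lam alp /\ is_completion JX cX,
      is_localization R e,
      is_completion JM cM,
      ca_ideal B = idl (cM @` JM)%classic
    & forall c, ca_map B c = cM (e (cX (lam (mps_const _ c))))].

End BRing.

(* Main.v *)
(* Over a complete L_t-algebra A, a homomorphism Z_p^h -> GG_0 extended to a
   homomorphism Q_p^h -> GG is the same as points q_j of GG_0 and a_(k,j) of GG with
   a_(0,j) = q_j and p a_(k+1,j) = a_(k,j). The colimit and its completion represent
   these systems. Inverting the values y(phi(c/p^k)) amounts to making the coordinate
   of every P = sum_j c_j a_(k,j), with c nonzero modulo p^k, a unit: y vanishes at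
   the zero section, hence is divisible by x; and where y vanishes, P lies in GG_0,
   where x is nilpotent modulo I_t. Call such systems nondegenerate.

   A nondegenerate system gives a pushout. Factor the Weierstrass polynomial of [p^k]
   over L_t as g_0 g_1, with g_0 that of GG_0[p^k] and g_1 a unit modulo g_0. This
   yields an idempotent function delta that is 1 exactly on GG_0[p^k]. For a point Q
   of GG, the idempotents lifting delta(Q - P), for the points P as above, cover
   Spec A: otherwise, over some nonzero ring, g_0 g_1 would have p^(hk) + 1 roots with
   invertible differences, each of multiplicity p^(tk), but its degree is p^(nk). On
   each open and closed piece Q is a point of GG_0 plus an image of Q_p^h, in an
   essentially unique way, so sections of a sheaf glue.

   Conversely, if the coordinate of some P is not a unit, P lies in GG_0 over a nonzero
   discrete algebra. The pushout property is then tested against the sheaf that sends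
   A to the functions from the primes of A containing J to (Q_p/Z_p)^h; it is a sheaf
   because primes lift along flat covers and two primes over the same prime come from a
   common ring. Mapping GG_0 to 0 shows that c/p^k lies in Z_p^h, a contradiction. *)

Require Import Defs.
From HB Require Import structures.
From mathcomp Require Import all_boot.
From mathcomp Require Import ssralg poly polydiv ssrint intdiv zmodp matrix fraction ring zify.
From mathcomp Require Import boolp classical_sets.

Set Implicit Arguments.
Unset Strict Implicit.
Unset Printing Implicit Defensive.

Import GRing.Theory.
Local Open Scope ring_scope.

(** Ring maps out of a power series ring carry no topology here, so the images of the variables do
    not determine them. Weierstrass division by [[p^j](x)] is the remedy: modulo such series in
    every variable the ring is finite free on monomials, so maps that kill them at some level modulo
    each power of [J] are determined by the variables and can be assembled from one-variable maps.
    Sums of points and all uniqueness statements rest on this. The generator [y] lives on one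
    torsion level, while a point [P] is torsion only modulo powers of [J], at growing levels. Its
    value is [y(P - Q)] for a point [Q] of [GG_0] with [p^j Q = p^j P]. Such a [Q] exists only after
    a finite free extension, so invariant functions are extended to higher levels by descent along
    extensions that divide points of [GG_0] by [p^j]. In a general algebra the coordinates of the
    [q_j] are nilpotent modulo [J] but need not lie in [J]. Therefore the universal maps are
    continuous only up to a power, and counting takes place modulo an enlarged ideal. *)

Section MpsBasics.
Context (X : finType) (R : comPzRingType).
Implicit Types (f g h : mps X R) (m a b : monom X) (c : R).

(** * Power series *)

Lemma monomD a b x : (a + b) x = (a x + b x)%N. Proof. by rewrite ffunE. Qed.
Lemma monom0 x : (0 : monom X) x = 0%N. Proof. by rewrite ffunE. Qed.
Lemma monomMn a n x : (a *+ n) x = (a x * n)%N.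
Proof.
elim: n => [|n IHn]; first by rewrite mulr0n muln0 monom0.
by rewrite mulrS monomD IHn mulnS.
Qed.

Lemma mdegD a b : mdeg (a + b) = (mdeg a + mdeg b)%N.
Proof. by rewrite /mdeg -big_split; apply: eq_bigr => x _; rewrite ffunE. Qed.

Lemma mdeg_ge m x : (m x <= mdeg m)%N.
Proof. by rewrite /mdeg (bigD1 x) //= leq_addr. Qed.

Lemma mdeg_eq0 m : mdeg m = 0%N -> m = 0.
Proof.
move=> m0; apply/ffunP => x; rewrite ffunE; apply/eqP.
by rewrite -leqn0 -m0 mdeg_ge.
Qed.

Lemma box_monK N m : (forall x, (m x <= N)%N) ->
  exists a : {ffun X -> 'I_N.+1}, box_mon a = m.
Proof.
move=> mN; exists [ffun x => inord (m x)]; apply/ffunP => x.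
by rewrite !ffunE inordK ?ltnS.
Qed.

Definition mono a : mps X R := MPS (fun m => (m == a)%:R).

Definition ord N f := forall m, (mdeg m < N)%N -> f m = 0.

Lemma mcoefD f g m : (f + g) m = f m + g m. Proof. by []. Qed.
Lemma mcoefN f m : (- f) m = - f m. Proof. by []. Qed.
Lemma mcoefB f g m : (f - g) m = f m - g m. Proof. by []. Qed.
Lemma mcoef0 m : (0 : mps X R) m = 0. Proof. by []. Qed.
Lemma mcoef1 m : (1 : mps X R) m = if m == 0 then 1 else 0. Proof. by []. Qed.
Lemma mcoefM f g m : (f * g) m =
  \sum_(a : {ffun X -> 'I_(mdeg m).+1}) \sum_(b : {ffun X -> 'I_(mdeg m).+1})
    if box_mon a + box_mon b == m then f (box_mon a) * g (box_mon b) else 0.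
Proof. by []. Qed.
Lemma mcoef_sum I r (P : pred I) (G : I -> mps X R) m :
  mcoef (\sum_(i <- r | P i) G i) m = \sum_(i <- r | P i) G i m.
Proof. by elim/big_rec2: _ => // i y x _ <-. Qed.

Lemma mcoefM_eq f g f' g' m :
  (forall a b, a + b = m -> f a * g b = f' a * g' b) -> (f * g) m = (f' * g') m.
Proof.
move=> H; rewrite !mcoefM; apply: eq_bigr => a _; apply: eq_bigr => b _.
by case: eqP => // /H.
Qed.

Lemma mcoefM_0 f g m : (forall a b, a + b = m -> f a * g b = 0) -> (f * g) m = 0.
Proof.
move=> H; rewrite (@mcoefM_eq _ _ 0 0); first by rewrite mul0r.
by move=> a b /H ->; rewrite mcoef0 mul0r.
Qed.

Lemma mcoef_monoM a f m :
  (mono a * f) m = if [forall x, (a x <= m x)%N] then f [ffun x => (m x - a x)%N] else 0.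
Proof.
case: ifPn => [/forallP am|/negP am]; last first.
  apply: mcoefM_0 => b b' bm /=; case: eqP => [ba|]; rewrite ?mul0r //.
  by case: am; apply/forallP => x; rewrite -bm ba monomD leq_addr.
have [a0 a0E] := box_monK (fun x => leq_trans (am x) (mdeg_ge m x)).
pose d := [ffun x => (m x - a x)%N] : monom X.
have dm x : (d x <= mdeg m)%N.
  by rewrite ffunE; apply: leq_trans (leq_subr _ _) (mdeg_ge m x).
have [d0 d0E] := box_monK dm.
have adm : a + d = m by apply/ffunP => x; rewrite monomD ffunE; apply: subnKC.
have cancel b b' : b + b' = m -> b = a -> b' = d.
  move=> bm ba; apply/ffunP => x; rewrite ffunE -bm ba monomD.
  by rewrite addKn.
rewrite mcoefM (bigD1 a0) //= (bigD1 d0) //= a0E d0E adm !eqxx mul1r.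
rewrite big1 ?addr0 => [|b bd]; last first.
  case: eqP => // bm; case/eqP: bd.
  apply: (@box_inj X); rewrite ?a0E; rewrite (cancel _ _ bm erefl).
  by rewrite d0E.
rewrite big1 ?addr0 // => b ba; rewrite big1 // => b' _.
case: eqP => // _; case: eqP => [e|]; rewrite ?mul0r //.
by case/eqP: ba; apply: (@box_inj X); rewrite e a0E.
Qed.

Lemma monoM a b : mono a * mono b = mono (a + b).
Proof.
apply: mpsP => m; rewrite mcoef_monoM /=.
case: ifPn => [/forallP am|/negP am].
  congr (_%:R); congr nat_of_bool; apply/eqP/eqP => [/ffunP H|->].
    by apply/ffunP => x; move: (H x); rewrite monomD !ffunE => <-; rewrite subnKC.
  by apply/ffunP => x; rewrite ffunE monomD addKn.
case: eqP => // e; case: am; apply/forallP => x; rewrite e monomD; exact: leq_addr.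
Qed.

Lemma mono0 : mono 0 = 1.
Proof. by apply: mpsP => m /=; case: eqP. Qed.

Lemma mono_exp a n : mono a ^+ n = mono (a *+ n).
Proof.
elim: n => [|n IHn]; first by rewrite expr0 mulr0n mono0.
by rewrite exprS IHn monoM mulrS.
Qed.

Lemma mps_varE x : mps_var R x = mono [ffun y => nat_of_bool (y == x)].
Proof. by apply: mpsP => m /=; case: eqP. Qed.

Lemma mono_prod a : mono a = \prod_x mps_var R x ^+ a x.
Proof.
transitivity (\prod_x mono ([ffun y => nat_of_bool (y == x)] *+ a x)); last first.
  by apply: eq_bigr => x _; rewrite mps_varE mono_exp.
transitivity (mono (\sum_x ([ffun y => nat_of_bool (y == x)] : monom X) *+ a x)).
  congr mono; apply/ffunP => y; rewrite sum_ffunE (bigD1 y) //=.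
  rewrite big1 ?addr0 => [|x xy]; rewrite monomMn ffunE.
    by rewrite eqxx mul1n.
  by rewrite eq_sym (negPf xy) mul0n.
by elim/big_rec2: _ => [|x u v _ <-]; rewrite ?mono0 ?monoM.
Qed.

End MpsBasics.

Lemma mcoef_mono (X : finType) (R : comPzRingType) (a m : monom X) :
  mono R a m = (m == a)%:R.
Proof. by []. Qed.

Section Order.
Context (X : finType) (R : comPzRingType).
Implicit Types (f g h : mps X R) (m a b : monom X) (c : R).

Lemma mcoef_constM c f m : (mps_const X c * f) m = c * f m.
Proof.
transitivity ((1 * MPS (fun m => c * f m)) m); last by rewrite mul1r.
apply: mcoefM_eq => a b _; rewrite mcoef1 /=.
by case: ifP => _; rewrite ?mul0r ?mul1r.
Qed.

Lemma mps_constM c c' : mps_const X (c * c') = mps_const X c * mps_const X c'.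
Proof. by apply: mpsP => m; rewrite mcoef_constM /=; case: ifP; rewrite ?mulr0. Qed.

Lemma mps_const_zmod : zmod_morphism (@mps_const X R).
Proof. by move=> c c'; apply: mpsP => m /=; case: ifP; rewrite ?subr0. Qed.
Lemma mps_const_monoid : monoid_morphism (@mps_const X R).
Proof. by split=> [|c c']; rewrite ?mps_constM. Qed.
HB.instance Definition _ :=
  GRing.isZmodMorphism.Build R (mps X R) (@mps_const X R) mps_const_zmod.
HB.instance Definition _ :=
  GRing.isMonoidMorphism.Build R (mps X R) (@mps_const X R) mps_const_monoid.

Lemma mcoef_1M f g : (f * g) 0 = f 0 * g 0.
Proof.
transitivity ((mps_const X (f 0) * g) 0); last by rewrite mcoef_constM.
apply: mcoefM_eq => a b ab /=; have a0 : a = 0.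
  apply: mdeg_eq0; apply/eqP; rewrite -leqn0 -(_ : mdeg (0 : monom X) = 0%N).
    by rewrite -ab mdegD leq_addr.
  by rewrite /mdeg big1 // => x _; rewrite ffunE.
by rewrite a0 eqxx.
Qed.

Lemma mdeg0 : mdeg (0 : monom X) = 0%N.
Proof. by rewrite /mdeg big1 // => x _; rewrite ffunE. Qed.

Lemma ordW N M f : (N <= M)%N -> ord M f -> ord N f.
Proof. by move=> NM H m mN; apply: H; apply: leq_trans NM. Qed.
Lemma ord_all f : ord 0 f. Proof. by []. Qed.
Lemma ordD N f g : ord N f -> ord N g -> ord N (f + g).
Proof. by move=> Hf Hg m mN; rewrite mcoefD Hf ?Hg ?addr0. Qed.
Lemma ordN N f : ord N f -> ord N (- f).
Proof. by move=> Hf m mN; rewrite mcoefN Hf ?oppr0. Qed.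
Lemma ordB N f g : ord N f -> ord N g -> ord N (f - g).
Proof. by move=> Hf /ordN; apply: ordD. Qed.
Lemma ord_sum I r (P : pred I) (G : I -> mps X R) N :
  (forall i, P i -> ord N (G i)) -> ord N (\sum_(i <- r | P i) G i).
Proof. by move=> H; elim/big_ind: _ => //; apply: ordD. Qed.
Lemma ordM N M f g : ord N f -> ord M g -> ord (N + M) (f * g).
Proof.
move=> Hf Hg m mNM; apply: mcoefM_0 => a b ab.
have [aN|Na] := ltnP (mdeg a) N; first by rewrite Hf ?mul0r.
rewrite Hg ?mulr0 // -(ltn_add2l N); apply: leq_trans mNM.
by rewrite -ab mdegD ltnS leq_add2r.
Qed.
Lemma ordMr N f g : ord N f -> ord N (g * f).
Proof. by move=> Hf; apply: (@ordM 0 N). Qed.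
Lemma ordMl N f g : ord N f -> ord N (f * g).
Proof. by rewrite mulrC; apply: ordMr. Qed.
Lemma ord1P f : f 0 = 0 <-> ord 1 f.
Proof.
split=> [f0 m|/(_ 0)->//]; last by rewrite mdeg0.
by rewrite ltnS leqn0 => /eqP/mdeg_eq0 ->.
Qed.
Lemma ordX f n : f 0 = 0 -> ord n (f ^+ n).
Proof.
move=> /ord1P f1; elim: n => [|n IHn]; first exact: ord_all.
by rewrite exprS -add1n; apply: ordM.
Qed.
Lemma ord_eq f g : (forall N, ord N (f - g)) -> f = g.
Proof.
move=> H; apply: mpsP => m; apply/eqP; rewrite -subr_eq0; apply/eqP.
exact: (H (mdeg m).+1 m).
Qed.

(** Each exponent is cut at [N], not the total degree, so the sum runs over a box. Every monomial of
    degree at most [N] lies in the box, which is why the error has order above [N]. *)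
Definition trunc N f : mps X R :=
  \sum_(a : {ffun X -> 'I_N.+1}) mps_const X (f (box_mon a)) * mono R (box_mon a).

Lemma truncE N f m : (forall x, (m x <= N)%N) -> trunc N f m = f m.
Proof.
move=> /box_monK[a am]; rewrite mcoef_sum (bigD1 a) // big1 => [|b ba].
  by rewrite [LHS]addr0 mcoef_constM /= am eqxx mulr1.
rewrite mcoef_constM /= -am.
by case: eqP => [/box_inj e|]; rewrite ?mulr0 //; rewrite e eqxx in ba.
Qed.

Lemma ord_trunc N f : ord N.+1 (f - trunc N f).
Proof.
move=> m mN; rewrite mcoefB truncE ?subrr // => x.
by apply: leq_trans (mdeg_ge m x) _.
Qed.
End Order.

Section ContHom.
Context (X Y : finType) (R : comPzRingType).

(** Agreement on box truncations is formal, and maps that do not lower the order keep the error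
    [f - trunc N f] in high order. Identities between substitutions can thus be checked on
    variables. *)
Lemma cont_hom_uniq (u v : {rmorphism mps X R -> mps Y R}) :
  (forall N f, ord N f -> ord N (u f)) -> (forall N f, ord N f -> ord N (v f)) ->
  (forall c, u (mps_const X c) = v (mps_const X c)) ->
  (forall x, u 'x_x = v 'x_x) -> u =1 v.
Proof.
move=> cu cv uvc uvx f; apply: ord_eq => N; apply: (@ordW _ _ _ N.+1) => //.
have e : u (trunc N f) = v (trunc N f).
  rewrite !rmorph_sum; apply: eq_bigr => a _; rewrite !rmorphM uvc mono_prod.
  rewrite !rmorph_prod; congr (_ * _); apply: eq_bigr => x _.
  by rewrite !rmorphXn uvx.
have -> : u f - v f = u (f - trunc N f) - v (f - trunc N f).
  by rewrite !rmorphB e opprB addrA subrK.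
by apply: ordB; [apply: cu|apply: cv]; apply: ord_trunc.
Qed.
End ContHom.

Section Subst.
Context (X Y : finType) (R : comPzRingType).
Variables (g : X -> mps Y R).
Hypothesis g0 : forall x, g x 0 = 0.

Lemma ord_gprod (a : monom X) : ord (mdeg a) (\prod_x g x ^+ a x).
Proof.
rewrite /mdeg; elim/big_rec2: _ => [|x n h _ H]; first exact: ord_all.
by apply: ordM => //; apply: ordX.
Qed.

Lemma msubst_ord N f : ord N f -> ord N (msubst f g).
Proof.
move=> fN m mN /=; apply: big1 => a _.
have [aN|Na] := ltnP (mdeg (box_mon a)) N; first by rewrite fN ?mul0r.
have -> : mcoef (\prod_x g x ^+ a x) m = 0; last by rewrite mulr0.
rewrite -[RHS](ord_gprod (leq_trans mN Na)).
by congr (mcoef _ m); apply: eq_bigr => x _; rewrite ffunE.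
Qed.

Lemma mcoef_subst f m : msubst f g m = \sum_(a : {ffun X -> 'I_(mdeg m).+1})
  f (box_mon a) * mcoef (\prod_(x : X) g x ^+ a x) m.
Proof. by []. Qed.

Lemma msubstB f f' : msubst (f - f') g = msubst f g - msubst f' g.
Proof.
apply: mpsP => m; rewrite mcoefB /= -sumrB; apply: eq_bigr => a _.
by rewrite mulrBl.
Qed.

Lemma msubst0 : msubst 0 g = 0.
Proof. by rewrite -(subrr 0) msubstB subrr. Qed.

Lemma msubstD f f' : msubst (f + f') g = msubst f g + msubst f' g.
Proof.
apply: mpsP => m; rewrite mcoefD /= -big_split; apply: eq_bigr => a _.
by rewrite mulrDl.
Qed.

Lemma msubst_sum I r (P : pred I) (G : I -> mps X R) :
  msubst (\sum_(i <- r | P i) G i) g = \sum_(i <- r | P i) msubst (G i) g.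
Proof. exact: (big_morph _ msubstD msubst0). Qed.

Lemma msubst_cmono c (a : monom X) :
  msubst (mps_const X c * mono R a) g = mps_const Y c * \prod_x g x ^+ a x.
Proof.
apply: mpsP => m; rewrite mcoef_subst mcoef_constM.
have [am|am] := leqP (mdeg a) (mdeg m); last first.
  rewrite (ord_gprod am) mulr0 big1 // => b _; rewrite mcoef_constM mcoef_mono.
  case: eqP => [e|]; rewrite ?mulr0 ?mul0r // mulr1.
  suff -> : mcoef (\prod_x g x ^+ b x) m = 0 by rewrite mulr0.
  rewrite -[RHS](ord_gprod am); congr (mcoef _ m); apply: eq_bigr => x _.
  by rewrite -e ffunE.
have [a0 a0E] := box_monK (fun x => leq_trans (mdeg_ge a x) am).
rewrite (bigD1 a0) // -[RHS]addr0; congr (_ + _); last apply: big1 => b ba.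
  rewrite mcoef_constM mcoef_mono a0E eqxx mulr1; congr (_ * mcoef _ m).
  by apply: eq_bigr => x _; rewrite -a0E ffunE.
rewrite mcoef_constM mcoef_mono; case: eqP => [e|]; rewrite ?mulr0 ?mul0r //.
by case/eqP: ba; apply: (@box_inj X); rewrite e a0E.
Qed.

Lemma msubst_const c : msubst (mps_const X c) g = mps_const Y c.
Proof.
rewrite -[mps_const X c]mulr1 -mono0 msubst_cmono big1 ?mulr1 // => x _.
by rewrite ffunE expr0.
Qed.

Lemma msubst1 : msubst 1 g = 1. Proof. exact: msubst_const. Qed.

Lemma msubst_var x : msubst 'x_x g = g x.
Proof.
rewrite mps_varE -[mono _ _]mul1r -[1]/(mps_const X 1) msubst_cmono mul1r.
rewrite (bigD1 x) //= ffunE eqxx expr1 big1 ?mulr1 // => y yx.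
by rewrite ffunE (negPf yx) expr0.
Qed.

(** For truncations this is the law of exponents; replacing the factors by truncations costs only
    terms of order at least [N]. *)
Lemma msubstM f f' : msubst (f * f') g = msubst f g * msubst f' g.
Proof.
have tr N (h k : mps X R) : ord N (msubst (trunc N h * trunc N k) g
                       - msubst (trunc N h) g * msubst (trunc N k) g).
  apply: (_ : ord N (_ - _)); rewrite [X in X - _](_ : _ =
     msubst (trunc N h) g * msubst (trunc N k) g) ?subrr //.
  rewrite !msubst_sum !mulr_suml msubst_sum; apply: eq_bigr => a _.
  rewrite !mulr_sumr msubst_sum; apply: eq_bigr => b _.
  rewrite mulrACA monoM -mps_constM !msubst_cmono mps_constM mulrACA.
  congr (_ * _); rewrite -big_split; apply: eq_bigr => x _ /=.
  by rewrite monomD exprD.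
apply: ord_eq => N.
have dl (h : mps X R) : ord N (h - trunc N h) by exact: (ordW (leqnSn N) (@ord_trunc _ _ N h)).
have ds (h : mps X R) : ord N (msubst h g - msubst (trunc N h) g).
  by rewrite -msubstB; apply: msubst_ord.
(* Telescoping: one factor at a time is exchanged for its truncation, and the middle summand is
   handled by [tr]. *)
rewrite [X in ord N X](_ : _ = msubst ((f - trunc N f) * f') g
   + msubst (trunc N f * (f' - trunc N f')) g
   + (msubst (trunc N f * trunc N f') g - msubst (trunc N f) g * msubst (trunc N f') g)
   - (msubst f g - msubst (trunc N f) g) * msubst f' g
   - msubst (trunc N f) g * (msubst f' g - msubst (trunc N f') g)).
  apply: ordB; last by apply: ordMr.
  apply: ordB; last by apply: ordMl.
  apply: ordD => //; apply: ordD; apply: msubst_ord; first exact: ordMl.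
  exact: ordMr.
rewrite mulrBl mulrBr !msubstB; ring.
Qed.

Definition subst_fun (f : mps X R) := msubst f g.
Lemma subst_zmod : zmod_morphism subst_fun. Proof. exact: msubstB. Qed.
Lemma subst_monoid : monoid_morphism subst_fun.
Proof. by split; [exact: msubst1|exact: msubstM]. Qed.
End Subst.

Definition subst_rm (X Y : finType) (R : comPzRingType) (g : X -> mps Y R)
  (g0 : forall x, g x 0 = 0) : {rmorphism mps X R -> mps Y R} :=
  HB.pack (subst_fun g)
    (GRing.isZmodMorphism.Build (mps X R) (mps Y R) (subst_fun g) (subst_zmod g))
    (GRing.isMonoidMorphism.Build (mps X R) (mps Y R) (subst_fun g) (subst_monoid g0)).

Lemma subst_rmE (X Y : finType) (R : comPzRingType) (g : X -> mps Y R)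
  (g0 : forall x, g x 0 = 0) f : subst_rm g0 f = msubst f g.
Proof. by []. Qed.

Section Composition.
Context (R : comPzRingType).

Lemma msubst_at0 (X Y : finType) (f : mps X R) (g : X -> mps Y R) :
  (forall x, g x 0 = 0) -> msubst f g 0 = f 0.
Proof.
move=> g0; have f1 : ord 1 (f - mps_const X (f 0)).
  by apply/ord1P; rewrite mcoefB /= eqxx subrr.
have /ord1P := msubst_ord g0 f1.
by rewrite msubstB msubst_const // mcoefB /mcoef /= eqxx => /eqP; rewrite subr_eq0 => /eqP.
Qed.

Lemma msubst_msubst (X Y Z : finType) (f : mps X R) (g : X -> mps Y R)
    (h : Y -> mps Z R) : (forall x, g x 0 = 0) -> (forall y, h y 0 = 0) ->
  msubst (msubst f g) h = msubst f (fun x => msubst (g x) h).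
Proof.
move=> g0 h0; have gh0 x : msubst (g x) h 0 = 0 by rewrite msubst_at0.
pose u : {rmorphism mps X R -> mps Z R} := subst_rm h0 \o subst_rm g0.
apply: (@cont_hom_uniq _ _ _ u (subst_rm gh0)) => [N k kN|N k kN|c|x] /=.
- by apply/msubst_ord => //; apply/msubst_ord.
- exact/msubst_ord.
- by rewrite /subst_fun !msubst_const.
- by rewrite /subst_fun !msubst_var.
Qed.

Lemma msubst_vars (X : finType) (f : mps X R) : msubst f (fun x => 'x_x) = f.
Proof.
have v0 x : mps_var R x (0 : monom X) = 0.
  by rewrite /=; case: eqP => // /ffunP/(_ x); rewrite !ffunE eqxx.
apply: (@cont_hom_uniq _ _ _ (subst_rm v0) idfun) => [N k kN|//|c|x] /=.
- exact/msubst_ord.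
- by rewrite /subst_fun msubst_const.
- by rewrite /subst_fun msubst_var.
Qed.

Lemma eq_msubst (X Y : finType) (f : mps X R) (g g' : X -> mps Y R) :
  g =1 g' -> msubst f g = msubst f g'.
Proof. by move=> /funext ->. Qed.

Lemma var0 (X : finType) (x : X) : mps_var R x 0 = 0.
Proof. by rewrite /=; case: eqP => // /ffunP/(_ x); rewrite !ffunE eqxx. Qed.

Lemma scomp_var (h : mps unit R) : scomp h 'x_tt = h.
Proof. by rewrite -[RHS]msubst_vars; apply: eq_msubst => -[]. Qed.

Lemma scomp0 (X : finType) (h : mps unit R) (g : mps X R) :
  g 0 = 0 -> scomp h g 0 = h 0.
Proof. by move=> g0; apply: msubst_at0. Qed.

Lemma scompA (X Y : finType) (h : mps unit R) (g : mps X R) (k : X -> mps Y R) :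
  g 0 = 0 -> (forall x, k x 0 = 0) ->
  msubst (scomp h g) k = scomp h (msubst g k).
Proof. by move=> g0 k0; rewrite /scomp msubst_msubst. Qed.

Lemma scomp_scomp (X : finType) (h g : mps unit R) (k : mps X R) :
  g 0 = 0 -> k 0 = 0 -> scomp (scomp h g) k = scomp h (scomp g k).
Proof. by move=> g0 k0; apply: scompA. Qed.

Definition scomp_rm (X : finType) (g : mps X R) (g0 : g 0 = 0) :
  {rmorphism mps unit R -> mps X R} := subst_rm (fun=> g0 : (fun=> g) tt 0 = 0).

Lemma scomp_rmE (X : finType) (g : mps X R) (g0 : g 0 = 0) h :
  scomp_rm g0 h = scomp h g.
Proof. by []. Qed.
End Composition.

Section Shift.
Context (X : finType) (R : comPzRingType) (x : X).
Implicit Types (f g : mps X R) (m : monom X).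

Definition lo N f : mps X R := MPS (fun m => if (m x < N)%N then f m else 0).
Definition expo N : monom X := [ffun y => if y == x then N else 0%N].
Definition sh N f : mps X R := MPS (fun m => f (m + expo N)).

Lemma expoE N : mono R (expo N) = 'x_x ^+ N.
Proof.
rewrite mps_varE mono_exp; congr mono; apply/ffunP => y.
by rewrite monomMn !ffunE; case: eqP; rewrite ?mul1n.
Qed.

Lemma mcoef_varnM N f m :
  ('x_x ^+ N * f) m = if (N <= m x)%N then f [ffun y => if y == x then (m y - N)%N else m y]
                      else 0.
Proof.
rewrite -expoE mcoef_monoM; have [Nm|mN] := leqP N (m x).
  rewrite ifT; last by apply/forallP => y; rewrite ffunE; case: eqP => // ->.
  by congr (mcoef f _); apply/ffunP => y; rewrite !ffunE; case: eqP; rewrite ?subn0.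
rewrite ifN //; apply/negP => /forallP/(_ x); rewrite ffunE eqxx leqNgt.
by rewrite mN.
Qed.

Lemma lo_sh N f : f = lo N f + 'x_x ^+ N * sh N f.
Proof.
apply: mpsP => m; rewrite mcoefD mcoef_varnM /lo /=.
case: ltnP => Nm; rewrite ?addr0 // add0r; congr (mcoef f _).
apply/ffunP => y; rewrite monomD !ffunE; case: eqP => [->|]; rewrite ?addn0 //.
by rewrite subnK.
Qed.

Lemma sh_varnM N f : sh N ('x_x ^+ N * f) = f.
Proof.
apply: mpsP => m; rewrite /sh [LHS]mcoef_varnM monomD ffunE eqxx leq_addl.
congr (mcoef f _); apply/ffunP => y; rewrite ffunE monomD !ffunE.
by case: eqP; rewrite ?addn0 ?addnK.
Qed.

Lemma sh_lo N f : sh N (lo N f) = 0.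
Proof.
by apply: mpsP => m /=; rewrite monomD ffunE eqxx ltnNge leq_addl.
Qed.

Lemma loD N f g : lo N (f + g) = lo N f + lo N g.
Proof. by apply: mpsP => m /=; case: ifP; rewrite ?addr0. Qed.

(** The remainder condition of Weierstrass division: polynomial of degree below [N] in [x], with
    power series in the other variables as coefficients. *)
Definition low N f := forall m, (N <= m x)%N -> f m = 0.
Lemma low_lo N f : low N (lo N f).
Proof. by move=> m Nm /=; rewrite ltnNge Nm. Qed.
Lemma lo_low N f : low N f -> lo N f = f.
Proof. by move=> H; apply: mpsP => m /=; case: ltnP => // /H ->. Qed.
Lemma low_sh N f : low N f <-> sh N f = 0.
Proof.
split=> [H|H]; last by rewrite (lo_sh N f) H mulr0 addr0; apply: low_lo.
by rewrite -(lo_low H) sh_lo.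
Qed.
Lemma lowD N f g : low N f -> low N g -> low N (f + g).
Proof. by move=> Hf Hg m mN; rewrite mcoefD Hf ?Hg ?addr0. Qed.
Lemma lowN N f : low N f -> low N (- f).
Proof. by move=> Hf m mN; rewrite mcoefN Hf ?oppr0. Qed.
Lemma lowB N f g : low N f -> low N g -> low N (f - g).
Proof. by move=> Hf /lowN; apply: lowD. Qed.
End Shift.

Section Units.
Context (R : comPzRingType).

Lemma geo_inv : (1 - 'x_tt) * MPS (fun=> 1) = 1 :> mps unit R.
Proof.
rewrite mulrBl mul1r; apply: mpsP => m; rewrite mcoefB -['x_tt]expr1 mcoef_varnM mcoef1 /=.
case: posnP => m0; rewrite ?subr0 ?subrr; last first.
  by case: eqP => // e; rewrite e monom0 in m0.
by case: eqP => // -[]; apply/ffunP => -[]; rewrite m0 monom0.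
Qed.

(** The geometric series is substituted at [1 - f c], which has no constant term. *)
Lemma mps_unit (X : finType) (f : mps X R) (c : R) : f 0 * c = 1 -> exists v, f * v = 1.
Proof.
move=> fc; pose h := 1 - f * mps_const X c.
have h0 : h 0 = 0.
  by rewrite /h mcoefB mcoef_1M mcoef1 [mps_const X c 0]/= eqxx fc subrr.
exists (mps_const X c * scomp (MPS (fun=> 1)) h); rewrite mulrA.
have -> : f * mps_const X c = scomp (1 - 'x_tt) h.
  by rewrite /scomp msubstB msubst1 // msubst_var // subKr.
by rewrite -msubstM // geo_inv msubst1.
Qed.
End Units.

(** * Formal group laws *)

Lemma map_fadd (R R' : comPzRingType) (phi : {rmorphism R -> R'}) (Y : finType)
  (F : mps bool R) (f g : mps Y R) :
  map_mps phi (fadd F f g) = fadd (map_mps phi F) (map_mps phi f) (map_mps phi g).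
Proof. by rewrite /fadd map_msubst; apply: eq_msubst => -[]. Qed.

Lemma map_scomp (R R' : comPzRingType) (phi : {rmorphism R -> R'}) (Y : finType)
  (h : mps unit R) (g : mps Y R) :
  map_mps phi (scomp h g) = scomp (map_mps phi h) (map_mps phi g).
Proof. exact: map_msubst. Qed.

Lemma map_fgl (R R' : comPzRingType) (phi : {rmorphism R -> R'}) (F : mps bool R) :
  formal_group_law F -> formal_group_law (map_mps phi F).
Proof.
move=> [F0 F1 F2 F3]; split=> [|||x y z].
- by rewrite -[in RHS](map_mps_var phi) -F0 map_fadd rmorph0 map_mps_var.
- by rewrite -[in RHS](map_mps_var phi) -F1 map_fadd rmorph0 map_mps_var.
- by rewrite -2!(map_mps_var phi) -!map_fadd F2.
- by rewrite -3!(map_mps_var phi) -!map_fadd F3.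
Qed.

Lemma scompx (R : comPzRingType) (X : finType) (g : mps X R) : g 0 = 0 ->
  scomp 'x_tt g = g.
Proof. by move=> g0; rewrite /scomp msubst_var. Qed.

Lemma sum_only (V : nmodType) (I : finType) (i : I) (G : I -> V) :
  (forall j, j != i -> G j = 0) -> \sum_j G j = G i.
Proof. by move=> G0; rewrite (bigD1 i) //= big1 ?addr0. Qed.

Section FGL.
Context (R : comPzRingType) (F : mps bool R) (FGL : formal_group_law F).

Lemma fgl0 : F 0 = 0.
Proof.
have [F0 _ _ _] := FGL; have := congr1 (fun f => mcoef f 0) F0.
by rewrite /fadd msubst_at0 ?var0 // => -[|]; rewrite ?var0.
Qed.

Section Add.
Context (X : finType).
Implicit Types f g h k : mps X R.

Lemma bool0 f g : f 0 = 0 -> g 0 = 0 -> forall b : bool, (if b then g else f) 0 = 0.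
Proof. by move=> ? ? []. Qed.

Lemma fadd_at0 f g : f 0 = 0 -> g 0 = 0 -> fadd F f g 0 = 0.
Proof. by move=> f0 g0; rewrite /fadd msubst_at0 ?fgl0; last exact: bool0. Qed.

Lemma msubst_fadd (Y : finType) (k : X -> mps Y R) f g :
  f 0 = 0 -> g 0 = 0 -> (forall x, k x 0 = 0) ->
  msubst (fadd F f g) k = fadd F (msubst f k) (msubst g k).
Proof.
move=> f0 g0 k0; rewrite /fadd msubst_msubst //; last exact: bool0.
by apply: eq_msubst => -[].
Qed.
End Add.

Lemma scomp_fadd (X : finType) (f g : mps unit R) (k : mps X R) :
  f 0 = 0 -> g 0 = 0 -> k 0 = 0 ->
  scomp (fadd F f g) k = fadd F (scomp f k) (scomp g k).
Proof. by move=> *; apply: msubst_fadd. Qed.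

Section Add2.
Context (X : finType).
Implicit Types f g h k : mps X R.

Lemma faddf0 f : f 0 = 0 -> fadd F f 0 = f.
Proof.
move=> f0; have [F0 _ _ _] := FGL; have := congr1 (fun u => scomp u f) F0.
by rewrite scomp_fadd ?var0 // /scomp msubst_var // msubst0.
Qed.

Lemma fadd0f f : f 0 = 0 -> fadd F 0 f = f.
Proof.
move=> f0; have [_ F0 _ _] := FGL; have := congr1 (fun u => scomp u f) F0.
by rewrite scomp_fadd ?var0 // /scomp msubst_var // msubst0.
Qed.

Lemma faddC f g : f 0 = 0 -> g 0 = 0 -> fadd F f g = fadd F g f.
Proof.
move=> f0 g0; have [_ _ FC _] := FGL.
have := congr1 (fun u => msubst u (fun b : bool => if b then g else f)) FC.
by rewrite !msubst_fadd ?var0 ?msubst_var // => -[|].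
Qed.

Lemma faddA f g h : f 0 = 0 -> g 0 = 0 -> h 0 = 0 ->
  fadd F (fadd F f g) h = fadd F f (fadd F g h).
Proof.
move=> f0 g0 h0; have [_ _ _ FA] := FGL.
pose k (i : 'I_3) : mps X R := nth 0 [:: f; g; h] i.
have k0 i : k i 0 = 0 by case: i => -[|[|[|]]].
have := congr1 (fun u => msubst u k) (FA (inord 0) (inord 1) (inord 2)).
rewrite !msubst_fadd ?fadd_at0 ?var0 // !msubst_var //.
by rewrite /k !inordK.
Qed.

Lemma faddACA f g h k : f 0 = 0 -> g 0 = 0 -> h 0 = 0 -> k 0 = 0 ->
  fadd F (fadd F f g) (fadd F h k) = fadd F (fadd F f h) (fadd F g k).
Proof.
move=> f0 g0 h0 k0; rewrite !faddA ?fadd_at0 //; congr (fadd F _ _).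
by rewrite -!faddA //; congr (fadd F _ _); rewrite faddC.
Qed.
End Add2.

Lemma nseries_at0 m : nseries F m 0 = 0.
Proof. by elim: m => // m IH; apply: fadd_at0 => //; apply: var0. Qed.

Lemma nseries1 : nseries F 1 = 'x_tt.
Proof. by rewrite /nseries /= faddf0 ?var0. Qed.

Lemma nseriesS m : nseries F m.+1 = fadd F 'x_tt (nseries F m).
Proof. by []. Qed.

Lemma nseriesD a b : nseries F (a + b) = fadd F (nseries F a) (nseries F b).
Proof.
elim: a => [|a IHa]; first by rewrite fadd0f ?nseries_at0.
by rewrite addSn !nseriesS IHa faddA ?nseries_at0 ?var0.
Qed.

Lemma nseriesM a b : nseries F (a * b) = scomp (nseries F a) (nseries F b).
Proof.
elim: a => [|a IHa]; first by rewrite /scomp msubst0.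
rewrite mulSn nseriesD IHa nseriesS scomp_fadd ?nseries_at0 ?var0 //.
by rewrite scompx ?nseries_at0.
Qed.

Lemma nseries_fadd (X : finType) (f g : mps X R) m : f 0 = 0 -> g 0 = 0 ->
  scomp (nseries F m) (fadd F f g) = fadd F (scomp (nseries F m) f) (scomp (nseries F m) g).
Proof.
move=> f0 g0; elim: m => [|m IHm].
  by rewrite /scomp !msubst0 faddf0.
rewrite nseriesS !scomp_fadd ?nseries_at0 ?var0 ?fadd_at0 // IHm.
by rewrite !scompx ?fadd_at0 // faddACA ?scomp0 ?nseries_at0.
Qed.

(** The unit laws [F(x,0) = x = F(0,x)] read coefficientwise: killing the variable [b] leaves
    exactly the coefficients whose exponent at [b] is zero. *)
Lemma fgl_axis (b : bool) (m : monom bool) : m b = 0%N -> F m = mps_var R (~~ b) m.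
Proof.
move=> mb; pose G (b' : bool) : mps unit R := if b' == b then 0 else 'x_tt.
pose n : monom unit := [ffun=> m (~~ b)].
have mE (m' : monom bool) : m' b = 0%N -> m' = [ffun b' => if b' == b then 0%N else m' (~~ b)].
  by move=> m'b; apply/ffunP => b'; rewrite ffunE; case: eqP => [->//|]; case: (b'); case: (b).
have FG : msubst F G = 'x_tt.
  have [F0 F1 _ _] := FGL; rewrite /fadd in F0 F1; rewrite /G.
  by case: (b) => /=; [rewrite -F0|rewrite -F1]; apply: eq_msubst => -[].
have nm x : (n x <= mdeg n)%N by apply: mdeg_ge.
have dn : mdeg n = m (~~ b).
  by rewrite /mdeg (bigD1 tt) //= big1 ?addn0 ?ffunE // => -[].
have [a aE] : exists a : {ffun bool -> 'I_(mdeg n).+1}, box_mon a = m.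
  apply: box_monK => b'; by rewrite dn {1}(mE m mb) ffunE; case: eqP.
have Gp (c : monom bool) : \prod_x G x ^+ c x = if c b == 0%N then mono R [ffun=> c (~~ b)] else 0.
  rewrite (bigD1 b) //= (bigD1 (~~ b)) ?big1 ?mulr1; first last.
  - by case: (b).
  - by case=> //=; case: (b).
  rewrite /G eqxx (_ : (~~ b == b) = false); last by case: (b).
  rewrite expr0n; case: eqP => _; rewrite ?mul0r // mul1r.
  by rewrite [LHS]mulr1 mps_varE mono_exp; congr mono; apply/ffunP => y; rewrite monomMn !ffunE; case: y; rewrite eqxx mul1n.
have := congr1 (fun f => mcoef f n) FG; rewrite mcoef_subst (sum_only (i := a)) => [|c ca].
  rewrite (_ : (\prod_x _) = mono R n); last first.
    rewrite (eq_bigr (fun x => G x ^+ m x)) => [|x _]; last by rewrite -aE ffunE.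
    by rewrite Gp mb eqxx.
  rewrite mcoef_mono eqxx mulr1 aE => ->; rewrite !mps_varE !mcoef_mono.
  congr (nat_of_bool _)%:R; apply/eqP/eqP => [/ffunP/(_ tt)|/ffunP/(_ (~~ b))].
    rewrite !ffunE eqxx => m1; apply/ffunP => b'; rewrite (mE m mb) !ffunE m1.
    by case: (b'); case: (b).
  by rewrite !ffunE eqxx => m1; apply/ffunP => y; rewrite !ffunE m1; case: y.
rewrite (eq_bigr (fun x => G x ^+ box_mon c x)) => [|x _]; last by rewrite ffunE.
rewrite Gp; case: eqP => cb; rewrite ?mulr0 // mcoef_mono; case: eqP => [e|]; rewrite ?mulr0 //.
case/eqP: ca; apply: (@box_inj bool); rewrite aE (mE _ cb) (mE _ mb).
by move/ffunP: e => /(_ tt); rewrite !ffunE => ->.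
Qed.

(* [x +_F y = x + y v] with [v(0) = 1], so that [x(P + Q) - x(P)] and [x(Q)]
   differ by a unit. *)
Lemma fgl_unit : exists v w : mps bool R,
  [/\ F = 'x_false + 'x_true * v, v * w = 1 & v 0 = 1].
Proof.
have F1 : mcoef (sh true 1 F) 0 = 1.
  rewrite /sh /= add0r (@fgl_axis false) ?ffunE // mps_varE mcoef_mono.
  rewrite (_ : _ == _ = true) //; apply/eqP/ffunP => y.
  by rewrite !ffunE; case: eqP.
have [w vw] := @mps_unit _ _ (sh true 1 F) 1 (etrans (mulr1 _) F1).
exists (sh true 1 F), w; split=> //.
rewrite {1}(lo_sh true 1 F) expr1; congr (_ + _); apply: mpsP => m /=.
case: ltnP => m1; last first.
  by case: eqP => // /ffunP/(_ true); rewrite !ffunE /= => e; rewrite e in m1.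
by rewrite (@fgl_axis true) //; apply/eqP; rewrite -leqn0.
Qed.
End FGL.

Lemma rmorph_eq (R S : comPzRingType) (f g : {rmorphism R -> S}) : f =1 g -> f = g.
Proof.
case: f => f [[f1] [f2]]; case: g => g [[g1] [g2]] /= /funext fg.
move: f1 f2 g1 g2; rewrite fg => f1 f2 g1 g2.
by rewrite (Prop_irrelevance f1 g1) (Prop_irrelevance f2 g2).
Qed.

(** * Quotients, adic completeness and limits *)

Section GraphHom.
Context (R S : comPzRingType) (Gam : R -> S -> Prop).
Hypotheses (Gtot : forall x, exists a, Gam x a) (G0 : forall a, Gam 0 a -> a = 0).
Hypotheses (GB : forall x y a b, Gam x a -> Gam y b -> Gam (x - y) (a - b)).
Hypotheses (GM : forall x y a b, Gam x a -> Gam y b -> Gam (x * y) (a * b)).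
Hypothesis G1 : Gam 1 1.

(** Many maps below are known only through a description of their values that involves choices.
    Additivity reduces single-valuedness to the relation at zero, so [G0] carries the mathematical
    content. *)
Lemma graph_hom : exists f : {rmorphism R -> S}, forall x, Gam x (f x).
Proof.
have [f fG] := choice Gtot.
have uniq x a b : Gam x a -> Gam x b -> a = b.
  move=> xa xb; apply/eqP; rewrite -subr_eq0; apply/eqP/G0.
  by rewrite -(subrr x); apply: GB.
have fB : zmod_morphism f by move=> x y; apply: uniq (fG _) (GB _ _).
have fM : monoid_morphism f.
  by split=> [|x y]; [apply: uniq (fG _) G1|apply: uniq (fG _) (GM _ _)].
by exists (HB.pack_for {rmorphism R -> S} f (GRing.isZmodMorphism.Build R S f fB)
                     (GRing.isMonoidMorphism.Build R S f fM)).
Qed.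
End GraphHom.

Definition coset (R : comPzRingType) (J : set R) (x : R) : set R := fun y => J (x - y).

(** The elements are the cosets themselves, as sets, so equality in the quotient is plain equality
    for any ideal given by a predicate. *)
Record quot_type (R : comPzRingType) (J : set R) (HJ : is_ideal J) : Type :=
  Quot { qset : set R; qP : exists x, qset = coset J x }.

Section Quotient.
Context (R : comPzRingType) (J : set R) (HJ : is_ideal J).
Notation quot := (quot_type HJ).

Definition qpi (x : R) : quot := Quot HJ (ex_intro _ x erefl).
Definition qrep (q : quot) : R := projT1 (cid (qP q)).

Lemma ideal0 : J 0. Proof. by case: HJ. Qed.
Lemma idealD x y : J x -> J y -> J (x + y). Proof. by case: HJ => _ + _; apply. Qed.
Lemma idealMl r x : J x -> J (r * x). Proof. by case: HJ => _ _; apply. Qed.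
Lemma idealMr r x : J x -> J (x * r). Proof. by rewrite mulrC; apply: idealMl. Qed.
Lemma idealN x : J x -> J (- x). Proof. by move=> Jx; rewrite -mulN1r; apply: idealMl. Qed.
Lemma idealB x y : J x -> J y -> J (x - y).
Proof. by move=> Jx /idealN; apply: idealD. Qed.
Lemma ideal_sum I r (P : pred I) (G : I -> R) :
  (forall i, P i -> J (G i)) -> J (\sum_(i <- r | P i) G i).
Proof. by move=> H; elim/big_ind: _ => //; [apply: ideal0|apply: idealD]. Qed.
Lemma idealBC x y : J (x - y) -> J (y - x).
Proof. by move=> /idealN; rewrite opprB. Qed.
Lemma ideal_trans x y z : J (x - y) -> J (y - z) -> J (x - z).
Proof. by move=> xy /(idealD xy); rewrite addrA subrK. Qed.
Lemma idealBM x y z t : J (x - y) -> J (z - t) -> J (x * z - y * t).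
Proof.
move=> xy zt; rewrite (_ : _ - _ = (x - y) * z + y * (z - t)); last by ring.
by apply: idealD; [apply: idealMr|apply: idealMl].
Qed.

Lemma quot_eq (p q : quot) : qset p = qset q -> p = q.
Proof.
by case: p q => [s sP] [s' s'P] /= e; subst s'; rewrite (Prop_irrelevance sP s'P).
Qed.

Lemma qpi_eq x y : qpi x = qpi y <-> J (x - y).
Proof.
split=> [[e]|Jxy].
  by rewrite -[J _]/(coset J x y) e /coset subrr; apply: ideal0.
apply: quot_eq; apply/funext => z; apply/propext; split; last exact: ideal_trans.
by apply: ideal_trans; apply: idealBC.
Qed.

Lemma qrepK q : qpi (qrep q) = q.
Proof. by apply: quot_eq; rewrite /qrep; case: cid => x /=. Qed.
Lemma qrep_pi x : J (qrep (qpi x) - x).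
Proof. by apply/qpi_eq; rewrite qrepK. Qed.

HB.instance Definition _ := gen_eqMixin quot.
HB.instance Definition _ := gen_choiceMixin quot.

Definition qadd p q := qpi (qrep p + qrep q).
Definition qopp p := qpi (- qrep p).
Definition qmul p q := qpi (qrep p * qrep q).

Lemma qaddE x y : qadd (qpi x) (qpi y) = qpi (x + y).
Proof. by apply/qpi_eq; rewrite opprD addrACA; apply: idealD; apply: qrep_pi. Qed.
Lemma qoppE x : qopp (qpi x) = qpi (- x).
Proof. by apply/qpi_eq; rewrite -opprD; apply/idealN/qrep_pi. Qed.
Lemma qmulE x y : qmul (qpi x) (qpi y) = qpi (x * y).
Proof. by apply/qpi_eq/idealBM; apply: qrep_pi. Qed.

Lemma qaddA : associative qadd.
Proof. by move=> p q r; rewrite -(qrepK p) -(qrepK q) -(qrepK r) !qaddE addrA. Qed.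
Lemma qaddC : commutative qadd.
Proof. by move=> p q; rewrite -(qrepK p) -(qrepK q) !qaddE addrC. Qed.
Lemma qadd0 : left_id (qpi 0) qadd.
Proof. by move=> p; rewrite -(qrepK p) !qaddE add0r. Qed.
Lemma qaddN : left_inverse (qpi 0) qopp qadd.
Proof. by move=> p; rewrite -(qrepK p) qoppE !qaddE addNr. Qed.
Lemma qmulA : associative qmul.
Proof. by move=> p q r; rewrite -(qrepK p) -(qrepK q) -(qrepK r) !qmulE mulrA. Qed.
Lemma qmulC : commutative qmul.
Proof. by move=> p q; rewrite -(qrepK p) -(qrepK q) !qmulE mulrC. Qed.
Lemma qmul1 : left_id (qpi 1) qmul.
Proof. by move=> p; rewrite -(qrepK p) !qmulE mul1r. Qed.
Lemma qmulDl : left_distributive qmul qadd.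
Proof.
by move=> p q r; rewrite -(qrepK p) -(qrepK q) -(qrepK r) !(qmulE, qaddE) mulrDl.
Qed.

HB.instance Definition _ := GRing.isZmodule.Build quot qaddA qaddC qadd0 qaddN.
HB.instance Definition _ :=
  GRing.Zmodule_isComPzRing.Build quot qmulA qmulC qmul1 qmulDl.

Lemma qpi_zmod : zmod_morphism qpi.
Proof. by move=> x y; rewrite -[RHS]/(qadd _ (qopp _)) qoppE qaddE. Qed.
Lemma qpi_monoid : monoid_morphism qpi.
Proof. by split=> // x y; rewrite -[RHS]/(qmul _ _) qmulE. Qed.
HB.instance Definition _ := GRing.isZmodMorphism.Build R quot qpi qpi_zmod.
HB.instance Definition _ := GRing.isMonoidMorphism.Build R quot qpi qpi_monoid.

Lemma qpi0 x : qpi x = 0 <-> J x.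
Proof. by rewrite -[0]/(qpi 0) qpi_eq subr0. Qed.
Lemma qpi_surj q : exists x, q = qpi x.
Proof. by exists (qrep q); rewrite qrepK. Qed.

Lemma quot_hom (S : comPzRingType) (f : {rmorphism R -> S}) :
  (forall x, J x -> f x = 0) -> exists g : {rmorphism quot -> S}, forall x, g (qpi x) = f x.
Proof.
move=> fJ; have [q|a|p q a b|p q a b||g gG] :=
  @graph_hom quot S (fun q a => exists2 x, q = qpi x & a = f x).
- by exists (f (qrep q)), (qrep q); rewrite ?qrepK.
- by move=> [x /esym/qpi0/fJ fx ->].
- by move=> [x -> ->] [y -> ->]; exists (x - y); rewrite rmorphB.
- by move=> [x -> ->] [y -> ->]; exists (x * y); rewrite rmorphM.
- by exists 1; rewrite rmorph1.
exists g => x; have [y /qpi_eq/fJ] := gG (qpi x).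
by rewrite rmorphB => /eqP; rewrite subr_eq0 => /eqP ->.
Qed.
End Quotient.
Notation quot HJ := (quot_type HJ : comPzRingType).

Section IdealPowers.
Context (R : comPzRingType).
Implicit Types (J : set R) (m : nat).

Lemma idl_pow_ideal J m : is_ideal (idl_pow J m). Proof. exact: idl_is_ideal. Qed.

Lemma idl_pow0 J x : idl_pow J 0 x.
Proof.
rewrite -[x]mulr1; apply: (idealMl (idl_pow_ideal J 0)); apply: sub_idl.
by exists (fun=> 0); split=> [[]//|]; rewrite big_ord0.
Qed.

Lemma idl_powP J m (P : set R) : is_ideal P ->
  (forall a : 'I_m -> R, (forall i, J (a i)) -> P (\prod_i a i)) ->
  forall x, idl_pow J m x -> P x.
Proof. by move=> HP H x; apply: idl_sub x => // x [a [Ja ->]]; apply: H. Qed.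

Lemma idl_powSP J m (P : set R) : is_ideal P ->
  (forall x y, J x -> idl_pow J m y -> P (x * y)) -> forall x, idl_pow J m.+1 x -> P x.
Proof.
move=> HP H; apply: idl_powP => // a Ja; rewrite big_ord_recl; apply: H => //.
by apply: sub_idl; exists (fun i => a (lift ord0 i)).
Qed.

Lemma mulr_ideal (P : set R) (x : R) : is_ideal P -> is_ideal (fun y => P (x * y)).
Proof.
move=> HP; split=> [|y z|r y]; first by rewrite mulr0; apply: ideal0.
- by rewrite mulrDr; apply: idealD.
- by rewrite mulrCA; apply: idealMl.
Qed.

Lemma idl_powD J m m' x y : idl_pow J m x -> idl_pow J m' y -> idl_pow J (m + m') (x * y).
Proof.
move=> Hx Hy; have HP k := idl_pow_ideal J k.
suff: idl_pow J (m + m') (y * x) by rewrite mulrC.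
elim: m x Hx => [|m IHm] x; first by move=> _; apply: idealMr.
move: x; apply: idl_powSP; first exact: mulr_ideal.
move=> u v Ju Jv; rewrite mulrCA addSn; apply: idl_powS => //; exact: IHm.
Qed.

Lemma idl_pow1 J x : is_ideal J -> idl_pow J 1 x <-> J x.
Proof.
move=> HJ; split=> [|Jx]; last first.
  by rewrite -[x]mulr1; apply: idl_powS => //; apply: idl_pow0.
by apply: (idl_powSP HJ) => y z Jy _; apply: idealMr.
Qed.

Lemma idl_powW J m m' x : (m <= m')%N -> idl_pow J m' x -> idl_pow J m x.
Proof.
move=> /subnK <-; elim: (m' - m)%N x => // k IHk x /=; rewrite addSn.
move: x; apply: (idl_powSP (idl_pow_ideal _ _)) => x y _ /IHk.
exact: (idealMl (idl_pow_ideal _ _)).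
Qed.

Lemma idl_powX J m x : J x -> idl_pow J m (x ^+ m).
Proof.
move=> Jx; elim: m => [|m IHm]; first exact: idl_pow0.
by rewrite exprS; apply: idl_powS.
Qed.

Lemma idl_powXX J m k x : idl_pow J k x -> idl_pow J (k * m) (x ^+ m).
Proof.
move=> Jx; elim: m => [|m IHm]; first by rewrite muln0; apply: idl_pow0.
by rewrite mulnS exprS; apply: idl_powD.
Qed.

Lemma idl_powJ J m x : is_ideal J -> (0 < m)%N -> idl_pow J m x -> J x.
Proof. by move=> HJ m0 /(idl_powW m0)/idl_pow1; apply. Qed.

Lemma idl_pow_sub J J' m x : (forall y, J y -> J' y) -> idl_pow J m x -> idl_pow J' m x.
Proof.
move=> JJ'; apply: idl_sub; first exact: idl_pow_ideal.
by move=> y [a [Ja ->]]; apply: sub_idl; exists a; split=> // i; apply: JJ'.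
Qed.

Lemma zero_ideal : is_ideal (fun x : R => x = 0).
Proof. by split=> [|x y -> ->|r x ->]; rewrite ?addr0 ?mulr0. Qed.

(** Makes every ring a complete ring with the discrete topology, the target of all reductions
    below. *)
Lemma zero_complete : adic_complete (fun x : R => x = 0).
Proof.
split=> [x /(_ 1%N)/(idl_pow1 _ zero_ideal)//|u uE].
exists (u 1%N) => -[|m]; first exact: idl_pow0.
have -> : u 1%N = u m.+1; last by rewrite subrr; apply: (ideal0 (idl_pow_ideal _ _)).
elim: m => // m ->; have := idl_powJ zero_ideal (ltn0Sn m) (uE m.+1).
by move=> /eqP; rewrite subr_eq0 => /eqP.
Qed.

Lemma ideal1 (P : set R) : is_ideal P -> P 1 -> forall x, P x.
Proof. by move=> HP P1 x; rewrite -[x]mulr1; apply: idealMl. Qed.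
End IdealPowers.

Section Complete.
Context (A : comPzRingType) (J : set A) (HJ : is_ideal J) (CJ : adic_complete J).
Let HP m := idl_pow_ideal J m.

Lemma complete_eq x y : (forall m, idl_pow J m (x - y)) -> x = y.
Proof. by move=> /(CJ.1) /eqP; rewrite subr_eq0 => /eqP. Qed.

(** The inverse is [y] times the sum of the geometric series in [h = 1 - x y]. *)
Lemma complete_unit x y : J (x * y - 1) -> exists z, x * z = 1.
Proof.
move=> Jxy; pose h := 1 - x * y; have Jh : J h by apply: idealBC.
pose u m := \sum_(i < m) h ^+ i.
have [|z zu] := CJ.2 u.
  by move=> m; rewrite /u big_ord_recr /= addrAC subrr add0r; apply: idl_powX.
exists (y * z); rewrite mulrA; apply: complete_eq => m.
have -> : x * y * z - 1 = x * y * (z - u m) + (x * y * u m - 1) by ring.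
apply: idealD => //; first exact: idealMl.
have -> : x * y * u m - 1 = - h ^+ m.
  have -> : x * y = 1 - h by rewrite subKr.
  rewrite -[u m]/(\sum_(i < m) h ^+ i) -(big_mkord xpredT (fun i => h ^+ i)).
  elim: m => [|m IHm]; first by rewrite big_geq // mulr0 add0r expr0.
  by rewrite big_nat_recr //= mulrDr addrAC IHm exprS; ring.
by apply: idealN => //; apply: idl_powX.
Qed.

(** [A] is the limit of its quotients by the powers of [J]. Compatibility is phrased on
    representatives, so that the transition maps need no names. *)
Lemma limit_hom (R : comPzRingType) (Phi : forall m, {rmorphism R -> quot (HP m)}) :
  (forall m f a, Phi m.+1 f = qpi (HP m.+1) a -> Phi m f = qpi (HP m) a) ->
  exists Ph : {rmorphism R -> A}, forall m f, Phi m f = qpi (HP m) (Ph f).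
Proof.
move=> PhiC; have [f|a|f g a b|f g a b||Ph PhG] :=
  @graph_hom R A (fun f a => forall m, Phi m f = qpi (HP m) a).
- have [u uP] := choice (fun m => qpi_surj (Phi m f)).
  have [|a au] := CJ.2 u.
    move=> m; apply/qpi_eq; rewrite -(PhiC _ _ _ (uP m.+1)); exact: uP.
  by exists a => m; rewrite uP; apply/esym/qpi_eq.
- move=> Ha; apply: complete_eq => m; rewrite subr0; apply/(qpi0 (HP m)).
  by rewrite -Ha rmorph0.
- by move=> Hf Hg m; rewrite !rmorphB Hf Hg.
- by move=> Hf Hg m; rewrite !rmorphM Hf Hg.
- by move=> m; rewrite !rmorph1.
by exists Ph.
Qed.
End Complete.

Notation cf := Defs.coef1.

(** * Weierstrass division *)

(** Over [L_t] the powers of an ideal serve; over the Lubin-Tate ring a filtration that mixes powers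
    of [p] with degrees is more convenient. Weierstrass division uses only these common
    properties. *)
Record filtration (K : comPzRingType) := Filtration {
  fil :> nat -> set K;
  fil_ideal : forall m, is_ideal (fil m);
  fil_all : forall x, fil 0 x;
  fil_decr : forall m x, fil m.+1 x -> fil m x;
  fil_mul : forall i j x y, fil i x -> fil j y -> fil (i + j) (x * y);
  fil_sep : forall x, (forall m, fil m x) -> x = 0;
  fil_lim : forall u : nat -> K, (forall m, fil m (u m.+1 - u m)) ->
    exists x, forall m, fil m (x - u m) }.

(* Weierstrass division by a series in one variable, in any variable of any power
   series ring. *)
Definition wdiv (K : comPzRingType) (g : mps unit K) (N : nat) : Prop :=
  forall (X : finType) (x : X),
  (forall f : mps X K, exists q r, f = q * scomp g 'x_x + r /\ low x N r) /\
  (forall q : mps X K, low x N (q * scomp g 'x_x) -> q = 0).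

Definition wprep (K : comPzRingType) (g : mps unit K) (N : nat) : Prop :=
  exists v v' r : mps unit K, [/\ low tt N r, 'x_tt ^+ N - r = v * g & v * v' = 1].

Section Weierstrass.
Context (K : comPzRingType) (fl : filtration K).

(** The condition of having Weierstrass degree [N] with respect to the filtration. *)
Definition wei (g : mps unit K) (N : nat) : Prop :=
  (forall i, (i < N)%N -> fl 1 (cf g i)) /\ exists c, cf g N * c = 1.

Section Fil.
Context (X : finType).
Implicit Types f g : mps X K.

Definition Fil m f := forall a, fl m (mcoef f a).

Lemma Fil_ideal m : is_ideal (Fil m).
Proof.
have HI := fil_ideal fl m; split=> [a|f g Hf Hg a|r f Hf a].
- exact: ideal0.
- by rewrite mcoefD; apply: idealD.
- rewrite mcoefM; apply: ideal_sum => // b _; apply: ideal_sum => // c _.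
  by case: ifP => _; [apply: idealMl|apply: ideal0].
Qed.

Lemma FilM i j f g : Fil i f -> Fil j g -> Fil (i + j) (f * g).
Proof.
move=> Hf Hg a; have HI := fil_ideal fl (i + j).
rewrite mcoefM; apply: ideal_sum => // b _; apply: ideal_sum => // c _.
by case: ifP => _; [apply: fil_mul|apply: ideal0].
Qed.

Lemma Fil_sh x N m f : Fil m f -> Fil m (sh x N f).
Proof. by move=> Hf a; apply: Hf. Qed.

Lemma Fil_eq f g : (forall m, Fil m (f - g)) -> f = g.
Proof.
move=> H; apply: mpsP => a; apply/eqP; rewrite -subr_eq0; apply/eqP.
by apply: (fil_sep (f := fl)) => m; apply: H.
Qed.

(** Iteration of [Q = f - T Q] from zero. The conditions [Fil] are coefficientwise, so the limit is
    taken separately in each coefficient. *)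
Lemma contraction_solve (T : mps X K -> mps X K) f :
  (forall g h, T (g - h) = T g - T h) -> (forall m g, Fil m g -> Fil m.+1 (T g)) ->
  exists Q, Q + T Q = f.
Proof.
move=> TB TF; pose v k := iter k (fun g => f - T g) 0.
have vF k : Fil k (v k.+1 - v k).
  elim: k => [a|k IHk]; first exact: fil_all.
  have -> : v k.+2 - v k.+1 = - T (v k.+1 - v k) by rewrite TB /=; ring.
  by apply: (idealN (Fil_ideal _)); apply: TF.
have Qex a : exists y, forall m, fl m (y - mcoef (v m) a).
  by apply: fil_lim => m; apply: vF.
have [Q QP] := choice Qex.
have {}QP m : Fil m (MPS Q - v m) by move=> a; apply: QP.
exists (MPS Q); apply: Fil_eq => m; have HI := Fil_ideal m.
have -> : MPS Q + T (MPS Q) - f = (MPS Q - v m.+1) + T (MPS Q - v m).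
  by rewrite TB /=; ring.
by apply: (idealD HI) => a; apply: fil_decr; [exact: QP|exact: (TF m _ (QP m))].
Qed.

Lemma contraction_inj (T : mps X K -> mps X K) Q :
  (forall m g, Fil m g -> Fil m.+1 (T g)) -> Q + T Q = 0 -> Q = 0.
Proof.
move=> TF QT; have QE : Q = - T Q by apply/eqP; rewrite -addr_eq0 QT.
apply: Fil_eq => m; rewrite subr0; elim: m => [a|m IHm]; first exact: fil_all.
by rewrite QE; apply: (idealN (Fil_ideal _)); apply: TF.
Qed.
End Fil.

Lemma Fil_msubst (X Y : finType) m (f : mps X K) (g : X -> mps Y K) :
  Fil m f -> Fil m (msubst f g).
Proof.
move=> Hf a; rewrite mcoef_subst; apply: (ideal_sum (fil_ideal fl m)) => b _.
by apply: (idealMr (fil_ideal fl m)).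
Qed.

(** Inverts [c d = 1 - h] by the contraction that multiplies by [- h], and reads the solution in
    degree zero. *)
Lemma fil_unit (c d : K) : fl 1 (c * d - 1) -> exists e, c * e = 1.
Proof.
move=> cd; have HI := fil_ideal fl 1; pose h := 1 - c * d.
have h1 : fl 1 h by apply: idealBC.
have [||Q QE] := @contraction_solve unit (fun Q => mps_const unit (- h) * Q) 1.
- by move=> f g; rewrite mulrBr.
- move=> m f Hf a; rewrite mcoef_constM -add1n; apply: fil_mul => //.
  exact: idealN.
have := congr1 (fun f => mcoef f 0) QE.
rewrite mcoefD mcoef_constM mcoef1 eqxx => Q1; exists (d * Q 0).
rewrite -[RHS]Q1 /h; ring.
Qed.

Lemma coef1E (m : monom unit) : m = [ffun=> m tt].
Proof. by apply/ffunP => -[]; rewrite ffunE. Qed.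

Lemma coef1_lo N (f : mps unit K) i :
  cf (lo tt N f) i = if (i < N)%N then cf f i else 0.
Proof. by rewrite /cf /= ffunE. Qed.

Lemma sh_at0 N (f : mps unit K) : sh tt N f 0 = cf f N.
Proof.
by rewrite /sh /= add0r /Defs.coef1; congr (mcoef f _); apply/ffunP => -[].
Qed.

Lemma wei_lo g N : wei g N -> Fil 1 (lo tt N g).
Proof.
move=> [gN _] a; rewrite (coef1E a) -/(cf _ _) coef1_lo.
by case: ifP => [/gN//|_]; apply: (ideal0 (fil_ideal fl 1)).
Qed.

Lemma wei_sh g N : wei g N -> exists u', sh tt N g * u' = 1.
Proof. by move=> [_ [c gc]]; apply: (@mps_unit _ _ _ c); rewrite sh_at0. Qed.

Lemma scompX (X : finType) (x : X) N (g : mps unit K) :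
  scomp g 'x_x = scomp (lo tt N g) 'x_x + 'x_x ^+ N * scomp (sh tt N g) 'x_x.
Proof.
rewrite {1}(lo_sh tt N g) -!(scomp_rmE (var0 K x)).
by rewrite rmorphD rmorphM rmorphXn /= {2}/subst_fun msubst_var ?var0.
Qed.

(** Write [G = a + x^N U] with [U] a unit and [a] in the first step of the filtration. The remainder
    [f - q G] has degree below [N] in [x] exactly when [Q = q U] solves [Q + sh(a U' Q) = sh f],
    with [U'] inverse to [U], and this is a contraction equation. *)
Lemma wei_wdiv g N : wei g N -> wdiv g N.
Proof.
move=> gw X x; have [u' uu'] := wei_sh gw.
set G := scomp g 'x_x; set a := scomp (lo tt N g) 'x_x.
pose U := scomp (sh tt N g) 'x_x; pose U' := scomp u' 'x_x.
have GE : G = a + 'x_x ^+ N * U by apply: scompX.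
have UU' : U * U' = 1.
  by rewrite /U /U' /scomp -msubstM ?uu' ?msubst1 // => _; apply: var0.
have a1 : Fil 1 a by apply/Fil_msubst/wei_lo.
pose T Q := sh x N (a * U' * Q).
have TB h k : T (h - k) = T h - T k by rewrite /T mulrBr.
have TF m h : Fil m h -> Fil m.+1 (T h).
  move=> hm; apply: Fil_sh; rewrite -mulrA -add1n; apply: FilM => //.
  exact: (idealMl (Fil_ideal _ m)).
split=> [f|q].
  have [Q QE] := contraction_solve (sh x N f) TB TF.
  exists (U' * Q), (f - U' * Q * G); split; first by rewrite addrC subrK.
  apply/low_sh; rewrite GE.
  have -> : f - U' * Q * (a + 'x_x ^+ N * U) =
            f - a * U' * Q - 'x_x ^+ N * ((U * U') * Q) by ring.
  by rewrite UU' mul1r -[LHS]/(sh x N f - T Q - sh x N ('x_x ^+ N * Q)) sh_varnM -QE addrK subrr.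
move=> /low_sh qG; have : q * U = 0.
  apply: (contraction_inj TF); rewrite -qG GE /T.
  rewrite mulrDr [q * (_ * U)]mulrCA.
  rewrite -[RHS]/(sh x N (q * a) + sh x N ('x_x ^+ N * (q * U))) sh_varnM addrC; congr (sh x N _ + _).
  by rewrite -[RHS]mulr1 -UU'; ring.
by move=> qU; rewrite -[q]mulr1 -UU' mulrA qU mul0r.
Qed.

(** Divides [x^N] by [g]. Comparing coefficients of [x^N] shows that the constant term of the
    quotient is inverse to the coefficient of [g] in degree [N] modulo the first step of the
    filtration, so the quotient is a unit. *)
Lemma wei_wprep g N : wei g N -> wprep g N.
Proof.
move=> gw; have [/(_ ('x_tt ^+ N)) [q [r [qr rN]]] _] := wei_wdiv gw tt.
rewrite scomp_var in qr; have [_ [c gc]] := gw.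
have q1 : fl 1 (q 0 * cf g N - 1).
  have HI := fil_ideal fl 1; pose n : monom unit := [ffun=> N].
  have nE (f : mps unit K) : ('x_tt ^+ N * f) n = f 0.
    rewrite mcoef_varnM ffunE leqnn; congr (mcoef f _).
    by apply/ffunP => -[]; rewrite !ffunE subnn.
  have := congr1 (fun f => mcoef f n) qr.
  rewrite -{1}['x_tt ^+ N]mulr1 nE mcoef1 eqxx mcoefD (rN n) ?ffunE // addr0.
  rewrite {1}(lo_sh tt N g) mulrDr mulrCA mcoefD nE mcoef_1M sh_at0 => ->.
  rewrite opprD addrCA subrr addr0; apply: idealN => //.
  exact: (idealMl (Fil_ideal _ 1) _ (wei_lo gw)).
have [e qe] := fil_unit q1; have [q' qq'] := mps_unit qe.
by exists q, q', r; split; rewrite // qr addrK.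
Qed.

(** Modulo the first step of the filtration, [h = x^M b] and [g = x^N sh(g)], so [g(h) = x^(MN) w]
    with [w = b^N sh(g)(h)], whose constant term is a unit. *)
Lemma wei_scomp (g h : mps unit K) N M : g 0 = 0 -> h 0 = 0 -> wei g N -> wei h M ->
  wei (scomp g h) (N * M).
Proof.
move=> g0 h0 gw hw; have HI := fil_ideal fl 1; have HF := Fil_ideal unit 1.
pose b := sh tt M h; pose w := b ^+ N * scomp (sh tt N g) h.
have E : Fil 1 (scomp g h - 'x_tt ^+ (M * N) * w).
  rewrite {1}(lo_sh tt N g) -!(scomp_rmE h0) rmorphD rmorphM rmorphXn /=.
  rewrite {2}/subst_fun msubst_var //; set k := subst_fun _ (sh _ _ _).
  have -> : w = b ^+ N * k by [].
  rewrite -addrA; apply: (idealD HF); first exact/Fil_msubst/wei_lo.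
  rewrite mulrA exprM -exprMn.
  rewrite -mulrBl; apply: (idealMr HF); rewrite subrXX; apply: (idealMr HF).
  by rewrite {1}(lo_sh tt M h) addrK; apply: wei_lo.
have Ei i : fl 1 (cf (scomp g h) i - cf ('x_tt ^+ (M * N) * w) i) by apply: E.
split=> [i iN|].
  have := Ei i; rewrite [cf (_ ^+ _ * _) _]mcoef_varnM ffunE leqNgt mulnC iN.
  by rewrite subr0.
have := Ei (N * M)%N; rewrite [cf (_ ^+ _ * _) _]mcoef_varnM ffunE mulnC leqnn.
rewrite [X in mcoef w X](_ : _ = 0); last by apply/ffunP => -[]; rewrite !ffunE subnn.
have [[_ [c gc]] [_ [d hd]]] := (gw, hw).
have wE : w 0 * (d ^+ N * c) = 1.
  rewrite /w mcoef_1M scomp0 // !sh_at0 (_ : mcoef (b ^+ N) 0 = cf h M ^+ N).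
    by rewrite mulrACA -exprMn gc hd expr1n mulr1.
  elim: (N) => [|k IHk]; first by rewrite !expr0 mcoef1 eqxx.
  by rewrite !exprS mcoef_1M IHk sh_at0.
move=> H; apply: (@fil_unit _ (d ^+ N * c)); rewrite -wE -mulrBl.
exact: (idealMr HI).
Qed.

Lemma wei_nseries (F : mps bool K) p q j : formal_group_law F ->
  wei (nseries F p) q -> wei (nseries F (p ^ j)) (q ^ j).
Proof.
move=> FGL pw; elim: j => [|j IHj].
  rewrite expn0 (nseries1 FGL); split=> [[|//] _|].
    rewrite (_ : cf _ _ = 0); first exact: (ideal0 (fil_ideal fl 1)).
    by rewrite /cf -[RHS](var0 K tt); congr (mcoef _ _); apply/ffunP => -[]; rewrite !ffunE.
  exists 1; rewrite mulr1 /cf mps_varE mcoef_mono.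
  by rewrite (_ : _ == _ = true) //; apply/eqP/ffunP => -[]; rewrite !ffunE.
by rewrite !expnS (nseriesM FGL); apply: wei_scomp => //; apply: nseries_at0.
Qed.
End Weierstrass.

Definition adic_filtration (K : comPzRingType) (J : set K) (CJ : adic_complete J) :
  filtration K := Filtration (fil := idl_pow J) (idl_pow_ideal J) (@idl_pow0 K J)
    (fun m x => @idl_powW K J m m.+1 x (leqnSn m)) (@idl_powD K J) (CJ.1) (CJ.2).

Section OneVariable.
Context (K : comPzRingType).

Lemma mcoef_varn (X : finType) (x : X) n m :
  mcoef ('x_x ^+ n : mps X K) m = (m == expo x n)%:R.
Proof. by rewrite -expoE. Qed.

Lemma low_poly (f : mps unit K) N M : (N <= M)%N -> low tt N f ->
  f = \sum_(i < M) mps_const unit (cf f i) * 'x_tt ^+ i.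
Proof.
move=> NM fN; apply: mpsP => m; rewrite mcoef_sum.
have e i : (m == expo tt i) = (i == m tt).
  apply/eqP/eqP => [->|->]; first by rewrite ffunE.
  by apply/ffunP => -[]; rewrite ffunE.
have [mM|Mm] := ltnP (m tt) M.
  rewrite (sum_only (i := Ordinal mM)) => [|j jm].
    by rewrite mcoef_constM mcoef_varn e eqxx mulr1 {1}(coef1E m).
  rewrite mcoef_constM mcoef_varn e (_ : (_ == _) = false) ?mulr0 //.
  by apply: contraNF jm => /eqP jm; apply/eqP/val_inj.
rewrite fN ?(leq_trans NM) // big1 // => i _; rewrite mcoef_constM mcoef_varn e.
by rewrite ltn_eqF ?mulr0 // (leq_trans (ltn_ord i)).
Qed.

Lemma scomp_varE (X : finType) (x : X) (f : mps unit K) N M : (N <= M)%N -> low tt N f ->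
  scomp f 'x_x = \sum_(i < M) mps_const X (cf f i) * 'x_x ^+ i.
Proof.
move=> NM /(low_poly NM) {1}->; rewrite -!(scomp_rmE (var0 K x)) rmorph_sum.
apply: eq_bigr => i _; rewrite rmorphM rmorphXn /= /subst_fun msubst_const ?msubst_var //.
all: by move=> *; apply: var0.
Qed.

Lemma low_scomp (X : finType) (x : X) (f : mps unit K) N : low tt N f -> low x N (scomp f 'x_x).
Proof.
move=> fN m Nm; rewrite (scomp_varE x (leqnn N) fN) mcoef_sum big1 // => i _.
rewrite mcoef_constM mcoef_varn; case: eqP => [e|]; rewrite ?mulr0 //.
by rewrite e ffunE eqxx leqNgt ltn_ord in Nm.
Qed.

Lemma scomp_var_indep (X : finType) (x y : X) (f : mps unit K) (m : monom X) :
  y != x -> (0 < m y)%N -> scomp f 'x_x m = 0.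
Proof.
move=> yx my; rewrite mcoef_subst big1 // => a _; rewrite (big_pred1 tt) => [|[]//].
rewrite mcoef_varn; case: eqP => [e|]; rewrite ?mulr0 //.
by rewrite e ffunE (negPf yx) in my.
Qed.

Lemma mcoef_lo (X : finType) (x : X) N (f : mps X K) m :
  lo x N f m = if (m x < N)%N then f m else 0.
Proof. by []. Qed.

(** A series in [x] alone does not touch the exponent of [y], so truncation in [y] is linear over
    such series. *)
Lemma lo_indepM (X : finType) (x y : X) (f : mps unit K) (q : mps X K) N :
  y != x -> lo y N (q * scomp f 'x_x) = lo y N q * scomp f 'x_x.
Proof.
move=> yx; apply: mpsP => m; rewrite mcoef_lo; case: ifP => mN.
  apply: mcoefM_eq => a b ab; have [b0|b0] := posnP (b y).
    by rewrite /= (_ : a y = m y) ?mN // -ab monomD b0 addn0.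
  by rewrite !(scomp_var_indep _ yx b0) !mulr0.
apply/esym/mcoefM_0 => a b ab; have [b0|b0] := posnP (b y).
  by rewrite /= (_ : a y = m y) ?mN ?mul0r // -ab monomD b0 addn0.
by rewrite !(scomp_var_indep _ yx b0) !mulr0.
Qed.

Lemma low_loo (X : finType) (x y : X) (q : mps X K) N M : low x N q -> low x N (lo y M q).
Proof. by move=> H m Nm /=; rewrite H ?if_same. Qed.

Lemma trunc_id (X : finType) M (r : mps X K) :
  (forall (m : monom X) x, (M < m x)%N -> r m = 0) -> trunc M r = r.
Proof.
move=> rM; apply: mpsP => m.
have [/forallP/truncE//|/forallPn[x]] := boolP [forall x, (m x <= M)%N].
rewrite -ltnNge => xM; rewrite (rM m x) // mcoef_sum big1 // => a _.
rewrite mcoef_constM mcoef_mono; case: eqP => [e|]; rewrite ?mulr0 //.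
by move: xM; rewrite e ffunE ltnNge -ltnS ltn_ord.
Qed.
End OneVariable.

(** * Power series modulo one series in each variable *)

Section Reduction.
Context (K : comPzRingType) (X : finType) (g : X -> mps unit K) (N : X -> nat).
Hypothesis wd : forall x, wdiv (g x) (N x).
Implicit Types (s : seq X) (f r : mps X K).
Notation G x := (scomp (g x) (mps_var K x)).

Definition reduced s f := forall x, x \in s -> low x (N x) f.

(** Division in a new variable could spoil reducedness in the old ones. Truncating quotient and
    remainder in the old variables repairs it, since these truncations commute with multiplication
    by [G x] and fix [f]. *)
Lemma red_step s x f : reduced s f -> x \notin s ->
  exists q r, [/\ f = q * G x + r, low x (N x) r & reduced s r].
Proof.
elim: s => [|y s IHs] fr xs.
  by have [/(_ f)[q [r [qr rN]]] _] := wd x x; exists q, r.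
rewrite inE negb_or in xs; have /andP[xy {}xs] := xs.
have [|q [r [fE rN rs]]] := IHs _ xs; first by move=> z zs; apply: fr; rewrite inE zs orbT.
exists (lo y (N y) q), (lo y (N y) r); split.
- rewrite -lo_indepM 1?eq_sym // -loD -fE lo_low //; apply: fr.
  by rewrite inE eqxx.
- exact: low_loo.
- move=> z; rewrite inE => /orP[/eqP ->|/rs]; [exact: low_lo|exact: low_loo].
Qed.

Lemma red_exists s f : uniq s ->
  exists (c : X -> mps X K) r, f = \sum_(x <- s) c x * G x + r /\ reduced s r.
Proof.
elim: s => [_|x s IHs] /=; first by exists (fun=> 0), f; rewrite big_nil add0r.
move=> /andP[xs /IHs[c [r [fE rr]]]]; have [q [r' [rE rx rs]]] := red_step rr xs.
exists (fun z => if z == x then q else c z), r'; split; last first.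
  by move=> z; rewrite inE => /orP[/eqP ->|/rs].
rewrite big_cons eqxx fE rE addrA [q * _ + _]addrC; congr (_ + _ + _).
apply: eq_big_seq => z zs; case: eqP => // zx.
by rewrite zx (negPf xs) in zs.
Qed.

(** The cofactor of [G x] is first reduced in the other variables to [rho]. By induction
    [r = rho * G x], and uniqueness of division in [x] kills [rho]. *)
Lemma red_uniq s (c : X -> mps X K) r : uniq s -> r = \sum_(x <- s) c x * G x -> reduced s r ->
  r = 0.
Proof.
elim: s c r => [c r _ ->|x s IHs c r /= /andP[xs us] rE rr]; first by rewrite big_nil.
have [d [rho [cE rhor]]] := red_exists (c x) us.
have rr' : reduced s (rho * G x).
  move=> y ys; have yx : y != x by apply: contraNneq xs => <-.
  by rewrite -[rho](lo_low (rhor y ys)) -lo_indepM //; apply: low_lo.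
have : r - rho * G x = 0.
  apply: (IHs (fun y => c y + d y * G x)) => //.
    rewrite rE big_cons cE mulrDl addrAC addrK.
    rewrite mulr_suml -big_split; apply: eq_bigr => y _ /=; ring.
  by move=> y ys; apply: lowB; [apply: rr; rewrite inE ys orbT|apply: rr'].
move=> /eqP; rewrite subr_eq0 => /eqP rG; rewrite rG.
have [_ /(_ rho) ->] := wd x x; rewrite ?mul0r //.
by rewrite -rG; apply: rr; rewrite inE eqxx.
Qed.

Definition red_ideal f := exists c : X -> mps X K, f = \sum_x c x * G x.

Lemma red_idealP : is_ideal red_ideal.
Proof.
split=> [|f f' [c ->] [c' ->]|r f [c ->]].
- by exists (fun=> 0); rewrite big1 // => x _; rewrite mul0r.
- exists (fun x => c x + c' x); rewrite -big_split.
  by apply: eq_bigr => x _ /=; rewrite mulrDl.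
- exists (fun x => r * c x); rewrite mulr_sumr.
  by apply: eq_bigr => x _ /=; rewrite mulrA.
Qed.

Lemma red_idealG x h : red_ideal (h * G x).
Proof.
exists (fun y => if y == x then h else 0).
rewrite (bigD1 x) //= eqxx big1 ?addr0 // => y yx.
by rewrite (negPf yx) mul0r.
Qed.

Lemma reduced_sum f : exists M, exists2 k : {ffun X -> 'I_M.+1} -> K,
  red_ideal (f - \sum_a mps_const X (k a) * mono K (box_mon a)) & True.
Proof.
have [c [r [fE rr]]] := red_exists f (enum_uniq X); pose M := (\sum_x N x)%N.
exists M, (fun a => r (box_mon a)) => //.
exists c; rewrite -/(trunc M r) trunc_id => [|m x mM].
  by rewrite fE addrK; apply/esym; rewrite big_enum.
apply: (rr x); rewrite ?mem_enum //; apply: leq_trans (ltnW mM).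
by rewrite /M (bigD1 x) //= leq_addr.
Qed.

Section Hom.
Context (A : comPzRingType) (s : {rmorphism K -> A}) (P : X -> {rmorphism mps unit K -> A}).
Hypotheses (Ps : forall x c, P x (mps_const _ c) = s c) (Pg : forall x, P x (g x) = 0).

Let term (t : K * (X -> mps unit K)) : mps X K :=
  mps_const X t.1 * \prod_x scomp (t.2 x) 'x_x.
Let val (t : K * (X -> mps unit K)) : A := s t.1 * \prod_x P x (t.2 x).

(** The quotient by [red_ideal] is a tensor product of one-variable quotients. Instead of forming
    it, a series is presented modulo the ideal by a finite list of pure tensors, on which the value
    is forced. *)
Let Gam f a := exists2 l : seq (K * (X -> mps unit K)),
  red_ideal (f - \sum_(t <- l) term t) & a = \sum_(t <- l) val t.

Let scompD x (h h' : mps unit K) :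
  scomp (h * h') 'x_x = scomp h 'x_x * scomp h' 'x_x :> mps X K.
Proof. by rewrite /scomp msubstM // => *; apply: var0. Qed.

(** Replacing every factor by its Weierstrass remainder changes no value, since [P x] kills [g x].
    The resulting series [W] is reduced and lies in the ideal, hence is zero, and so is each
    coefficient [k] of its expansion in monomials. *)
Let Gam0 a : Gam 0 a -> a = 0.
Proof.
move=> [l l0 ->].
have rho_ex (xh : X * mps unit K) : exists rho, low tt (N xh.1) rho /\
    exists q, xh.2 = q * g xh.1 + rho.
  have [/(_ xh.2)[q [r [E rN]]] _] := wd xh.1 tt.
  by exists r; split=> //; exists q; rewrite E scomp_var.
have [rho rhoP] := choice rho_ex.
pose M := (\sum_x N x)%N.
have NM x : (N x <= M)%N by rewrite /M (bigD1 x) //= leq_addr.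
pose r (t : K * (X -> mps unit K)) x := rho (x, t.2 x) : mps unit K.
have rN t x : low tt (N x) (r t x) by have [] := rhoP (x, t.2 x).
have Pr t x : P x (t.2 x) = P x (r t x).
  have [_ [q /= ->]] := rhoP (x, t.2 x).
  by rewrite rmorphD rmorphM Pg mulr0 add0r.
pose W := \sum_(t <- l) mps_const X t.1 * \prod_x scomp (r t x) 'x_x.
pose k (a : {ffun X -> 'I_M}) := \sum_(t <- l) t.1 * \prod_x cf (r t x) (a x).
pose mn (a : {ffun X -> 'I_M}) : monom X := [ffun x => nat_of_ord (a x)].
have W0 : W = 0.
  suff [c WE] : red_ideal W.
    apply: (@red_uniq (enum X) c); rewrite ?enum_uniq ?WE ?big_enum // -WE => x _.
    move=> m xm; rewrite /W mcoef_sum big1 // => t _; rewrite mcoef_constM.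
    suff -> : mcoef (\prod_y scomp (r t y) 'x_y) m = 0 by rewrite mulr0.
    have -> : \prod_y scomp (r t y) 'x_y = scomp (r t x) 'x_x *
        \prod_(y | y != x) scomp (r t y) 'x_y :> mps X K by rewrite (bigD1 x).
    set h := \prod_(y | y != x) _.
    suff hx q : lo x (N x) (q * h) = lo x (N x) q * h.
      rewrite -[scomp _ 'x_x](lo_low (low_scomp (x := x) (rN t x))) -hx.
      exact: (@low_lo _ _ x (N x) _ m xm).
    rewrite /h; elim/big_rec: _ q => [|y h' yx IH] q; first by rewrite !mulr1.
    by rewrite mulrA IH lo_indepM 1?eq_sym // mulrA.
  have HI := red_idealP.
  suff : red_ideal (W - \sum_(t <- l) term t).
    by move=> /(idealD HI) H; move: (idealN HI l0); rewrite sub0r opprK => /H; rewrite subrK.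
  rewrite -sumrB; apply: (ideal_sum HI) => t _; rewrite -mulrBr; apply: (idealMl HI).
  elim/big_rec2: _ => [|x u v _ uv]; first by rewrite subrr; apply: ideal0.
  apply: (idealBM HI) => //; have [_ [q /= ->]] := rhoP (x, t.2 x).
  rewrite -!(scomp_rmE (var0 K x)) rmorphD rmorphM opprD addrCA subrr addr0.
  apply: (idealN HI); exact: red_idealG.
have WE : W = \sum_a mps_const X (k a) * mono K (mn a).
  rewrite /k; under eq_bigr => a0 _ do rewrite rmorph_sum mulr_suml.
  rewrite exchange_big; apply: eq_bigr => t _ /=.
  under eq_bigr do rewrite (scomp_varE _ (NM _) (rN _ _)).
  rewrite bigA_distr_bigA mulr_sumr; apply: eq_bigr => a0 _.
  rewrite mps_constM rmorph_prod mono_prod -mulrA -big_split; congr (_ * _).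
  by apply: eq_bigr => x _; rewrite ffunE.
have k0 a0 : k a0 = 0.
  have := congr1 (fun f => mcoef f (mn a0)) WE; rewrite W0 mcoef_sum (sum_only (i := a0)).
    by rewrite mcoef_constM mcoef_mono eqxx mulr1 => /esym.
  move=> b ba; rewrite mcoef_constM mcoef_mono; case: eqP => [e|]; rewrite ?mulr0 //.
  case/eqP: ba; apply/ffunP => x; apply/val_inj.
  by move/ffunP: e => /(_ x); rewrite !ffunE => /esym.
transitivity (\sum_a s (k a) * \prod_x P x 'x_tt ^+ (a x)); last first.
  by rewrite big1 // => a0 _; rewrite k0 rmorph0 mul0r.
rewrite /k; under [RHS]eq_bigr => a0 _ do rewrite rmorph_sum mulr_suml.
rewrite exchange_big; apply: eq_bigr => t _ /=; rewrite /val.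
under eq_bigr => x _.
  rewrite Pr (low_poly (NM x) (rN t x)) rmorph_sum.
  under eq_bigr do rewrite rmorphM Ps rmorphXn.
  over.
rewrite bigA_distr_bigA mulr_sumr; apply: eq_bigr => a0 _.
by rewrite rmorphM rmorph_prod -mulrA -big_split.
Qed.

(** With two variables this is what makes the sum of two points exist. *)
Lemma assembly : exists Phi : {rmorphism mps X K -> A},
  (forall c, Phi (mps_const X c) = s c) /\ forall x h, Phi (scomp h 'x_x) = P x h.
Proof.
have HI := red_idealP.
have [f|f f' a a' [l fl ->] [l' fl' ->]|f f' a a' [l fl ->] [l' fl' ->]||Phi PhiG] :=
  @graph_hom _ _ Gam _ Gam0.
- have [M [k fk _]] := reduced_sum f.
  pose l := [seq (k a, fun x => 'x_tt ^+ (a x) : mps unit K) | a <- index_enum {ffun X -> 'I_M.+1}].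
  exists (\sum_(t <- l) val t), l => //; rewrite /l big_map; move: fk.
  congr (red_ideal (_ - _)); apply: eq_bigr => a _; rewrite /term /= mono_prod.
  congr (_ * _); apply: eq_bigr => x _; rewrite ffunE -(scomp_rmE (var0 K x)).
  by rewrite rmorphXn /= /subst_fun msubst_var // => *; apply: var0.
- exists (l ++ [seq (- t.1, t.2) | t <- l']); rewrite big_cat big_map /=.
    have -> : \sum_(t <- l') term (- t.1, t.2) = - \sum_(t <- l') term t.
      by rewrite -sumrN; apply: eq_bigr => t _; rewrite /term /= rmorphN mulNr.
    by rewrite opprD addrACA -opprD; apply: (idealB HI).
  congr (_ + _); rewrite -sumrN; apply: eq_bigr => t _.
  by rewrite /val /= rmorphN mulNr.
- exists [seq (t.1 * t'.1, fun x => t.2 x * t'.2 x) | t <- l, t' <- l'].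
    rewrite big_allpairs_dep /=.
    have -> : \sum_(t <- l) \sum_(t' <- l') term (t.1 * t'.1, fun x => t.2 x * t'.2 x) =
              (\sum_(t <- l) term t) * (\sum_(t <- l') term t).
      rewrite mulr_suml; apply: eq_bigr => t _; rewrite mulr_sumr; apply: eq_bigr => t' _.
      rewrite /term /= mps_constM mulrACA -big_split; congr (_ * _).
      by apply: eq_bigr => x _; rewrite scompD.
    exact: (idealBM HI).
  rewrite big_allpairs_dep mulr_suml; apply: eq_bigr => t _; rewrite mulr_sumr.
  apply: eq_bigr => t' _; rewrite /val /= rmorphM mulrACA -big_split; congr (_ * _).
  by apply: eq_bigr => x _; rewrite rmorphM.
- exists [:: (1, fun=> 1)]; rewrite big_seq1 /term /val /= ?rmorph1 big1 ?mulr1 //.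
  + by rewrite subrr; apply: (ideal0 HI).
  + by move=> x _; rewrite /scomp msubst1 // => *; apply: var0.
  + by move=> x _; rewrite rmorph1.
have PhiE f a : Gam f a -> Phi f = a.
  move=> [l fl ->]; have [l' fl' ->] := PhiG f.
  apply/eqP; rewrite -subr_eq0; apply/eqP/Gam0.
  exists (l' ++ [seq (- t.1, t.2) | t <- l]); rewrite big_cat big_map /=.
    have -> : \sum_(t <- l) term (- t.1, t.2) = - \sum_(t <- l) term t.
      by rewrite -sumrN; apply: eq_bigr => t _; rewrite /term /= rmorphN mulNr.
    rewrite (_ : 0 - _ = (f - \sum_(t <- l') term t) - (f - \sum_(t <- l) term t)).
      exact: (idealB HI).
    ring.
  congr (_ + _); rewrite -sumrN; apply: eq_bigr => t _.
  by rewrite /val /= rmorphN mulNr.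
exists Phi; split=> [c|x h]; apply: PhiE.
  exists [:: (c, fun=> 1)]; rewrite big_seq1 /term /val /= big1 ?mulr1 //.
  - by rewrite subrr; apply: (ideal0 HI).
  - by move=> x _; rewrite /scomp msubst1 // => *; apply: var0.
  - by move=> x _; rewrite rmorph1.
exists [:: (1, fun y => if y == x then h else 1)]; rewrite big_seq1 /term /val /= ?rmorph1 mul1r.
  rewrite (bigD1 x) //= eqxx big1 ?mulr1 ?subrr; first exact: (ideal0 HI).
  by move=> y /negPf ->; rewrite /scomp msubst1 // => *; apply: var0.
rewrite (bigD1 x) //= eqxx big1 ?mulr1 // => y /negPf ->.
exact: rmorph1.
Qed.

(** No continuity is assumed: modulo the ideal every series is a finite combination of monomials. *)
Lemma assembly_uniq (Phi Psi : {rmorphism mps X K -> A}) :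
  (forall c, Phi (mps_const X c) = Psi (mps_const X c)) ->
  (forall x, Phi 'x_x = Psi 'x_x) ->
  (forall x, Phi (G x) = 0) -> (forall x, Psi (G x) = 0) -> Phi =1 Psi.
Proof.
move=> Ec Ex PhiG PsiG f; have [M [k [c fE] _]] := reduced_sum f.
move/eqP: fE; rewrite subr_eq => /eqP ->; rewrite !rmorphD !rmorph_sum.
congr (_ + _); first by apply: eq_bigr => x _; rewrite !rmorphM PhiG PsiG !mulr0.
apply: eq_bigr => a _; rewrite !rmorphM Ec mono_prod !rmorph_prod; congr (_ * _).
by apply: eq_bigr => x _; rewrite !rmorphXn Ex.
Qed.
End Hom.
End Reduction.

Lemma principal_ideal (R : comPzRingType) (r : R) : is_ideal (fun x => exists w, x = r * w).
Proof.
split=> [|y z [w ->] [w' ->]|s y [w ->]]; first by exists 0; rewrite mulr0.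
  by exists (w + w'); rewrite mulrDr.
by exists (s * w); rewrite mulrCA.
Qed.

(** * Weierstrass degrees over the Lubin-Tate ring and over [L_t] *)

Section LubinTateFiltration.
Context (X : finType) (W : comPzRingType) (p : nat).
Hypothesis Wc : adic_complete (idl [set (p%:R : W)]%classic).

Lemma idl_pow_principal m (x : W) :
  idl_pow (idl [set (p%:R : W)]%classic) m x <-> exists w, x = p%:R ^+ m * w.
Proof.
split=> [|[w ->]]; last first.
  by apply: (idealMr (idl_pow_ideal _ _)); apply/idl_powX/sub_idl.
apply: (idl_powP (principal_ideal _)).
move=> a Ja; elim: m a Ja => [|m IHm] a Ja.
  by exists 1; rewrite big_ord0 mulr1.
rewrite big_ord_recl; have [|w ->] := IHm (fun i => a (lift ord0 i)); first by move=> i.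
have [N [r [g [gp ->]]]] := Ja ord0.
have -> : \sum_i r i * g i = p%:R * \sum_i r i.
  by rewrite mulr_sumr; apply: eq_bigr => i _; rewrite gp mulrC.
by exists ((\sum_i r i) * w); rewrite exprS mulrACA.
Qed.

(** The powers of the ideal generated by [p] and the variables, described by coefficients. The
    subtraction is truncated, so monomials of degree at least [m] are unrestricted. *)
Definition lt_fil (m : nat) : set (mps X W) :=
  fun f => forall a : monom X, exists w, f a = p%:R ^+ (m - mdeg a) * w.

Lemma lt_fil_ideal m : is_ideal (lt_fil m).
Proof.
split=> [a|f g Hf Hg a|r f Hf a]; first by exists 0; rewrite mulr0.
  have [[w fw] [w' gw]] := (Hf a, Hg a).
  by exists (w + w'); rewrite mcoefD fw gw mulrDr.
have HI := principal_ideal (p%:R ^+ (m - mdeg a) : W).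
rewrite mcoefM; apply: (ideal_sum HI) => b _; apply: (ideal_sum HI) => c _.
case: eqP => [bc|_]; last exact: (ideal0 HI).
have [w ->] := Hf (box_mon c); apply: (idealMl HI).
exists (p%:R ^+ (mdeg a - mdeg (box_mon c) - (mdeg a - m)) * w).
rewrite mulrA -exprD; congr (_ ^+ _ * _).
have : mdeg a = (mdeg (box_mon b) + mdeg (box_mon c))%N by rewrite -mdegD bc.
lia.
Qed.

Lemma lt_fil_mul i j f g : lt_fil i f -> lt_fil j g -> lt_fil (i + j) (f * g).
Proof.
move=> Hf Hg a.
have HI := principal_ideal (p%:R ^+ (i + j - mdeg a) : W).
rewrite mcoefM; apply: (ideal_sum HI) => b _; apply: (ideal_sum HI) => c _.
case: eqP => [bc|_]; last exact: (ideal0 HI).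
have [[w ->] [w' ->]] := (Hf (box_mon b), Hg (box_mon c)).
have bcE : mdeg a = (mdeg (box_mon b) + mdeg (box_mon c))%N by rewrite -mdegD bc.
rewrite mulrACA -exprD; set e := (_ + _)%N.
exists (p%:R ^+ (e - (i + j - mdeg a)) * (w * w')).
by rewrite [RHS]mulrA -exprD; congr (_ ^+ _ * _); rewrite /e; lia.
Qed.

Lemma lt_fil_sep f : (forall m, lt_fil m f) -> f = 0.
Proof.
move=> H; apply: mpsP => a; apply: (Wc.1) => m; apply/idl_pow_principal.
by have [w ->] := H (m + mdeg a)%N a; exists w; rewrite addnK.
Qed.

Lemma lt_fil_lim (u : nat -> mps X W) : (forall m, lt_fil m (u m.+1 - u m)) ->
  exists x, forall m, lt_fil m (x - u m).
Proof.
move=> uC.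
have xex a : exists y, forall m,
    idl_pow (idl [set (p%:R : W)]%classic) m (y - u (m + mdeg a)%N a).
  apply: (Wc.2 (fun m => u (m + mdeg a)%N a)) => m; apply/idl_pow_principal.
  have [w] := uC (m + mdeg a)%N a; rewrite addnK => e.
  by exists w; rewrite -e.
have [x xP] := choice xex; exists (MPS x) => m a.
have [am|ma] := leqP (mdeg a) m; last first.
  by exists (mcoef (MPS x - u m) a); rewrite (_ : (m - _)%N = 0%N) ?mul1r //; lia.
have /idl_pow_principal[w e] := xP a (m - mdeg a)%N.
by exists w; rewrite -e subnK.
Qed.

Definition lt_filtration : filtration (mps X W).
Proof.
refine (@Filtration (mps X W) lt_fil lt_fil_ideal _ _ lt_fil_mul lt_fil_sep lt_fil_lim).
  by move=> f a; exists (f a); rewrite sub0n mul1r.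
move=> m f H a; have [w ->] := H a.
exists (p%:R ^+ (m.+1 - mdeg a - (m - mdeg a)) * w).
by rewrite mulrA -exprD; congr (_ ^+ _ * _); lia.
Defined.
End LubinTateFiltration.

Lemma ideal_of (R : comPzRingType) (fl : filtration R) (X : set R) :
  (forall x, X x -> fl 1%N x) -> forall x, idl X x -> fl 1%N x.
Proof. by move=> H; apply: idl_sub => //; apply: fil_ideal. Qed.

Lemma natr_const (X : finType) (R : comPzRingType) m :
  m%:R = mps_const X m%:R :> mps X R.
Proof. by rewrite rmorph_nat. Qed.

Section Instances.
Context (p n : nat) (k : fieldType) (W : comPzRingType) (pi : {rmorphism W -> k}).
Context (F : mps bool (LTring n W)) (EF : morava_E_theory p pi F).
Hypothesis n0 : (0 < n)%N.

Let Wc : adic_complete (idl [set (p%:R : W)]%classic).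
Proof. by have [] := met_witt EF. Qed.

(** The coordinate is adapted at [i = n], where [u_n = 1] and [I_n] lies in the first step of the
    filtration. *)
Lemma morava_wei : wei (lt_filtration 'I_n.-1 Wc) (nseries F p) (p ^ n).
Proof.
set fl := lt_filtration _ _; have HI := fil_ideal fl 1.
have sub x : lt_ideal p n x -> fl 1%N x.
  apply: ideal_of => _ [i /= iN <-] a; case: i iN => [_|i iN] /=.
    rewrite natr_const /=; case: eqP => [->|_]; last by exists 0; rewrite mulr0.
    by exists 1; rewrite mdeg0 mulr1.
  have iN' : (i < n.-1)%N by lia.
  rewrite (insubT (fun i => i < n.-1)%N iN') /oapp mps_varE mcoef_mono; case: eqP => [->|_]; last by exists 0; rewrite mulr0.
  exists 1; rewrite mulr1 (_ : mdeg _ = 1%N) ?expr0 // /mdeg (bigD1 (Ordinal iN')) //=.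
  by rewrite ffunE eqxx big1 // => j ji; rewrite ffunE (negPf ji).
have [c [v cv] H] := met_coord EF (leqnn n).
(* [insub] fails at [n.-1], so the default value of [lt_u] is reached. For [n = 0] the value would
   be [p]. *)
have un : lt_u p n W n = 1.
  by move: n0; rewrite /lt_u; case: (n) => // n' _ /=; rewrite insubF ?ltnn.
split=> [i iN|]; first by have := sub _ (H i (ltnW iN)); rewrite ltn_eqF // subr0.
have /sub := H _ (leqnn _); rewrite eqxx un mulr1 => cH.
apply: (@fil_unit _ fl _ v); rewrite -cv -mulrBl; exact: (idealMr HI).
Qed.

Lemma morava_wdiv j : wdiv (nseries F (p ^ j)) (p ^ (n * j)).
Proof.
rewrite expnM; apply: (@wei_wdiv _ (lt_filtration 'I_n.-1 Wc)).
by apply: wei_nseries; [apply: met_fgl EF|apply: morava_wei].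
Qed.

Lemma morava_wprep j : wprep (nseries F (p ^ j)) (p ^ (n * j)).
Proof.
rewrite expnM; apply: (@wei_wprep _ (lt_filtration 'I_n.-1 Wc)).
by apply: wei_nseries; [apply: met_fgl EF|apply: morava_wei].
Qed.

Section LocalRing.
Context (t : nat) (L : comNzRingType) (iota : {rmorphism LTring n W -> L}).
Hypotheses (tn : (t < n)%N) (hL : is_Lt p t iota).

Lemma Lt_complete : adic_complete (Lt_ideal p t iota).
Proof.
have [U [e [c [He [Hc _ _] E]]]] := hL; congr adic_complete: Hc.
apply/funext => x; apply/propext; split.
  apply: idl_sub; first exact: idl_is_ideal.
  move=> _ [y Jy <-]; move: y Jy.
  have HP : is_ideal (fun y => Lt_ideal p t iota (c y)).
    have HI : is_ideal (Lt_ideal p t iota) by apply: idl_is_ideal.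
    split=> [|y z cy cz|r y cy]; first by rewrite rmorph0; apply: (ideal0 HI).
      by rewrite rmorphD; apply: (idealD HI).
    by rewrite rmorphM; apply: (idealMl HI).
  apply: (idl_sub HP) => _ [g Jg <-]; apply: sub_idl; exists g => //.
apply: idl_sub; first exact: idl_is_ideal.
move=> _ [g Jg <-]; apply: sub_idl; exists (e g); last by rewrite E.
by apply: sub_idl; exists g.
Qed.

(** The coordinate is adapted at [i = t]. Here [u_t] is a unit, since it was inverted, and the image
    of [I_t] generates the ideal of definition. *)
Lemma local_wei : wei (adic_filtration Lt_complete) (nseries (map_mps iota F) p) (p ^ t).
Proof.
set fl := adic_filtration _; have HI := fil_ideal fl 1.
have HL : is_ideal (Lt_ideal p t iota) by apply: idl_is_ideal.
have sub x : lt_ideal p t x -> fl 1%N (iota x).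
  by move=> Jx; apply/(idl_pow1 _ HL)/sub_idl; exists x.
have [c [v cv] H] := met_coord EF (ltnW tn).
have [U [e [d [[He _ _] _ E]]]] := hL.
have [w uw] : exists w, iota (lt_u p n W t) * w = 1.
  have [|w ew] := He (lt_u p n W t).
    by exists [:: lt_u p n W t]; rewrite ?big_seq1 // => x; rewrite inE => /eqP.
  by exists (d w); rewrite E /= -rmorphM ew rmorph1.
have cE i : cf (nseries (map_mps iota F) p) i = iota (cf (nseries F p) i).
  by rewrite -map_nseries.
split=> [i iN|].
  by rewrite cE; have := sub _ (H i (ltnW iN)); rewrite ltn_eqF // subr0.
have /sub := H _ (leqnn _); rewrite eqxx rmorphB rmorphM => cH.
apply: (@fil_unit _ fl _ (iota v * w)).
have -> : 1 = iota c * iota (lt_u p n W t) * (iota v * w).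
  by rewrite mulrACA uw mulr1 -rmorphM cv rmorph1.
rewrite cE -mulrBl; exact: (idealMr HI).
Qed.

Lemma local_fgl : formal_group_law (map_mps iota F).
Proof. by apply: map_fgl; apply: met_fgl EF. Qed.

Lemma local_wdiv j : wdiv (nseries (map_mps iota F) (p ^ j)) (p ^ (t * j)).
Proof.
rewrite expnM; apply: (@wei_wdiv _ (adic_filtration Lt_complete)).
by apply: wei_nseries; [apply: local_fgl|apply: local_wei].
Qed.

Lemma local_wprep j : wprep (nseries (map_mps iota F) (p ^ j)) (p ^ (t * j)).
Proof.
rewrite expnM; apply: (@wei_wprep _ (adic_filtration Lt_complete)).
by apply: wei_nseries; [apply: local_fgl|apply: local_wei].
Qed.

Lemma local_coef j i : (i < p ^ (t * j))%N ->
  Lt_ideal p t iota (cf (nseries (map_mps iota F) (p ^ j)) i).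
Proof.
have HL : is_ideal (Lt_ideal p t iota) by apply: idl_is_ideal.
have [] := wei_nseries j local_fgl local_wei.
by rewrite -expnM => H _ /H /(idl_pow1 _ HL).
Qed.

Lemma local_lead j :
  exists c, cf (nseries (map_mps iota F) (p ^ j)) (p ^ (t * j)) * c = 1.
Proof. by have [_] := wei_nseries j local_fgl local_wei; rewrite -expnM. Qed.
End LocalRing.
End Instances.

Section Divisibility.
Context (K : comPzRingType).

Lemma mcoef_scomp_var (X : finType) (x : X) (h : mps unit K) (m : monom X) :
  scomp h 'x_x m = if [forall y, (y != x) ==> (m y == 0%N)] then cf h (m x) else 0.
Proof.
case: ifPn => [/forallP H|/forallPn[y]]; last first.
  by rewrite negb_imply -lt0n => /andP[yx my]; apply: (scomp_var_indep _ yx).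
have mE : m = expo x (m x).
  by apply/ffunP => y; rewrite ffunE; case: eqP (H y) => [->|_ /= /eqP].
have gE (a : monom unit) : \prod_(i : unit) ('x_x : mps X K) ^+ a i = 'x_x ^+ a tt.
  by rewrite (big_pred1 tt) // => -[].
have dm : mdeg m = m x.
  by rewrite /mdeg (bigD1 x) //= big1 ?addn0 // => y yx; have := H y; rewrite yx => /eqP.
have [a aE] : exists a : {ffun unit -> 'I_(mdeg m).+1}, box_mon a = [ffun=> m x].
  by apply: box_monK => y; rewrite ffunE dm.
have aE' : a tt = m x :> nat by move/ffunP: aE => /(_ tt); rewrite !ffunE.
rewrite mcoef_subst (sum_only (i := a)) => [|b ba].
  rewrite (big_pred1 tt) => [|[]//]; rewrite aE' aE mcoef_varn.
  by rewrite (_ : (m == _) = true) ?mulr1 //; apply/eqP.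
rewrite (big_pred1 tt) => [|[]//]; rewrite mcoef_varn; case: eqP => [e|]; rewrite ?mulr0 //.
case/eqP: ba; apply/ffunP => -[]; apply/val_inj; rewrite /= aE'.
by move/(congr1 (fun u : monom X => u x)): e; rewrite ffunE eqxx.
Qed.

(* [h(x) - h(y)] is divisible by [x - y]. *)
Lemma scomp_sub_dvd (X : finType) (h : mps unit K) (a b : mps X K) : a 0 = 0 -> b 0 = 0 ->
  exists k, scomp h a - scomp h b = (a - b) * k.
Proof.
(* Universal case: [(x^d - y^d)/(x - y)] is the sum of the [x^i y^j] with [i + j + 1 = d], whence
   the successor in the index. *)
move=> a0 b0; pose k : mps bool K := MPS (fun m => cf h (m false + m true).+1).
have E : scomp h 'x_false - scomp h 'x_true = ('x_false - 'x_true) * k.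
  apply: mpsP => m; rewrite mulrBl -['x_false]expr1 -['x_true]expr1 !mcoefB.
  rewrite !mcoef_varnM !expr1 !mcoef_scomp_var.
  have fE (c : bool) : [forall y, (y != c) ==> (m y == 0%N)] = (m (~~ c) == 0%N).
    apply/forallP/idP => [/(_ (~~ c))|mb y]; first by case: (c).
    by apply/implyP => yb; rewrite (_ : y = ~~ c) //; case: (y) (c) yb => -[].
  rewrite !fE /= !ffunE /= !subn1.
  case: (posnP (m false)) (posnP (m true)) => [->|f0] [->|t0] //=.
  - by rewrite !subrr.
  - by rewrite -[in LHS](prednK t0).
  - by rewrite addn0 prednK.
  - by rewrite -addSn prednK // -addnS prednK // !subrr.
have c0 (c : bool) : (if c then b else a) 0 = 0 by case: c.
exists (msubst k (fun c : bool => if c then b else a)).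
have := congr1 (subst_rm c0) E; rewrite rmorphM !rmorphB !subst_rmE.
by rewrite !scompA ?var0 // !msubst_var.
Qed.

Lemma scomp_dvd (X : finType) (h : mps unit K) (a : mps X K) : a 0 = 0 -> h 0 = 0 ->
  exists k, scomp h a = a * k.
Proof.
move=> a0 h0; have [k] := scomp_sub_dvd h a0 (erefl : (0 : mps X K) 0 = 0).
rewrite subr0 (_ : scomp h 0 = 0) ?subr0 => [->|]; first by exists k.
have -> : h = 'x_tt * sh tt 1 h.
  rewrite {1}(lo_sh tt 1 h) expr1 (_ : lo tt 1 h = 0) ?add0r //; apply: mpsP => m.
  rewrite mcoef_lo ltnS leqn0; case: eqP => // mt; rewrite -[RHS]h0; congr (mcoef h _).
  by apply/ffunP => -[]; rewrite mt monom0.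
by rewrite /scomp msubstM // msubst_var // mul0r.
Qed.
Lemma const_sh (k : mps unit K) : k = mps_const unit (k 0) + 'x_tt * sh tt 1 k.
Proof.
rewrite {1}(lo_sh tt 1 k) expr1; congr (_ + _); apply: mpsP => u.
rewrite mcoef_lo ltnS leqn0 /=; case: eqP => ut; case: eqP => // e.
- by rewrite e.
- by case: e; apply/ffunP => -[]; rewrite ut monom0.
- by case: ut; rewrite e monom0.
Qed.

Lemma scomp_zero (X : finType) (k : mps unit K) : scomp k (0 : mps X K) = mps_const X (k 0).
Proof.
rewrite {1}(const_sh k) /scomp msubstD msubstM // msubst_var // mul0r addr0.
exact: msubst_const.
Qed.
End Divisibility.

(** * Groups of points *)

(** One theory of points serves twice: for [GG] over [E_n^0] with height [n], and for [GG_0] over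
    [L_t] with height [t]. Of the ground ring only Weierstrass division by the torsion series is
    kept. *)
Record fgrp := FGrp {
  fgK : comPzRingType;
  fgF : mps bool fgK;
  fgp : nat;
  fght : nat;
  fgp_gt0 : (0 < fgp)%N;
  fgP : formal_group_law fgF;
  fgwd : forall j, wdiv (nseries fgF (fgp ^ j)) (fgp ^ (fght * j)) }.

Record cring := CRing {
  cr :> comPzRingType;
  cJ : set cr;
  cJi : is_ideal cJ;
  cJc : adic_complete cJ }.

Definition discr (A : comPzRingType) : cring :=
  @CRing A _ (zero_ideal A) (zero_complete A).

(** Made discrete, because a point is killed by a power of [p] only at such a level. *)
Definition lvl (A : cring) m : cring := discr (quot (idl_pow_ideal (cJ (c := A)) m)).

Section Evaluation.
Context (X : finType) (K : comPzRingType).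
Definition ev0 (f : mps X K) : K := f 0.
Lemma ev0_zmod : zmod_morphism ev0. Proof. by []. Qed.
Lemma ev0_monoid : monoid_morphism ev0.
Proof. by split=> [|f g]; rewrite /ev0 ?mcoef1 ?eqxx ?mcoef_1M. Qed.
HB.instance Definition _ := GRing.isZmodMorphism.Build (mps X K) K ev0 ev0_zmod.
HB.instance Definition _ := GRing.isMonoidMorphism.Build (mps X K) K ev0 ev0_monoid.
End Evaluation.

Section Point.
Context (G : fgrp) (A : cring) (s : {rmorphism fgK G -> A}).
Notation K := (fgK G).
Notation F := (fgF G).
Notation p := (fgp G).
Notation tor j := (nseries F (p ^ j)).
Let HJ m := idl_pow_ideal (cJ (c := A)) m.
Notation "x == y %mod m" := (idl_pow (cJ (c := A)) m (x - y)) (at level 70, y at next level).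

Record gpt := Gpt {
  gp_hom :> {rmorphism mps unit K -> A};
  gp_lin : forall c, gp_hom (mps_const _ c) = s c;
  gp_tors : forall m, exists j, idl_pow (cJ (c := A)) m (gp_hom (tor j)) }.

HB.instance Definition _ := gen_eqMixin gpt.
HB.instance Definition _ := gen_choiceMixin gpt.

Lemma gpt_eq (P Q : gpt) : P =1 Q -> P = Q.
Proof.
case: P Q => [f fl ft] [g gl gt] /= /rmorph_eq e; subst g.
by rewrite (Prop_irrelevance fl gl) (Prop_irrelevance ft gt).
Qed.

Lemma tor_dvd i j : (i <= j)%N -> exists k, tor j = tor i * k.
Proof.
move=> /subnK <-; rewrite expnD (nseriesM (fgP G)).
by apply: scomp_dvd; apply: (nseries_at0 (fgP G)).
Qed.

Lemma scomp_dvd_hom (X : finType) (Psi : {rmorphism mps X K -> A}) m (h : mps unit K)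
  (a : mps X K) : a 0 = 0 -> h 0 = 0 ->
  idl_pow (cJ (c := A)) m (Psi a) -> idl_pow (cJ (c := A)) m (Psi (scomp h a)).
Proof. by move=> a0 h0; have [k ->] := scomp_dvd a0 h0; rewrite rmorphM; apply: idealMr. Qed.

Lemma tors_le (P : {rmorphism mps unit K -> A}) m i j : (i <= j)%N ->
  idl_pow (cJ (c := A)) m (P (tor i)) -> idl_pow (cJ (c := A)) m (P (tor j)).
Proof. by move=> /tor_dvd[k ->]; rewrite rmorphM; apply: idealMr. Qed.

Lemma tors_leX (X : finType) (x : X) (P : {rmorphism mps X K -> A}) m i j : (i <= j)%N ->
  idl_pow (cJ (c := A)) m (P (scomp (tor i) 'x_x)) ->
  idl_pow (cJ (c := A)) m (P (scomp (tor j) 'x_x)).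
Proof. exact: (@tors_le (P \o scomp_rm (var0 K x))). Qed.

Lemma tors_common (X : finType) (Q : X -> gpt) m :
  exists j, forall x, idl_pow (cJ (c := A)) m (Q x (tor j)).
Proof.
have [j jP] := choice (fun x => gp_tors (Q x) m).
by exists (\max_x j x) => x; apply: tors_le (jP x); apply: leq_bigmax.
Qed.

Section Assembly.
Context (X : finType).

(** Modulo [J^m] both maps kill one [[p^j]] in every variable, so [assembly_uniq] applies. *)
Lemma hom_uniq (Phi Psi : {rmorphism mps X K -> A}) :
  (forall c, Phi (mps_const X c) = Psi (mps_const X c)) ->
  (forall x, Phi 'x_x = Psi 'x_x) ->
  (forall m, exists j, forall x, idl_pow (cJ (c := A)) m (Phi (scomp (tor j) 'x_x))) ->
  (forall m, exists j, forall x, idl_pow (cJ (c := A)) m (Psi (scomp (tor j) 'x_x))) ->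
  Phi =1 Psi.
Proof.
move=> Ec Ex Pht Pst f; apply: (complete_eq (cJc A)) => m.
have [[i iP] [j jP]] := (Pht m, Pst m); apply/(qpi_eq (HJ m)).
apply: (@assembly_uniq _ _ _ _ (fun=> fgwd G (maxn i j)) _
  (qpi (HJ m) \o Phi) (qpi (HJ m) \o Psi)) f => [c|x|x|x] /=.
- by rewrite Ec.
- by rewrite Ex.
- by apply/qpi0; apply: tors_leX (iP x); apply: leq_maxl.
- by apply/qpi0; apply: tors_leX (jP x); apply: leq_maxr.
Qed.

(** The maps are assembled modulo each power of the ideal. The exponents [j m] are unrelated, but
    uniqueness for their maximum makes successive levels compatible. *)
Lemma point_assembly (Q : X -> gpt) : exists Phi : {rmorphism mps X K -> A},
  (forall c, Phi (mps_const X c) = s c) /\ forall x h, Phi (scomp h 'x_x) = Q x h.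
Proof.
have [j jP] := choice (tors_common Q).
have as_m m := @assembly _ _ _ _ (fun=> fgwd G (j m)) _ (qpi (HJ m) \o s)
  (fun x => qpi (HJ m) \o Q x) (fun x c => congr1 _ (gp_lin (Q x) c))
  (fun x => (qpi0 (HJ m) _).2 (jP m x)).
pose Phi m := projT1 (cid (as_m m)); have PhiP m := projT2 (cid (as_m m)).
have [m f a fa|Ph PhE] := @limit_hom A _ (cJc A) _ Phi.
  have qle x : idl_pow (cJ (c := A)) m.+1 x -> qpi (HJ m) x = 0.
    by move=> Jx; apply/qpi0; apply: idl_powW Jx.
  have [th thE] := quot_hom (HJ m.+1) qle.
  rewrite -thE -fa; move: f {a fa} => f.
  apply: (@assembly_uniq _ _ _ _ (fun=> fgwd G (maxn (j m) (j m.+1))) _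
    (Phi m) (th \o Phi m.+1)) f => [c|x|x|x].
  - by rewrite (PhiP m).1 /= (PhiP m.+1).1 thE.
  - by rewrite -(scompx (var0 K x)) (PhiP m).2 [RHS]/= (PhiP m.+1).2 /= thE.
  - rewrite (PhiP m).2; apply/qpi0; apply: tors_le (jP m x); exact: leq_maxl.
  - rewrite /= (PhiP m.+1).2 thE; apply/qpi0; apply: tors_le (jP m x); exact: leq_maxl.
exists Ph; split=> [c|x h]; apply: (complete_eq (cJc A)) => m; apply/(qpi_eq (HJ m)).
  by rewrite -PhE (PhiP m).1.
by rewrite -PhE (PhiP m).2.
Qed.
End Assembly.

Lemma gpt_ext (P Q : gpt) : P 'x_tt = Q 'x_tt -> P = Q.
Proof.
move=> e; apply/gpt_eq/hom_uniq => [c|[]//|m|m]; first by rewrite !gp_lin.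
  by have [j jP] := gp_tors P m; exists j => -[]; rewrite scomp_var.
by have [j jP] := gp_tors Q m; exists j => -[]; rewrite scomp_var.
Qed.

(** The map [Phi] of the pair is determined by [P] and [Q], and the sum is its composite with
    substitution of [F]. *)
Lemma is_sum_uniq (P Q R R' : gpt) : is_sum s F P Q R -> is_sum s F P Q R' -> R = R'.
Proof.
move=> [Phi [Phc PhE]] [Psi [Psc PsE]]; apply: gpt_eq => h.
have [_ _ <-] := PhE h; have [_ _ <-] := PsE h; apply: hom_uniq => [c|b|m|m].
- by rewrite Phc Psc.
- rewrite -(scompx (var0 K b)); have [E1 E2 _] := PhE 'x_tt; have [E3 E4 _] := PsE 'x_tt.
  by case: b; rewrite ?E1 ?E2 ?E3 ?E4.
- have [j jP] := tors_common (fun b : bool => if b then Q else P) m.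
  exists j => b; have [E1 E2 _] := PhE (tor j); have := jP b.
  by case: b; rewrite ?E1 ?E2.
- have [j jP] := tors_common (fun b : bool => if b then Q else P) m.
  exists j => b; have [E1 E2 _] := PsE (tor j); have := jP b.
  by case: b; rewrite ?E1 ?E2.
Qed.

(** [[p^j]] is additive for [F], and [F(a,b) = a + b v], so the ideal absorbs both summands. *)
Lemma fadd_tors (X : finType) (Psi : {rmorphism mps X K -> A}) m (a b : mps X K) j :
  a 0 = 0 -> b 0 = 0 ->
  idl_pow (cJ (c := A)) m (Psi (scomp (tor j) a)) ->
  idl_pow (cJ (c := A)) m (Psi (scomp (tor j) b)) ->
  idl_pow (cJ (c := A)) m (Psi (scomp (tor j) (fadd F a b))).
Proof.
move=> a0 b0 Ja Jb; rewrite (nseries_fadd (fgP G)) //.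
have [v [w [FE _ _]]] := fgl_unit (fgP G); rewrite /fadd {1}FE.
have c0 (c : bool) : (if c then scomp (tor j) b else scomp (tor j) a) 0 = 0.
  by case: c; rewrite scomp0 // (nseries_at0 (fgP G)).
rewrite msubstD msubstM // !msubst_var // rmorphD rmorphM; apply: idealD => //.
exact: idealMr.
Qed.

Lemma gsum_ex (P Q : gpt) : exists R : gpt, is_sum s F P Q R.
Proof.
have [Phi [Phc PhE]] := point_assembly (fun b : bool => if b then Q else P).
have Rl c : (Phi \o scomp_rm (fgl0 (fgP G))) (mps_const _ c) = s c.
  by rewrite /= /subst_fun msubst_const // => _; rewrite (fgl0 (fgP G)).
have Rt m : exists j, idl_pow (cJ (c := A)) m ((Phi \o scomp_rm (fgl0 (fgP G))) (tor j)).
  have [j jP] := tors_common (fun b : bool => if b then Q else P) m; exists j.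
  rewrite /= -[subst_fun _ _]/(scomp _ F) -[F in scomp _ F]msubst_vars.
  rewrite -[msubst F _]/(msubst F (fun b : bool => mps_var K b)).
  rewrite (_ : (fun b => 'x_b) = fun b : bool => if b then 'x_true else 'x_false).
    by apply: fadd_tors; rewrite ?var0 // PhE; [apply: (jP false)|apply: (jP true)].
  by apply/funext => -[].
by exists (Gpt Rl Rt), Phi; split=> // h; rewrite !PhE.
Qed.

Definition gadd (P Q : gpt) : gpt := projT1 (cid (gsum_ex P Q)).
Lemma gaddP (P Q : gpt) : is_sum s F P Q (gadd P Q). Proof. by rewrite /gadd; case: cid. Qed.

Lemma gzero_lin c : (s \o @ev0 unit K) (mps_const _ c) = s c.
Proof. by rewrite /= /ev0 /= eqxx. Qed.
Lemma gzero_tors m : exists j, idl_pow (cJ (c := A)) m ((s \o @ev0 unit K) (tor j)).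
Proof.
exists 0%N; rewrite -[_ (tor _)]/(s (mcoef (tor 0) 0)) (nseries_at0 (fgP G)) rmorph0.
exact: (ideal0 (idl_pow_ideal _ _)).
Qed.
Definition gzero : gpt := Gpt gzero_lin gzero_tors.

(** For points that factor through one map [Psi], sums are computed by formal addition of the
    substituted series. The group axioms then follow from the identities of [F]. *)
Lemma gaddE (X : finType) (Psi : {rmorphism mps X K -> A}) (a b : mps X K) (P Q : gpt) :
  (forall c, Psi (mps_const X c) = s c) -> a 0 = 0 -> b 0 = 0 ->
  (forall h, P h = Psi (scomp h a)) -> (forall h, Q h = Psi (scomp h b)) ->
  forall h, gadd P Q h = Psi (scomp h (fadd F a b)).
Proof.
move=> Pc a0 b0 PE QE.
have c0 (c : bool) : (if c then b else a) 0 = 0 by case: c.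
have f0 : fadd F a b 0 = 0 by apply: (fadd_at0 (fgP G)).
have Rl c : (Psi \o scomp_rm f0) (mps_const _ c) = s c.
  by rewrite /= /subst_fun msubst_const // => _.
have Rt m : exists j, idl_pow (cJ (c := A)) m ((Psi \o scomp_rm f0) (tor j)).
  have [j jP] := tors_common (fun b : bool => if b then Q else P) m; exists j.
  apply: fadd_tors => //; first by rewrite -PE; apply: (jP false).
  by rewrite -QE; apply: (jP true).
move=> h; rewrite (@is_sum_uniq P Q (gadd P Q) (Gpt Rl Rt) (gaddP P Q)) //.
exists (Psi \o subst_rm c0); split=> [c|k] /=; first by rewrite /subst_fun msubst_const.
rewrite /subst_fun !scompA ?(fgl0 (fgP G)) ?var0 // !msubst_var //.
Qed.

Lemma gptE (P : gpt) h : P h = P (scomp h 'x_tt). Proof. by rewrite scomp_var. Qed.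

Lemma gaddC : commutative gadd.
Proof.
move=> P Q; have [Phi [Phc PhE]] := point_assembly (fun b : bool => if b then Q else P).
have EP h : P h = Phi (scomp h 'x_false) by rewrite PhE.
have EQ h : Q h = Phi (scomp h 'x_true) by rewrite PhE.
apply: gpt_eq => h; rewrite (gaddE Phc (var0 K false) (var0 K true) EP EQ).
rewrite (gaddE Phc (var0 K true) (var0 K false) EQ EP).
by rewrite (faddC (fgP G)) ?var0.
Qed.

Lemma gadd0 : left_id gzero gadd.
Proof.
move=> P; apply: gpt_eq => h; rewrite (@gaddE _ P 0 'x_tt) ?var0 //.
- by rewrite (fadd0f (fgP G)) ?var0 // -gptE.
- exact: gp_lin.
- by move=> k; rewrite scomp_zero gp_lin.
- exact: gptE.
Qed.

Lemma gaddA : associative gadd.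
Proof.
move=> P Q R; pose T (i : 'I_3) := nth P [:: P; Q; R] i.
have [Phi [Phc PhE]] := point_assembly T.
pose x i : mps 'I_3 K := 'x_(inord i).
have xE i h : (i < 3)%N -> nth P [:: P; Q; R] i h = Phi (scomp h (x i)).
  by move=> i3; rewrite PhE /T inordK.
have x0 i : x i 0 = 0 by apply: var0.
have [[E0 E1] E2] := (fun h => xE 0%N h isT, fun h => xE 1%N h isT, fun h => xE 2%N h isT).
have f0 a b : fadd F (x a) (x b) 0 = 0 by rewrite (fadd_at0 (fgP G)).
have E01 := gaddE Phc (x0 0%N) (x0 1%N) E0 E1.
have E12 := gaddE Phc (x0 1%N) (x0 2%N) E1 E2.
apply: gpt_eq => h; rewrite (gaddE Phc (x0 0%N) (f0 _ _) E0 E12).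
by rewrite (gaddE Phc (f0 _ _) (x0 2%N) E01 E2) (faddA (fgP G)).
Qed.
End Point.

Section Map.
Context (G : fgrp) (A A' : cring) (f : {rmorphism A -> A'}).
Hypothesis fc : exists a, forall x, idl_pow (cJ (c := A)) a x -> cJ (f x).
Context (s : {rmorphism fgK G -> A}) (s' : {rmorphism fgK G -> A'}).
Hypothesis fs : forall c, f (s c) = s' c.

Lemma gmap_lin (P : gpt s) c : (f \o P) (mps_const _ c) = s' c.
Proof. by rewrite /= gp_lin fs. Qed.
Lemma gmap_tors (P : gpt s) m : exists j,
  idl_pow (cJ (c := A')) m ((f \o P) (nseries (fgF G) (fgp G ^ j))).
Proof.
have [a ua] := fc; have [j Pj] := gp_tors P (a * m).
by exists j; apply: (idl_pow_morph ua).
Qed.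
Definition gmap (P : gpt s) : gpt s' := Gpt (gmap_lin P) (gmap_tors P).

Lemma gmapE (P : gpt s) h : gmap P h = f (P h). Proof. by []. Qed.

Lemma gmap_add (P Q : gpt s) : gmap (gadd P Q) = gadd (gmap P) (gmap Q).
Proof.
apply: is_sum_uniq (gaddP _ _); have [Phi [Phc PhE]] := gaddP P Q.
exists (f \o Phi); split=> [c|h]; first by rewrite /= Phc fs.
by have [E1 E2 E3] := PhE h; rewrite /= E1 E2 E3.
Qed.
End Map.

Section Level.
Context (G : fgrp) (A : cring) (s : {rmorphism fgK G -> A}).
Notation F := (fgF G).
Notation p := (fgp G).
Notation tor j := (nseries F (p ^ j)).
Let HJ m := idl_pow_ideal (cJ (c := A)) m.
Notation pJ := (idl_pow (cJ (c := A))).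

Definition lpi m : {rmorphism A -> lvl A m} := qpi (HJ m).
Lemma lpi0 m x : lpi m x = 0 <-> pJ m x. Proof. exact: qpi0. Qed.
Lemma lpi_eq m x y : lpi m x = lpi m y <-> pJ m (x - y). Proof. exact: qpi_eq. Qed.
Lemma lpi_cont m : exists a, forall x, pJ a x -> cJ (lpi m x).
Proof. by exists m => x /lpi0. Qed.

Definition gl m (P : gpt s) : gpt (lpi m \o s) :=
  gmap (lpi_cont m) (fun c => erefl : lpi m (s c) = (lpi m \o s) c) P.

Lemma gl_ext (P Q : gpt s) : (forall m, gl m P = gl m Q) -> P = Q.
Proof.
move=> PQ; apply: gpt_eq => h; apply: (complete_eq (cJc A)) => m.
by apply/lpi_eq; have := congr1 (fun P : gpt _ => P h) (PQ m).
Qed.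

(** [[a]] and [[a mod p^j]] differ by a multiple of [[p^j]], because [F(r,y) - r] is divisible by
    [y]. *)
Lemma nseries_tor_mod (P : gpt s) m j a b : pJ m (P (tor j)) -> a = b %[mod p ^ j] ->
  forall h, pJ m (P (scomp h (nseries F a)) - P (scomp h (nseries F b))).
Proof.
move=> Pj ab h; have FG := fgP G; have n0 := nseries_at0 FG.
have H c : pJ m (P (scomp h (nseries F c)) - P (scomp h (nseries F (c %% p ^ j)%N))).
  rewrite -rmorphB; have [k ->] := scomp_sub_dvd h (n0 c) (n0 (c %% p ^ j)%N).
  rewrite {1}(divn_eq c (p ^ j)%N) addnC (nseriesD FG) (nseriesM FG).
  have [k' ->] := scomp_dvd (n0 (p ^ j)%N) (n0 (c %/ p ^ j)%N).
  have [v [w [FE _ _]]] := fgl_unit FG.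
  set r := nseries _ (_ %% _); set y := tor j * k'.
  have y0 : y 0 = 0 by rewrite /y mcoef_1M n0 mul0r.
  have c0 (e : bool) : (if e then y else r) 0 = 0 by case: e; rewrite ?n0.
  rewrite /fadd {1}FE msubstD msubstM // !msubst_var // addrC addKr /y.
  by rewrite !rmorphM -!mulrA; apply: idealMr.
by apply: (ideal_trans (HJ m)) (H a) _; rewrite ab; apply: (idealBC (HJ m)).
Qed.

(** A [p]-adic integer given by its residues; it permits multiplication by [-1] before any ring of
    [p]-adic integers is fixed. *)
Definition compat (a : nat -> nat) := forall j, a j.+1 = a j %[mod p ^ j].

Lemma compat_le a : compat a -> forall i j, (i <= j)%N -> a j = a i %[mod p ^ i].
Proof.
move=> ac i j /subnK <-; elim: (j - i)%N => // d IHd; rewrite addSn -IHd.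
have pd : (p ^ i %| p ^ (d + i))%N by rewrite expnD dvdn_mull.
by rewrite -(modn_dvdm (a (d + i).+1) pd) ac modn_dvdm.
Qed.

(** At level [m] the multiple is taken by [a (j m)], where [p^(j m)] kills [P]. Other exponents give
    the same map there by [nseries_tor_mod], so the levels fit together. *)
Lemma pscale_ex (P : gpt s) a : compat a -> exists R : gpt s,
  forall m, exists2 j, pJ m (P (tor j)) & forall h, pJ m (R h - P (scomp h (nseries F (a j)))).
Proof.
move=> ac; have FG := fgP G; have n0 := nseries_at0 FG.
have [j jP] := choice (gp_tors P).
pose Phi m : {rmorphism mps unit (fgK G) -> quot (HJ m)} :=
  qpi (HJ m) \o (P \o scomp_rm (n0 (a (j m)))).
have [m h b /(qpi_eq (HJ _)) hb|R RP] := @limit_hom A _ (cJc A) _ Phi.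
  apply/(qpi_eq (HJ m)); apply: ideal_trans (idl_powW (leqnSn m) hb) => //.
  have jm1 := idl_powW (leqnSn m) (jP m.+1).
  have [le|/ltnW le] := leqP (j m) (j m.+1).
    by apply: (nseries_tor_mod (jP m)); rewrite (compat_le ac).
  by apply: (nseries_tor_mod jm1); rewrite (compat_le ac).
have RP' m h : pJ m (R h - P (scomp h (nseries F (a (j m))))).
  by apply/(qpi_eq (HJ m)); rewrite -RP.
have Rl c : R (mps_const _ c) = s c.
  apply: (complete_eq (cJc A)) => m; rewrite -(gp_lin P).
  have := RP' m (mps_const _ c); by rewrite /scomp msubst_const.
have Rt m : exists j, pJ m (R (tor j)).
  exists (j m); have := RP' m (tor (j m)); rewrite -(nseriesM FG) mulnC (nseriesM FG).
  move=> H; rewrite -(subrK (P (scomp (nseries F (a (j m))) (tor (j m)))) (R _)).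
  by apply: (idealD (HJ m)) => //; apply: scomp_dvd_hom.
by exists (Gpt Rl Rt) => m; exists (j m) => [|h]; [apply: jP|apply: RP'].
Qed.

Definition pscale (a : nat -> nat) (P : gpt s) : gpt s :=
  if pselect (compat a) is left ac then projT1 (cid (pscale_ex P ac)) else P.

Lemma pscaleP a (P : gpt s) m j : compat a -> pJ m (P (tor j)) ->
  forall h, pJ m (pscale a P h - P (scomp h (nseries F (a j)))).
Proof.
move=> ac Pj h; rewrite /pscale; case: pselect => // ac'; case: cid => R RP /=.
have [i Pi /(_ h) Ri] := RP m; apply: (ideal_trans (HJ m)) Ri _.
have [le|/ltnW le] := leqP i j.
  by apply: (nseries_tor_mod Pi); rewrite (compat_le ac).
by apply: (nseries_tor_mod Pj); rewrite (compat_le ac).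
Qed.

Lemma compat_opp : compat (fun j => (p ^ j)%N.-1).
Proof.
move=> j; have p0 := fgp_gt0 G.
have -> : ((p ^ j.+1).-1 = (p ^ j).-1 + p.-1 * p ^ j)%N.
  have := expn_gt0 p j; rewrite p0 /= => pj.
  by rewrite expnS -{1}(prednK p0) mulSn -[in LHS](prednK pj) addSn /= prednK.
by rewrite addnC modnMDl.
Qed.

(** The inverse is multiplication by [-1], the limit of [p^j - 1]; no inverse series of [F] is
    constructed. *)
Definition gopp (P : gpt s) : gpt s := pscale (fun j => (p ^ j)%N.-1) P.

End Level.

Lemma gaddN (G : fgrp) (A : cring) (s : {rmorphism fgK G -> A}) :
  left_inverse (gzero s) (@gopp G A s) (@gadd G A s).
Proof.
move=> P; have FG := fgP G; have n0 := nseries_at0 FG; apply: gl_ext => m.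
rewrite {1}/gl gmap_add -!/(gl m _); apply: gpt_ext.
have [j Pj] := gp_tors P m.
have PE h : gl m (gopp P) h = gl m P (scomp h (nseries (fgF G) (fgp G ^ j)%N.-1)).
  by apply/lpi_eq; apply: pscaleP Pj _; apply: compat_opp.
have QE h : gl m P h = gl m P (scomp h 'x_tt) by rewrite scomp_var.
rewrite (gaddE (gp_lin (gl m P)) (n0 _) (var0 _ _) PE QE) scompx; last first.
  by rewrite (fadd_at0 FG) ?var0.
rewrite -(nseries1 FG) -(nseriesD FG) addn1 prednK ?expn_gt0 ?fgp_gt0 //.
rewrite [LHS](lpi0 _ _).2 // (nseries1 FG).
by rewrite -[RHS]/(lpi A m (s (mcoef 'x_tt 0))) var0 !rmorph0.
Qed.

HB.instance Definition _ (G : fgrp) (A : cring) (s : {rmorphism fgK G -> A}) :=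
  GRing.isZmodule.Build (gpt s) (@gaddA G A s) (@gaddC G A s) (@gadd0 G A s) (@gaddN G A s).

Section MapMorphism.
Context (G : fgrp) (A A' : cring) (f : {rmorphism A -> A'}).
Hypothesis fc : exists a, forall x, idl_pow (cJ (c := A)) a x -> cJ (f x).
Context (s : {rmorphism fgK G -> A}) (s' : {rmorphism fgK G -> A'}).
Hypothesis fs : forall c, f (s c) = s' c.
Notation gm := (gmap fc fs).

Lemma gmapD : {morph gm : P Q / P + Q}. Proof. exact: gmap_add. Qed.
Lemma gmap0 : gm 0 = 0.
Proof. by apply: (addrI (gm 0)); rewrite -gmapD !addr0. Qed.
Lemma gmapMn (P : gpt s) n : gm (P *+ n) = gm P *+ n.
Proof. by elim: n => [|n IHn]; rewrite ?gmap0 // !mulrS gmapD IHn. Qed.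
Lemma gmapN (P : gpt s) : gm (- P) = - gm P.
Proof. by apply/eqP; rewrite -addr_eq0 -gmapD addNr gmap0. Qed.
Lemma gmapB : {morph gm : P Q / P - Q}.
Proof. by move=> P Q; rewrite gmapD gmapN. Qed.
Lemma gmap_sum I r (p : pred I) (E : I -> gpt s) :
  gm (\sum_(i <- r | p i) E i) = \sum_(i <- r | p i) gm (E i).
Proof. exact: (big_morph _ gmapD gmap0). Qed.
End MapMorphism.

Section Multiples.
Context (G : fgrp) (A : cring) (s : {rmorphism fgK G -> A}).
Notation F := (fgF G).
Notation p := (fgp G).
Notation tor j := (nseries F (p ^ j)).
Notation pJ := (idl_pow (cJ (c := A))).
Implicit Types (P Q : gpt s).

Lemma gpt0E h : (0 : gpt s) h = s (h 0). Proof. by []. Qed.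

Lemma gpt0x : (0 : gpt s) 'x_tt = 0.
Proof. by rewrite -[LHS]/(s (mcoef 'x_tt 0)) var0 rmorph0. Qed.

Lemma gpt_addE (X : finType) (Psi : {rmorphism mps X (fgK G) -> A}) (a b : mps X (fgK G)) P Q :
  (forall c, Psi (mps_const X c) = s c) -> a 0 = 0 -> b 0 = 0 ->
  (forall h, P h = Psi (scomp h a)) -> (forall h, Q h = Psi (scomp h b)) ->
  forall h, (P + Q) h = Psi (scomp h (fadd F a b)).
Proof. exact: gaddE. Qed.

Lemma gptMn P n h : (P *+ n) h = P (scomp h (nseries F n)).
Proof.
have FG := fgP G; have n0 := nseries_at0 FG.
elim: n h => [|n IHn] h; last first.
  rewrite mulrS; apply: (gpt_addE (Psi := P)); rewrite ?var0 //; first exact: gp_lin.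
  by move=> k; rewrite scomp_var.
by rewrite mulr0n gpt0E -(gp_lin P) -(scomp_zero unit h).
Qed.

Lemma gptMnx P n : (P *+ n) 'x_tt = P (nseries F n).
Proof. by rewrite gptMn scompx // (nseries_at0 (fgP G)). Qed.

Lemma gpt_tor0 P j : P *+ (p ^ j) = 0 <-> P (tor j) = 0.
Proof.
rewrite -gptMnx; split=> [->|Px]; first exact: gpt0x.
by apply: gpt_ext; rewrite Px gpt0x.
Qed.

Lemma gpt_addx P Q : exists u v, (P + Q) 'x_tt = P 'x_tt + Q 'x_tt * u /\ u * v = 1.
Proof.
have [Phi [Phc PhE]] := gaddP P Q; have [v [w [FE vw _]]] := fgl_unit (fgP G).
exists (Phi v), (Phi w); rewrite -rmorphM vw rmorph1; split=> //.
have [E1 E2 E3] := PhE 'x_tt; rewrite -[P + Q]/(gadd P Q) -E3 -E1 -E2.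
by rewrite !scompx ?var0 ?(fgl0 (fgP G)) // {1}FE rmorphD rmorphM.
Qed.

Lemma gpt_subx P Q : exists u v, P 'x_tt - Q 'x_tt = (P - Q) 'x_tt * u /\ u * v = 1.
Proof.
have [u [v [E uv]]] := gpt_addx Q (P - Q); exists u, v; split=> //.
by move: E; rewrite addrC subrK => ->; rewrite addrAC subrr add0r.
Qed.

Lemma gpt_xP0 P : P 'x_tt = 0 -> P = 0.
Proof. by move=> Px; apply: gpt_ext; rewrite Px gpt0x. Qed.
End Multiples.

Section LevelTorsion.
Context (G : fgrp) (A : cring) (s : {rmorphism fgK G -> A}).
Notation p := (fgp G).
Implicit Types P : gpt s.

Lemma glD m : {morph @gl G A s m : P Q / P + Q}. Proof. exact: gmapD. Qed.
Lemma glMn m P n : gl m (P *+ n) = gl m P *+ n. Proof. exact: gmapMn. Qed.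

Lemma gl_tor P m : exists j, gl m P *+ (p ^ j) = 0.
Proof. have [j Pj] := gp_tors P m; exists j; exact/gpt_tor0/lpi0. Qed.

Lemma gl_tor_le P m i j : (i <= j)%N -> gl m P *+ (p ^ i) = 0 -> gl m P *+ (p ^ j) = 0.
Proof. by move=> /subnK <- e; rewrite expnD mulnC mulrnA e mul0rn. Qed.
End LevelTorsion.

Lemma mulrn_tor (V : zmodType) (x : V) q a b :
  x *+ q = 0 -> a = b %[mod q] -> x *+ a = x *+ b.
Proof.
move=> xq ab; rewrite (divn_eq a q) (divn_eq b q) ab !mulrnDr.
by rewrite ![(_ * q)%N]mulnC !mulrnA xq !mul0rn.
Qed.

(** * Multiples by p-adic integers *)

(** The two facts about [Z_p] on which scaling of points rests: natural numbers are dense, and they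
    determine residues modulo [p^j]. *)
Record zpring (p : nat) := ZpRing {
  zp :> comPzRingType;
  zp_approx : forall (z : zp) j, exists a : nat, exists w, z = a%:R + p%:R ^+ j * w;
  zp_inj : forall (a b : nat) j (w : zp), a%:R = b%:R + p%:R ^+ j * w ->
    a = b %[mod p ^ j] }.

Section Zscale.
Context (G : fgrp) (Z : zpring (fgp G)).
Notation p := (fgp G).

Definition zseq (z : Z) j : nat := projT1 (cid (zp_approx z j)).
Lemma zseqP (z : Z) j : exists w, z = (zseq z j)%:R + p%:R ^+ j * w.
Proof. by rewrite /zseq; case: cid. Qed.

Lemma zseq_mod (z : Z) j a w : z = a%:R + p%:R ^+ j * w -> zseq z j = a %[mod p ^ j].
Proof.
move=> zE; have [w' zE'] := zseqP z j; apply: (@zp_inj p Z _ _ _ (w - w')).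
by rewrite mulrBr addrA -zE {2}zE' addrK.
Qed.

Lemma zseq_compat z : compat G (zseq z).
Proof.
move=> j; have [w zE] := zseqP z j; have [w' zE'] := zseqP z j.+1.
apply/esym/(@zseq_mod z j _ (p%:R * w')).
by rewrite mulrA -exprSr.
Qed.

Section Scale.
Context (A : cring) (s : {rmorphism fgK G -> A}).
Implicit Types (P Q : gpt s) (z : Z).

Definition zscale z P : gpt s := pscale (zseq z) P.

Lemma zscale_spec z P m j (a : nat) w :
  idl_pow (cJ (c := A)) m (P (nseries (fgF G) (p ^ j))) -> z = a%:R + p%:R ^+ j * w ->
  forall h, idl_pow (cJ (c := A)) m (zscale z P h - P (scomp h (nseries (fgF G) a))).
Proof.
move=> Pj zE h; have HJ := idl_pow_ideal (cJ (c := A)) m.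
apply: (ideal_trans HJ) (pscaleP (zseq_compat z) Pj h) _.
exact: (nseries_tor_mod Pj (zseq_mod zE)).
Qed.

Lemma zscale_gl z P m j (a : nat) w : gl m P *+ (p ^ j) = 0 -> z = a%:R + p%:R ^+ j * w ->
  gl m (zscale z P) = gl m P *+ a.
Proof.
move=> /gpt_tor0/lpi0 Pj zE; apply: gpt_eq => h; rewrite gptMn; apply/lpi_eq.
exact: zscale_spec Pj zE h.
Qed.

Lemma zscaleDr z : {morph zscale z : P Q / P + Q}.
Proof.
move=> P Q; apply: gl_ext => m; rewrite glD.
have [[i iP] [j jQ]] := (gl_tor P m, gl_tor Q m).
have [w zE] := zseqP z (maxn i j).
have Pm := gl_tor_le (leq_maxl i j) iP; have Qm := gl_tor_le (leq_maxr i j) jQ.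
rewrite (zscale_gl Pm zE) (zscale_gl Qm zE) -mulrnDl -glD.
by apply: zscale_gl zE; rewrite glD mulrnDl Pm Qm addr0.
Qed.

Lemma zscaleDl z z' P : zscale (z + z') P = zscale z P + zscale z' P.
Proof.
apply: gl_ext => m; rewrite glD.
have [j Pj] := gl_tor P m; have [[w zE] [w' zE']] := (zseqP z j, zseqP z' j).
rewrite (zscale_gl Pj zE) (zscale_gl Pj zE') -mulrnDr.
apply: (zscale_gl (w := w + w')) Pj _.
by move: (zseq z j) (zseq z' j) zE zE' => a a' -> ->; rewrite natrD; ring.
Qed.

Lemma zscaleA z z' P : zscale z (zscale z' P) = zscale (z * z') P.
Proof.
apply: gl_ext => m; have [j Pj] := gl_tor P m.
have [[w zE] [w' zE']] := (zseqP z j, zseqP z' j).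
have P'j : gl m (zscale z' P) *+ (p ^ j) = 0.
  by rewrite (zscale_gl Pj zE') -mulrnA mulnC mulrnA Pj mul0rn.
rewrite (zscale_gl P'j zE) (zscale_gl Pj zE') -mulrnA mulnC; symmetry.
apply: (zscale_gl (w := (zseq z j)%:R * w' + w * z')) Pj _.
by move: (zseq z j) (zseq z' j) zE zE' => a a' -> ->; rewrite natrM; ring.
Qed.

Lemma zscale_nat n P : zscale n%:R P = P *+ n.
Proof.
apply: gl_ext => m; have [j Pj] := gl_tor P m.
by rewrite (zscale_gl (a := n) (w := 0) Pj) ?mulr0 ?addr0 // glMn.
Qed.

Lemma zscale1 P : zscale 1 P = P. Proof. exact: (zscale_nat 1). Qed.
Lemma zscaler0 z : zscale z 0 = 0.
Proof. by apply: (addrI (zscale z 0)); rewrite -zscaleDr !addr0. Qed.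
Lemma zscale_sum z I r (q : pred I) (E : I -> gpt s) :
  zscale z (\sum_(i <- r | q i) E i) = \sum_(i <- r | q i) zscale z (E i).
Proof. exact: (big_morph _ (zscaleDr z) (zscaler0 z)). Qed.

Lemma zscale_uniq z P (R : gpt s) :
  (forall m, exists j a w, [/\ idl_pow (cJ (c := A)) m (P (nseries (fgF G) (p ^ j))),
    z = a%:R + p%:R ^+ j * w :> Z
    & forall h, idl_pow (cJ (c := A)) m (R h - P (scomp h (nseries (fgF G) a)))]) ->
  R = zscale z P.
Proof.
move=> H; apply: gl_ext => m; have [j [a [w [Pj zE Rh]]]] := H m.
rewrite (zscale_gl (j := j) _ zE); last exact/gpt_tor0/lpi0.
by apply: gpt_eq => h; rewrite gptMn; apply/lpi_eq.
Qed.
End Scale.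

Lemma gmap_zscale (A A' : cring) (f : {rmorphism A -> A'})
  (fc : exists a, forall x, idl_pow (cJ (c := A)) a x -> cJ (f x))
  (s : {rmorphism fgK G -> A}) (s' : {rmorphism fgK G -> A'})
  (fs : forall c, f (s c) = s' c) (z : Z) (P : gpt s) :
  gmap fc fs (zscale z P) = zscale z (gmap fc fs P).
Proof.
apply: zscale_uniq => m; have [a fa] := fc.
have [j Pj] := gp_tors P (a * m); have [w zE] := zseqP z j.
exists j, (zseq z j), w; split=> // [|h].
  exact: (idl_pow_morph fa).
rewrite !gmapE -rmorphB; apply: (idl_pow_morph fa).
exact: zscale_spec Pj zE h.
Qed.
End Zscale.

(** * Polynomials and Weierstrass polynomials *)

Section PolyEval.
Context (L : comNzRingType) (B : comPzRingType) (r : {rmorphism L -> B}) (x : B).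

(** The target may be the zero ring, which can occur among the quotients below. *)
Definition pev (q : {poly L}) : B := \sum_(i < size q) r q`_i * x ^+ i.

Lemma pevE M (q : {poly L}) : (size q <= M)%N -> pev q = \sum_(i < M) r q`_i * x ^+ i.
Proof.
move=> qM; rewrite /pev (big_ord_widen _ (fun i => r q`_i * x ^+ i) qM) big_mkcond.
apply: eq_bigr => i _; case: ltnP => // iq.
by rewrite nth_default // rmorph0 mul0r.
Qed.

Lemma pev_zmod : zmod_morphism pev.
Proof.
move=> q q'; set M := maxn (size q) (size q').
rewrite !(@pevE M) ?leq_maxl ?leq_maxr //; last first.
  by rewrite (leq_trans (size_polyD _ _)) // size_polyN.
by rewrite -sumrB; apply: eq_bigr => i _; rewrite coefB rmorphB mulrBl.
Qed.
HB.instance Definition _ := GRing.isZmodMorphism.Build {poly L} B pev pev_zmod.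

Lemma pevC c : pev c%:P = r c.
Proof. by rewrite (@pevE 1%N) ?size_polyC_leq1 // big_ord1 coefC mulr1. Qed.

Lemma pevMX q : pev (q * 'X) = pev q * x.
Proof.
rewrite (@pevE (size q).+1) ?(leq_trans (size_polyMleq _ _)) ?size_polyX ?addn2 //.
rewrite big_ord_recl coefMX rmorph0 mul0r add0r mulr_suml; apply: eq_bigr => i _.
by rewrite coefMX /= exprSr mulrA.
Qed.

Lemma pev_monoid : monoid_morphism pev.
Proof.
split=> [|q q']; first by rewrite -[RHS](rmorph1 r) -pevC.
elim/poly_ind: q => [|q c IHq]; first by rewrite mul0r raddf0 mul0r.
have cM : pev (c%:P * q') = r c * pev q'.
  rewrite (@pevE (size q')) ?(leq_trans (size_polyMleq _ _)) //; last first.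
    by have := size_polyC_leq1 c; case: (size c%:P) => [|[|]] //= _; rewrite ?leq_pred ?add1n.
  rewrite /pev mulr_sumr; apply: eq_bigr => i _.
  by rewrite coefCM rmorphM mulrA.
rewrite mulrDl !raddfD /= cM pevMX pevC mulrDl; congr (_ + _).
by rewrite -mulrA [('X * _)]mulrC mulrA pevMX IHq mulrAC.
Qed.
HB.instance Definition _ := GRing.isMonoidMorphism.Build {poly L} B pev pev_monoid.

Lemma pevX : pev 'X = x.
Proof. by rewrite -['X]mul1r pevMX rmorph1 mul1r. Qed.

Lemma pev_poly M (c : nat -> L) : pev (\poly_(i < M) c i) = \sum_(i < M) r (c i) * x ^+ i.
Proof.
rewrite (@pevE M) ?size_poly //; apply: eq_bigr => i _.
by rewrite coef_poly ltn_ord.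
Qed.
End PolyEval.

Lemma pev_map (L : comNzRingType) (B B' : comPzRingType) (r : {rmorphism L -> B})
  (f : {rmorphism B -> B'}) (r' : {rmorphism L -> B'}) x q :
  (forall c, f (r c) = r' c) -> f (pev r x q) = pev r' (f x) q.
Proof.
move=> fr; rewrite rmorph_sum; apply: eq_bigr => i _.
by rewrite rmorphM rmorphXn fr.
Qed.

Section PolySeries.
Context (L : comNzRingType).

Definition pol : {poly L} -> mps unit L := pev (@mps_const unit L) 'x_tt.
HB.instance Definition _ := GRing.RMorphism.on pol.

Lemma polE (q : {poly L}) (m : monom unit) : pol q m = q`_(m tt).
Proof.
rewrite /pol (@pevE _ _ _ _ (maxn (size q) (m tt).+1)) ?leq_maxl // mcoef_sum.
have mM : (m tt < maxn (size q) (m tt).+1)%N by apply: leq_maxr.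
have e i : (m == expo tt i) = (i == m tt).
  apply/eqP/eqP => [->|->]; first by rewrite ffunE.
  by apply/ffunP => -[]; rewrite ffunE.
rewrite (sum_only (i := Ordinal mM)) => [|i im].
  by rewrite mcoef_constM mcoef_varn e eqxx mulr1.
rewrite mcoef_constM mcoef_varn e (_ : (_ == _) = false) ?mulr0 //.
by apply: contraNF im => /eqP im; apply/eqP/val_inj.
Qed.

Lemma polX : pol 'X = 'x_tt. Proof. exact: pevX. Qed.

Lemma pol_inj q : pol q = 0 -> q = 0.
Proof.
move=> q0; apply/polyP => i; rewrite coef0.
by have := congr1 (fun f => mcoef f [ffun=> i]) q0; rewrite polE ffunE.
Qed.

Lemma pol_low M q : low tt M (pol q) <-> (size q <= M)%N.
Proof.
split=> [H|qM m mM]; last by rewrite polE nth_default // (leq_trans qM).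
by apply/leq_sizeP => i iM; have := H [ffun=> i]; rewrite polE ffunE; apply.
Qed.

Lemma low_pol M (f : mps unit L) : low tt M f -> pol (\poly_(i < M) cf f i) = f.
Proof.
move=> fM; apply: mpsP => m; rewrite polE coef_poly; case: ltnP => mM.
  by rewrite {2}(coef1E m).
by rewrite fM.
Qed.

Lemma hom_pol (B : comPzRingType) (r : {rmorphism L -> B}) (Q : {rmorphism mps unit L -> B}) q :
  (forall c, Q (mps_const _ c) = r c) -> Q (pol q) = pev r (Q 'x_tt) q.
Proof. exact: pev_map. Qed.

Lemma monic_div (g : {poly L}) : g \is monic -> forall q, exists m rho,
  q = g * m + rho /\ (size rho < size g)%N.
Proof.
move=> gm q; exists (Pdiv.CommonRing.rdivp q g), (Pdiv.CommonRing.rmodp q g); split.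
  by rewrite mulrC -(Pdiv.RingMonic.rdivp_eq gm).
by rewrite Pdiv.CommonRing.ltn_rmodp monic_neq0.
Qed.

(* Dividing a polynomial by the Weierstrass polynomial of a series is the same as
   dividing it by the series. *)
Lemma pol_dvd (f : mps unit L) N v (g : {poly L}) : wdiv f N -> g \is monic ->
  size g = N.+1 -> pol g = v * f -> forall q k, pol q = k * f -> exists m, q = g * m.
Proof.
move=> wd gm gN gf q k qk; have [m [rho [qE rhoN]]] := monic_div gm q.
exists m; rewrite qE (_ : rho = 0) ?addr0 //; apply: pol_inj.
have E : pol rho = (k - pol m * v) * scomp f 'x_tt.
  by rewrite scomp_var mulrBl -qk -mulrA -gf qE rmorphD rmorphM mulrC addrAC subrr add0r.
rewrite E; have [_ /(_ (k - pol m * v)) ->] := wd unit tt; rewrite ?mul0r // -E.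
by apply/pol_low; rewrite gN ltnS in rhoN.
Qed.
End PolySeries.

(** All that the sequel uses of Morava E-theory and of [L_t]: division and preparation for [[p^j]]
    over both rings, and the position of the coefficients of [[p^j]] relative to [I_t]. *)
Record lts := Lts {
  st_p : nat; st_n : nat; st_t : nat; st_W : comPzRingType;
  st_F : mps bool (LTring st_n st_W);
  st_L : comNzRingType;
  st_iota : {rmorphism LTring st_n st_W -> st_L};
  st_prime : prime st_p;
  st_tn : (st_t < st_n)%N;
  st_fgl : formal_group_law st_F;
  st_wd : forall j, wdiv (nseries st_F (st_p ^ j)) (st_p ^ (st_n * j));
  st_wp : forall j, wprep (nseries st_F (st_p ^ j)) (st_p ^ (st_n * j));
  st_wdL : forall j, wdiv (nseries (map_mps st_iota st_F) (st_p ^ j)) (st_p ^ (st_t * j));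
  st_wpL : forall j, wprep (nseries (map_mps st_iota st_F) (st_p ^ j)) (st_p ^ (st_t * j));
  st_coef : forall j i, (i < st_p ^ (st_t * j))%N ->
    Lt_ideal st_p st_t st_iota (cf (nseries (map_mps st_iota st_F) (st_p ^ j)) i);
  st_lead : forall j, exists c,
    cf (nseries (map_mps st_iota st_F) (st_p ^ j)) (st_p ^ (st_t * j)) * c = 1 }.

Definition GE (S : lts) : fgrp :=
  @FGrp _ (st_F S) (st_p S) (st_n S) (prime_gt0 (st_prime S)) (st_fgl S) (@st_wd S).
Definition GL (S : lts) : fgrp :=
  @FGrp _ (map_mps (st_iota S) (st_F S)) (st_p S) (st_t S) (prime_gt0 (st_prime S))
    (map_fgl (st_iota S) (st_fgl S)) (@st_wdL S).

Section WeierstrassPolynomials.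
Context (S : lts) (j : nat).
Notation p := (st_p S).
Notation L := (st_L S).
Notation E := (LTring (st_n S) (st_W S)).
Notation iota := (st_iota S).
Notation torE := (nseries (st_F S) (p ^ j)).
Notation torL := (nseries (map_mps iota (st_F S)) (p ^ j)).

(** The two forms of [d] are a Bezout relation: [d] is zero modulo [g1] and one modulo [g0]. The
    last clause says that [g0 * g1] is an equation of [GG[p^j]]. *)
Definition et_split (g0 g1 d : {poly L}) : Prop :=
  [/\ g0 \is monic, size g0 = (p ^ (st_t S * j)).+1,
      g0 * g1 \is monic /\ size (g0 * g1) = (p ^ (st_n S * j)).+1,
      exists v, pol g0 = v * torL
    & exists r s, [/\ d = g1 * r, d = 1 + g0 * s &
  forall (B : comPzRingType) (r : {rmorphism L -> B}) (P : {rmorphism mps unit E -> B}),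
    (forall c, P (mps_const _ c) = r (iota c)) -> P torE = 0 ->
    pev r (P 'x_tt) (g0 * g1) = 0]].

(** Over [L] the polynomial of [GG[p^j]] is a multiple of [[p^j]], hence of [g0]. The cofactor [g1]
    is a unit as a power series, and [L[x]/(g0) = L[[x]]/[p^j]] turns its inverse into a polynomial
    inverse modulo [g0]. *)
Lemma et_split_ex : exists gs : {poly L} * {poly L} * {poly L}, et_split gs.1.1 gs.1.2 gs.2.
Proof.
have [v0 [v0' [r0 [r0N E0 vv0]]]] := st_wpL S j.
have [v [v' [r [rN EE vv]]]] := st_wp S j.
have mon M (f : mps unit L) : low tt M f -> exists g : {poly L},
    [/\ g \is monic, size g = M.+1 & pol g = 'x_tt ^+ M - f].
  move=> /low_pol fM; pose q := \poly_(i < M) cf f i.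
  have qM : (size (- q) < size ('X^M : {poly L}))%N by rewrite size_polyN size_polyXn ltnS size_poly.
  exists ('X^M - q); split.
  - by rewrite monicE lead_coefDl // lead_coefXn.
  - by rewrite size_polyDl // size_polyXn.
  - by rewrite rmorphB rmorphXn /= fM /pol pevX.
have [g0 [g0m g0s g0E]] := mon _ _ r0N.
have [|g [gm gs gE]] := mon (p ^ (st_n S * j))%N (map_mps iota r).
  by move=> m mM; rewrite /= rN ?rmorph0.
have gtor : pol g = map_mps iota v * torL.
  by rewrite gE -map_nseries -rmorphM -EE rmorphB rmorphXn; congr (_ ^+ _ - _); apply/esym/map_mps_var.
rewrite E0 in g0E.
have [g1 gg] := pol_dvd (st_wdL S j) g0m g0s g0E gtor.
have wdL0 k : k * torL = 0 -> k = 0.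
  have [_ H] := st_wdL S j tt; move: (H k); rewrite scomp_var => /[swap] -> H'.
  by apply: H' => m.
have g1v : map_mps iota v = v0 * pol g1.
  apply/eqP; rewrite -subr_eq0; apply/eqP/wdL0; rewrite mulrBl -gtor gg rmorphM /= g0E.
  by rewrite mulrAC subrr.
(* [v0 * map_mps iota v'] is the power series inverse of [pol g1]; its Weierstrass remainder gives
   the polynomial [rp]. *)
have [/(_ (v0 * map_mps iota v')) [q [r' [qE r'N]]] _] := st_wdL S j tt.
rewrite scomp_var in qE; pose rp := \poly_(i < p ^ (st_t S * j)) cf r' i.
have rpE : pol rp = r' by apply: low_pol.
have one : pol (g1 * rp - 1) = (- pol g1 * q) * torL.
  rewrite rmorphB rmorph1 rmorphM /= rpE.
  have -> : r' = v0 * map_mps iota v' - q * torL by rewrite qE addrC addKr.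
  rewrite mulrBr mulrA [pol g1 * v0]mulrC -g1v -rmorphM vv rmorph1; ring.
have [s sE] := pol_dvd (st_wdL S j) g0m g0s g0E one.
exists (g0, g1, g1 * rp); split; rewrite /= -?gg //; first by exists v0.
exists rp, s; split=> // [|B rB P Pc Pt]; first by rewrite -sE addrC subrK.
have xr : P ('x_tt ^+ (p ^ (st_n S * j)) - r) = 0 by rewrite EE rmorphM Pt mulr0.
rewrite -[RHS]xr.
have -> : g = 'X^(p ^ (st_n S * j)) - \poly_(i < p ^ (st_n S * j)) iota (cf r i).
  apply: (_ : injective (@pol L)) => [u u' /eqP|]; first by rewrite -subr_eq0 -rmorphB => /eqP/pol_inj/eqP; rewrite subr_eq0 => /eqP.
  rewrite gE rmorphB rmorphXn /= polX; congr (_ - _).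
  apply/esym/(@low_pol _ _ (map_mps iota r)) => m mM.
  by rewrite /= rN ?rmorph0.
rewrite !rmorphB !rmorphXn /= pevX pev_poly; congr (_ - _).
rewrite [in RHS](low_poly (leqnn _) rN) rmorph_sum; apply: eq_bigr => i _.
by rewrite rmorphM rmorphXn Pc.
Qed.
End WeierstrassPolynomials.

Notation GEpt r := (@gpt (GE _) _ (r \o st_iota _)).
Notation GLpt r := (@gpt (GL _) _ r).

(** * The connected part at a finite level *)

Section Inclusion.
Context (S : lts) (A : cring) (r : {rmorphism st_L S -> A}).
Notation E := (LTring (st_n S) (st_W S)).
Notation iota := (st_iota S).

Definition rE : {rmorphism fgK (GE S) -> A} := r \o iota.
Definition rL : {rmorphism fgK (GL S) -> A} := r.

Section Def.
Variable P : gpt rL.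
Let Pi : {rmorphism mps unit (fgK (GE S)) -> A} := gp_hom P \o map_mps iota.
Lemma incl_lin_subproof c : Pi (mps_const _ c) = rE c.
Proof. by rewrite /Pi /= map_mps_const; apply: (gp_lin P). Qed.
Lemma incl_tors_subproof m : exists j,
  idl_pow (cJ (c := A)) m (Pi (nseries (fgF (GE S)) (fgp (GE S) ^ j))).
Proof. by have [j Pj] := gp_tors P m; exists j; rewrite /Pi /= map_nseries. Qed.
Definition gincl : gpt rE := Gpt incl_lin_subproof incl_tors_subproof.
End Def.

Lemma incl_x (P : gpt rL) : gincl P 'x_tt = P 'x_tt.
Proof. by rewrite -[LHS]/(P (map_mps iota 'x_tt)) map_mps_var. Qed.

Lemma incl_inj : injective gincl.
Proof. by move=> P Q PQ; apply: gpt_ext; rewrite -!incl_x PQ. Qed.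

Lemma inclD : {morph gincl : P Q / P + Q}.
Proof.
move=> P Q; apply: is_sum_uniq (gaddP _ _).
have [Phi [Phc PhE]] := gaddP P Q.
exists (Phi \o map_mps iota); split=> [c|h].
  by rewrite /= map_mps_const; apply: Phc.
have [E1 E2 E3] := PhE (map_mps iota h); split.
- by rewrite -[RHS]E1 /= map_scomp map_mps_var.
- by rewrite -[RHS]E2 /= map_scomp map_mps_var.
- by rewrite -[RHS]E3 /= map_scomp.
Qed.

Lemma incl0 : gincl 0 = 0.
Proof. by apply: (addrI (gincl 0)); rewrite -inclD !addr0. Qed.
Lemma inclMn (P : gpt rL) n : gincl (P *+ n) = gincl P *+ n.
Proof. by elim: n => [|n IHn]; rewrite ?incl0 // !mulrS inclD IHn. Qed.
Lemma inclN (P : gpt rL) : gincl (- P) = - gincl P.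
Proof. by apply/eqP; rewrite -addr_eq0 -inclD addNr incl0. Qed.
Lemma inclB : {morph gincl : P Q / P - Q}.
Proof. by move=> P Q; rewrite inclD inclN. Qed.
Lemma incl_tor0 (P : gpt rL) n : gincl P *+ n = 0 -> P *+ n = 0.
Proof. by rewrite -inclMn -incl0 => /incl_inj. Qed.
End Inclusion.
Arguments rE {S A} r.
Arguments rL {S A} r.

Section Discrete.
Context (B B' : comPzRingType) (f : {rmorphism B -> B'}).
Lemma discr_cont : exists a, forall x, idl_pow (cJ (c := discr B)) a x -> cJ (c := discr B') (f x).
Proof.
by exists 1%N => x /(idl_pow1 _ (zero_ideal B)) ->; rewrite -[cJ _]/(_ = 0) rmorph0.
Qed.

Context (S : lts) (r : {rmorphism st_L S -> discr B}) (r' : {rmorphism st_L S -> discr B'}).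
Hypothesis fr : forall c, f (r c) = r' c.
Definition dE (P : gpt (rE r)) : gpt (rE r') :=
  @gmap (GE S) (discr B) (discr B') f discr_cont (rE r) (rE r') (fun c => fr (st_iota S c)) P.
Definition dL (P : gpt (rL r)) : gpt (rL r') :=
  @gmap (GL S) (discr B) (discr B') f discr_cont (rL r) (rL r') fr P.
Lemma dE_incl P : dE (gincl P) = gincl (dL P). Proof. exact: gpt_eq. Qed.
Lemma dED : {morph dE : P Q / P + Q}. Proof. exact: gmapD. Qed.
Lemma dE0 : dE 0 = 0. Proof. exact: gmap0. Qed.
Lemma dEMn P n : dE (P *+ n) = dE P *+ n. Proof. exact: gmapMn. Qed.
Lemma dEB : {morph dE : P Q / P - Q}. Proof. exact: gmapB. Qed.
Lemma dLMn P n : dL (P *+ n) = dL P *+ n. Proof. exact: gmapMn. Qed.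
Lemma dL0 : dL 0 = 0. Proof. exact: gmap0. Qed.
End Discrete.

(** Modulo [1 - e] the idempotent [e] becomes one, hence so does [f], which gives [e = e f]; then
    the roles are exchanged. *)
Lemma idem_eq (B : comPzRingType) (e f : B) : e * e = e -> f * f = f ->
  (forall (B' : comPzRingType) (pi : {rmorphism B -> B'}), pi e = 1 -> pi f = 1) ->
  (forall (B' : comPzRingType) (pi : {rmorphism B -> B'}), pi f = 1 -> pi e = 1) -> e = f.
Proof.
have half (u v : B) : u * u = u ->
    (forall (B' : comPzRingType) (pi : {rmorphism B -> B'}), pi u = 1 -> pi v = 1) -> u = u * v.
  move=> uu H; have HI := principal_ideal (1 - u).
  have /(qpi0 HI)[k vk] : qpi HI (1 - v) = 0.
    rewrite rmorphB rmorph1 H ?subrr //; apply/eqP; rewrite eq_sym -subr_eq0 -(rmorph1 (qpi HI)).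
    by rewrite -rmorphB; apply/eqP/qpi0; exists 1; rewrite mulr1.
  apply/eqP; rewrite -subr_eq0 -{1}[u]mulr1 -mulrBr vk mulrA mulrBr uu mulr1 subrr mul0r.
  exact: eqxx.
by move=> ee ff H1 H2; rewrite {1}(half e f ee H1) mulrC -(half f e ff H2).
Qed.

Section Delta.
Context (S : lts).
Notation L := (st_L S).
Notation p := (st_p S).

Definition dsplit j := projT1 (cid (et_split_ex S j)).
Definition dpoly j : {poly L} := (dsplit j).2.
Lemma dsplitP j : et_split (S := S) j (dsplit j).1.1 (dsplit j).1.2 (dpoly j).
Proof. exact: (projT2 (cid (et_split_ex S j))). Qed.

Definition del (B : comPzRingType) (r : {rmorphism L -> discr B}) j (P : gpt (rE r)) : B :=
  pev r (P 'x_tt) (dpoly j).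

Lemma del_map (B B' : comPzRingType) (f : {rmorphism B -> B'}) (r : {rmorphism L -> discr B})
  (r' : {rmorphism L -> discr B'}) (fr : forall c, f (r c) = r' c) j (P : gpt (rE r)) :
  del j (dE fr P) = f (del j P).
Proof. exact/esym/pev_map. Qed.

Section Finite.
Context (B : comPzRingType) (r : {rmorphism L -> discr B}) (j : nat).
Implicit Types (P R : gpt (rE r)) (Q : gpt (rL r)).

Lemma gpoly0 P : P *+ (p ^ j) = 0 ->
  pev r (P 'x_tt) ((dsplit j).1.1 * (dsplit j).1.2) = 0.
Proof.
move=> /gpt_tor0 Pj; have [_ _ _ _ [u [v [_ _ H]]]] := dsplitP j.
exact: (H _ r P (gp_lin P) Pj).
Qed.

Lemma del_idem P : P *+ (p ^ j) = 0 -> del j P * del j P = del j P.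
Proof.
move=> /gpoly0 gP; have [_ _ _ _ [u [v [d1 d2 _]]]] := dsplitP j.
pose ev := pev r (P 'x_tt); rewrite rmorphM in gP.
have dE1 : del j P = ev (dsplit j).1.2 * ev u by rewrite -rmorphM -d1.
have dE2 : del j P = 1 + ev (dsplit j).1.1 * ev v by rewrite -rmorphM -(rmorph1 ev) -rmorphD -d2.
rewrite {2}dE2 dE1 mulrDr mulr1 [X in _ + X](_ : _ =
  ev (dsplit j).1.1 * ev (dsplit j).1.2 * (ev u * ev v)); last by ring.
by rewrite gP mul0r addr0.
Qed.

Lemma del_g0 P : P *+ (p ^ j) = 0 -> del j P = 1 -> pev r (P 'x_tt) (dsplit j).1.1 = 0.
Proof.
move=> /gpoly0 gP e1; have [_ _ _ _ [u [v [d1 _ _]]]] := dsplitP j.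
rewrite rmorphM in gP; rewrite -[LHS]mulr1 -e1 /del d1 rmorphM.
by rewrite mulrA gP mul0r.
Qed.

Lemma g0_del P : pev r (P 'x_tt) (dsplit j).1.1 = 0 -> del j P = 1.
Proof.
move=> g0; have [_ _ _ _ [u [v [_ d2 _]]]] := dsplitP j.
by rewrite /del d2 rmorphD rmorph1 rmorphM /= g0 mul0r addr0.
Qed.

Lemma del_incl Q : Q *+ (p ^ j) = 0 -> del j (gincl Q) = 1.
Proof.
move=> /gpt_tor0 Qj; apply: g0_del; rewrite incl_x.
have [_ _ _ [v vE] _] := dsplitP j.
rewrite -(hom_pol _ (gp_lin Q)) vE rmorphM.
by rewrite [X in _ * X]Qj mulr0.
Qed.

(** Where delta is one, [g0] vanishes at the coordinate. Since [L[[x]]/[p^j] = L[x]/(g0)], a series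
    can be sent to the value of any polynomial congruent to it. *)
Lemma del1_incl P : P *+ (p ^ j) = 0 -> del j P = 1 ->
  exists Q, gincl Q = P /\ Q *+ (p ^ j) = 0.
Proof.
move=> Pj e1; have g0 := del_g0 Pj e1; have [g0m g0s _ [v vE] _] := dsplitP j.
set torL := nseries _ _ in vE; have wd := st_wdL S j.
pose Gam (f : mps unit L) (b : B) :=
  exists q k, f - pol q = k * torL /\ b = pev r (P 'x_tt) q.
have [f|b [q [k]]|f f' b b' [q [k [fq ->]]] [q' [k' [fq' ->]]]|f f' b b' [q [k [fq ->]]] [q' [k' [fq' ->]]]||Q QG] :=
  @graph_hom _ _ Gam.
- have [/(_ f)[k [rho [fE rhoN]]] _] := wd unit tt; rewrite scomp_var in fE.
  exists (pev r (P 'x_tt) (\poly_(i < p ^ (st_t S * j)) cf rho i)), (\poly_(i < p ^ (st_t S * j)) cf rho i), k.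
  by rewrite low_pol // fE addrK.
- rewrite sub0r => [[qk ->]]; have [|m ->] := pol_dvd wd g0m g0s vE (q := q) (k := - k).
    by rewrite mulNr -qk opprK.
  by rewrite rmorphM /= g0 mul0r.
- exists (q - q'), (k - k'); rewrite !rmorphB /= mulrBl -fq -fq'; split=> //; ring.
- exists (q * q'), (k * f' + pol q * k'); rewrite !rmorphM /=; split=> //.
  rewrite mulrDl mulrAC -fq -[RHS]/(_ + _ * _ * torL) -mulrA -fq'; ring.
- by exists 1, 0; rewrite !rmorph1 subrr mul0r.
have QE f b : Gam f b -> Q f = b.
  move=> [q [k [fq ->]]]; have [q' [k' [fq' ->]]] := QG f.
  apply/eqP; rewrite -subr_eq0 -rmorphB.
  have [|m ->] := pol_dvd wd g0m g0s vE (q := q' - q) (k := k - k').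
    by rewrite rmorphB /= mulrBl -fq -fq'; ring.
  by rewrite rmorphM /= g0 mul0r.
have Qx : Q 'x_tt = P 'x_tt by apply: QE; exists 'X, 0; rewrite polX subrr mul0r pevX.
have Ql c : Q (mps_const _ c) = rL r c.
  by apply: QE; exists c%:P, 0; rewrite pevC /pol pevC subrr mul0r.
have Qt : Q torL = 0.
  by apply: QE; exists 0, 1; rewrite !rmorph0 subr0 mul1r.
have Qm m : exists j, idl_pow (cJ (c := discr B)) m (Q (nseries (fgF (GL S)) (p ^ j))).
  by exists j; rewrite [X in idl_pow _ _ X]Qt; apply: (ideal0 (idl_pow_ideal _ _)).
exists (@Gpt (GL S) (discr B) (rL r) Q Ql Qm); split; last exact/gpt_tor0.
by apply: gpt_ext; rewrite incl_x.
Qed.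

(** [g0] has no constant term because [[p^j](0) = 0]. Consequently a vanishing delta makes the
    coordinate a unit. *)
Lemma del_compl P : exists k, 1 - del j P = P 'x_tt * k.
Proof.
have [_ _ _ [v vE] [u [w [_ d2 _]]]] := dsplitP j; set g0 := (dsplit j).1.1 in vE d2.
have g00 : g0`_0 = 0.
  have := polE g0 0; rewrite vE mcoef_1M (nseries_at0 (fgP (GL S))) mulr0 monom0.
  by move=> <-.
have [k kE] : exists k, g0 = k * 'X.
  exists (\poly_(i < size g0) g0`_i.+1); apply/polyP => -[|i]; rewrite coefMX //= coef_poly.
  case: ltnP => // iN; rewrite nth_default // (leq_trans iN) //.
exists (- pev r (P 'x_tt) (k * w)).
by rewrite /del d2 kE rmorphD rmorph1 opprD addrA subrr sub0r !rmorphM /= pevX; ring.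
Qed.

End Finite.

Lemma del0 (B : comPzRingType) (r : {rmorphism L -> discr B}) j : del j (0 : gpt (rE r)) = 1.
Proof. by rewrite -incl0; apply: del_incl; rewrite mul0rn. Qed.

(** By [idem_eq] only quotients where delta is one matter, and there both points lie in [GG_0]. *)
Lemma del_translate (B : comPzRingType) (r : {rmorphism L -> discr B}) j
  (P : gpt (rE r)) (Q : gpt (rL r)) :
  P *+ (p ^ j) = 0 -> Q *+ (p ^ j) = 0 -> del j (P + gincl Q) = del j P.
Proof.
move=> Pj Qj.
have Rj : (P + gincl Q) *+ (p ^ j) = 0 by rewrite mulrnDl Pj -inclMn Qj incl0 addr0.
have half (P1 : gpt (rE r)) (Q1 : gpt (rL r)) : P1 *+ (p ^ j) = 0 -> Q1 *+ (p ^ j) = 0 ->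
    forall (B' : comPzRingType) (pi : {rmorphism B -> B'}),
    pi (del j P1) = 1 -> pi (del j (P1 + gincl Q1)) = 1.
  move=> P1j Q1j B' pi e1; pose r' : {rmorphism L -> discr B'} := pi \o r.
  have pr c : pi (r c) = r' c by [].
  rewrite -(del_map pr) in e1; rewrite -(del_map pr).
  have [|Q' [Q'P Q'j]] := del1_incl _ e1; first by rewrite -dEMn P1j dE0.
  rewrite dED -Q'P dE_incl -inclD; apply: del_incl.
  by rewrite mulrnDl Q'j -dLMn Q1j dL0 addr0.
apply: idem_eq; rewrite ?del_idem //; last exact: half.
have := half (P + gincl Q) (- Q) Rj; rewrite inclN addrK; apply.
by rewrite mulNrn Qj oppr0.
Qed.
End Delta.

Lemma mps_nz (X : finType) (L : comNzRingType) : (1 : mps X L) != 0.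
Proof.
apply/eqP => /(congr1 (fun f : mps X L => f 0)); rewrite mcoef1 eqxx.
by move=> /eqP; rewrite oner_eq0.
Qed.
HB.instance Definition _ (X : finType) (L : comNzRingType) :=
  GRing.PzSemiRing_isNonZero.Build (mps X L) (mps_nz X L).

(* A power series ring in [x] is free over the series in [f], with basis
   [1, ..., x^(N-1)]. *)
Section FreeOverSeries.
Context (L : comNzRingType) (f : mps unit L) (N : nat).
Hypotheses (wd : wdiv f N) (f0 : f 0 = 0).

(** Repeated division expands [h] as the sum of the [rho_k f^k] with [rho_k] of degree below [N].
    Collecting the coefficients of [x^i] over all [k] gives [c i]. *)
Lemma series_basis (h : mps unit L) : exists c : nat -> mps unit L,
  h = \sum_(i < N) scomp (c i) f * 'x_tt ^+ i.
Proof.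
have dv (k : mps unit L) : exists qr : mps unit L * mps unit L,
    k = qr.1 * f + qr.2 /\ low tt N qr.2.
  by have [/(_ k)[q [r qr]] _] := wd tt; rewrite scomp_var in qr; exists (q, r).
have [d dP] := choice dv.
have [hh [rho [hh0 hS rhoN]]] : exists hh rho : nat -> mps unit L,
    [/\ hh 0%N = h, forall k, hh k = hh k.+1 * f + rho k & forall k, low tt N (rho k)].
  exists (fun k => iter k (fun u => (d u).1) h).
  exists (fun k => (d (iter k (fun u => (d u).1) h)).2).
  by split=> // k; have [] := dP (iter k (fun u => (d u).1) h).
have hsum M : h = \sum_(k < M) rho k * f ^+ k + hh M * f ^+ M.
  elim: M => [|M IH]; first by rewrite big_ord0 add0r expr0 mulr1 hh0.
  by rewrite {1}IH big_ord_recr /= {1}(hS M) exprS; ring.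
pose c (i : nat) : mps unit L := MPS (fun m : monom unit => cf (rho (m tt)) i).
exists c.
apply: ord_eq => M; rewrite {1}(hsum M).
have cE i : scomp (c i) f = \sum_(k < M) mps_const unit (cf (rho k) i) * f ^+ k
                            + f ^+ M * scomp (sh tt M (c i)) f.
  rewrite {1}(lo_sh tt M (c i)) -!(scomp_rmE f0) rmorphD rmorphM rmorphXn /=.
  rewrite /subst_fun msubst_var //; congr (_ + _).
  rewrite (low_poly (leqnn M) (@low_lo _ _ tt M (c i))) -[LHS](scomp_rmE f0) rmorph_sum.
  apply: eq_bigr => k _.
  have -> : cf (lo tt M (c i)) k = cf (rho k) i.
    by rewrite coef1_lo ltn_ord /c /Defs.coef1 /= ffunE.
  rewrite rmorphM rmorphXn; congr (_ * _ ^+ _); first exact: msubst_const.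
  exact: msubst_var.
have -> : \sum_(i < N) scomp (c i) f * 'x_tt ^+ i =
   \sum_(i < N) (\sum_(k < M) mps_const unit (cf (rho k) i) * f ^+ k) * 'x_tt ^+ i
   + \sum_(i < N) f ^+ M * scomp (sh tt M (c i)) f * 'x_tt ^+ i.
  by rewrite -big_split; apply: eq_bigr => i _; rewrite cE mulrDl.
have -> : \sum_(i < N) (\sum_(k < M) mps_const unit (cf (rho k) i) * f ^+ k) * 'x_tt ^+ i
          = \sum_(k < M) rho k * f ^+ k.
  under eq_bigr do rewrite mulr_suml.
  rewrite exchange_big; apply: eq_bigr => k _ /=.
  rewrite [in RHS](low_poly (leqnn N) (rhoN k)) mulr_suml; apply: eq_bigr => i _.
  by rewrite mulrAC.
rewrite [X in X - _]addrC opprD addrA addrK; apply: ordB.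
  by apply: ordMr; apply: ordX.
by apply: ord_sum => i _; apply/ordMl/ordMl/ordX.
Qed.

(** Separating constant terms, the sum is [a + b f] with [a] of degree below [N]; uniqueness of
    division gives [b = 0], hence [a = 0]. *)
Lemma series_free_step (c : nat -> mps unit L) :
  \sum_(i < N) scomp (c i) f * 'x_tt ^+ i = 0 ->
  (forall i, (i < N)%N -> c i 0 = 0) /\
  \sum_(i < N) scomp (sh tt 1 (c i)) f * 'x_tt ^+ i = 0.
Proof.
move=> c0; set b := \sum_(i < N) scomp (sh _ _ _) _ * _.
pose a : mps unit L := \sum_(i < N) mps_const unit (c i 0) * 'x_tt ^+ i.
have ab : a + b * f = 0.
  rewrite -[RHS]c0 /a /b mulr_suml -big_split; apply: eq_bigr => k _.
  rewrite [in RHS](const_sh (c k)) -[in RHS](scomp_rmE f0) rmorphD rmorphM /=.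
  by rewrite /subst_fun msubst_const // msubst_var // mulrDl -/(scomp _ _); ring.
have alow : low tt N a.
  move=> u Nu; rewrite mcoef_sum big1 // => k _; rewrite mcoef_constM mcoef_varn.
  case: eqP => [e|]; rewrite ?mulr0 //; by rewrite e ffunE eqxx leqNgt ltn_ord in Nu.
have b0 : b = 0.
  have [_ /(_ b)] := wd tt; rewrite scomp_var; apply.
  by rewrite -(addKr a (b * f)) ab addr0; apply: lowN.
split=> // i iN; have a0 : a = 0 by rewrite -ab b0 mul0r addr0.
have := congr1 (fun f => mcoef f (expo tt i)) a0; rewrite mcoef_sum.
rewrite (sum_only (i := Ordinal iN)) => [|k ki].
  by rewrite mcoef_constM mcoef_varn eqxx mulr1.
rewrite mcoef_constM mcoef_varn; case: eqP => [e|]; rewrite ?mulr0 //.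
case/eqP: ki; apply/val_inj; move/ffunP: e => /(_ tt); rewrite !ffunE eqxx.
by move/esym.
Qed.

Lemma series_free (c : nat -> mps unit L) : \sum_(i < N) scomp (c i) f * 'x_tt ^+ i = 0 ->
  forall i, (i < N)%N -> c i = 0.
Proof.
move=> c0 i iN; apply: mpsP => m; rewrite (coef1E m) mcoef0.
elim: (m tt) c c0 => [|n IHn] c /series_free_step[c0 c1].
  by rewrite -[RHS](c0 i iN); congr (mcoef _ _); apply/ffunP => -[]; rewrite !ffunE.
rewrite -[RHS](IHn (fun i => sh tt 1 (c i)) c1) /sh /=; congr (mcoef _ _).
by apply/ffunP => -[]; rewrite monomD !ffunE addn1.
Qed.
End FreeOverSeries.

(** * Division by [p^j] in the connected part *)

Section Cover.
Context (S : lts) (j l : nat).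
Notation p := (st_p S).
Notation L := (st_L S).
Notation torL j := (nseries (map_mps (st_iota S) (st_F S)) (p ^ j)).
Notation N := (p ^ (st_t S * j))%N.

(** Substitution of [[p^j]] makes [L[[x]]] free over itself, so the fibre of multiplication by [p^j]
    over [Q1] is [B[z]/(w)]. Here [w] is the image under [Q1] of the relation that expresses [x^N]
    in the basis. *)
Lemma cover_basis (B : comPzRingType) (r : {rmorphism L -> discr B}) (Q1 : gpt (rL r)) :
  Q1 *+ (p ^ l) = 0 ->
  exists (B' : comPzRingType) (io : {rmorphism B -> B'}) (r' : {rmorphism L -> discr B'})
    (rr : forall c, io (r c) = r' c) (Q : gpt (rL r')),
  [/\ Q *+ (p ^ j) = dL rr Q1,
      forall b', exists b : nat -> B, b' = \sum_(i < N) io (b i) * Q 'x_tt ^+ i,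
      forall b : nat -> B, \sum_(i < N) io (b i) * Q 'x_tt ^+ i = 0 ->
        forall i, (i < N)%N -> b i = 0
    & forall (C : comPzRingType) (ka : {rmorphism B -> C}) (rC : {rmorphism L -> discr C})
        (kr : forall c, ka (r c) = rC c) (QC : gpt (rL rC)), QC *+ (p ^ j) = dL kr Q1 ->
        exists psi : {rmorphism B' -> C}, (forall b, psi (io b) = ka b) /\
          psi (Q 'x_tt) = QC 'x_tt].
Proof.
(* Polynomials over [B] are formed below, so the zero ring is treated apart; there all equations
   hold trivially. *)
move=> Q1l; have [B1|/eqP B1] := eqVneq (1 : B) 0.
  have Bz (b : B) : b = 0 by rewrite -[b]mulr1 B1 mulr0.
  have rr c : (idfun : {rmorphism B -> B}) (r c) = r c by [].
  exists B, idfun, r, rr, Q1; split=> [|b'|b _ i _|C ka rC kr QC _].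
  - by apply: gpt_ext; rewrite [LHS]Bz [RHS]Bz.
  - by exists (fun=> 0); rewrite [LHS]Bz [RHS]Bz.
  - exact: Bz.
  have Cz (c : C) : c = 0 by rewrite -[c]mulr1 -(rmorph1 ka) B1 rmorph0 mulr0.
  by exists ka; split=> //; rewrite [LHS]Cz [RHS]Cz.
pose Bn : comNzRingType := HB.pack_for comNzRingType (GRing.ComPzRing.sort B)
  (GRing.PzSemiRing_isNonZero.Build B (introN eqP B1)).
have T0 : torL j 0 = 0 by apply: (nseries_at0 (fgP (GL S))).
have wd := st_wdL S j.
have [cc ccE] := series_basis wd T0 ('x_tt ^+ N).
pose Q1n : {rmorphism mps unit L -> Bn} := Q1.
pose w : {poly Bn} := 'X^N - \poly_(i < N) Q1n (cc i).
have wN : size w = N.+1.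
  by rewrite size_polyDl ?size_polyXn // size_polyN ltnS size_poly.
have wm : w \is monic.
  rewrite monicE lead_coefDl ?lead_coefXn // size_polyN size_polyXn ltnS.
  exact: size_poly.
have HI := principal_ideal w; pose B' : comPzRingType := quot HI.
pose io : {rmorphism Bn -> B'} := qpi HI \o @polyC Bn.
pose z : B' := qpi HI 'X.
have pevz (u : {poly Bn}) : qpi HI u = pev io z u.
  rewrite -[u in LHS]coefK poly_def rmorph_sum; apply: eq_bigr => i _.
  by rewrite -mul_polyC rmorphM rmorphXn.
have pevw : pev io z w = 0 by rewrite -pevz; apply/qpi0; exists 1; rewrite mulr1.
(* [evx] writes series as polynomials in [x] over the series in [[p^j]], and [evz] gives their
   intended images. A polynomial killed by [evx] is divisible by [W], by freeness, hence is killed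
   by [evz]. *)
pose evx : {rmorphism {poly mps unit L} -> mps unit L} := pev (scomp_rm T0) ('x_tt : mps unit L).
pose evz : {rmorphism {poly mps unit L} -> B'} := pev (io \o Q1n) z.
pose W : {poly mps unit L} := 'X^N - \poly_(i < N) cc i.
have WN : size W = N.+1.
  by rewrite size_polyDl ?size_polyXn // size_polyN ltnS size_poly.
have Wm : W \is monic.
  rewrite monicE lead_coefDl ?lead_coefXn // size_polyN size_polyXn ltnS.
  exact: size_poly.
have evzW : evz W = 0.
  rewrite -[RHS]pevw /evz /W /w !rmorphB !rmorphXn /= !pevX !pev_poly; congr (_ - _).
have evx0 Phi : evx Phi = 0 -> evz Phi = 0.
  have [m [rho [-> rhoN]]] := monic_div Wm Phi; rewrite WN ltnS in rhoN.
  have evxW : evx W = 0.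
    rewrite /evx /W rmorphB rmorphXn /= pevX pev_poly; apply/eqP; rewrite subr_eq0; apply/eqP.
    by rewrite {1}ccE; apply: eq_bigr.
  rewrite !rmorphD !rmorphM /= evzW evxW !mul0r !add0r.
  rewrite /evx (pevE _ _ rhoN) => /(series_free wd T0) rho0.
  rewrite (_ : rho = 0) ?rmorph0 //; apply/polyP => i; rewrite coef0.
  by have [/rho0//|Ni] := ltnP i N; rewrite nth_default // (leq_trans rhoN).
have [f|b [Phi [/evx0 Phi0 <-]]//|f f' b b' [Phi [<- <-]] [Phi' [<- <-]]|
      f f' b b' [Phi [<- <-]] [Phi' [<- <-]]||Q QG] :=
  @graph_hom _ _ (fun (f : mps unit L) (b : B') => exists Phi, evx Phi = f /\ evz Phi = b).
- have [c cE] := series_basis wd T0 f.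
  exists (evz (\poly_(i < N) c i)), (\poly_(i < N) c i); split=> //.
  by rewrite /evx /= pev_poly [RHS]cE; apply: eq_bigr.
- by exists (Phi - Phi'); rewrite !rmorphB.
- by exists (Phi * Phi'); rewrite !rmorphM.
- by exists 1; rewrite !rmorph1.
have QE Phi : Q (evx Phi) = evz Phi.
  have [Phi' [e <-]] := QG (evx Phi); apply/eqP; rewrite -subr_eq0 -rmorphB.
  by apply/eqP/evx0; rewrite rmorphB /= e subrr.
have Qc (h : mps unit L) : Q (scomp h (torL j)) = io (Q1 h).
  by have := QE h%:P; rewrite /evx /evz /= !pevC.
pose r' : {rmorphism L -> discr B'} := io \o (r : {rmorphism L -> Bn}).
have rr c : io (r c) = r' c by [].
have Ql c : Q (mps_const _ c) = rL r' c.
  transitivity (io (Q1 (mps_const _ c))); first by rewrite -Qc /scomp msubst_const.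
  by rewrite (gp_lin Q1).
have Qt m : exists i, idl_pow (cJ (c := discr B')) m (Q (nseries (fgF (GL S)) (p ^ i))).
  exists (l + j)%N; rewrite expnD (nseriesM (fgP (GL S))).
  rewrite [X in idl_pow _ _ X]Qc (_ : Q1 _ = 0); last exact/gpt_tor0.
  by rewrite rmorph0; apply: (ideal0 (idl_pow_ideal _ _)).
have Qx : Q 'x_tt = z by have := QE 'X; rewrite /evx /evz /= !pevX.
exists B', io, r', rr, (@Gpt (GL S) (discr B') (rL r') Q Ql Qt); split.
- by apply: gpt_eq => h; rewrite gptMn [LHS]Qc.
- move=> b'; have [u ->] := qpi_surj b'; have [m [rho [uE rhoN]]] := monic_div wm u.
  rewrite wN ltnS in rhoN; exists (fun i => rho`_i); rewrite /= Qx.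
  rewrite pevz uE rmorphD rmorphM /= pevw mul0r add0r (pevE _ _ rhoN) //.
- move=> b; rewrite /= Qx => b0 i iN.
  have /qpi0[k kE] : qpi HI (\poly_(i < N) (b i : Bn)) = 0.
    by rewrite pevz pev_poly -[RHS]b0; apply: eq_bigr.
  have k0 : k = 0.
    apply/eqP/negPn/negP => k0; have := size_poly N (b : nat -> Bn); rewrite kE size_monicM // wN addSn /=.
    by rewrite -[X in (_ <= X)%N]addn0 leq_add2l leqn0 size_poly_eq0 (negPf k0).
  by have := congr1 (fun q : {poly Bn} => q`_i) kE; rewrite k0 mulr0 coef0 coef_poly iN.
move=> C ka rC kr QC QCE.
have wC : pev (ka : {rmorphism Bn -> C}) (QC 'x_tt) w = 0.
  have QCc h : QC (scomp h (torL j)) = ka (Q1 h).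
    by have := congr1 (fun P : gpt (rL rC) => P h) QCE; rewrite gptMn.
  rewrite /w rmorphB rmorphXn /= pevX pev_poly -[_ ^+ _](rmorphXn QC) ccE rmorph_sum.
  apply/eqP; rewrite subr_eq0; apply/eqP; apply: eq_bigr => i _.
  by rewrite rmorphM rmorphXn QCc.
have [|psi psiE] := @quot_hom _ _ HI _ (pev (ka : {rmorphism Bn -> C}) (QC 'x_tt)).
  by move=> u [k ->]; rewrite rmorphM /= wC mul0r.
exists psi; split=> [b|]; first by rewrite /io /= psiE /= pevC.
by rewrite /= Qx psiE /= pevX.
Qed.

(** Since [1] belongs to the basis, [io] is injective. For descent, the two maps from [B'] to
    [B' (x)_B B'] are compared, that ring being obtained by repeating the construction over [B'];
    comparing coefficients at [1] puts [b'] in [B]. *)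
Lemma cover_point (B : comPzRingType) (r : {rmorphism L -> discr B}) (Q1 : gpt (rL r)) :
  Q1 *+ (p ^ l) = 0 ->
  exists (B' : comPzRingType) (io : {rmorphism B -> B'}) (r' : {rmorphism L -> discr B'})
    (rr : forall c, io (r c) = r' c) (Q : gpt (rL r')),
  [/\ Q *+ (p ^ j) = dL rr Q1, injective io,
      forall b' : B', (forall (C : comPzRingType) (u v : {rmorphism B' -> C}),
         (forall b, u (io b) = v (io b)) -> u b' = v b') -> exists b, b' = io b
    & forall (C : comPzRingType) (ka : {rmorphism B -> C}) (rC : {rmorphism L -> discr C})
        (kr : forall c, ka (r c) = rC c) (QC : gpt (rL rC)), QC *+ (p ^ j) = dL kr Q1 ->
        exists psi : {rmorphism B' -> C}, (forall b, psi (io b) = ka b) /\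
          psi (Q 'x_tt) = QC 'x_tt].
Proof.
move=> Q1l; have [B' [io [r' [rr [Q [QQ span free univ]]]]]] := cover_basis Q1l.
have N0 : (0 < N)%N by rewrite expn_gt0 prime_gt0 ?st_prime.
have ioS (b : B) : io b = \sum_(i < N) io (if i == 0%N :> nat then b else 0) * Q 'x_tt ^+ i.
  rewrite (sum_only (i := Ordinal N0)) ?expr0 ?mulr1 // => k k0.
  by rewrite ifN ?rmorph0 ?mul0r //.
exists B', io, r', rr, Q; split=> //.
  move=> a b /eqP; rewrite -subr_eq0 -rmorphB ioS => /eqP ab0.
  have /= := free (fun i => if i == 0%N then a - b else 0) ab0 0%N N0.
  by move=> /eqP; rewrite subr_eq0 => /eqP.
move=> b' H; have Q1'l : dL rr Q1 *+ (p ^ l) = 0 by rewrite -dLMn Q1l dL0.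
have [B2 [io2 [r2 [rr2 [Q2 [QQ2 span2 free2 univ2]]]]]] := cover_basis Q1'l.
have kr c : (io2 \o io) (r c) = r2 c by rewrite /= rr rr2.
have [|psi [psiB psiQ]] := univ B2 (io2 \o io) r2 kr Q2.
  by rewrite QQ2; apply: gpt_eq.
have E : io2 b' = psi b' by apply: H => b; rewrite psiB.
have [b bE] := span b'; exists (b 0%N).
have S0 : \sum_(i < N) io2 ((if i == 0%N :> nat then b' else 0) - io (b i)) * Q2 'x_tt ^+ i = 0.
  transitivity (io2 b' - psi b'); last by rewrite E subrr.
  rewrite {3}bE rmorph_sum.
  transitivity (\sum_(i < N) (io2 (if i == 0%N :> nat then b' else 0) * Q2 'x_tt ^+ i
    - psi (io (b i) * Q 'x_tt ^+ i))).
    by apply: eq_bigr => i _; rewrite rmorphB mulrBl rmorphM rmorphXn psiB psiQ.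
  rewrite sumrB; congr (_ - _); rewrite (sum_only (i := Ordinal N0)) ?expr0 ?mulr1 // => k k0.
  by rewrite ifN ?rmorph0 ?mul0r.
have /= := free2 (fun i => (if i == 0%N then b' else 0) - io (b i)) S0 0%N N0.
by move=> /eqP; rewrite subr_eq0 => /eqP.
Qed.
End Cover.

(** * Functions on the etale quotient *)

Section TorsionRings.
Context (S : lts).
Notation p := (st_p S).
Notation n := (st_n S).
Notation W := (st_W S).
Notation F := (st_F S).
Notation L := (st_L S).
Notation E := (LTring n W).
Notation iota := (st_iota S).
Context (O : nat -> comPzRingType) (oL : forall j, {rmorphism L -> O j})
  (oE : forall j, {rmorphism mps unit E -> O j}).
Hypothesis hO : forall j, is_torsion_ring p F iota j (oL j) (oE j).
Notation etf j := (et_function p F iota j (oL j) (oE j)).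

Definition oLd j : {rmorphism L -> discr (O j)} := oL j.

Lemma upt_lin j c : oE j (mps_const _ c) = rE (oLd j) c.
Proof. by have [[H _] _] := hO j; apply: H. Qed.
Lemma upt_tors j m : exists i,
  idl_pow (cJ (c := discr (O j))) m (oE j (nseries (fgF (GE S)) (p ^ i))).
Proof.
exists j; have [[_ H] _] := hO j; rewrite [X in idl_pow _ _ X]H.
exact: (ideal0 (idl_pow_ideal _ _)).
Qed.
Definition upt j : gpt (rE (oLd j)) := @Gpt (GE S) (discr (O j)) (rE (oLd j)) (oE j)
  (@upt_lin j) (@upt_tors j).

Lemma upt_tor j : upt j *+ (p ^ j) = 0.
Proof. by apply/gpt_tor0; have [[_ H] _] := hO j; apply: H. Qed.

Lemma ohom_ex j (A : comPzRingType) (s : {rmorphism L -> discr A}) (P : gpt (rE s)) :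
  P *+ (p ^ j) = 0 -> exists chi : {rmorphism O j -> A},
  (forall c, chi (oL j c) = s c) /\ forall h, chi (oE j h) = P h.
Proof.
move=> /gpt_tor0 Pj; have [_ H] := hO j.
by have [|chi [c1 c2] _] := H A s P; [split=> // c; apply: (gp_lin P)|exists chi].
Qed.

Lemma ohom_uniq j (A : comPzRingType) (chi chi' : {rmorphism O j -> A}) :
  (forall c, chi (oL j c) = chi' (oL j c)) -> (forall h, chi (oE j h) = chi' (oE j h)) ->
  chi =1 chi'.
Proof.
move=> eL eE; have [[H1 H2] H] := hO j.
have [|psi _ psiU] := H A (chi \o oL j) (chi \o oE j).
  by split=> [c|] /=; rewrite ?H1 // H2 rmorph0.
move=> a; rewrite (psiU chi) ?(psiU chi') //; split=> [c|h] /=; rewrite ?eL ?eE //.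
Qed.

Section Value.
Context (j : nat) (A : comPzRingType) (s : {rmorphism L -> discr A}) (chi : {rmorphism O j -> A}).
Hypothesis cs : forall c, chi (oLd j c) = s c.
Definition vpt : gpt (rE s) := @dE _ _ chi S (oLd j) s cs (upt j).
Lemma vpt_tor : vpt *+ (p ^ j) = 0. Proof. by rewrite -dEMn upt_tor dE0. Qed.
End Value.

(** Restates invariance under [GG_0[p^j]] with the group law on points in place of [is_sum]. *)
Lemma et_intro j (a : O j) :
  (forall (A : comPzRingType) (s : {rmorphism L -> discr A}) (chi chi' : {rmorphism O j -> A})
    (P R : gpt (rE s)) (Q : gpt (rL s)),
    (forall c, chi (oL j c) = s c) -> (forall c, chi' (oL j c) = s c) ->
    (forall h, chi (oE j h) = P h) -> (forall h, chi' (oE j h) = R h) ->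
    Q *+ (p ^ j) = 0 -> R = P + gincl Q -> chi' a = chi a) -> etf j a.
Proof.
move=> H A s P R Q Ps Rs Qc Qt sPQR.
have Qm m : exists i, idl_pow (cJ (c := discr A)) m (Q (nseries (fgF (GL S)) (p ^ i))).
  by exists j; rewrite [X in idl_pow _ _ X]Qt; apply: (ideal0 (idl_pow_ideal _ _)).
pose s' : {rmorphism L -> discr A} := s.
pose Q' : gpt (rL s') := @Gpt (GL S) (discr A) (rL s') Q Qc Qm.
have Ps' c : P (oLd j c) = s' c by apply: Ps.
have Rs' c : R (oLd j c) = s' c by apply: Rs.
apply: (H A s' P R (vpt Ps') (vpt Rs') Q') => //; first exact/gpt_tor0.
exact: (@is_sum_uniq (GE S) (discr A) (rE s') (vpt Ps') (gincl Q') (vpt Rs') _ sPQR (gaddP _ _)).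
Qed.

Lemma et_eq j (a : O j) (A : comPzRingType) (s : {rmorphism L -> discr A})
    (chi chi' : {rmorphism O j -> A}) (P R : gpt (rE s)) (Q : gpt (rL s)) : etf j a ->
  (forall c, chi (oL j c) = s c) -> (forall c, chi' (oL j c) = s c) ->
  (forall h, chi (oE j h) = P h) -> (forall h, chi' (oE j h) = R h) ->
  Q *+ (p ^ j) = 0 -> R = P + gincl Q -> chi' a = chi a.
Proof.
move=> aet cs cs' cP cR Qj RPQ; apply: (aet A s chi chi' Q cs cs').
- exact: (gp_lin Q).
- exact: (gpt_tor0 Q j).1 Qj.
- have [Phi [Phc PhE]] := gaddP P (gincl Q); exists Phi; split=> // h.
  have [E1 E2 E3] := PhE h; split; [rewrite E1|exact: E2|rewrite E3].
    by rewrite -cP.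
  by rewrite -[gadd _ _]/(P + gincl Q) -RPQ -cR.
Qed.

(* The subring generated by the coordinate and by [L] has the universal property of
   the whole ring. *)
Lemma torsion_span j (a : O j) : exists q, a = pev (oL j) (oE j 'x_tt) q.
Proof.
pose ev : {rmorphism {poly L} -> O j} := pev (oL j) (oE j 'x_tt).
have HI : is_ideal (fun q => ev q = 0).
  split=> [|q q' q0 q0'|r q q0]; first exact: rmorph0.
    by rewrite rmorphD q0 q0' addr0.
  by rewrite rmorphM q0 mulr0.
pose M := quot HI; have [//|i iE] := @quot_hom _ _ HI _ ev.
have i_inj u : i u = 0 -> u = 0.
  by have [q ->] := qpi_surj u; rewrite iE => q0; apply/qpi0.
have [f|m /esym|f f' m m' e e'|f f' m m' e e'||eM eME] :=
  @graph_hom _ M (fun (f : mps unit E) (m : M) => oE j f = i m).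
- have [/(_ f)[k [rho [fE rhoN]]] _] := st_wd S j tt; rewrite scomp_var in fE.
  exists (qpi HI (\poly_(i < p ^ (n * j)) iota (cf rho i))); rewrite iE /ev /= pev_poly.
  have [[H1 H2] _] := hO j; rewrite fE rmorphD rmorphM H2 mulr0 add0r.
  rewrite {1}(low_poly (leqnn _) rhoN) rmorph_sum; apply: eq_bigr => k' _.
  by rewrite rmorphM rmorphXn H1.
- by rewrite rmorph0; apply: i_inj.
- by rewrite !rmorphB e e'.
- by rewrite !rmorphM e e'.
- by rewrite !rmorph1.
pose aM : {rmorphism L -> M} := qpi HI \o @polyC L.
have iaM c : i (aM c) = oL j c by rewrite /aM /= iE /ev /= pevC.
have i_inj' u v : i u = i v -> u = v.
  by move=> /eqP; rewrite -subr_eq0 -rmorphB => /eqP/i_inj/eqP; rewrite subr_eq0 => /eqP.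
have [[H1 H2] H] := hO j; have [|chi [c1 c2] _] := H M aM eM.
  split=> [c|]; apply: i_inj'; first by rewrite -eME H1 iaM.
  by rewrite -eME H2 rmorph0.
have idE : i \o chi =1 idfun.
  apply: ohom_uniq => [c|h] /=; first by rewrite -[chi _]/((chi \o oL j) c) c1 iaM.
  by rewrite -[chi _]/((chi \o oE j) h) c2 -eME.
have [q qE] := qpi_surj (chi a); exists q.
by rewrite -[LHS]idE /= qE iE.
Qed.

Lemma torsion_sum j (a : O j) : exists N (d : 'I_N -> L) (f : 'I_N -> mps unit E),
  a = \sum_i oL j (d i) * oE j (f i).
Proof.
have [q ->] := torsion_span a; exists (size q), (fun i => q`_i), (fun i => 'x_tt ^+ i).
by apply: eq_bigr => i _; rewrite rmorphXn.
Qed.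

Definition idL : {rmorphism L -> discr L} := @idfun L.

Lemma zero_section j : exists z : {rmorphism O j -> L},
  (forall c, z (oL j c) = c) /\ forall h, z (oE j h) = iota (h 0).
Proof.
have [|z [z1 z2]] := @ohom_ex j L idL 0; first by rewrite mul0rn.
by exists z; split=> // h; rewrite z2 gpt0E.
Qed.

(** Every function is a polynomial in the coordinate, and its constant term is its value on the zero
    section. *)
Lemma augmentation_dvd j (a : O j) : (forall z : {rmorphism O j -> L},
   (forall c, z (oL j c) = c) -> (forall h, z (oE j h) = iota (h 0)) -> z a = 0) ->
  exists k, a = oE j 'x_tt * k.
Proof.
have [z [z1 z2]] := zero_section j => /(_ z z1 z2).
have [q ->] := torsion_span a; have [k qE] : exists k : {poly L}, q = (q`_0)%:P + k * 'X.
  exists (\poly_(i < size q) q`_i.+1); apply/polyP => -[|i]; rewrite coefD coefMX coefC /=.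
    by rewrite addr0.
  rewrite add0r coef_poly; case: ltnP => // iN; rewrite nth_default // (leq_trans iN) //.
rewrite qE rmorphD rmorphM /= pevC pevX rmorphD z1 rmorphM z2 var0 rmorph0 mulr0 addr0.
by move=> ->; rewrite rmorph0 add0r; exists (pev (oL j) (oE j 'x_tt) k); rewrite mulrC.
Qed.

Definition dlt j : O j := del j (upt j).

Lemma dlt_map j (A : comPzRingType) (s : {rmorphism L -> discr A}) (chi : {rmorphism O j -> A})
  (P : gpt (rE s)) : (forall c, chi (oL j c) = s c) -> (forall h, chi (oE j h) = P h) ->
  chi (dlt j) = del j P.
Proof.
move=> cs cP; rewrite -(@del_map S _ _ chi (oLd j) s cs j (upt j)); congr del.
by apply: gpt_eq => h; apply: cP.
Qed.

Lemma dlt_et j : etf j (dlt j).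
Proof.
apply: et_intro => A s chi chi' P R Q cs cs' cP cR Qj RPQ.
rewrite (dlt_map cs cP) (dlt_map cs' cR) RPQ; apply: del_translate => //.
have -> : P = @vpt j A s chi cs by apply: gpt_eq => h; rewrite -cP.
exact: vpt_tor.
Qed.

Section Generator.
Context (y : forall j, O j).
Hypothesis hy : forall j, (0 < j)%N -> et_generator p F iota oL oE (y j).

Lemma gen_zero j (z : {rmorphism O j -> L}) : (0 < j)%N -> (forall c, z (oL j c) = c) ->
  (forall h, z (oE j h) = iota (h 0)) -> z (y j) = 0.
Proof. by move=> j0 z1 z2; have [_ _] := hy j0; apply. Qed.

(* A point of GG[p^j] at which y vanishes lies in GG_0: the idempotent defining the
   component of the zero section is a polynomial in y. *)
Lemma gen_zero_incl j (A : comPzRingType) (s : {rmorphism L -> discr A})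
    (chi : {rmorphism O j -> A}) (P : gpt (rE s)) : (0 < j)%N ->
  (forall c, chi (oL j c) = s c) -> (forall h, chi (oE j h) = P h) -> chi (y j) = 0 ->
  exists Q : gpt (rL s), gincl Q = P.
Proof.
move=> j0 cs cP cy; have [/(_ (dlt j))[/(_ (@dlt_et j))[r rE] _] _ _] := hy j0.
have ev (B : comPzRingType) (psi : {rmorphism O j -> B}) : psi (y j) = 0 ->
    psi (\sum_(i < size r) oL j r`_i * y j ^+ i) = psi (oL j r`_0).
  move=> py; rewrite rmorph_sum; case: (size r) (@nth_default _ 0 r 0) => [|N] r0.
    by rewrite big_ord0 r0 // !rmorph0.
  rewrite big_ord_recl expr0 mulr1 big1 ?addr0 // => i _.
  by rewrite rmorphM rmorphXn py expr0n mulr0.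
have [z [z1 z2]] := zero_section j.
have r0 : r`_0 = 1.
  have := ev _ z (gen_zero j0 z1 z2); rewrite -rE z1 => <-.
  by rewrite (@dlt_map j L idL z 0 z1) ?del0 // => h; rewrite z2 gpt0E.
have Pj : P *+ (p ^ j) = 0.
  have -> : P = @vpt j A s chi cs by apply: gpt_eq => h; rewrite -cP.
  exact: vpt_tor.
have [|Q [QP _]] := del1_incl (j := j) Pj; last by exists Q.
by rewrite -(dlt_map cs cP) rE ev // r0 !rmorph1.
Qed.
End Generator.

Lemma restriction j l : exists rho : {rmorphism O (j + l) -> O j},
  (forall c, rho (oL (j + l) c) = oL j c) /\ forall h, rho (oE (j + l) h) = oE j h.
Proof. by apply: (@ohom_ex (j + l) (O j) (oLd j) (upt j)); rewrite expnD mulrnA upt_tor mul0rn. Qed.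
End TorsionRings.

Section Extension.
Context (S : lts).
Notation p := (st_p S).
Notation F := (st_F S).
Notation L := (st_L S).
Notation E := (LTring (st_n S) (st_W S)).
Notation iota := (st_iota S).
Context (O : nat -> comPzRingType) (oL : forall j, {rmorphism L -> O j})
  (oE : forall j, {rmorphism mps unit E -> O j}).
Hypothesis hO : forall j, is_torsion_ring p F iota j (oL j) (oE j).
Notation etf j := (et_function p F iota j (oL j) (oE j)).

(* The value at [P] of an extension of [a] is [a(P - Q)] for any [Q] in [GG_0] with
   [p^j Q = p^j P]; such a [Q] exists after a faithful extension of scalars. *)
Lemma extension_value j i i' (a : O j) (b : O (j + i)) (b' : O (j + i'))
    (rho : {rmorphism O (j + i) -> O j}) (rho' : {rmorphism O (j + i') -> O j})
    (B : comPzRingType) (s : {rmorphism L -> discr B}) (P : gpt (rE s)) (Q1 : gpt (rL s))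
    (chi : {rmorphism O (j + i) -> B}) (chi' : {rmorphism O (j + i') -> B}) :
  etf (j + i) b -> etf (j + i') b' ->
  (forall c, rho (oL _ c) = oL j c) -> (forall h, rho (oE _ h) = oE j h) -> rho b = a ->
  (forall c, rho' (oL _ c) = oL j c) -> (forall h, rho' (oE _ h) = oE j h) -> rho' b' = a ->
  (forall c, chi (oL _ c) = s c) -> (forall h, chi (oE _ h) = P h) ->
  (forall c, chi' (oL _ c) = s c) -> (forall h, chi' (oE _ h) = P h) ->
  P *+ (p ^ j) = gincl Q1 -> chi b = chi' b'.
Proof.
move=> bet b'et rL1 rE1 rb rL2 rE2 rb' cL cE cL' cE' PQ1.
have tor k (psi : {rmorphism O k -> B}) : (forall c, psi (oL _ c) = s c) ->
    (forall h, psi (oE _ h) = P h) -> P *+ (p ^ k) = 0.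
  move=> pL pE; have -> : P = @vpt S O oL oE hO k B s psi pL.
    by apply: gpt_eq => h; rewrite -pE.
  exact: vpt_tor.
have Q1i : Q1 *+ (p ^ i) = 0.
  by apply: incl_tor0; rewrite -PQ1 -mulrnA -expnD (tor _ chi).
have [B' [io [s' [ss [Q [QE io_inj _ _]]]]]] := cover_point j Q1i.
apply: io_inj; pose P' := dE ss P; pose D := P' - gincl Q.
have Dj : D *+ (p ^ j) = 0.
  rewrite mulrnBl -dEMn PQ1 dE_incl -QE -inclMn subrr //.
have [chiD [dL1 dE1]] := @ohom_ex S O oL oE hO j B' s' D Dj.
have Qtor k (m : nat) (psi : {rmorphism O (j + m) -> B}) : (forall c, psi (oL _ c) = s c) ->
    (forall h, psi (oE _ h) = P h) -> k = (j + m)%N -> Q *+ (p ^ k) = 0.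
  move=> pL pE ->; rewrite expnD mulrnA QE -dLMn.
  have -> : Q1 *+ (p ^ m) = 0; last exact: dL0.
  by apply: incl_tor0; rewrite -PQ1 -mulrnA -expnD (tor _ psi).
have half m (d : O (j + m)) (ro : {rmorphism O (j + m) -> O j}) (psi : {rmorphism O (j + m) -> B}) :
    etf (j + m) d -> (forall c, ro (oL _ c) = oL j c) -> (forall h, ro (oE _ h) = oE j h) ->
    (forall c, psi (oL _ c) = s c) -> (forall h, psi (oE _ h) = P h) ->
    io (psi d) = chiD (ro d).
  move=> det rl re pl pe.
  apply: (@et_eq S O oL oE (j + m) d B' s' (chiD \o ro) (io \o psi) D P' Q det).
  - by move=> c; rewrite /= rl dL1.
  - by move=> c; rewrite /= pl; apply: ss.
  - by move=> h; rewrite /= re dE1.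
  - by move=> h; rewrite /= pe.
  - exact: Qtor pl pe erefl.
  - by rewrite /D subrK.
by rewrite (half _ _ _ _ bet rL1 rE1 cL cE) (half _ _ _ _ b'et rL2 rE2 cL' cE') rb rb'.
Qed.

Lemma quot_unit (B : comPzRingType) (e : B) (HI : is_ideal (fun x => exists w, x = (1 - e) * w)) :
  qpi HI e = 1.
Proof.
apply/eqP; rewrite eq_sym -subr_eq0 -(rmorph1 (qpi HI)) -rmorphB; apply/eqP/qpi0.
by exists 1; rewrite mulr1.
Qed.

(** The extension is zero off the locus where [p^j P] lies in [GG_0]. On the locus, after a cover
    that divides by [p^j], its value at [P] is [a(P - Q)] with [Q] in [GG_0] and [p^j Q = p^j P].
    This is independent of [Q], so it descends. *)
Lemma et_extension j l (a : O j) (rho : {rmorphism O (j + l) -> O j}) : etf j a ->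
  (forall c, rho (oL _ c) = oL j c) -> (forall h, rho (oE _ h) = oE j h) ->
  exists b, etf (j + l) b /\ rho b = a.
Proof.
move=> aet rL1 rE1; set N := (j + l)%N; pose uP := upt hO N; pose s0 := oLd oL N.
have uN : uP *+ (p ^ j) *+ (p ^ l) = 0 by rewrite -mulrnA -expnD upt_tor.
(* The idempotent of the locus where [p^j] times the universal point lies in [GG_0[p^l]]. *)
pose d := del l (uP *+ (p ^ j)).
have dd : d * d = d by apply: del_idem.
have HI := principal_ideal (1 - d).
pose A : comPzRingType := quot HI; pose sA : {rmorphism L -> discr A} := qpi HI \o oL N.
have piA c : qpi HI (s0 c) = sA c by [].
pose PA := dE piA uP.
have PAl : (PA *+ (p ^ j)) *+ (p ^ l) = 0 by rewrite -!dEMn uN dE0.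
have [|Q1 [Q1E Q1l]] := del1_incl (j := l) PAl.
  by rewrite -dEMn del_map; apply: quot_unit.
have [A' [io [sA' [ss [Q [QE io_inj desc univ]]]]]] := cover_point j Q1l.
pose D := dE ss PA - gincl Q.
have Dj : D *+ (p ^ j) = 0 by rewrite mulrnBl -dEMn -Q1E dE_incl -QE -inclMn subrr.
have [chi [cL cE]] := @ohom_ex S O oL oE hO j A' sA' D Dj.
(* Descent condition: two choices of [Q] differ by a point of [GG_0[p^j]], under which [a] is
   invariant. *)
have [|aA aAE] := desc (chi a).
  move=> C u v uv; pose sC : {rmorphism L -> discr C} := u \o sA'.
  have us c : u (sA' c) = sC c by [].
  have vs c : v (sA' c) = sC c by rewrite -ss -uv ss.
  apply/esym/(@et_eq S O oL oE j a C sC (u \o chi) (v \o chi) (dE us D) (dE vs D)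
    (dL us Q - dL vs Q) aet).
  - by move=> c; rewrite /= cL.
  - by move=> c; rewrite /= cL.
  - by move=> h; rewrite /= cE.
  - by move=> h; rewrite /= cE.
  - rewrite mulrnBl -!dLMn QE; apply/eqP; rewrite subr_eq0; apply/eqP.
    by apply: gpt_eq => h; apply: uv.
  - rewrite !dEB !dE_incl inclB addrA subrK; congr (_ - _).
    by apply: gpt_eq => h; rewrite [LHS]/= -uv.
(* Multiplication by [d] makes the choice of lift immaterial. Over [O j] the universal point is
   killed by [p^j], so [Q = 0] is allowed, and the extension restricts to [a]. *)
have [aO aOE] := qpi_surj aA; exists (d * aO); split; last first.
  have rs c : rho (s0 c) = oLd oL j c by apply: rL1.
  have ruP : dE rs uP = upt hO j by apply: gpt_eq => h; apply: rE1.
  have rd : rho d = 1.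
    by rewrite /d -(del_map rs) dEMn ruP upt_tor del0.
  have [|rb rbE] := @quot_hom _ _ HI _ rho.
    by move=> x [k ->]; rewrite rmorphM rmorphB rmorph1 rd subrr mul0r.
  have rbs c : rb (sA c) = oLd oL j c by rewrite /sA /= rbE.
  have rbP : dE rbs PA = upt hO j by rewrite -ruP; apply: gpt_eq => h; apply: rbE.
  have [|psi [psio psiQ]] := univ (O j) rb (oLd oL j) rbs 0.
    by apply: incl_inj; rewrite mul0rn incl0 -dE_incl Q1E dEMn rbP upt_tor.
  have ps c : psi (sA' c) = oLd oL j c by rewrite -ss psio rbs.
  have psD : dE ps D = upt hO j.
    rewrite dEB dE_incl (_ : dL ps Q = 0) ?incl0 ?subr0.
      by rewrite -rbP; apply: gpt_eq => h; apply: psio.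
    by apply: gpt_xP0; rewrite [LHS]psiQ gpt0x.
  have idE : psi \o chi =1 idfun.
    apply: (ohom_uniq hO) => [c|h] /=; first by rewrite cL ps.
    by rewrite cE -[LHS]/(dE ps D h) psD.
  by rewrite rmorphM rd mul1r -rbE -aOE -psio -aAE -[RHS]idE.
apply: (et_intro hO) => B s chP chR P R Qb PL RL PE RE QbN RPQ.
have Ps c : chP (s0 c) = s c by apply: PL.
have Rs c : chR (s0 c) = s c by apply: RL.
have PuP : dE Ps uP = P by apply: gpt_eq => h; apply: PE.
have RuP : dE Rs uP = R by apply: gpt_eq => h; apply: RE.
have dP : chP d = del l (P *+ (p ^ j)) by rewrite /d -(del_map Ps) dEMn PuP.
have dR : chR d = chP d.
  rewrite dP /d -(del_map Rs) dEMn RuP RPQ mulrnDl -inclMn; apply: del_translate.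
    by rewrite -PuP -mulrnA -expnD -dEMn upt_tor dE0.
  by rewrite -mulrnA -expnD.
(* Both values are multiples of [e], so they may be compared modulo [1 - e], where both maps factor
   through [A]. *)
set e := chP d in dP dR; have ee : e * e = e by rewrite -rmorphM dd.
have HB := principal_ideal (1 - e); pose pB : {rmorphism B -> quot HB} := qpi HB.
pose s1 : {rmorphism L -> discr (quot HB)} := pB \o s.
have pBs c : pB (s c) = s1 c by [].
have pBe : pB e = 1 := quot_unit HB.
have fac (ch : {rmorphism O N -> B}) : ch d = e ->
    exists phi : {rmorphism A -> quot HB}, forall x, phi (qpi HI x) = pB (ch x).
  move=> che; have [|phi phiE] := @quot_hom _ _ HI _ (pB \o ch); last by exists phi.
  by move=> x [k ->] /=; rewrite !rmorphM !rmorphB !rmorph1 che pBe subrr mul0r.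
have [[phP phPE] [phR phRE]] := (fac chP erefl, fac chR dR).
have phPs c : phP (sA c) = s1 c by rewrite /sA /= phPE /s1 /= PL.
have phRs c : phR (sA c) = s1 c by rewrite /sA /= phRE /s1 /= RL.
have phPP : dE phPs PA = dE pBs P.
  by rewrite -PuP; apply: gpt_eq => h; apply: phPE.
have phRP : dE phRs PA = dE pBs R.
  by rewrite -RuP; apply: gpt_eq => h; apply: phRE.
have Q1'l : dL phPs Q1 *+ (p ^ l) = 0 by rewrite -dLMn Q1l dL0.
have [B' [io1 [s2 [ss1 [Q' [Q'E io1_inj _ _]]]]]] := cover_point j Q1'l.
pose Qb1 := dL ss1 (dL pBs Qb).
have kP c : (io1 \o phP) (sA c) = s2 c by rewrite /= phPs ss1.
have kR c : (io1 \o phR) (sA c) = s2 c by rewrite /= phRs ss1.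
have [|psP [psPio psPQ]] := univ B' (io1 \o phP) s2 kP Q'.
  by rewrite Q'E; apply: gpt_eq.
(* [Q'] serves for [P] and [Q' + Qb1] for [R]. With these choices the two differences [D] agree, so
   [chi a] has the same image both times. *)
have [|psR [psRio psRQ]] := univ B' (io1 \o phR) s2 kR (Q' + Qb1).
  apply: incl_inj; rewrite mulrnDl Q'E inclD -!dE_incl -!dLMn -!dE_incl.
  have -> : dE kR (gincl Q1) = dE ss1 (dE phRs (gincl Q1)) by apply: gpt_eq.
  by rewrite !Q1E !dEMn phRP phPP RPQ !dED mulrnDl inclMn !dEMn.
have psPs c : psP (sA' c) = s2 c by rewrite -ss psPio; apply: kP.
have psRs c : psR (sA' c) = s2 c by rewrite -ss psRio; apply: kR.
have eP : dE psPs D = dE ss1 (dE pBs P) - gincl Q'.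
  rewrite dEB dE_incl; congr (_ - gincl _).
    by rewrite -phPP; apply: gpt_eq => h; apply: psPio.
  exact: gpt_ext.
have eR : dE psRs D = dE ss1 (dE pBs R) - gincl (Q' + Qb1).
  rewrite dEB dE_incl; congr (_ - gincl _).
    by rewrite -phRP; apply: gpt_eq => h; apply: psRio.
  exact: gpt_ext.
have ePR : dE psRs D = dE psPs D.
  by rewrite eR eP RPQ !dED !dE_incl inclD opprD addrACA subrr addr0.
have cc : psP \o chi =1 psR \o chi.
  apply: (ohom_uniq hO) => [c|h] /=; first by rewrite cL psPs psRs.
  by rewrite cE -[LHS]/(dE psPs D h) -ePR.
have H : pB (chP aO) = pB (chR aO).
  apply: io1_inj; rewrite -phPE -phRE -aOE -[LHS]/((io1 \o phP) aA) -psPio.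
  by rewrite -[RHS]/((io1 \o phR) aA) -psRio -aAE; apply: cc.
move/(qpi_eq HB): H => [k kE]; rewrite !rmorphM dR -/e.
apply/eqP; rewrite eq_sym -subr_eq0 -mulrBr kE mulrA mulrBr mulr1 ee subrr mul0r.
exact: eqxx.
Qed.
End Extension.

(** * Comparison with the points of the statement *)

Section PadicIntegers.
Context (p : nat) (p_prime : prime p) (Zp : comPzRingType).
Hypothesis hZp : is_completion (idl [set (p%:Z : int)]%classic) (intr : int -> Zp).

Lemma padic_pow m (y : Zp) :
  idl_pow (idl (intr @` idl [set (p%:Z : int)])%classic) m y -> exists w, y = p%:R ^+ m * w.
Proof.
move=> Jy; apply/idl_pow_principal; apply: idl_pow_sub Jy.
apply: idl_sub; first exact: idl_is_ideal.
move=> _ [z [N [r [g [gp ->]]]] <-]; rewrite rmorph_sum.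
apply: (ideal_sum (idl_is_ideal _)) => i _; rewrite gp rmorphM /=.
by apply: (idealMl (idl_is_ideal _)); apply: sub_idl.
Qed.

Lemma padic_approx (z : Zp) j : exists a : nat, exists w, z = a%:R + p%:R ^+ j * w.
Proof.
have [_ _ /(_ j z)[x /padic_pow[w zx]]] := hZp.
have [a [y xE]] : exists a : nat, exists y : int, x = a%:Z + (p ^ j)%:Z * y.
  have p0 : (0 < p ^ j)%N by rewrite expn_gt0 prime_gt0.
  case: x {zx} => [a|a]; first by exists a, 0; rewrite mulr0 addr0.
  (* A negative integer becomes natural by adding [p^j] times its absolute value. *)
  exists ((p ^ j) * a.+1 - a.+1)%N, (- a.+1%:Z); rewrite NegzE.
  have : (a.+1 <= (p ^ j) * a.+1)%N by rewrite leq_pmull.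
  lia.
exists a, (w + y%:~R).
have -> : z = p%:R ^+ j * w + x%:~R by rewrite -zx subrK.
rewrite xE rmorphD rmorphM /= (_ : ((p ^ j)%N%:Z)%:~R = p%:R ^+ j :> Zp) -?natrX //.
by rewrite -[(Posz a)%:~R]/(a%:R); ring.
Qed.

Lemma padic_inj (a b : nat) j (w : Zp) : a%:R = b%:R + p%:R ^+ j * w -> a = b %[mod p ^ j].
Proof.
move=> ab; have [_ H _] := hZp.
have H' :
    idl_pow (idl (intr @` idl [set (p%:Z : int)])%classic) j ((a%:Z - b%:Z)%:~R : Zp).
  rewrite rmorphB /= -[(Posz a)%:~R]/(a%:R) -[(Posz b)%:~R]/(b%:R) ab addrC addKr.
  apply: (idealMr (idl_pow_ideal _ _)); apply: idl_powX; apply: sub_idl.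
  by exists (p%:Z); [apply: sub_idl|].
have := H _ _ H'; rewrite -[p%:Z]natz => /idl_pow_principal[w' E].
have {}E : (a%:Z - b%:Z = (p ^ j)%N%:Z * w').
  by rewrite E; congr (_ * _); rewrite -natrX ?natz.
have : (a == b %[mod (p ^ j)%N])%Z by rewrite eqz_mod_dvd E dvdz_mulr.
by rewrite !modz_nat => /eqP[].
Qed.

Definition padic : zpring p := ZpRing padic_approx padic_inj.
End PadicIntegers.

Definition cc (L : comPzRingType) (I : set L) (A : calg I) : cring :=
  CRing (ca_idealP A) (ca_complete A).

Section Convert.
Context (L : comPzRingType) (I : set L) (G : fgrp) (kappa : {rmorphism fgK G -> L}).
Context (Z : zpring (fgp G)).
Notation fpt A := (pt (fgp G) kappa (fgF G) A).

Section One.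
Context (A : calg I) (s : {rmorphism fgK G -> cc A}).
Hypothesis hs : forall c, ca_map A (kappa c) = s c.

Lemma toG_lin (P : fpt A) c : P (mps_const _ c) = s c.
Proof. by rewrite pt_lin hs. Qed.
Definition toG (P : fpt A) : gpt s := @Gpt G (cc A) s P (toG_lin P) (pt_tors P).

Lemma ofG_lin (P : gpt s) c : P (mps_const _ c) = ca_map A (kappa c).
Proof. by rewrite (gp_lin P) hs. Qed.
Definition ofG (P : gpt s) : fpt A := @Pt _ _ _ _ kappa _ A P (ofG_lin P) (gp_tors P).

Lemma ofGK P : toG (ofG P) = P. Proof. exact: gpt_eq. Qed.
Lemma pt_eq (P Q : fpt A) : P =1 Q -> P = Q.
Proof.
case: P Q => [f fl ft] [g gl gt] /= /rmorph_eq e; subst g.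
by rewrite (Prop_irrelevance fl gl) (Prop_irrelevance ft gt).
Qed.
Lemma toGK P : ofG (toG P) = P. Proof. exact: pt_eq. Qed.

(** The sum exists, so the default value of [xget] is not taken, and uniqueness identifies the
    chosen point. *)
Lemma toG_add P Q : toG (pt_add P Q) = toG P + toG Q.
Proof.
have hsE : (ca_map A \o kappa : _ -> _) = s :> (fgK G -> A) by apply/funext.
have H : is_sum (ca_map A \o kappa) (fgF G) P Q (pt_add P Q).
  rewrite /pt_add; case: xgetP => [R -> //|/(_ (ofG (toG P + toG Q)))[]].
  by rewrite hsE; apply: (gaddP (toG P) (toG Q)).
rewrite hsE in H.
exact: (@is_sum_uniq G (cc A) s (toG P) (toG Q) (toG (pt_add P Q)) (toG P + toG Q) H (gaddP _ _)).
Qed.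

Lemma toG_scale (z : Z) P : toG (pt_scale z P) = zscale z (toG P).
Proof.
have H : forall m j (a : nat), idl_pow (ca_ideal A) m (P (nseries (fgF G) (fgp G ^ j))) ->
    (exists w, z = a%:R + (fgp G)%:R ^+ j * w) ->
    forall h, idl_pow (ca_ideal A) m (pt_scale z P h - P (scomp h (nseries (fgF G) a))).
  rewrite /pt_scale; case: xgetP => [R -> //|/(_ (ofG (zscale z (toG P))))[]].
  move=> m j a Pj [w zE] h.
  exact: (@zscale_spec G Z (cc A) s z (toG P) m j a w Pj zE h).
apply: zscale_uniq => m; have [j Pj] := pt_tors P m; have [w zE] := zseqP z j.
exists j, (zseq z j), w; split=> //; apply: H Pj _; by exists w.
Qed.
End One.

Definition res_hom (A B : calg I) (u : chom A B) : {rmorphism cc A -> cc B} := u.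
End Convert.

(** * Coordinates of points of the connected part *)

Section Criterion.
Context (S : lts) (A : cring) (r : {rmorphism st_L S -> A}).
Notation p := (st_p S).
Notation L := (st_L S).
Notation I := (Lt_ideal (st_p S) (st_t S) (st_iota S)).
Notation q j := (p ^ (st_t S * j))%N.
Notation torL j := (nseries (map_mps (st_iota S) (st_F S)) (p ^ j)).
Notation pJ := (idl_pow (cJ (c := A))).
Hypothesis rI : forall c, I c -> cJ (r c).
Let HP m := idl_pow_ideal (cJ (c := A)) m.
Let HJ := @cJi A.

Lemma hom_lo (Q : {rmorphism mps unit L -> A}) j : (forall c, Q (mps_const _ c) = r c) ->
  cJ (Q (lo tt (q j) (torL j))).
Proof.
move=> Qc; rewrite (low_poly (leqnn _) (@low_lo _ _ tt (q j) _)) rmorph_sum.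
apply: (ideal_sum HJ) => i _; rewrite rmorphM Qc coef1_lo ltn_ord.
by apply: (idealMr HJ); apply/rI/st_coef.
Qed.

Lemma sh_unit j : exists v, sh tt (q j) (torL j) * v = 1.
Proof. by have [c cE] := @st_lead S j; apply: (@mps_unit _ _ _ c); rewrite sh_at0. Qed.

(** Up to terms with coefficients in [I_t], [[p^j]] is [x^(p^(tj))] times a unit. *)
Lemma gpt_nil (Q : gpt (rL r)) : exists N, cJ (Q 'x_tt ^+ N).
Proof.
have [j /(idl_pow1 _ HJ) Qj] := gp_tors Q 1%N; have [v vE] := sh_unit j; exists (q j).
have e := lo_sh tt (q j) (torL j).
have -> : Q 'x_tt ^+ q j = (Q (torL j) - Q (lo tt (q j) (torL j))) * Q v.
  rewrite {1}e rmorphD addrC addKr !rmorphM -mulrA -rmorphM vE rmorph1 mulr1.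
  by rewrite rmorphXn.
by apply/(idealMr HJ)/(idealB HJ) => //; apply: hom_lo; apply: (gp_lin Q).
Qed.

(** For [t = 0] the Weierstrass degree is one, so [[p^j]] is exactly [x] times a unit and [GG_0] is
    trivial. *)
Lemma gpt_t0 (Q : gpt (rL r)) : st_t S = 0%N -> Q 'x_tt = 0.
Proof.
move=> t0; apply: (complete_eq (cJc A)) => m; rewrite subr0.
have [j Qj] := gp_tors Q m; have [v vE] := sh_unit j.
have q1 : q j = 1%N by rewrite t0 mul0n.
have e := lo_sh tt (q j) (torL j); rewrite q1 in e vE.
have l0 : lo tt 1 (torL j) = 0.
  apply: mpsP => m' /=; case: ltnP => // m1.
  have -> : m' = 0 by apply/ffunP => -[]; rewrite ffunE; apply/eqP; rewrite -leqn0 -ltnS.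
  exact: (nseries_at0 (fgP (GL S))).
have -> : Q 'x_tt = Q (torL j) * Q v.
  by rewrite -rmorphM {1}e l0 add0r expr1 -mulrA vE mulr1.
exact: (idealMr (HP m)).
Qed.

Lemma pev_high xi N m (f : {poly L}) : cJ (xi ^+ N) -> (forall i, (i < N * m)%N -> f`_i = 0) ->
  pJ m (pev r xi f).
Proof.
move=> xiN f0; apply: (ideal_sum (HP m)) => i _.
have [/f0 ->|Mi] := ltnP i (N * m)%N; first by rewrite rmorph0 mul0r; apply: (ideal0 (HP m)).
apply: (idealMl (HP m)); rewrite -(subnK Mi) exprD; apply: (idealMl (HP m)).
by rewrite exprM -{1}[m]mul1n; apply: idl_powXX; apply/(idl_pow1 _ HJ).
Qed.

(** Modulo [J^m] all terms of degree at least [N m] vanish, so values of series are limits of values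
    of truncations. *)
Lemma series_eval xi N : cJ (xi ^+ N) -> exists Ph : {rmorphism mps unit L -> A},
  (forall m f, pJ m (Ph f - pev r xi (\poly_(i < N * m) cf f i))) /\
  forall f, Ph (pol f) = pev r xi f.
Proof.
move=> xiN; pose tr m (f : mps unit L) := \poly_(i < N * m) cf f i.
have trE m f i : (i < N * m)%N -> (tr m f)`_i = cf f i by move=> iM; rewrite coef_poly iM.
have polC (g : {poly L}) i : cf (pol g) i = g`_i by rewrite /cf /Defs.coef1 polE ffunE.
have high m (g g' : {poly L}) : (forall i, (i < N * m)%N -> g`_i = g'`_i) ->
    pJ m (pev r xi g - pev r xi g').
  move=> gg; rewrite -rmorphB; apply: (pev_high xiN) => i iM.
  by rewrite coefB gg // subrr.
have lowM m (f g : mps unit L) : exists k, f * g = pol (tr m f * tr m g) + 'x_tt ^+ (N * m) * k.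
  have e h : exists k, h = pol (tr m h) + 'x_tt ^+ (N * m) * k.
    exists (sh tt (N * m) h); rewrite {1}(lo_sh tt (N * m) h); congr (_ + _).
    rewrite -(low_pol (@low_lo _ _ tt (N * m) h)); congr pol; apply/polyP => i.
    by rewrite !coef_poly; case: ifP => // iM; rewrite coef1_lo iM.
  have [[k kE] [k' kE']] := (e f, e g).
  exists (pol (tr m f) * k' + k * pol (tr m g) + k * ('x_tt ^+ (N * m) * k')).
  by rewrite {1}kE {1}kE' rmorphM /=; ring.
have [f|a Ha|f g a b Hf Hg|f g a b Hf Hg||Ph PhE] :=
  @graph_hom (mps unit L) A (fun f a => forall m, pJ m (a - pev r xi (tr m f))).
- have [|a aE] := (cJc A).2 (fun m => pev r xi (tr m f)); last by exists a.
  move=> m; apply: high => i iM; rewrite !trE // (leq_trans iM) //.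
  by rewrite leq_mul2l leqnSn orbT.
- apply: (complete_eq (cJc A)) => m; have := Ha m.
  by rewrite (_ : tr m 0 = 0) ?rmorph0 //; apply/polyP => i; rewrite coef_poly coef0 if_same.
- move=> m; have -> : tr m (f - g) = tr m f - tr m g.
    by apply/polyP => i; rewrite coefB !coef_poly; case: ifP => //; rewrite subr0.
  have -> : a - b - pev r xi (tr m f - tr m g) = (a - pev r xi (tr m f)) - (b - pev r xi (tr m g)).
    by rewrite rmorphB; ring.
  exact: (idealB (HP m)).
- move=> m; apply: (ideal_trans (HP m)) (idealBM (HP m) (Hf m) (Hg m)) _.
  rewrite -rmorphM; apply: high => i iM; rewrite trE //; have [k kE] := lowM m f g.
  by rewrite kE -[RHS]/(mcoef (_ + _) _) mcoefD mcoef_varnM !ffunE leqNgt iM addr0 polE ffunE.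
- move=> m; rewrite -[1 in X in pJ m X](rmorph1 (pev r xi)); apply: high => i iM.
  by rewrite trE // -polC rmorph1.
exists Ph; split=> // f; apply: (complete_eq (cJc A)) => m.
apply: (ideal_trans (HP m)) (PhE (pol f) m) _; apply: high => i iM.
by rewrite trE // polC.
Qed.

(** Converse to [gpt_nil]: evaluation of series over [L] at the coordinate extends [D] from [E[[x]]]
    to [L[[x]]]. *)
Lemma nil_incl (D : gpt (rE r)) N : cJ (D 'x_tt ^+ N) -> exists Q : gpt (rL r), gincl Q = D.
Proof.
move=> DN; have [Ph [PhE PhP]] := series_eval DN.
have PhD f : Ph (map_mps (st_iota S) f) = D f.
  apply: (complete_eq (cJc A)) => m; apply: (ideal_trans (HP m)) (PhE m _) _.
  have {2}-> := lo_sh tt (N * m) f; rewrite pev_poly rmorphD rmorphM rmorphXn opprD addrA.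
  rewrite (low_poly (leqnn _) (@low_lo _ _ tt (N * m) f)) rmorph_sum -sumrB big1 ?sub0r.
    apply/(idealN (HP m))/(idealMr (HP m)); rewrite exprM -{1}[m]mul1n.
    by apply: idl_powXX; apply/(idl_pow1 _ HJ).
  move=> i _; rewrite rmorphM rmorphXn (gp_lin D) coef1_lo ltn_ord; exact: subrr.
have Ql c : Ph (mps_const _ c) = rL r c by have := PhP c%:P; rewrite /pol !pevC.
have Qt m : exists j, pJ m (Ph (nseries (fgF (GL S)) (p ^ j))).
  by have [j Dj] := gp_tors D m; exists j; rewrite -map_nseries PhD.
exists (@Gpt (GL S) A (rL r) Ph Ql Qt); apply: gpt_ext; rewrite incl_x.
by rewrite -[LHS]/(Ph 'x_tt) -polX PhP pevX.
Qed.

(** For [t > 0] the linear coefficient of [[p]] lies in [I_t], so each application of [[p]] gains a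
    power of [J]. For [t = 0] this fails, which is why the coordinate is then required to vanish. *)
Lemma small_tors (Q : {rmorphism mps unit L -> A}) : (forall c, Q (mps_const _ c) = r c) ->
  cJ (Q 'x_tt) -> (st_t S = 0%N -> Q 'x_tt = 0) -> forall m, pJ m (Q (torL m)).
Proof.
move=> Qc Qx Q0; have n0 := nseries_at0 (fgP (GL S)).
have [/Q0 {}Qx|t0] := eqVneq (st_t S) 0%N.
  move=> m; have [k kE] := scomp_dvd (var0 L tt) (n0 (p ^ m)%N).
  rewrite scomp_var in kE; rewrite [X in Q X]kE rmorphM Qx mul0r; exact: (ideal0 (HP m)).
elim=> [|m IHm]; first exact: idl_pow0.
rewrite expnS (nseriesM (fgP (GL S))) -[nseries _ p](mul1r) mul1r.
set T := nseries (fgF (GL S)) (p ^ m); set f := nseries _ p.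
have [c1 c1I [k fE]] : exists2 c1, I c1 & exists k, f = 'x_tt * (mps_const _ c1 + 'x_tt * k).
  exists (cf f 1).
    have := @st_coef S 1 1; rewrite !expn1 muln1; apply.
    by rewrite -{1}(expn0 p) ltn_exp2l ?prime_gt1 ?st_prime // lt0n.
  exists (sh tt 2 f); rewrite mulrDr mulrA -expr2 {1}(lo_sh tt 2 f); congr (_ + _).
  rewrite (low_poly (leqnn _) (@low_lo _ _ tt 2 f)) big_ord_recl big_ord1 !coef1_lo /=.
  rewrite (_ : cf f 0 = 0) ?rmorph0 ?mul0r ?add0r ?expr1 1?mulrC //.
  by rewrite -[RHS](n0 p) /cf /Defs.coef1; congr (mcoef f _); apply/ffunP => -[]; rewrite !ffunE.
have T0 : T 0 = 0 by apply: n0.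
have -> : scomp f T = T * (mps_const _ c1 + T * scomp k T).
  rewrite {1}fE -!(scomp_rmE T0) rmorphM rmorphD rmorphM /= /subst_fun !msubst_var //.
  by rewrite msubst_const.
rewrite rmorphM mulrC; apply: idl_powS => //; rewrite rmorphD rmorphM Qc.
apply: (idealD HJ); first exact: rI.
apply: (idealMr HJ); have [k' kE] := scomp_dvd (var0 L tt) T0.
by rewrite scomp_var in kE; rewrite kE rmorphM; apply: (idealMr HJ).
Qed.
End Criterion.

(** * Homomorphisms from Qp^h *)

Definition caL (S : lts) (A : calg (Lt_ideal (st_p S) (st_t S) (st_iota S))) :
  {rmorphism st_L S -> cc A} := ca_map A.
Notation PE A := (gpt (rE (caL A))).
Notation PL A := (gpt (rL (caL A))).

Section Systems.
Context (S : lts).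
Notation p := (st_p S).
Notation L := (st_L S).
Notation I := (Lt_ideal (st_p S) (st_t S) (st_iota S)).
Notation h := (st_n S - st_t S)%N.
Implicit Types A B : calg I.

Lemma caI A c : I c -> cJ (c := cc A) (caL A c). Proof. exact: ca_sub. Qed.

Section Res.
Context A B (u : chom A B).
Definition resE (P : PE A) : PE B :=
  @gmap (GE S) (cc A) (cc B) (res_hom u) (ch_cont u)
    (rE (caL A)) (rE (caL B)) (fun c => ch_lin u (st_iota S c)) P.
Definition resL (P : PL A) : PL B :=
  @gmap (GL S) (cc A) (cc B) (res_hom u) (ch_cont u)
    (rL (caL A)) (rL (caL B)) (fun c => ch_lin u c) P.
Lemma resEE P h : resE P h = u (P h). Proof. by []. Qed.
Lemma res_incl (Q : PL A) : resE (gincl Q) = gincl (resL Q). Proof. exact: gpt_eq. Qed.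
Lemma resED : {morph resE : P Q / P + Q}. Proof. exact: gmapD. Qed.
Lemma resEB : {morph resE : P Q / P - Q}. Proof. exact: gmapB. Qed.
Lemma resEMn P n : resE (P *+ n) = resE P *+ n. Proof. exact: gmapMn. Qed.
Lemma resE_sum J (r : seq J) (P : pred J) (f : J -> PE A) :
  resE (\sum_(i <- r | P i) f i) = \sum_(i <- r | P i) resE (f i).
Proof. exact: gmap_sum. Qed.
Lemma resL_sum J (r : seq J) (P : pred J) (f : J -> PL A) :
  resL (\sum_(i <- r | P i) f i) = \sum_(i <- r | P i) resL (f i).
Proof. exact: gmap_sum. Qed.
Lemma resE_scale (Z : zpring p) (z : Z) (P : PE A) :
  resE (@zscale (GE S) Z _ _ z P) = @zscale (GE S) Z _ _ z (resE P).
Proof. exact: gmap_zscale. Qed.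
Lemma resL_scale (Z : zpring p) (z : Z) (P : PL A) :
  resL (@zscale (GL S) Z _ _ z P) = @zscale (GL S) Z _ _ z (resL P).
Proof. exact: gmap_zscale. Qed.
End Res.

Lemma incl_scale A (Z : zpring p) (z : Z) (P : PL A) :
  gincl (@zscale (GL S) Z _ _ z P) = @zscale (GE S) Z _ _ z (gincl P).
Proof.
apply: (@zscale_uniq (GE S)) => m; have [j Pj] := gp_tors P m; have [w zE] := @zseqP (GL S) Z z j.
exists j, (zseq (G := GL S) z j), w; split=> // [|k].
  by rewrite -[gincl P _]/(P (map_mps _ _)) map_nseries.
have := @zscale_spec (GL S) Z _ _ z P m j _ w Pj zE (map_mps (st_iota S) k).
by rewrite -map_nseries -map_scomp.
Qed.

(* A lift of the map (b_j / p^k |-> a_(k,j)) and of its restriction to the lattice. *)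
Record sys A := Sys {
  sq : 'I_h -> PL A;
  sa : nat -> 'I_h -> PE A;
  sys0 : forall i, sa 0 i = gincl (sq i);
  sysS : forall k i, sa k.+1 i *+ p = sa k i }.

Lemma sys_eq A (s s' : sys A) : (forall k i, sa s k i = sa s' k i) -> s = s'.
Proof.
case: s s' => [q a a0 aS] [q' a' a0' aS'] /= e.
have ea : a = a' by apply/funext => k; apply/funext => i.
subst a'; have eq : q = q' by apply/funext => i; apply: incl_inj; rewrite -a0 -a0'.
by subst q'; rewrite (Prop_irrelevance a0 a0') (Prop_irrelevance aS aS').
Qed.

Section SysMap.
Context A B (u : chom A B) (s : sys A).
Lemma sysmap0 i : resE u (sa s 0 i) = gincl (resL u (sq s i)).
Proof. by rewrite sys0 res_incl. Qed.
Lemma sysmapS k i : resE u (sa s k.+1 i) *+ p = resE u (sa s k i).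
Proof. by rewrite -resEMn sysS. Qed.
Definition sysmap : sys B := Sys sysmap0 sysmapS.
End SysMap.

Lemma saX A (s : sys A) k m i : sa s (k + m) i *+ (p ^ m) = sa s k i.
Proof.
elim: m => [|m IHm]; first by rewrite addn0 mulr1n.
by rewrite addnS expnS mulrnA sysS.
Qed.

Definition spt A (s : sys A) j (c : 'I_h -> nat) : PE A := \sum_i sa s j i *+ c i.

Lemma spt_res A B (u : chom A B) (s : sys A) j c :
  resE u (spt s j c) = spt (sysmap u s) j c.
Proof. by rewrite /spt resE_sum; apply: eq_bigr => i _; rewrite resEMn. Qed.

Definition nondeg A (s : sys A) := forall j (c : 'I_h -> 'I_(p ^ j)), (0 < j)%N ->
  (exists i, c i != 0%N :> nat) -> exists v, spt s j c 'x_tt * v = 1.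

Lemma nondeg_res A B (u : chom A B) (s : sys A) : nondeg s -> nondeg (sysmap u s).
Proof.
move=> sn j c j0 c0; have [v vE] := sn j c j0 c0; exists (u v).
by rewrite -spt_res resEE -rmorphM vE rmorph1.
Qed.

Section Qp.
Context (Z : zpring p) (Qp : comPzRingType) (iQ : {rmorphism Z -> Qp}).
Hypothesis hQp : is_localization [set (p%:R : Z)]%classic iQ.
Notation zE := (@zscale (GE S) Z _ _).
Notation zL := (@zscale (GL S) Z _ _).
Notation iQm := (map_mx iQ).

Lemma pow_list (l : seq Z) : (forall x, x \in l -> x = p%:R) ->
  \prod_(x <- l) x = p%:R ^+ size l.
Proof.
elim: l => [|x l IHl] H; first by rewrite big_nil.
rewrite big_cons exprS (H x) ?mem_head // IHl // => y yl; apply: H.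
by rewrite inE yl orbT.
Qed.

Lemma Qp_den (z : Qp) : exists k r, p%:R ^+ k * z = iQ r.
Proof.
have [_ H _] := hQp; have [r [s [[l lP sE] zs]]] := H z; exists (size l), r.
by rewrite -zs sE pow_list // rmorphXn rmorph_nat mulrC.
Qed.

Lemma Qp_tor r : iQ r = 0 -> exists k, p%:R ^+ k * r = 0.
Proof.
by have [_ _ H] := hQp; move=> /H[s [l lP ->]]; rewrite pow_list // => E; exists (size l).
Qed.

Lemma Qp_inv : exists v : Qp, p%:R * v = 1.
Proof.
have [H _ _] := hQp; have [|v vE] := H p%:R; last by exists v; rewrite rmorph_nat in vE.
exists [:: p%:R]; last by rewrite big_seq1.
by move=> x; rewrite inE => /eqP.
Qed.

Lemma Qp_inj k (w w' : 'rV[Qp]_h) : p%:R ^+ k *: w = p%:R ^+ k *: w' -> w = w'.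
Proof.
have [v vE] := Qp_inv => /(congr1 (fun u => v ^+ k *: u)).
by rewrite !scalerA -exprMn mulrC vE expr1n !scale1r.
Qed.

Lemma Qp_denom (w : 'rV[Qp]_h) : exists k v, p%:R ^+ k *: w = iQm v.
Proof.
have [k kP] := choice (fun i => Qp_den (w 0 i)); have [r rP] := choice kP.
exists (\sum_i k i)%N, (\row_i (p%:R ^+ (\sum_(j | j != i) k j)%N * r i)).
apply/rowP => i; rewrite !mxE rmorphM -rP rmorphXn rmorph_nat mulrA -exprD.
by congr (_ ^+ _ * _); rewrite (bigD1 i) //= addnC.
Qed.

Section Value.
Context A (s : sys A).

Definition sf (v : 'rV[Z]_h) : PL A := \sum_i zL (v 0 i) (sq s i).
Definition sg_at k (v : 'rV[Z]_h) : PE A := \sum_i zE (v 0 i) (sa s k i).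

Lemma sa_zscale k m i : sa s k i = zE (p%:R ^+ m) (sa s (k + m) i).
Proof. by rewrite -natrX zscale_nat saX. Qed.

(** Equal fractions have numerators that agree after cross multiplication only up to [p]-power
    torsion of [Z]; passing to level [k + k' + m] of the system absorbs it. *)
Lemma sg_at_uniq k k' v v' (w : 'rV[Qp]_h) :
  p%:R ^+ k *: w = iQm v -> p%:R ^+ k' *: w = iQm v' -> sg_at k v = sg_at k' v'.
Proof.
move=> wv wv'; apply: eq_bigr => i _.
have [|m mE] := @Qp_tor (p%:R ^+ k' * v 0 i - p%:R ^+ k * v' 0 i).
  have := congr1 (fun x : 'rV_h => x 0 i) wv; have := congr1 (fun x : 'rV_h => x 0 i) wv'.
  rewrite !mxE rmorphB !rmorphM !rmorphXn !rmorph_nat /= => <- <-.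
  by rewrite mulrCA subrr.
rewrite (sa_zscale k (k' + m)) (sa_zscale k' (k + m)) !zscaleA addnA addnA (addnC k' k).
congr zscale; apply/eqP; rewrite -subr_eq0 -[X in _ == X]mE !exprD; apply/eqP; ring.
Qed.

Definition sg (w : 'rV[Qp]_h) : PE A :=
  sg_at (projT1 (cid (Qp_denom w))) (projT1 (cid (projT2 (cid (Qp_denom w))))).

Lemma sgE k v w : p%:R ^+ k *: w = iQm v -> sg w = sg_at k v.
Proof.
move=> wv; rewrite /sg; case: cid => k' /= H; case: cid => v' /= wv'.
exact: sg_at_uniq wv' wv.
Qed.

Lemma sg_sf v : sg (iQm v) = gincl (sf v).
Proof.
rewrite (@sgE 0 v) ?expr0 ?scale1r // /sg_at /sf (big_morph _ (@inclD _ _ _) (incl0 _)).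
by apply: eq_bigr => i _; rewrite incl_scale sys0.
Qed.

Lemma Qp_common (w w' : 'rV[Qp]_h) : exists k v v',
  p%:R ^+ k *: w = iQm v /\ p%:R ^+ k *: w' = iQm v'.
Proof.
have [[k [v wv]] [k' [v' wv']]] := (Qp_denom w, Qp_denom w').
exists (k + k')%N, (p%:R ^+ k' *: v), (p%:R ^+ k *: v').
rewrite !map_mxZ !rmorphXn !rmorph_nat -wv -wv' !scalerA -!exprD (addnC k' k).
by split.
Qed.

Lemma sgD : {morph sg : w w' / w + w'}.
Proof.
move=> w w'; have [k [v [v' [wv wv']]]] := Qp_common w w'.
rewrite (sgE wv) (sgE wv') (@sgE k (v + v')) ?map_mxD -?wv -?wv' ?scalerDr //.
by rewrite /sg_at -big_split; apply: eq_bigr => i _; rewrite mxE zscaleDl.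
Qed.

Lemma sgZ z w : sg (iQ z *: w) = zE z (sg w).
Proof.
have [k [v wv]] := Qp_denom w.
rewrite (sgE wv) (@sgE k (z *: v)) ?map_mxZ -?wv ?scalerA 1?mulrC //.
rewrite /sg_at zscale_sum; apply: eq_bigr => i _; by rewrite mxE zscaleA.
Qed.

Lemma sfD : {morph sf : v v' / v + v'}.
Proof.
by move=> v v'; rewrite /sf -big_split; apply: eq_bigr => i _; rewrite mxE zscaleDl.
Qed.

Lemma sfZ z v : sf (z *: v) = zL z (sf v).
Proof. by rewrite /sf zscale_sum; apply: eq_bigr => i _; rewrite mxE zscaleA. Qed.

Lemma sg_spt j (c : 'I_h -> nat) w : p%:R ^+ j *: w = iQm (\row_i (c i)%:R) -> sg w = spt s j c.
Proof. by move=> /sgE ->; apply: eq_bigr => i _; rewrite mxE zscale_nat. Qed.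

Lemma sg0 : sg 0 = 0.
Proof. by apply: (addrI (sg 0)); rewrite -sgD !addr0. Qed.
Lemma sgB : {morph sg : w w' / w - w'}.
Proof. by move=> w w'; apply: (addIr (sg w')); rewrite -sgD !subrK. Qed.
End Value.

Lemma sg_res A B (u : chom A B) (s : sys A) w : resE u (sg s w) = sg (sysmap u s) w.
Proof.
have [k [v wv]] := Qp_denom w; rewrite !(sgE _ wv) /sg_at resE_sum.
by apply: eq_bigr => i _; rewrite resE_scale.
Qed.

Lemma sf_res A B (u : chom A B) (s : sys A) v : resL u (sf s v) = sf (sysmap u s) v.
Proof. by rewrite /sf resL_sum; apply: eq_bigr => i _; rewrite resL_scale. Qed.

Lemma Qp_frac (w : 'rV[Qp]_h) : (exists v, w = iQm v) \/
  exists j (c : 'I_h -> 'I_(p ^ j)) v, [/\ (0 < j)%N, exists i, c i != 0%N :> nat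
    & p%:R ^+ j *: (w - iQm v) = iQm (\row_i (c i)%:R)].
Proof.
have [k [v wv]] := Qp_denom w.
have H i : exists cu : 'I_(p ^ k) * Z, v 0 i = (cu.1 : nat)%:R + p%:R ^+ k * cu.2.
  have [a [u vE]] := zp_approx (v 0 i) k.
  have pk : (a %% p ^ k < p ^ k)%N by rewrite ltn_pmod // expn_gt0 prime_gt0 ?st_prime.
  exists (Ordinal pk, u + (a %/ p ^ k)%:R); rewrite vE /= {1}(divn_eq a (p ^ k)).
  by rewrite natrD natrM natrX; ring.
have [cu cuE] := choice H; pose u := \row_i (cu i).2.
have wE : p%:R ^+ k *: (w - iQm u) = iQm (\row_i ((cu i).1 : nat)%:R).
  rewrite scalerBr wv; apply/rowP => i; rewrite !mxE cuE rmorphD rmorphM rmorphXn !rmorph_nat.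
  by rewrite addrK.
have [[i ci]|c0] := pselect (exists i, (cu i).1 != 0%N :> nat).
  right; exists k, (fun i => (cu i).1), u; split=> //; last by exists i.
  case: (k) (cu i) ci => // -[[c]] /=; rewrite expn0; by case: c.
left; exists u; apply/eqP; rewrite -subr_eq0; apply/eqP/(@Qp_inj k); rewrite wE scaler0.
apply/rowP => i; rewrite !mxE; case: eqP (fun e => c0 (ex_intro _ i e)) => [->|_ /(_ isT)//].
by rewrite rmorph0.
Qed.

(** If [w - w'] is not integral, its fractional part gives a point whose coordinate is a unit by
    nondegeneracy and nilpotent modulo [J] because the point lies in [GG_0]; this forces the ring to
    be zero. *)
Lemma decomposition_uniq A (s : sys A) : nondeg s -> forall (Q Q' : PL A) w w',
  gincl Q + sg s w = gincl Q' + sg s w' -> (1 : A) = 0 \/ exists v, w = w' + iQm v /\ Q' = Q + sf s v.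
Proof.
move=> sn Q Q' w w' E.
have {}E : sg s (w - w') = gincl (Q' - Q).
  by rewrite sgB inclB; apply/eqP; rewrite subr_eq addrAC -E [gincl Q + _]addrC addrK.
have [[v vE]|[j [c [v [j0 c0 wE]]]]] := Qp_frac (w - w').
  right; exists v; split; first by rewrite -vE addrC subrK.
  by apply/eqP; rewrite addrC -subr_eq; apply/eqP/incl_inj; rewrite -E vE sg_sf.
left; have [k kE] := sn j c j0 c0; rewrite -(sg_spt s wE) sgB E sg_sf -inclB incl_x in kE.
have [N /(idl_pow1 _ (@cJi (cc A))) NJ] := gpt_nil (@caI A) (Q' - Q - sf s v).
apply: (complete_eq (ca_complete A)) => m; rewrite subr0 -(expr1n _ (N * m)) -kE exprMn.
apply: (idealMr (idl_pow_ideal _ _)); rewrite exprM -[m in idl_pow _ m]mul1n.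
exact: idl_powXX.
Qed.
End Qp.
End Systems.

Definition nz_ring (C : comPzRingType) (C1 : (1 : C) != 0) : comNzRingType :=
  HB.pack_for comNzRingType (GRing.ComPzRing.sort C) (GRing.PzSemiRing_isNonZero.Build C C1).

(** * Counting torsion points *)

Section NilpotentExtension.
Context (R : comPzRingType).
Implicit Types (J K : set R) (x : R).

Definition add_gen K x : set R := fun y => exists k w, K k /\ y = k + x * w.

Lemma add_gen_ideal K x : is_ideal K -> is_ideal (add_gen K x).
Proof.
move=> HK; split=> [|y z [k [w [Kk ->]]] [k' [w' [Kk' ->]]]|r y [k [w [Kk ->]]]].
- by exists 0, 0; split; [apply: ideal0|rewrite mulr0 addr0].
- by exists (k + k'), (w + w'); split; [apply: idealD|ring].
- by exists (r * k), (r * w); split; [apply: idealMl|ring].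
Qed.

(** Adding an element nilpotent modulo [J] changes the topology only up to powers. This accommodates
    the coordinates of the [q_j], which need not lie in the ideal of a general algebra. *)
Lemma add_gen_pow J K x a N : is_ideal J -> (forall y, idl_pow K a y -> J y) -> J (x ^+ N) ->
  exists b, forall y, idl_pow (add_gen K x) b y -> J y.
Proof.
move=> HJ Ka xN; have HJx := add_gen_ideal x HJ.
have base y : idl_pow (add_gen K x) a y -> add_gen J x y.
  move: y; apply: (idl_powP HJx) => c cK; have [k kP] := choice cK; have [w wP] := choice kP.
  have e : forall i, add_gen J x (c i - k i).
    move=> i; exists 0, (w i); rewrite (wP i).2 addrC addKr add0r; split=> //; exact: ideal0.
  have E : add_gen J x (\prod_i c i - \prod_i k i).
    elim/big_rec2: _ => [|i y1 y2 _ H]; first by rewrite subrr; apply: ideal0.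
    exact: idealBM.
  rewrite -[X in add_gen J x X](subrK (\prod_i k i)); apply: (idealD HJx) => //.
  exists (\prod_i k i), 0; rewrite mulr0 addr0; split=> //; apply: Ka; apply: sub_idl.
  by exists k; split=> // i; apply: (wP i).1.
(* A product of [a] factors lies in [J + (x)], so one of [a N] factors lies in [J + (x^N)]. *)
exists (a * N)%N => y.
suff H n : forall y, idl_pow (add_gen K x) (a * n) y -> exists j w, J j /\ y = j + x ^+ n * w.
  by move=> /H[j [w [Jj ->]]]; apply: (idealD HJ) => //; apply: (idealMr HJ).
elim: n => [z _|n IHn]; first by exists 0, z; rewrite expr0 mul1r add0r; split=> //; apply: ideal0.
have HP : is_ideal (fun y => exists j w, J j /\ y = j + x ^+ n.+1 * w).
  exact: add_gen_ideal.
move=> z; rewrite mulnS; apply: (idl_powP HP) => c cK; rewrite big_split_ord /=.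
have in_pow m (d : 'I_m -> R) : (forall i, add_gen K x (d i)) -> idl_pow (add_gen K x) m (\prod_i d i).
  by move=> dK; apply: sub_idl; exists d.
have [|j [w [Jj ->]]] := base (\prod_(i < a) c (lshift _ i)); first exact: in_pow.
have [|j' [w' [Jj' ->]]] := IHn (\prod_(i < a * n) c (rshift _ i)); first exact: in_pow.
exists (j * j' + j * (x ^+ n * w') + x * w * j'), (w * w'); split; last by rewrite exprS; ring.
by apply: (idealD HJ); [apply: (idealD HJ); apply: (idealMr HJ)|apply: (idealMl HJ)].
Qed.

Definition add_gens J (s : seq R) : set R := foldr (fun x K => add_gen K x) J s.

Lemma add_gens_ideal J s : is_ideal J -> is_ideal (add_gens J s).
Proof. by move=> HJ; elim: s => //= x s; apply: add_gen_ideal. Qed.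

Lemma add_gens_pow J s : is_ideal J -> (forall x, x \in s -> exists N, J (x ^+ N)) ->
  exists b, forall y, idl_pow (add_gens J s) b y -> J y.
Proof.
move=> HJ; elim: s => [|x s IHs] sN; first by exists 1%N => y /idl_pow1; apply.
have [|a Ha] := IHs; first by move=> y ys; apply: sN; rewrite inE ys orbT.
by have [N xN] := sN x (mem_head _ _); apply: add_gen_pow Ha xN.
Qed.

Lemma add_gens_sub J s y : is_ideal J -> J y -> add_gens J s y.
Proof.
move=> HJ Jy; elim: s => //= x s IHs; exists y, 0; by rewrite mulr0 addr0.
Qed.

Lemma add_gens_mem J s x : is_ideal J -> x \in s -> add_gens J s x.
Proof.
move=> HJ; elim: s => //= z s IHs; rewrite inE => /orP[/eqP->|/IHs sx].
  exists 0, 1; rewrite mulr1 add0r; split=> //; by apply: ideal0; apply: add_gens_ideal.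
by exists x, 0; rewrite mulr0 addr0.
Qed.
End NilpotentExtension.

Section Multiplicity.
Context (C : comNzRingType).
Implicit Types g : {poly C}.

Lemma unit_nil (D : comPzRingType) (u v n : D) q : u * v = 1 -> n ^+ q = 0 ->
  exists w, (n + u) * w = 1.
Proof.
move=> uv nq; have := subrXX u (- n) q.
rewrite exprNn nq mulr0 subr0 opprK addrC => E.
exists ((\sum_(i < q) u ^+ (q.-1 - i) * (- n) ^+ i) * v ^+ q).
by rewrite mulrA -E -exprMn uv expr1n.
Qed.

Lemma separated_roots (J : eqType) (x : J -> C) (s : seq J) q g : uniq s ->
  (forall i k, i != k -> exists v, (x i - x k) * v = 1) ->
  (forall i, exists m, g = ('X - (x i)%:P) ^+ q * m) ->
  exists m, g = (\prod_(i <- s) ('X - (x i)%:P) ^+ q) * m.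
Proof.
move=> us xU gx; elim: s us => [|i s IHs] /=; first by exists g; rewrite big_nil mul1r.
move=> /andP[si /IHs[m gE]]; have HI := principal_ideal (('X - (x i)%:P) ^+ q).
pose pi : {rmorphism {poly C} -> quot HI} := qpi HI.
have nil : pi ('X - (x i)%:P) ^+ q = 0.
  by rewrite -rmorphXn; apply/qpi0; exists 1; rewrite mulr1.
have [w wE] : exists w, pi (\prod_(k <- s) ('X - (x k)%:P) ^+ q) * w = 1.
  elim: s si {IHs gE} => [|k s IHs]; first by exists 1; rewrite big_nil rmorph1 mulr1.
  rewrite inE negb_or => /andP[ik /IHs[w wE]].
  have [v vE] := xU _ _ ik.
  have [|w' w'E] := @unit_nil _ (pi (x i - x k)%:P) (pi v%:P) _ q _ nil.
    by rewrite -!rmorphM vE !rmorph1.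
  exists (w' ^+ q * w); rewrite big_cons rmorphM rmorphXn mulrACA wE mulr1 -exprMn.
  by rewrite -rmorphD /= polyCB addrA subrK in w'E; rewrite w'E expr1n.
have [m0 gE0] := gx i.
have /qpi0[m' m'E] : pi m = 0.
  rewrite -[LHS]mulr1 -wE mulrA -rmorphM [m * _]mulrC -gE gE0 rmorphM rmorphXn nil.
  by rewrite !mul0r.
by exists m'; rewrite big_cons gE m'E mulrCA mulrA.
Qed.

Lemma separated_roots_size (J : finType) (x : J -> C) q g : g \is monic ->
  (forall i k, i != k -> exists v, (x i - x k) * v = 1) ->
  (forall i, exists m, g = ('X - (x i)%:P) ^+ q * m) -> (#|J| * q < size g)%N.
Proof.
move=> gm xU gx; have [m gE] := separated_roots (enum_uniq J) xU gx.
have H (s : seq J) : (\prod_(i <- s) ('X - (x i)%:P) ^+ q) \is monic /\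
    size (\prod_(i <- s) ('X - (x i)%:P) ^+ q) = (size s * q).+1.
  elim: s => [|i s [sm ss]]; first by rewrite big_nil monic1 size_poly1.
  have im : ('X - (x i)%:P) ^+ q \is monic by rewrite monic_exp ?monicXsubC.
  rewrite big_cons monicMl // sm size_monicM ?monic_neq0 // ss; split=> //.
  rewrite size_exp_XsubC /= mulSn; lia.
have [sm ss] := H (enum J); have m0 : m != 0.
  by apply/eqP => m0; move: (monic_neq0 gm); rewrite gE m0 mulr0 eqxx.
by rewrite gE size_monicM // ss cardE addSn /= -[X in (X < _)%N]addn0 ltn_add2l size_poly_gt0.
Qed.
End Multiplicity.

Lemma pev_comp (C : comNzRingType) (D : comPzRingType) (s : {rmorphism C -> D}) y (f u : {poly C}) :
  pev s y (f \Po u) = pev s (pev s y u) f.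
Proof.
elim/poly_ind: f => [|f c IHf]; first by rewrite comp_poly0 !rmorph0.
by rewrite comp_polyD comp_polyM comp_polyX comp_polyC !rmorphD !rmorphM /= IHf !pevC pevX.
Qed.

Lemma pev_map_poly (L C : comNzRingType) (D : comPzRingType) (r : {rmorphism L -> C})
  (s : {rmorphism C -> D}) (s' : {rmorphism L -> D}) y (f : {poly L}) :
  (forall c, s (r c) = s' c) -> pev s y (map_poly r f) = pev s' y f.
Proof.
move=> sr; elim/poly_ind: f => [|f c IHf]; first by rewrite !rmorph0.
by rewrite !rmorphD !rmorphM /= map_polyX map_polyC IHf /= !pevC !pevX sr.
Qed.

Section Counting.
Context (S : lts) (C : comPzRingType) (C1 : (1 : C) != 0) (r : {rmorphism st_L S -> discr C}).
Notation p := (st_p S).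
Notation L := (st_L S).
Hypothesis rI : forall c, Lt_ideal (st_p S) (st_t S) (st_iota S) c -> r c = 0.
Context (j : nat).
Notation q := (p ^ (st_t S * j))%N.
Notation torL := (nseries (map_mps (st_iota S) (st_F S)) (p ^ j)).
Notation Cn := (nz_ring C1).
Let rn : {rmorphism L -> Cn} := r.
Let g : {poly Cn} := map_poly rn ((dsplit S j).1.1 * (dsplit S j).1.2).
Let HI := principal_ideal ('X^q : {poly Cn}).
Let D : comPzRingType := quot HI.
Let iD : {rmorphism Cn -> D} := qpi HI \o @polyC Cn.
Let eps : D := qpi HI 'X.
Let rD : {rmorphism L -> discr D} := iD \o rn.

Lemma eps_nil : eps ^+ q = 0.
Proof. by rewrite -rmorphXn; apply/qpi0; exists 1; rewrite mulr1. Qed.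

(** Modulo [I_t] the series [[p^j]] is a multiple of [x^q], so [eps] with [eps^q = 0] is the
    coordinate of a point of [GG_0[p^j]]. *)
Lemma infinitesimal_point : exists Q : gpt (rL rD), Q 'x_tt = eps /\ Q *+ (p ^ j) = 0.
Proof.
have rDI c : Lt_ideal (st_p S) (st_t S) (st_iota S) c -> cJ (c := discr D) (rD c).
  by move=> /rI rc; rewrite -[cJ _]/(iD (r c) = 0) rc; apply: (rmorph0 iD).
have e0 : cJ (c := discr D) (eps ^+ q) by apply: eps_nil.
have [Ph [_ PhP]] := @series_eval S (discr D) rD eps q e0.
have Phc c : Ph (mps_const _ c) = rL rD c by have := PhP c%:P; rewrite /pol !pevC.
have Phx : Ph 'x_tt = eps by rewrite -polX PhP pevX.
have Pht : Ph torL = 0.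
  rewrite {1}(lo_sh tt q torL) rmorphD rmorphM rmorphXn [Ph 'x_tt]Phx [_ ^+ q]eps_nil mul0r addr0.
  exact: (hom_lo rDI j Phc).
have Pm m : exists i, idl_pow (cJ (c := discr D)) m (Ph (nseries (fgF (GL S)) (fgp (GL S) ^ i))).
  by exists j; rewrite [X in idl_pow _ _ X]Pht; apply: (ideal0 (idl_pow_ideal _ _)).
by exists (@Gpt (GL S) (discr D) (rL rD) Ph Phc Pm); split=> //; apply/gpt_tor0.
Qed.

(** Translation of [P] by the infinitesimal point gives another root of [g], of the form
    [x(P) + eps u] with [u] a unit. Hence the Taylor coefficients of [g] at [x(P)] vanish below
    degree [q]. *)
Lemma root_multiplicity (P : gpt (rE r)) : P *+ (p ^ j) = 0 ->
  exists m, g = ('X - (P 'x_tt : Cn)%:P) ^+ q * m.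
Proof.
move=> Pj; have [Q [Qx Qj]] := infinitesimal_point.
have rDE c : iD (r c) = rD c by [].
pose x : Cn := P 'x_tt; pose P' := @dE C D iD S r rD rDE P.
have [u [v [P'x uv]]] := gpt_addx P' (gincl Q).
have gP : pev rD ((P' + gincl Q) 'x_tt) ((dsplit S j).1.1 * (dsplit S j).1.2) = 0.
  by apply: gpoly0; rewrite mulrnDl -inclMn Qj incl0 addr0 -dEMn Pj dE0.
pose b := g \Po ('X + x%:P).
have bE : pev iD (eps * u) b = 0.
  rewrite pev_comp.
  have -> : pev iD (eps * u) ('X + x%:P) = (P' + gincl Q) 'x_tt.
    by rewrite P'x incl_x Qx rmorphD /= pevX pevC addrC.
  rewrite (@pev_map_poly L Cn D rn iD rD) //; exact: gP.
have b0 k : (k < q)%N -> b`_k = 0.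
  elim/ltn_ind: k => k IHk kq.
  (* The factor [eps^(q-1-k)] kills the terms above [k], those below vanish by induction, and the
     remaining multiple of [eps^(q-1)] detects the coefficient [k]. *)
  have : pev iD (eps * u) b * eps ^+ (q.-1 - k) * v ^+ k = 0 by rewrite bE !mul0r.
  rewrite (@pevE _ _ iD _ (maxn (size b) k.+1)) ?leq_maxl // !mulr_suml.
  have kM : (k < maxn (size b) k.+1)%N by apply: leq_maxr.
  rewrite (sum_only (i := Ordinal kM)) => [|i ik].
    rewrite /= exprMn -!mulrA [u ^+ k * _]mulrCA -exprMn uv expr1n mulr1 -exprD.
    have -> : (k + (q.-1 - k))%N = q.-1 by lia.
    move=> H; have /qpi0[w /(congr1 (fun f : {poly Cn} => f`_q.-1))] :
        qpi HI ((b`_k)%:P * 'X^(q.-1)) = 0 by rewrite rmorphM rmorphXn; exact: H.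
    have q0 : (0 < q)%N by apply: leq_trans kq.
    have qq : (q.-1 < q)%N by rewrite prednK.
    by rewrite coefCM coefXn eqxx mulr1 mulrC coefMXn qq.
  have [ltik|leki] := ltnP i k.
    have -> : b`_i = 0 by apply: IHk => //; apply: ltn_trans kq.
    by rewrite (rmorph0 iD) !mul0r.
  have e0 : eps ^+ i * eps ^+ (q.-1 - k) = 0.
    rewrite -exprD; have -> : (i + (q.-1 - k) = q + (i - k.+1))%N.
      have : (k < i)%N.
        by rewrite ltn_neqAle leki andbT; apply: contraNneq ik => e; apply/eqP/val_inj.
      by lia.
    by rewrite exprD eps_nil mul0r.
  rewrite exprMn; move: (eps ^+ i) (eps ^+ (q.-1 - k)) e0 => e1 e2 e0.
  transitivity (iD b`_i * u ^+ i * v ^+ k * (e1 * e2)); first by ring.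
  by rewrite e0 mulr0.
have [m mE] : exists m, b = 'X^q * m.
  exists (\poly_(i < size b) b`_(q + i)); apply/polyP => i; rewrite mulrC coefMXn.
  case: ltnP => [/b0 //|qi]; rewrite coef_poly subnKC //; case: ltnP => // sb.
  by rewrite nth_default // (leq_trans sb) // leq_subr.
exists (m \Po ('X - x%:P)).
have -> : g = b \Po ('X - x%:P).
  by rewrite /b -comp_polyA comp_polyD comp_polyX comp_polyC subrK comp_polyXr.
by rewrite mE comp_polyM rmorphXn /= comp_polyX.
Qed.

Lemma point_count (J : finType) (T : J -> gpt (rE r)) : (forall i, T i *+ (p ^ j) = 0) ->
  (forall i k, i != k -> exists v, (T i - T k) 'x_tt * v = 1) ->
  (#|J| * q <= p ^ (st_n S * j))%N.
Proof.
move=> Tj TU; have [_ _ [gm gs] _ _] := dsplitP S j.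
have gnm : g \is monic by apply: monic_map.
have gns : size g = (p ^ (st_n S * j)).+1.
  by rewrite size_map_poly_id0 ?gs // (monicP gm) rmorph1 oner_eq0.
rewrite -ltnS -gns; apply: (@separated_roots_size Cn J (fun i => T i 'x_tt : Cn)) => //.
  move=> i k /TU[v vE]; have [u [w [E uw]]] := gpt_subx (T i) (T k).
  exists (w * v); rewrite [X in X * _]E [w * v]mulrC mulrACA vE uw; exact: mulr1.
by move=> i; apply: root_multiplicity.
Qed.
End Counting.

(** * Covers by idempotents *)

Section IdempotentLifting.
Context (A : comPzRingType) (J : set A) (HJ : is_ideal J) (CJ : adic_complete J).
Let HP m := idl_pow_ideal J m.

(** Iteration of [3 x^2 - 2 x^3], whose new defect from idempotency is a multiple of the square of
    the old one. *)
Lemma idem_lift d : J (d * d - d) -> exists e, e * e = e /\ J (e - d).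
Proof.
move=> Jd; pose nx x : A := 3 * x ^+ 2 - 2 * x ^+ 3; pose u m := iter m nx d.
have uJ m : idl_pow J m.+1 (u m * u m - u m).
  elim: m => [|m IHm]; first exact/idl_pow1.
  have -> : u m.+1 * u m.+1 - u m.+1 =
      (4 * u m ^+ 2 - 4 * u m - 3) * ((u m * u m - u m) * (u m * u m - u m)).
    by rewrite /u /= /nx; ring.
  apply: (idealMl (HP _)); rewrite -[m.+2]addn1; apply: idl_powD => //.
  by apply: idl_powW IHm.
have [|e eE] := CJ.2 u.
  move=> m; have -> : u m.+1 - u m = - (2 * u m - 1) * (u m * u m - u m).
    by rewrite /u /= /nx; ring.
  by apply: (idealMl (HP _)); apply: idl_powW (uJ m).
exists e; split.
  apply: (complete_eq CJ) => m.
  have -> : e * e - e = (e - u m) * (e + u m - 1) + (u m * u m - u m) by ring.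
  by apply: (idealD (HP m)); [apply: (idealMr (HP m))|apply: idl_powW (uJ m)].
apply: (ideal_trans HJ) (_ : J (u 1%N - d)); first exact/(idl_pow1 _ HJ)/eE.
have -> : u 1%N - d = - (2 * d - 1) * (d * d - d) by rewrite /u /= /nx; ring.
exact: (idealMl HJ).
Qed.
End IdempotentLifting.

Lemma image_ideal (R R' : comPzRingType) (f : {rmorphism R -> R'}) (K : set R) :
  (forall y, exists x, y = f x) -> is_ideal K -> is_ideal (fun y => exists x, K x /\ y = f x).
Proof.
move=> fS HK; split=> [|y z [x [Kx ->]] [x' [Kx' ->]]|r y [x [Kx ->]]].
- by exists 0; rewrite rmorph0; split=> //; apply: ideal0.
- by exists (x + x'); rewrite rmorphD; split=> //; apply: idealD.
- by have [s ->] := fS r; exists (s * x); rewrite rmorphM; split=> //; apply: idealMl.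
Qed.

Lemma image_pow (R R' : comPzRingType) (f : {rmorphism R -> R'}) (K : set R) m y :
  (forall y, exists x, y = f x) -> idl_pow (fun y => exists x, K x /\ y = f x) m y ->
  exists x, idl_pow K m x /\ y = f x.
Proof.
move=> fS; apply: (idl_powP (image_ideal fS (idl_pow_ideal K m))) => a aK; have [x xP] := choice aK; exists (\prod_i x i); split.
  by apply: sub_idl; exists x; split=> // i; apply: (xP i).1.
by rewrite rmorph_prod; apply: eq_bigr => i _; apply: (xP i).2.
Qed.

Section IdempotentQuotient.
Context (L : comPzRingType) (I : set L) (A : calg I) (e : A).
Hypothesis ee : e * e = e.
Let J := ca_ideal A.
Let HP m := idl_pow_ideal J m.
Let HI := principal_ideal (1 - e).
Let Q : comPzRingType := quot HI.
Let pi : {rmorphism A -> Q} := qpi HI.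
Let qJ : set Q := fun y => exists x, J x /\ y = pi x.
Let piS (y : Q) : exists x, y = pi x. Proof. exact: qpi_surj. Qed.

Lemma idq_eq x y : pi x = pi y <-> e * x = e * y.
Proof.
rewrite /pi qpi_eq; split=> [[w E]|E].
  by apply/eqP; rewrite -subr_eq0 -mulrBr E mulrA mulrBr ee mulr1 subrr mul0r.
exists (x - y); apply/eqP; rewrite -subr_eq0 mulrBl mul1r opprB addrCA subrr addr0.
by rewrite mulrBr E subrr.
Qed.

(** [A/(1 - e)] is the factor [e A], so its topology and its completeness can be read in [A] after
    multiplication by [e]. *)
Lemma idq_pow m x : idl_pow qJ m (pi x) <-> idl_pow J m (e * x).
Proof.
split=> [/(image_pow piS)[x' [Jx' /idq_eq ->]]|Jx]; first exact: (idealMl (HP m)).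
have -> : pi x = pi (e * x) by apply/idq_eq; rewrite mulrA ee.
rewrite -[m]mul1n in Jx; apply: (idl_pow_morph (J := J) (a := 1)) Jx => y.
by move=> /(idl_pow1 _ (ca_idealP A)) Jy; exists y.
Qed.

Lemma idq_ideal : is_ideal qJ. Proof. exact: image_ideal piS (ca_idealP A). Qed.
Lemma idq_sub c : I c -> qJ ((pi \o ca_map A) c).
Proof. by move=> Ic; exists (ca_map A c); split=> //; apply: ca_sub. Qed.
Lemma idq_complete : adic_complete qJ.
Proof.
have CJ := ca_complete A; split=> [y|u uE].
  have [x ->] := piS y => H; rewrite -(rmorph0 pi); apply/idq_eq; rewrite mulr0.
  by apply: CJ.1 => m; apply/idq_pow.
have [v vE] := choice (fun m => piS (u m)).
have [|x xE] := CJ.2 (fun m => e * v m).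
  by move=> m; rewrite -mulrBr; apply/idq_pow; rewrite rmorphB -!vE.
exists (pi x) => m; rewrite vE -rmorphB; apply/idq_pow.
have -> : e * (x - v m) = e * (x - e * v m) by rewrite !mulrBr mulrA ee.
exact: (idealMl (HP m)).
Qed.

Definition idq : calg I := CAlg idq_ideal idq_sub idq_complete.
Definition idq_rm : {rmorphism A -> idq} := pi.
Lemma idq_cont : exists a, forall x, idl_pow (ca_ideal A) a x -> ca_ideal idq (idq_rm x).
Proof. by exists 1%N => x /(idl_pow1 _ (ca_idealP A)) Jx; exists x. Qed.
Definition idq_pi : chom A idq := @CHom _ _ A idq idq_rm (fun c => erefl) idq_cont.

Lemma idq_surj (y : idq) : exists x, y = idq_pi x. Proof. exact: piS. Qed.
Lemma idq_e : idq_pi e = 1.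
Proof. by rewrite -(rmorph1 idq_pi); apply/idq_eq; rewrite ee mulr1. Qed.

Lemma idq_factor (C : calg I) (u : chom A C) : u e = 1 ->
  exists u' : chom idq C, forall x, u' (idq_pi x) = u x.
Proof.
move=> ue; have [|v vE] := @quot_hom _ _ HI _ u.
  by move=> x [w ->]; rewrite rmorphM rmorphB rmorph1 ue subrr mul0r.
have vl c : v (ca_map idq c) = ca_map C c by rewrite [LHS]vE ch_lin.
have vc : exists a, forall x, idl_pow (ca_ideal idq) a x -> ca_ideal C (v x).
  have [a ua] := ch_cont u; exists a => y /(image_pow piS)[x [Jx ->]].
  by rewrite vE; apply: ua.
by exists (CHom vl vc).
Qed.

Lemma idq_ext K y : is_ideal K -> idl (idq_pi @` K)%classic y -> exists x, K x /\ y = idq_pi x.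
Proof.
have H : (idq_pi @` K `<=` (fun y => exists x, K x /\ y = idq_pi x))%classic.
  by move=> _ [x Kx <-]; exists x.
by move=> HK; apply: (idl_sub _ H); apply: (image_ideal piS HK).
Qed.
End IdempotentQuotient.

Lemma idem_cover (L : comPzRingType) (I : set L) (A : calg I) N (e : 'I_N -> A)
    (ee : forall i, e i * e i = e i) : \prod_i (1 - e i) = 0 ->
  fppf_cover (fun i => idq_pi (ee i)).
Proof.
move=> e0; have HJ m := idl_pow_ideal (ca_ideal A) m; split.
- move=> i; exists 1%N => y /(idl_pow1 _ (idq_ideal (e i)))[x [Jx ->]].
  by apply: sub_idl; exists x => //; apply/(idl_pow1 _ (ca_idealP A)).
- move=> i m M a b /(idq_ext (HJ m))[x [Jx E]].
  have [b' bE] := choice (fun k => idq_surj (b k)).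
  (* Flatness: lifting the [b k] and multiplying by [e] turns the relation in the quotient into one
     in [A], with the single element [1] as generator. *)
  exists 1%N, (fun k _ => e i * b' k), (fun=> 1); split=> [k|_].
    rewrite big_ord1 mulr1 bE (_ : _ - _ = 0); last first.
      by rewrite rmorphM idq_e mul1r subrr.
    exact: (ideal0 (idl_is_ideal _)).
  suff -> : \sum_k a k * (e i * b' k) = e i * x by apply: (idealMl (HJ m)).
  have -> : \sum_k a k * (e i * b' k) = e i * \sum_k a k * b' k.
    by rewrite mulr_sumr; apply: eq_bigr => k _; rewrite mulrCA.
  apply/(idq_eq (ee i)); rewrite -[RHS]E rmorph_sum; apply: eq_bigr => k _.
  by rewrite rmorphM bE.
(* A presentation without generators, with the constant relation [1 - e = 0]. *)
- move=> i m; exists 0%N, (fun=> 0), [:: [:: (1 - e i, [ffun=> 0%N])]]; split=> [q|C rho c rhoJ].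
    rewrite inE => /eqP ->; rewrite /eval_pol big_seq1 /= big_ord0 mulr1.
    rewrite (_ : idq_pi (ee i) (1 - e i) = 0); first exact: (ideal0 (idl_is_ideal _)).
    by rewrite rmorphB rmorph1 idq_e subrr.
  move=> /(_ _ (mem_head _ _)); rewrite /eval_pol big_seq1 /= big_ord0 mulr1 => re.
  have [|chi chiE] := @quot_hom _ _ (principal_ideal (1 - e i)) _ rho.
    by move=> x [w ->]; rewrite rmorphM re mul0r.
  exists chi; first split=> [y /(idq_ext (HJ m))[x [Jx ->]]|x|[]//].
  - by rewrite [LHS]chiE; apply: rhoJ.
  - exact: chiE.
  move=> chi' [_ c2 _] y; have [x ->] := idq_surj y; by rewrite [RHS]chiE; apply: c2.
(* If every extension of [P] were trivial, each [e i] would lie in [P], and the product of the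
   [1 - e i], which is zero, would be one modulo [P]. *)
- move=> P m HP _ P1; apply: contrapT => /forallNP H; apply: P1.
  have eP i : P (e i).
    have /contrapT/(idq_ext HP)[x [Px E]] := H i.
    have : e i * 1 = e i * x by apply/(idq_eq (ee i)); rewrite rmorph1.
    by rewrite mulr1 => ->; apply: idealMl.
  rewrite -[1]subr0 -{1}e0.
  elim/big_rec: _ => [|i z _ Pz]; first by rewrite subrr; apply: ideal0.
  have -> : 1 - (1 - e i) * z = (1 - z) + e i * z by ring.
  by apply: idealD => //; apply: idealMr.
Qed.

Lemma sub_mod_neq0 N (a b : 'I_N) : a != b -> ((a + (N - b)) %% N)%N != 0%N.
Proof.
move=> ab; apply: contraNneq ab => /eqP/dvdnP[k kE]; apply/eqP/val_inj.
have [aN bN] := (ltn_ord a, ltn_ord b); case: k kE => [|[|k]] kE /=; rewrite ?mulSn in kE; lia.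
Qed.

Lemma ord_neq_exp_gt0 p j (a b : 'I_(p ^ j)) : a != b -> (0 < j)%N.
Proof.
rewrite lt0n; apply: contraNneq => j0; subst j.
by move: a b; rewrite expn0 => a b; rewrite (ord1 a) (ord1 b).
Qed.

Section LocalSplitting.
Context (S : lts).
Notation p := (st_p S).
Notation L := (st_L S).
Notation I := (Lt_ideal (st_p S) (st_t S) (st_iota S)).
Notation h := (st_n S - st_t S)%N.

Section Reduction.
Context (A : calg I) (C : comPzRingType) (f : {rmorphism A -> C}).
Hypothesis fJ : forall x, ca_ideal A x -> f x = 0.
Definition rdr : {rmorphism L -> discr C} := f \o ca_map A.
Lemma red_cont : exists a, forall x, idl_pow (cJ (c := cc A)) a x -> cJ (c := discr C) (f x).
Proof. by exists 1%N => x /(idl_pow1 _ (ca_idealP A)); apply: fJ. Qed.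
Definition red (P : PE A) : gpt (rE rdr) :=
  @gmap (GE S) (cc A) (discr C) f red_cont (rE (caL A)) (rE rdr) (fun c => erefl) P.
Lemma redI c : I c -> rdr c = 0. Proof. by move=> Ic; apply/fJ/ca_sub. Qed.
Lemma redB : {morph red : P Q / P - Q}. Proof. exact: gmapB. Qed.
Lemma redMn P n : red (P *+ n) = red P *+ n. Proof. exact: gmapMn. Qed.
Lemma red_sum J (s : seq J) (P : pred J) (g : J -> PE A) :
  red (\sum_(i <- s | P i) g i) = \sum_(i <- s | P i) red (g i).
Proof. exact: gmap_sum. Qed.
Lemma red_tor (P : PE A) j : idl_pow (ca_ideal A) 1 (P (nseries (st_F S) (p ^ j))) ->
  red P *+ (p ^ j) = 0.
Proof. by move=> /(idl_pow1 _ (ca_idealP A))/fJ Pj; apply/gpt_tor0. Qed.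
Lemma red_del j (P : PE A) : del j (red P) = f (pev (ca_map A) (P 'x_tt) (dpoly S j)).
Proof. by rewrite (@pev_map _ _ _ _ f rdr). Qed.
End Reduction.

Lemma spt_tor A (s : sys A) j c : spt s j c *+ (p ^ j) = \sum_i (@gincl S (cc A) (caL A) (sq s i)) *+ c i.
Proof.
rewrite /spt -sumrMnl; apply: eq_bigr => i _.
by rewrite -mulrnA mulnC mulrnA -{1}[j]add0n saX sys0.
Qed.

Lemma local_split (A : calg I) (s : sys A) (P : PE A) : nondeg s ->
  exists N (e : 'I_N -> A), [/\ forall i, e i * e i = e i, \prod_i (1 - e i) = 0
    & forall i (C : calg I) (u : chom A C), u (e i) = 1 ->
      exists Q j c, resE u P = gincl Q + spt (sysmap u s) j c].
Proof.
move=> sn; pose J := ca_ideal A; have HJ : is_ideal J := ca_idealP A; have CJ := ca_complete A.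
have [j Pj] := gp_tors P 1; have [l ql] := tors_common (fun i : 'I_h => sq s i) 1.
(* Modulo [J], [p^j] kills [P] and sends [spl c] to a combination of the [q_i], which [p^l]
   kills. *)
pose k := (j + l)%N; pose Lam := {ffun 'I_h -> 'I_(p ^ j)}.
pose spl (c : Lam) := spt s j (fun i => c i).
pose D (c : Lam) := P - spl c.
have redD (C : comPzRingType) (f : {rmorphism A -> C}) (fJ : forall x, ca_ideal A x -> f x = 0) c :
    red fJ (D c) *+ (p ^ k) = 0.
  rewrite redB /k expnD mulrnA mulrnBl (red_tor fJ Pj) sub0r -redMn spt_tor red_sum mulNrn.
  rewrite -sumrMnl big1 ?oppr0 // => i _.
  rewrite redMn -mulrnA mulnC mulrnA (red_tor fJ) ?mul0rn //.
  by rewrite -[gincl _ _]/(sq s i (map_mps _ _)) map_nseries; apply: ql.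
pose ev c := pev (ca_map A) (D c 'x_tt) (dpoly S k).
have ev_idem c : J (ev c * ev c - ev c).
  pose f : {rmorphism A -> quot HJ} := qpi HJ.
  have fJ x : ca_ideal A x -> f x = 0 by move=> Jx; apply/qpi0.
  apply/(qpi_eq HJ); rewrite rmorphM -!(red_del fJ); apply: del_idem; exact: redD.
have [e eP] := choice (fun c => idem_lift HJ CJ (ev_idem c)).
pose N := #|{: Lam}|; pose en (i : 'I_N) : A := e (enum_val i).
pose E := \prod_i (1 - en i).
have EE : E * E = E.
  rewrite /E -big_split; apply: eq_bigr => i _ /=.
  have ee : en i * en i = en i := (eP _).1.
  by rewrite mulrBl mul1r mulrBr mulr1 ee subrr subr0.
have EX m : E ^+ m.+1 = E by elim: m => [|m IHm]; rewrite ?expr1 // exprS IHm.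
have eE c : e c * E = 0.
  rewrite /E (bigD1 (enum_rank c)) //= mulrA /en enum_rankK mulrBr mulr1 (eP c).1 subrr.
  by rewrite mul0r.
pose qs := [seq sq s i 'x_tt | i <- enum 'I_h]; pose K0 := add_gens J qs.
have HK0 : is_ideal K0 by apply: add_gens_ideal.
(* [E] is the idempotent of the uncovered part. If it were nonzero modulo [J] and the coordinates of
   the [q_i], the quotient [C] by the annihilator of its class would be nonzero, while all [e c]
   vanish there. *)
have KE : K0 E.
  apply: contrapT => nKE; have HK := mulr_ideal E HK0; pose C : comPzRingType := quot HK.
  pose f : {rmorphism A -> C} := qpi HK.
  have fJ x : ca_ideal A x -> f x = 0.
    by move=> Jx; apply/qpi0; apply: (idealMl HK0); apply: add_gens_sub.
  have C1 : (1 : C) != 0.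
    by apply/eqP => C10; apply: nKE; rewrite -[E]mulr1; apply/(qpi0 HK); rewrite rmorph1.
  have q0 i : red fJ (@gincl S (cc A) (caL A) (sq s i)) = 0.
    apply: gpt_xP0; rewrite -[LHS]/(f (@gincl S (cc A) (caL A) (sq s i) 'x_tt)) incl_x; apply/qpi0.
    by apply: (idealMl HK0); apply: add_gens_mem => //; apply: map_f; rewrite mem_enum.
  have aj i : red fJ (sa s j i) *+ (p ^ j) = 0 by rewrite -redMn -{1}[j]add0n saX sys0 q0.
  have DU c : exists v, red fJ (D c) 'x_tt * v = 1.
    have [v vE] := del_compl k (red fJ (D c)); exists v; rewrite -vE red_del.
    have -> : f (ev c) = f (e c).
      by apply/esym/eqP; rewrite -subr_eq0 -rmorphB; apply/eqP/fJ; apply: (eP c).2.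
    have -> : f (e c) = 0; last by rewrite subr0.
    by apply/qpi0; rewrite mulrC eE; apply: ideal0.
  have negU (R : gpt (rE (rdr f))) : (exists v, R 'x_tt * v = 1) -> exists v, (- R) 'x_tt * v = 1.
    move=> [v vE]; have [u [w [Eu uw]]] := gpt_subx 0 R.
    rewrite gpt0x !sub0r in Eu; exists (u * - v).
    by rewrite mulrA -Eu mulrNN.
  (* In [C] the [q_i] are zero, so the [p^(jh)] points [spl c] and [P] are all [p^j]-torsion: one
     more than the degree allows. *)
  pose T (o : option Lam) := if o is Some c then red fJ (spl c) else red fJ P.
  have Tj o : T o *+ (p ^ j) = 0.
    case: o => [c|] /=; last exact: red_tor.
    by rewrite -redMn spt_tor red_sum big1 // => i _; rewrite redMn q0 mul0rn.
  have TU o o' : o != o' -> exists v, (T o - T o') 'x_tt * v = 1.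
    case: o o' => [c|] [c'|] //= cc'.
    - have [i ci] : exists i, c i != c' i.
        apply: contrapT => /forallNP H; move: cc'; rewrite (_ : c = c') ?eqxx //.
        by apply/ffunP => i; apply: contrapT => /eqP; apply: H.
      have pj : (0 < p ^ j)%N by rewrite expn_gt0 prime_gt0 ?st_prime.
      have d_lt i' : ((c i' + (p ^ j - c' i')) %% p ^ j < p ^ j)%N by rewrite ltn_pmod.
      have j0 := ord_neq_exp_gt0 ci.
      have [|v vE] := sn j (fun i' => Ordinal (d_lt i')) j0.
        by exists i; apply: sub_mod_neq0.
      exists (f v); rewrite -(rmorph1 f) -vE rmorphM; congr (_ * _).
      pose c2 (i' : 'I_h) : nat := Ordinal (d_lt i').
      suff R : red fJ (spl c) - red fJ (spl c') = red fJ (spt s j c2) by rewrite R.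
      rewrite !red_sum -sumrB; apply: eq_bigr => i' _; rewrite !redMn /=.
      apply/eqP; rewrite subr_eq -mulrnDr; apply/eqP; apply: mulrn_tor (aj i') _.
      rewrite modnDml -addnA subnK ?modnDr //; exact: ltnW.
    - by rewrite -opprB -redB; apply/negU/DU.
    - by rewrite -redB; apply: DU.
  have := @point_count S C C1 (rdr f) (redI fJ) j _ T Tj TU.
  have -> : (p ^ (st_n S * j) = (p ^ j) ^ h * p ^ (st_t S * j))%N.
    by rewrite -expnM -expnD [(j * h)%N]mulnC -mulnDl subnK // ltnW ?st_tn.
  rewrite card_option card_ffun !card_ord mulSn -[X in (_ <= X)%N]add0n leq_add2r leqNgt.
  by rewrite expn_gt0 prime_gt0 // st_prime.
(* The coordinates of the [q_i] are nilpotent modulo [J], so a power of [E], which is [E] itself,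
   lies in [J]; being idempotent, it lies in every [J^m]. *)
have qsN x : x \in qs -> exists N, J (x ^+ N).
  by move=> /mapP[i _ ->]; apply: gpt_nil (@caI S A) _.
have [b Kb] := add_gens_pow HJ qsN.
have JE : J E by rewrite -(EX b); apply: Kb; apply: idl_powW (idl_powX _ KE).
have E0 : E = 0.
  apply: CJ.1 => -[|m]; first exact: idl_pow0.
  by rewrite -(EX m); apply: idl_powX.
exists N, en; split=> // [i|i C u ue]; first exact: (eP _).1.
set c := enum_val i; have ee : en i * en i = en i := (eP c).1.
(* On this piece delta of [D c] is one only modulo [J]. That makes the coordinate nilpotent modulo
   [J], and [nil_incl] then lifts membership in [GG_0]. *)
have [u' u'E] := idq_factor ee ue; pose v := idq_pi ee.
have HJq := ca_idealP (idq ee).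
pose B : comPzRingType := quot HJq; pose f : {rmorphism idq ee -> B} := qpi HJq.
have fJ x : ca_ideal (idq ee) x -> f x = 0 by move=> Jx; apply/qpi0.
have f1 : del k (red fJ (resE v (D c))) = 1.
  rewrite red_del.
  have -> : pev (ca_map (idq ee)) (resE v (D c) 'x_tt) (dpoly S k) = v (ev c).
    by rewrite (@pev_map _ _ _ _ v (ca_map (idq ee))).
  rewrite -(rmorph1 f) -(idq_e ee); apply/(qpi_eq HJq); rewrite -rmorphB.
  by exists (ev c - en i); split=> //; apply: (idealBC HJ); apply: (eP c).2.
have fk : red fJ (resE v (D c)) *+ (p ^ k) = 0.
  have fvJ x : ca_ideal A x -> (f \o v) x = 0.
    by move=> Jx; apply: (fJ (v x)); exists x.
  have := redD B (f \o v) fvJ c.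
  move=> /gpt_tor0 H; exact/gpt_tor0.
have [Q [QE _]] := del1_incl fk f1.
have rI x : I x -> cJ (c := discr B) (rdr f x) by apply: (redI fJ).
have [M /= QM] := gpt_nil rI Q.
have DM : cJ (c := cc (idq ee)) (resE v (D c) 'x_tt ^+ M).
  apply/(qpi0 HJq); rewrite rmorphXn; move: QM.
  by rewrite -incl_x QE.
have [Q' Q'E] := nil_incl DM.
exists (resL u' Q'), j, (fun i => nat_of_ord (c i)); rewrite -spt_res -res_incl Q'E.
have -> : resE u' (resE v (D c)) = resE u (D c) by apply: gpt_eq => x; apply: u'E.
by rewrite /D resEB subrK.
Qed.
End LocalSplitting.

(** * Nondegenerate systems give pushouts *)

Section Pushouts.
Context (S : lts) (Z : zpring (st_p S)).
Notation p := (st_p S).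
Notation L := (st_L S).
Notation iota := (st_iota S).
Notation F := (st_F S).
Notation I := (Lt_ideal (st_p S) (st_t S) (st_iota S)).
Notation h := (st_n S - st_t S)%N.
Notation FE A := (pt p iota F A).
Notation FL A := (pt p (@idfun L) (map_mps iota F) A).

Section Points.
Context (A : calg I).
Definition toE (P : FE A) : PE A :=
  @toG L I (GE S) iota A (rE (caL A)) (fun c => erefl) P.
Definition ofE (P : PE A) : FE A :=
  @ofG L I (GE S) iota A (rE (caL A)) (fun c => erefl) P.
Definition toL (P : FL A) : PL A :=
  @toG L I (GL S) (@idfun L) A (rL (caL A)) (fun c => erefl) P.
Definition ofL (P : PL A) : FL A :=
  @ofG L I (GL S) (@idfun L) A (rL (caL A)) (fun c => erefl) P.
Lemma ofEK P : toE (ofE P) = P. Proof. exact: ofGK. Qed.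
Lemma ofLK P : toL (ofL P) = P. Proof. exact: ofGK. Qed.
Lemma toEK P : ofE (toE P) = P.
Proof. exact: (@toGK L I (GE S) iota A (rE (caL A)) (fun c => erefl) P). Qed.
Lemma toLK P : ofL (toL P) = P.
Proof. exact: (@toGK L I (GL S) (@idfun L) A (rL (caL A)) (fun c => erefl) P). Qed.
Lemma toE_inj : injective toE. Proof. exact: can_inj toEK. Qed.
Lemma toL_inj : injective toL. Proof. exact: can_inj toLK. Qed.
Lemma toE_add P Q : toE (pt_add P Q) = toE P + toE Q.
Proof. exact: (@toG_add L I (GE S) iota A (rE (caL A)) (fun c => erefl) P Q). Qed.
Lemma toL_add P Q : toL (pt_add P Q) = toL P + toL Q.
Proof. exact: (@toG_add L I (GL S) (@idfun L) A (rL (caL A)) (fun c => erefl) P Q). Qed.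
Lemma toE_scale (z : Z) P : toE (pt_scale z P) = @zscale (GE S) Z _ _ z (toE P).
Proof. exact: (@toG_scale L I (GE S) iota Z A (rE (caL A)) (fun c => erefl) z P). Qed.
Lemma toL_scale (z : Z) P : toL (pt_scale z P) = @zscale (GL S) Z _ _ z (toL P).
Proof. exact: (@toG_scale L I (GL S) (@idfun L) Z A (rL (caL A)) (fun c => erefl) z P). Qed.
Lemma toE_incl P : toE (G0_incl P) = gincl (toL P). Proof. exact: gpt_eq. Qed.
Lemma ofE_add P Q : ofE (P + Q) = pt_add (ofE P) (ofE Q).
Proof. by apply: toE_inj; rewrite toE_add !ofEK. Qed.
Lemma ofL_add P Q : ofL (P + Q) = pt_add (ofL P) (ofL Q).
Proof. by apply: toL_inj; rewrite toL_add !ofLK. Qed.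
End Points.

Lemma toE_res (A B : calg I) (u : chom A B) P : toE (pt_res u P) = resE u (toE P).
Proof. exact: gpt_eq. Qed.
Lemma toL_res (A B : calg I) (u : chom A B) P : toL (pt_res u P) = resL u (toL P).
Proof. exact: gpt_eq. Qed.
Lemma ofL_res (A B : calg I) (u : chom A B) Q : ofL (resL u Q) = pt_res u (ofL Q).
Proof. by apply: toL_inj; rewrite toL_res !ofLK. Qed.

Lemma sysmap_comp (A B C : calg I) (u : chom A B) (v : chom B C) (w : chom A C) s :
  (forall x, w x = v (u x)) -> sysmap v (sysmap u s) = sysmap w s.
Proof. by move=> wE; apply: sys_eq => k i; apply: gpt_eq => x; rewrite !resEE wE. Qed.

Context (Qp : comPzRingType) (iQ : {rmorphism Z -> Qp}).
Hypothesis hQp : is_localization [set (p%:R : Z)]%classic iQ.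
Context (R0 : calg I) (s : sys R0).
Notation sA A := (sysmap (ov_map A) s).
Notation G0 := (G0_psh p Z iota F R0).
Notation GG := (G_psh p Z iota F R0).
Notation ZH := (ZpH_psh Z h R0).
Notation QH := (QpH_psh iQ h R0).

Lemma sA_res (A B : Defs.over R0) (u : ohom A B) : sysmap u (sA A) = sA B.
Proof. by apply: sysmap_comp => x; rewrite oh_comm. Qed.

Definition fval (A : Defs.over R0) (v : sec ZH A) : sec G0 A := ofL (sf (sA A) (v : 'rV[Z]_h)).
Definition gval (A : Defs.over R0) (w : sec QH A) : sec GG A := ofE (sg hQp (sA A) (w : 'rV[Qp]_h)).

Lemma fval_add A (x y : sec ZH A) : fval (padd x y) = padd (fval x) (fval y).
Proof. by rewrite /fval [padd x y]/(_ + _) sfD ofL_add. Qed.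
Lemma fval_scale A z (x : sec ZH A) : fval (Defs.pscale z x) = Defs.pscale z (fval x).
Proof. by apply: toL_inj; rewrite toL_scale !ofLK -sfZ. Qed.
Lemma fval_res A B (u : ohom A B) (x : sec ZH A) : fval (pres u x) = pres u (fval x).
Proof. by apply: toL_inj; rewrite toL_res !ofLK sf_res sA_res. Qed.
Definition fpm : pmor ZH G0 := PMor fval_add fval_scale fval_res.

Lemma gval_add A (x y : sec QH A) : gval (padd x y) = padd (gval x) (gval y).
Proof. by rewrite /gval [padd x y]/(_ + _) sgD ofE_add. Qed.
Lemma gval_scale A z (x : sec QH A) : gval (Defs.pscale z x) = Defs.pscale z (gval x).
Proof. by apply: toE_inj; rewrite toE_scale !ofEK -sgZ. Qed.
Lemma gval_res A B (u : ohom A B) (x : sec QH A) : gval (pres u x) = pres u (gval x).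
Proof. by apply: toE_inj; rewrite toE_res !ofEK sg_res sA_res. Qed.
Definition gpm : pmor QH GG := PMor gval_add gval_scale gval_res.

Lemma fg_comm (A : Defs.over R0) x : @G0_incl p _ L I iota F A (fpm A x) = gpm A (map_mx iQ x).
Proof. by apply: toE_inj; rewrite toE_incl ofLK ofEK sg_sf. Qed.

Lemma oid_cont (A : calg I) : exists a, forall x, idl_pow (ca_ideal A) a x -> ca_ideal A (@idfun A x).
Proof. by exists 1%N => x /(idl_pow1 _ (ca_idealP A)). Qed.
Definition cid_hom (A : calg I) : chom A A := @CHom _ _ A A (@idfun A) (fun c => erefl) (oid_cont A).
Definition oid (A : Defs.over R0) : ohom A A := @OHom _ _ _ A A (cid_hom A) (fun x => erefl).

Lemma ocomp_comm (A B C : Defs.over R0) (v : ohom B C) (u : ohom A B) x :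
  ch_comp v u (ov_map A x) = ov_map C x.
Proof. by rewrite /= !oh_comm. Qed.
Definition ocomp A B C (v : ohom B C) (u : ohom A B) : ohom A C := OHom (ocomp_comm v u).

Section Gluing.
Hypothesis sn : nondeg s.
Context (T : zp_sheaf Z R0) (a : pmor G0 (sheaf_psh T)) (b : pmor QH (sheaf_psh T)).
Hypothesis ab : forall A x, a A (fpm A x) = b A (map_mx iQ x).
Notation TT A := (sh_mod T A).
Definition aa (A : Defs.over R0) (Q : PL A) : TT A := a A (ofL Q).
Definition bb (A : Defs.over R0) (w : 'rV[Qp]_h) : TT A := b A w.
Arguments bb : clear implicits.

Lemma aaD (A : Defs.over R0) (Q Q' : PL A) : aa (Q + Q') = aa Q + aa Q'.
Proof. by rewrite /aa ofL_add; apply: (pm_add a). Qed.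
Lemma bbD (A : Defs.over R0) w w' : bb A (w + w') = bb A w + bb A w'. Proof. exact: (pm_add b). Qed.
Lemma aa0 (A : Defs.over R0) : aa (0 : PL A) = 0.
Proof. by apply: (addrI (aa (0 : PL A))); rewrite -aaD !addr0. Qed.
Lemma bb0 (A : Defs.over R0) : bb A 0 = 0. Proof. by apply: (addrI (bb A 0)); rewrite -bbD !addr0. Qed.
Lemma aa_res (A B : Defs.over R0) (u : ohom A B) (Q : PL A) : sh_res T u (aa Q) = aa (resL u Q).
Proof. by rewrite /aa ofL_res; apply/esym/(pm_res a u). Qed.
Lemma bb_res (A B : Defs.over R0) (u : ohom A B) w : sh_res T u (bb A w) = bb B w.
Proof. by apply/esym/(pm_res b u). Qed.
Lemma aaZ (A : Defs.over R0) z (Q : PL A) : aa (@zscale (GL S) Z _ _ z Q) = z *: aa Q.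
Proof.
rewrite /aa -[RHS](pm_scale a z (ofL Q)); congr (a A _).
by apply: toL_inj; rewrite toL_scale !ofLK.
Qed.
Lemma bbZ (A : Defs.over R0) z w : bb A (iQ z *: w) = z *: bb A w. Proof. exact: (pm_scale b). Qed.
Lemma ab_sf (A : Defs.over R0) v : aa (sf (sA A) v) = bb A (map_mx iQ v). Proof. exact: ab. Qed.

Definition dec (A : Defs.over R0) (P : PE A) Q w := P = gincl Q + sg hQp (sA A) w.

Lemma dec_res (A B : Defs.over R0) (u : ohom A B) P Q w : dec P Q w -> @dec B (resE u P) (resL u Q) w.
Proof. by rewrite /dec => ->; rewrite resED res_incl sg_res sA_res. Qed.

(** The zero ring is covered by the empty family. *)
Lemma zero_sheaf (A : Defs.over R0) : (1 : A) = 0 -> forall t t' : TT A, t = t'.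
Proof.
move=> A0 t t'; pose B (i : 'I_0) : Defs.over R0 := A; pose v (i : 'I_0) : ohom A (B i) := oid A.
have cv : fppf_cover v.
  split=> [[]//|[]//|[]//|P m HP _ P1]; case: P1; rewrite A0; exact: ideal0.
have [|y [_ yU]] := @sh_glue _ _ _ _ T A 0 B v cv (fun i => 0) => [[]//|].
by rewrite -(yU t) ?(yU t') // => -[].
Qed.

(** Unless the ring is zero, two decompositions differ by an element of the lattice, on which [aa]
    and [bb] agree. *)
Lemma dec_uniq (A : Defs.over R0) (P : PE A) Q w Q' w' : dec P Q w -> dec P Q' w' ->
  aa Q + bb A w = aa Q' + bb A w'.
Proof.
move=> E E'; have [A0|[v [-> ->]]] := @decomposition_uniq S Z Qp iQ hQp A (sA A)
  (nondeg_res (ov_map A) sn) Q Q' w w' (etrans (esym E) E').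
- exact: zero_sheaf.
- by rewrite aaD bbD ab_sf [bb A w' + _]addrC addrA.
Qed.

(** The value at [P] that the induced map must take, tested only where [P] decomposes. By
    [splitting] such algebras cover, so at most one [t] qualifies. *)
Definition isd (A : Defs.over R0) (P : PE A) (t : TT A) := forall (C : Defs.over R0) (u : ohom A C) Q w,
  dec (resE u P) Q w -> sh_res T u t = aa Q + bb C w.

Lemma res_comp (A B C : Defs.over R0) (u : ohom A B) (v : ohom B C) (w : ohom A C) t :
  (forall x, w x = v (u x)) -> sh_res T w t = sh_res T v (sh_res T u t).
Proof. by move=> wE; apply: (@sh_comp _ _ _ _ T A B C u v w). Qed.

Lemma resE_comp (A B C : calg I) (u : chom A B) (v : chom B C) (w : chom A C) (P : PE A) :
  (forall x, w x = v (u x)) -> resE w P = resE v (resE u P).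
Proof. by move=> wE; apply: gpt_eq => x; rewrite !resEE wE. Qed.

Lemma isd_dec (A : Defs.over R0) (P : PE A) Q w : dec P Q w -> isd P (aa Q + bb A w).
Proof.
move=> E C u Q' w' E'; rewrite linearD /= aa_res bb_res.
exact: dec_uniq (dec_res u E) E'.
Qed.

Lemma isd_res (A B : Defs.over R0) (u : ohom A B) (P : PE A) t : isd P t -> isd (resE u P) (sh_res T u t).
Proof.
move=> H C v Q w E; rewrite -(@res_comp _ _ _ u v (ocomp v u)) //; apply: H.
by rewrite (@resE_comp _ _ _ u v).
Qed.

Section Cover.
Context (A : Defs.over R0) N (e : 'I_N -> A) (ee : forall i, e i * e i = e i).
Hypothesis e0 : \prod_i (1 - e i) = 0.
Definition cB i : Defs.over R0 := Over (ch_comp (idq_pi (ee i)) (ov_map A)).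
Definition cv i : ohom A (cB i) := @OHom _ _ _ A (cB i) (idq_pi (ee i)) (fun x => erefl).

Lemma cover_sep (t t' : TT A) : (forall i, sh_res T (cv i) t = sh_res T (cv i) t') -> t = t'.
Proof.
move=> tt'; have [|y [_ yU]] := @sh_glue _ _ _ _ T A N cB cv (idem_cover ee e0)
    (fun i => sh_res T (cv i) t).
  move=> i k C g g' gg'; rewrite -(@res_comp _ _ _ (cv i) g (ocomp g (cv i))) //.
  by rewrite -(@res_comp _ _ _ (cv k) g' (ocomp g (cv i))).
by rewrite -(yU t) // (yU t').
Qed.
End Cover.

Lemma splitting (A : Defs.over R0) (P : PE A) : exists N (e : 'I_N -> A) (ee : forall i, e i * e i = e i),
  \prod_i (1 - e i) = 0 /\ forall i, exists Q w, @dec (cB ee i) (resE (cv ee i) P) Q w.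
Proof.
have [N [e [ee e0 H]]] := local_split P (nondeg_res (ov_map A) sn).
exists N, e, ee; split=> // i; have [|Q [j [c E]]] := H i (cB ee i) (cv ee i).
  exact: idq_e.
have [v vE] := Qp_inv hQp.
have wE : p%:R ^+ j *: (v ^+ j *: map_mx iQ (\row_k (c k)%:R)) = map_mx iQ (\row_k (c k)%:R).
  by rewrite scalerA -exprMn vE expr1n scale1r.
exists Q, (v ^+ j *: map_mx iQ (\row_k (c k)%:R)).
by rewrite /dec (sg_spt hQp _ wE) E; congr (_ + spt _ _ _); apply: sA_res.
Qed.

Lemma isd_sep (A : Defs.over R0) (P : PE A) (t t' : TT A) : (forall (C : Defs.over R0) (u : ohom A C) Q w, dec (resE u P) Q w ->
  sh_res T u t = sh_res T u t') -> t = t'.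
Proof.
move=> H; have [N [e [ee [e0 D]]]] := splitting P; apply: (cover_sep (ee := ee) e0) => i.
by have [Q [w E]] := D i; apply: H E.
Qed.

Lemma isd_uniq (A : Defs.over R0) (P : PE A) t t' : isd P t -> isd P t' -> t = t'.
Proof. by move=> H H'; apply: (@isd_sep _ P) => C u Q w E; rewrite (H _ _ _ _ E) (H' _ _ _ _ E). Qed.

(** Lets several points be assumed decomposed at once: a test algebra is localized further until [R]
    decomposes too. *)
Lemma isd_weak (A : Defs.over R0) (R P : PE A) t : (forall (C : Defs.over R0) (u : ohom A C) Q w, dec (resE u R) Q w ->
  isd (resE u P) (sh_res T u t)) -> isd P t.
Proof.
move=> H C u Q w E; apply: (@isd_sep _ (resE u R)) => C' v Q' w' E'.
have := H C' (ocomp v u) Q' w'; rewrite !(@resE_comp _ _ _ u v (ocomp v u)) // => /(_ E').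
move=> /(_ C' (oid C') (resL v Q) w); rewrite (@res_comp _ _ _ u v (ocomp v u)) // sh_id //.
rewrite linearD /= aa_res bb_res; apply.
by have := dec_res v E; rewrite /dec => <-; apply: gpt_eq.
Qed.

(** Over the idempotent cover that splits [P] the values are forced and agree on overlaps by
    [dec_uniq], so they glue. *)
Lemma isd_ex (A : Defs.over R0) (P : PE A) : exists t, isd P t.
Proof.
have [N [e [ee [e0 D]]]] := splitting P.
pose Q i := projT1 (cid (D i)); pose w i := projT1 (cid (projT2 (cid (D i)))).
have wP i : dec (resE (cv ee i) P) (Q i) (w i) := projT2 (cid (projT2 (cid (D i)))).
have [|t [tE _]] := @sh_glue _ _ _ _ T A N (cB ee) (cv ee) (idem_cover ee e0)
    (fun i => aa (Q i) + bb _ (w i)).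
  move=> i k C g g' gg'; rewrite !linearD /= !aa_res !bb_res; apply: dec_uniq (dec_res g (wP i)) _.
  have := dec_res g' (wP k); rewrite /dec => <-; apply: gpt_eq => x; exact: gg'.
(* For an arbitrary test algebra the cover is pulled back along [u], and the values are compared on
   each piece. *)
exists t => C u Q' w' E.
have ue i : u (e i) * u (e i) = u (e i) by rewrite -rmorphM ee.
apply: (cover_sep (e := fun i => u (e i)) (ee := ue)).
  rewrite -(rmorph0 u) -e0 rmorph_prod; apply: eq_bigr => i _.
  by rewrite rmorphB rmorph1.
move=> i; have [|g gE] := @idq_factor _ _ _ _ (ee i) (cB ue i) (ch_comp (cv ue i) u).
  exact: (idq_e (ue i)).
have go x : g (ov_map (cB ee i) x) = ov_map (cB ue i) x by rewrite /= gE /= oh_comm.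
pose g' : ohom (cB ee i) (cB ue i) := @OHom _ _ _ (cB ee i) (cB ue i) g go.
rewrite -(@res_comp _ _ _ u (cv ue i) (ocomp (cv ue i) u)) //.
rewrite (@res_comp _ _ _ (cv ee i) g' (ocomp (cv ue i) u)) // tE.
rewrite !linearD /= !aa_res !bb_res; apply: dec_uniq (dec_res g' (wP i)) _.
have := dec_res (cv ue i) E; rewrite /dec => <-; apply: gpt_eq => x; exact: gE.
Qed.

Definition dval (A : Defs.over R0) (P : sec GG A) : sec (sheaf_psh T) A := projT1 (cid (isd_ex (toE P))).
Lemma dvalP (A : Defs.over R0) (P : sec GG A) : isd (toE P) (dval P).
Proof. by rewrite /dval; case: cid. Qed.

Lemma dval_add (A : Defs.over R0) (x y : sec GG A) : dval (padd x y) = padd (dval x) (dval y).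
Proof.
apply: (@isd_uniq A (toE (padd x y)) _ _ (@dvalP _ (padd x y)) _); rewrite [toE _]toE_add [padd _ _]/(_ + _).
apply: (@isd_weak _ (toE x)) => C u Q w E; rewrite linearD /=.
apply: (@isd_weak _ (resE u (toE y))) => C' v Q' w' E'; rewrite linearD /=.
rewrite (dvalP E) -(@res_comp _ _ _ u v (ocomp v u)) //.
rewrite -(@resE_comp _ _ _ u v (ocomp v u)) // in E'.
rewrite (dvalP E') linearD /= aa_res bb_res addrACA -aaD -bbD; apply: isd_dec.
rewrite /dec inclD sgD addrACA !resED; congr (_ + _); first exact: dec_res E.
by rewrite -E'; apply: gpt_eq.
Qed.

Lemma dval_scale (A : Defs.over R0) z (x : sec GG A) : dval (Defs.pscale z x) = Defs.pscale z (dval x).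
Proof.
apply: (@isd_uniq A (toE (Defs.pscale z x)) _ _ (@dvalP _ (Defs.pscale z x)) _); rewrite [toE _]toE_scale [Defs.pscale _ _]/(_ *: _).
apply: (@isd_weak _ (toE x)) => C u Q w E; rewrite linearZ /= (dvalP E) scalerDr.
by rewrite -aaZ -bbZ; apply: isd_dec; rewrite /dec resE_scale E zscaleDr incl_scale sgZ.
Qed.

Lemma dval_res (A B : Defs.over R0) (u : ohom A B) (x : sec GG A) : dval (pres u x) = pres u (dval x).
Proof.
apply: (@isd_uniq B (toE (pres u x)) _ _ (@dvalP _ (pres u x)) _); rewrite [toE _]toE_res.
exact (@isd_res A B u (toE x) (dval x) (@dvalP A x)).
Qed.
Definition dpm : pmor GG (sheaf_psh T) := PMor dval_add dval_scale dval_res.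

Lemma glued : exists2 d : pmor GG (sheaf_psh T),
  (forall (A : Defs.over R0) x, d A (@G0_incl p _ L I iota F A x) = a A x) /\ (forall A x, d A (gpm A x) = b A x)
  & forall d' : pmor GG (sheaf_psh T),
    (forall (A : Defs.over R0) x, d' A (@G0_incl p _ L I iota F A x) = a A x) /\ (forall A x, d' A (gpm A x) = b A x) ->
    forall A x, d' A x = d A x.
Proof.
exists dpm; first split=> A x.
- apply: (@isd_uniq A _ _ _ (@dvalP _ (G0_incl x)) _); rewrite toE_incl -[a A x]addr0 -(bb0 A).
  rewrite -(toLK x) -/(aa (toL x)) ofLK; apply: isd_dec.
  by rewrite /dec sg0 addr0.
- apply: (@isd_uniq A _ _ _ (@dvalP _ (gpm A x)) _); rewrite [toE _]ofEK -[b A x]add0r -(aa0 A).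
  by apply: isd_dec; rewrite /dec incl0 add0r.
move=> d' [da db] A x; apply: (fun H => @isd_uniq A (toE x) _ _ H (@dvalP A x)) => C u Q w E.
rewrite -[sh_res T u _](pm_res d' u) (_ : pres u x = pt_add (G0_incl (ofL Q)) (gpm C w)).
  by rewrite (pm_add d') da db.
by apply: toE_inj; rewrite toE_add toE_incl ofLK ofEK -E toE_res.
Qed.
End Gluing.

Lemma nondeg_pushout : nondeg s ->
  sheaf_pushout fpm gpm (fun _ v => map_mx iQ v) (fun (A : Defs.over R0) => @G0_incl p _ L I iota F A).
Proof. by move=> sn; split=> [A x|T a b ab]; [apply: fg_comm|apply: glued]. Qed.
End Pushouts.

(** * The universal property of B_t *)

Section Universal.
Context (R R' : comPzRingType) (J : set R) (f : {rmorphism R -> R'}).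
Notation J' := (idl (f @` J)%classic).

(** Powers of the extended ideal are reached one factor at a time, so continuity can be tested on
    images of powers of [J]. *)
Lemma idl_image_pow (C : comPzRingType) (g : {rmorphism R' -> C}) (P : set C) a : is_ideal P ->
  (forall x, idl_pow J a x -> P (g (f x))) -> forall y, idl_pow J' a y -> P (g y).
Proof.
move=> HP H; pose V (K : set R') := is_ideal K.
suff E : forall (K : set R'), V K -> (forall x, idl_pow J a x -> K (f x)) ->
    forall y, idl_pow J' a y -> K y.
  apply: (E (fun y => P (g y))) => //; split=> [|x y|r x].
  - by rewrite rmorph0; apply: ideal0.
  - by rewrite rmorphD; apply: idealD.
  - by rewrite rmorphM; apply: idealMl.
elim: a {H} => [|a IHa] K HK H; first by move=> y _; apply: ideal1 => //; rewrite -(rmorph1 f); apply: H; apply: idl_pow0.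
apply: (idl_powSP HK) => x y J'x J'y; have HKy : is_ideal (fun z => K (z * y)).
  by split=> [|u v|r u]; rewrite ?mul0r ?mulrDl -?mulrA; [apply: ideal0|apply: idealD|apply: idealMl].
have sub : (f @` J `<=` (fun z => K (z * y)))%classic.
  move=> _ [x0 Jx0 <-]; have HKx : is_ideal (fun z => K (f x0 * z)) by apply: mulr_ideal.
  apply: (IHa _ HKx) J'y => z Jz; rewrite -rmorphM; apply: H; exact: idl_powS.
exact: (idl_sub HKy sub J'x).
Qed.

Section Complete.
Context (C : comPzRingType) (JC : set C) (HC : is_ideal JC) (CC : adic_complete JC).
Hypothesis hf : is_completion J f.
Let HP m := idl_pow_ideal JC m.

(** Only the power [J^a] is known to go into [JC], so an approximation of [z] modulo [J'^(a m)]
    fixes the image modulo [JC^m]. The relation demands this of all approximations at once. *)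
Lemma completion_ext (g : {rmorphism R -> C}) a : (forall x, idl_pow J a x -> JC (g x)) ->
  exists g' : {rmorphism R' -> C}, (forall x, g' (f x) = g x) /\
    forall y, idl_pow J' a y -> JC (g' y).
Proof.
have [_ inj app] := hf; move=> ga; have HJ' m := idl_pow_ideal J' m.
have gm m x y : idl_pow J' (a * m) (f x - f y) -> idl_pow JC m (g x - g y).
  by rewrite -!rmorphB => /inj; apply: idl_pow_morph.
have [z|b Hb|z z' b b' Hb Hb'|z z' b b' Hb Hb'||g' g'E] := @graph_hom R' C
  (fun z b => forall m x, idl_pow J' (a * m) (z - f x) -> idl_pow JC m (b - g x)).
- have [x xE] := choice (fun m => app (a * m)%N z).
  have xx m k : (m <= k)%N -> idl_pow JC m (g (x k) - g (x m)).
    move=> mk; apply: gm; apply: (ideal_trans (HJ' _)) (xE m).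
    by apply: (idealBC (HJ' _)); apply: idl_powW (xE k); rewrite leq_mul2l mk orbT.
  have [|b bE] := CC.2 (fun m => g (x m)); first by move=> m; apply: xx.
  exists b => m y zy; apply: (ideal_trans (HP m)) (bE m) _; apply: gm.
  by apply: (ideal_trans (HJ' _)) zy; apply: (idealBC (HJ' _)).
- apply: (complete_eq CC) => m; rewrite -(rmorph0 g); apply: Hb.
  by rewrite rmorph0 subrr; apply: (ideal0 (HJ' _)).
- move=> m x zx; have [[x1 E1] [x2 E2]] := (app (a * m)%N z, app (a * m)%N z').
  have -> : b - b' - g x = (b - g x1) - (b' - g x2) + (g (x1 - x2) - g x).
    by rewrite rmorphB; ring.
  apply: (idealD (HP m)); first by apply: (idealB (HP m)); [apply: Hb|apply: Hb'].
  apply: gm; have -> : f (x1 - x2) - f x = (z' - f x2) - (z - f x1) + (z - z' - f x).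
    by rewrite rmorphB; ring.
  by apply: (idealD (HJ' _)) => //; apply: (idealB (HJ' _)).
- move=> m x zx; have [[x1 E1] [x2 E2]] := (app (a * m)%N z, app (a * m)%N z').
  apply: (ideal_trans (HP m)) (idealBM (HP m) (Hb _ _ E1) (Hb' _ _ E2)) _.
  rewrite -rmorphM; apply: gm; rewrite rmorphM; apply: (ideal_trans (HJ' _)) zx.
  by apply: (idealBM (HJ' _)); apply: (idealBC (HJ' _)).
- by move=> m x; rewrite -(rmorph1 f) => E1; rewrite -(rmorph1 g); apply: gm.
exists g'; split=> [x|y J'y].
  by apply: (complete_eq CC) => m; apply: g'E; rewrite subrr; apply: (ideal0 (HJ' _)).
apply/(idl_pow1 _ HC); rewrite -[g' y]subr0 -(rmorph0 g); apply: g'E.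
by rewrite muln1 rmorph0 subr0.
Qed.

Lemma completion_uniq (g1 g2 : {rmorphism R' -> C}) :
  (exists a, forall y, idl_pow J' a y -> JC (g1 y)) ->
  (exists a, forall y, idl_pow J' a y -> JC (g2 y)) ->
  (forall x, g1 (f x) = g2 (f x)) -> g1 =1 g2.
Proof.
move=> [a1 H1] [a2 H2] E y; have [_ _ app] := hf.
apply: (complete_eq CC) => m; have [x yx] := app ((a1 + a2) * m)%N y.
have -> : g1 y - g2 y = g1 (y - f x) - g2 (y - f x) by rewrite !rmorphB E; ring.
apply: (idealB (HP m)).
  by apply: (idl_pow_morph H1); apply: idl_powW yx; rewrite leq_mul2r leq_addr orbT.
by apply: (idl_pow_morph H2); apply: idl_powW yx; rewrite leq_mul2r leq_addl orbT.
Qed.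
End Complete.

Section Localize.
Context (X : set R) (hf : is_localization X f) (C : comPzRingType).

Lemma loc_ext (g : {rmorphism R -> C}) : (forall x, X x -> exists v, g x * v = 1) ->
  exists g' : {rmorphism R' -> C}, forall x, g' (f x) = g x.
Proof.
move=> gX; have [inv frac ker] := hf.
pose M s := exists2 l : seq R, (forall x, x \in l -> X x) & s = \prod_(x <- l) x.
have M1 : M 1 by exists [::]; rewrite ?big_nil.
have MM s s' : M s -> M s' -> M (s * s').
  move=> [l lX ->] [l' lX' ->]; exists (l ++ l'); last by rewrite big_cat.
  by move=> x; rewrite mem_cat => /orP[/lX|/lX'].
have gM s : M s -> exists v, g s * v = 1.
  move=> [l lX ->]; elim: l lX => [|x l IHl] lX; first by exists 1; rewrite big_nil rmorph1 mulr1.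
  have [|v vE] := IHl; first by move=> y yl; apply: lX; rewrite inE yl orbT.
  have [w wE] := gX x (lX _ (mem_head _ _)).
  by exists (w * v); rewrite big_cons rmorphM mulrACA wE vE mulr1.
have g0 r : f r = 0 -> g r = 0.
  move=> /ker[s /gM[v vE] sr]; rewrite -[g r]mul1r -vE mulrAC -rmorphM sr rmorph0 mul0r //.
have [z|b|z z' b b'|z z' b b'||g' g'E] := @graph_hom R' C
  (fun z b => exists r s, [/\ M s, z * f s = f r & b * g s = g r]).
- have [r [s [Ms zs]]] := frac z; have [v vE] := gM s Ms.
  by exists (g r * v), r, s; split=> //; rewrite -mulrA [v * _]mulrC vE mulr1.
- move=> [r [s [/gM[v vE]]]]; rewrite mul0r => /esym/g0 -> bs.
  by rewrite -[b]mulr1 -vE mulrA bs mul0r.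
- move=> [r [s [Ms zs bs]]] [r' [s' [Ms' zs' bs']]].
  exists (r * s' - r' * s), (s * s'); split; first exact: MM.
    by rewrite !(rmorphB, rmorphM) -zs -zs'; ring.
  by rewrite !(rmorphB, rmorphM) -bs -bs'; ring.
- move=> [r [s [Ms zs bs]]] [r' [s' [Ms' zs' bs']]].
  exists (r * r'), (s * s'); split; first exact: MM.
    by rewrite !rmorphM -zs -zs'; ring.
  by rewrite !rmorphM -bs -bs'; ring.
- by exists 1, 1; rewrite !rmorph1 !mul1r.
exists g' => x; have [r [s [/gM[v vE] + E]]] := g'E (f x).
rewrite -rmorphM => /eqP; rewrite -subr_eq0 -rmorphB => /eqP/g0/eqP.
rewrite rmorphB subr_eq0 => /eqP E'; rewrite -[LHS]mulr1 -vE mulrA E -E' rmorphM.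
by rewrite -mulrA vE mulr1.
Qed.

Lemma loc_uniq (g1 g2 : {rmorphism R' -> C}) : (forall x, g1 (f x) = g2 (f x)) -> g1 =1 g2.
Proof.
have [inv frac _] := hf; move=> E z; have [r [s [Ms zs]]] := frac z.
have [v vE] := inv s Ms.
have H (g : {rmorphism R' -> C}) : g z = g (f r) * g v.
  by rewrite -rmorphM -zs -mulrA vE mulr1.
have gv : g1 v = g2 v.
  have E1 : g1 (f s) * g1 v = 1 by rewrite -rmorphM vE rmorph1.
  have E2 : g2 (f s) * g2 v = 1 by rewrite -rmorphM vE rmorph1.
  by rewrite -[g1 v]mulr1 -E2 mulrA -E [g1 v * _]mulrC E1 mul1r.
by rewrite !H E gv.
Qed.
End Localize.
End Universal.

(** * Values of the generator [y] at points *)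

Section EtaleValues.
Context (S : lts).
Notation p := (st_p S).
Notation F := (st_F S).
Notation L := (st_L S).
Notation E := (LTring (st_n S) (st_W S)).
Notation iota := (st_iota S).
Notation I := (Lt_ideal (st_p S) (st_t S) (st_iota S)).
Notation h := (st_n S - st_t S)%N.
Context (O : nat -> comPzRingType) (oL : forall j, {rmorphism L -> O j})
  (oE : forall j, {rmorphism mps unit E -> O j}).
Hypothesis hO : forall j, is_torsion_ring p F iota j (oL j) (oE j).
Notation etf j := (et_function p F iota j (oL j) (oE j)).

(** After a faithful cover, [P = D + Q] with [D] killed by [p^j] and [Q] in [GG_0]. Invariance
    identifies the value of [b] at [P] with that of its restriction at [D]. *)
Lemma value_cover j i (b : O (j + i)) (rho : {rmorphism O (j + i) -> O j})
    (B : comPzRingType) (s : {rmorphism L -> discr B}) (P : gpt (rE s)) (Q1 : gpt (rL s))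
    (chi : {rmorphism O (j + i) -> B}) :
  etf (j + i) b -> (forall c, rho (oL _ c) = oL j c) -> (forall h, rho (oE _ h) = oE j h) ->
  (forall c, chi (oL _ c) = s c) -> (forall h, chi (oE _ h) = P h) -> P *+ (p ^ j) = gincl Q1 ->
  exists (B' : comPzRingType) (io : {rmorphism B -> B'}) (s' : {rmorphism L -> discr B'})
    (ss : forall c, io (s c) = s' c) (D : gpt (rE s')) (Q : gpt (rL s')) (chiD : {rmorphism O j -> B'}),
  [/\ injective io, dE ss P = D + gincl Q, forall c, chiD (oL j c) = s' c,
      forall h, chiD (oE j h) = D h & io (chi b) = chiD (rho b)].
Proof.
move=> bet rL1 rE1 cL cE PQ1.
have Pk : P *+ (p ^ (j + i)) = 0.
  have -> : P = @vpt S O oL oE hO _ B s chi cL by apply: gpt_eq => k; rewrite -cE.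
  exact: vpt_tor.
have Q1i : Q1 *+ (p ^ i) = 0 by apply: incl_tor0; rewrite -PQ1 -mulrnA -expnD.
have [B' [io [s' [ss [Q [QE io_inj _ _]]]]]] := cover_point j Q1i.
pose P' := dE ss P; pose D := P' - gincl Q.
have Dj : D *+ (p ^ j) = 0 by rewrite mulrnBl -dEMn PQ1 dE_incl -QE -inclMn subrr.
have [chiD [dL1 dE1]] := @ohom_ex S O oL oE hO j B' s' D Dj.
exists B', io, s', ss, D, Q, chiD; split=> //; first by rewrite /D subrK.
apply: (@et_eq S O oL oE (j + i) b B' s' (chiD \o rho) (io \o chi) D P' Q bet).
- by move=> c; rewrite /= rL1 dL1.
- by move=> c; rewrite /= cL; apply: ss.
- by move=> k; rewrite /= rE1 dE1.
- by move=> k; rewrite /= cE.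
- by rewrite expnD mulrnA QE -dLMn Q1i dL0.
- by rewrite /D subrK.
Qed.

Section Modulo.
Context (A : calg I) (C : comPzRingType) (f : {rmorphism A -> C}).
Hypothesis fJ : exists a, forall x, idl_pow (ca_ideal A) a x -> f x = 0.
Definition mdr : {rmorphism L -> discr C} := f \o ca_map A.
Definition mdE (P : PE A) : gpt (rE mdr) :=
  @gmap (GE S) (cc A) (discr C) f fJ (rE (caL A)) (rE mdr) (fun c => erefl) P.
Definition mdL (P : PL A) : gpt (rL mdr) :=
  @gmap (GL S) (cc A) (discr C) f fJ (rL (caL A)) (rL mdr) (fun c => erefl) P.
Lemma mdE_incl (Q : PL A) : mdE (gincl Q) = gincl (mdL Q). Proof. exact: gpt_eq. Qed.
Lemma mdEMn P k : mdE (P *+ k) = mdE P *+ k. Proof. exact: gmapMn. Qed.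
End Modulo.
End EtaleValues.

Section Values.
Context (S : lts).
Notation p := (st_p S).
Notation F := (st_F S).
Notation L := (st_L S).
Notation E := (LTring (st_n S) (st_W S)).
Notation iota := (st_iota S).
Notation I := (Lt_ideal (st_p S) (st_t S) (st_iota S)).
Notation h := (st_n S - st_t S)%N.
Context (O : nat -> comPzRingType) (oL : forall j, {rmorphism L -> O j})
  (oE : forall j, {rmorphism mps unit E -> O j}).
Hypothesis hO : forall j, is_torsion_ring p F iota j (oL j) (oE j).
Context (y : forall j, O j).
Hypothesis hy : forall j, (0 < j)%N -> et_generator p F iota oL oE (y j).
Notation etf j := (et_function p F iota j (oL j) (oE j)).

Lemma gen_et j : (0 < j)%N -> etf j (y j).
Proof.
move=> j0; have [H _ _] := hy j0; apply/H; exists 'X.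
by rewrite size_polyX big_ord_recl big_ord1 !coefX /= rmorph0 mul0r add0r rmorph1 mul1r.
Qed.

Section Point.
Context (A : calg I) (P : PE A) (Q1 : PL A) (j : nat).
Hypotheses (j0 : (0 < j)%N) (PQ1 : P *+ (p ^ j) = gincl Q1).

(** The condition [et_value] for a point [P] of a complete algebra, without reference to [lam] and
    [alp]. *)
Definition value_of (b : A) := forall m, exists l N (d : 'I_N -> L) (f : 'I_N -> mps unit E),
  [/\ idl_pow (ca_ideal A) m (P (nseries F (p ^ (j + l)))),
      etf (j + l) (\sum_i oL (j + l) (d i) * oE (j + l) (f i)),
      \sum_i oL j (d i) * oE j (f i) = y j
    & idl_pow (ca_ideal A) m (b - \sum_i ca_map A (d i) * P (f i))].

(** Modulo [J] and [u b] the generator vanishes at [D], so [D] and then [P] lie in [GG_0], where the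
    coordinate is nilpotent. It is also a unit, so this quotient is zero, and [u b] is a unit by
    completeness. *)
Lemma value_unit (B : calg I) (u : chom A B) b : value_of b ->
  (exists v, u (P 'x_tt) * v = 1) -> exists v, u b * v = 1.
Proof.
move=> bP [x' Px]; have [a ua] := ch_cont u; have [l [N [d [f [Pt et sy bE]]]]] := bP a.
have HJ := ca_idealP B; have HK := add_gen_ideal (u b) HJ.
pose C : comPzRingType := quot HK; pose g : {rmorphism B -> C} := qpi HK.
have gJ x : ca_ideal B x -> g x = 0.
  by move=> Jx; apply/qpi0; exists x, 0; rewrite mulr0 addr0.
have guJ : exists a, forall x, idl_pow (ca_ideal A) a x -> (g \o u) x = 0.
  by exists a => x /ua/gJ.
pose PC := mdE guJ P; pose s := mdr (g \o u).
have Pk : PC *+ (p ^ (j + l)) = 0 by apply/gpt_tor0; apply: gJ; apply: ua.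
have [chi [cL cE]] := @ohom_ex S O oL oE hO _ C s PC Pk.
have [rho [rL1 rE1]] := restriction hO j l.
have PCj : PC *+ (p ^ j) = gincl (mdL guJ Q1) by rewrite -mdEMn PQ1 mdE_incl.
have [C' [io [s' [ss [D [Q [chiD [io_inj PD dL1 dE1 bD]]]]]]]] :=
  value_cover hO et rL1 rE1 cL cE PCj.
have b0 : chi (\sum_i oL _ (d i) * oE _ (f i)) = 0.
  have -> : chi (\sum_i oL _ (d i) * oE _ (f i)) = g (u (\sum_i ca_map A (d i) * P (f i))).
    rewrite !rmorph_sum; apply: eq_bigr => i _.
    by rewrite !rmorphM cL cE.
  transitivity (g (u b)); last by apply/qpi0; exists 0, 1; rewrite mulr1 add0r; split=> //; apply: ideal0.
  apply/esym/eqP; rewrite -subr_eq0 -!rmorphB; apply/eqP; apply: gJ; exact: ua.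
have rb : rho (\sum_i oL _ (d i) * oE _ (f i)) = y j.
  by rewrite -sy rmorph_sum; apply: eq_bigr => i _; rewrite rmorphM rL1 rE1.
rewrite b0 rmorph0 rb in bD.
have [Q' Q'D] := gen_zero_incl hO hy j0 dL1 dE1 (esym bD).
have s'I c : I c -> cJ (c := discr C') (s' c).
  move=> Ic; rewrite -[cJ _]/(s' c = 0) -ss -[s c]/(g (u (ca_map A c))) ch_lin gJ ?rmorph0 //.
  exact: ca_sub.
have [M QM] := gpt_nil s'I (Q' + Q).
have xM : io (g (u (P 'x_tt))) ^+ M = 0.
  rewrite -[RHS]QM -incl_x inclD Q'D -PD; by [].
have one0 : (1 : C) = 0.
  apply: io_inj; rewrite rmorph0 -(expr1n _ M) -(rmorph1 g) -Px rmorphM rmorphXn rmorphM.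
  by rewrite exprMn xM mul0r.
have [k [w [Jk E1]]] : add_gen (ca_ideal B) (u b) 1 by apply/(qpi0 HK); rewrite rmorph1.
apply: (complete_unit HJ (ca_complete B) (y := w)).
have -> : u b * w - 1 = - k by rewrite E1; ring.
exact: idealN.
Qed.

(** Extensions of [y] to higher torsion give approximations modulo [J^m], compatible by
    [extension_value]. Divisibility by the coordinate is what makes inverting the value invert the
    coordinate. *)
Lemma value_ex : exists b, value_of b /\ exists k, ca_ideal A (b - P 'x_tt * k).
Proof.
have HP m := idl_pow_ideal (ca_ideal A) m; have CJ := ca_complete A.
have step m : exists b l N (d : 'I_N -> L) (f : 'I_N -> mps unit E),
  [/\ idl_pow (ca_ideal A) m (P (nseries F (p ^ (j + l)))),
      etf (j + l) (\sum_i oL (j + l) (d i) * oE (j + l) (f i)),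
      \sum_i oL j (d i) * oE j (f i) = y j
    & b = \sum_i ca_map A (d i) * P (f i)].
  have [l Pl] := gp_tors P m; have [rho [rL1 rE1]] := restriction hO j l.
  have [b [bet rb]] := et_extension hO (gen_et j0) rL1 rE1.
  have [N [d [f bE]]] := torsion_sum hO b.
  exists (\sum_i ca_map A (d i) * P (f i)), l, N, d, f; split=> //.
  - by apply: (@tors_le (GE S) (cc A) P m l) Pl; apply: leq_addl.
  - by rewrite -bE.
  - by rewrite -rb bE rmorph_sum; apply: eq_bigr => i _; rewrite rmorphM rL1 rE1.
have [b bP] := choice step.
have lev m : exists a, forall x, idl_pow (ca_ideal A) a x -> qpi (HP m) x = 0.
  by exists m => x Jx; apply/qpi0.
have lval m l N (d : 'I_N -> L) (f : 'I_N -> mps unit E) :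
    idl_pow (ca_ideal A) m (P (nseries F (p ^ (j + l)))) ->
    exists chi : {rmorphism O (j + l) -> quot (HP m)},
    [/\ forall c, chi (oL _ c) = mdr (qpi (HP m)) c, forall h, chi (oE _ h) = mdE (lev m) P h
      & chi (\sum_i oL _ (d i) * oE _ (f i)) = qpi (HP m) (\sum_i ca_map A (d i) * P (f i))].
  move=> Pt; have Pk : mdE (lev m) P *+ (p ^ (j + l)) = 0 by apply/gpt_tor0; apply/qpi0.
  have [chi [cL cE]] := @ohom_ex S O oL oE hO _ _ _ _ Pk; exists chi; split=> //.
  by rewrite !rmorph_sum; apply: eq_bigr => i _; rewrite !rmorphM cL cE.
have rsum l N (d : 'I_N -> L) (f : 'I_N -> mps unit E) (rho : {rmorphism O (j + l) -> O j}) :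
    (forall c, rho (oL _ c) = oL j c) -> (forall h, rho (oE _ h) = oE j h) ->
    rho (\sum_i oL _ (d i) * oE _ (f i)) = \sum_i oL j (d i) * oE j (f i).
  by move=> r1 r2; rewrite rmorph_sum; apply: eq_bigr => i _; rewrite rmorphM r1 r2.
have [|bb bbE] := CJ.2 b.
  move=> m; have [l [N [d [f [Pt et sy bE]]]]] := bP m.
  have [l' [N' [d' [f' [Pt' et' sy' bE']]]]] := bP m.+1.
  have [chi [cL cE cb]] := lval m l N d f Pt.
  have [chi' [cL' cE' cb']] := lval m l' N' d' f' (idl_powW (leqnSn m) Pt').
  apply/(qpi_eq (HP m)); rewrite bE bE' -cb -cb'.
  have [rho [rL1 rE1]] := restriction hO j l; have [rho' [rL2 rE2]] := restriction hO j l'.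
  have PQ : mdE (lev m) P *+ (p ^ j) = gincl (mdL (lev m) Q1) by rewrite -mdEMn PQ1 mdE_incl.
  apply: (@extension_value S O oL oE hO j l' l (y j) _ _ rho' rho _ _ _ _ chi' chi
    et' et rL2 rE2 _ rL1 rE1 _ cL' cE' cL cE PQ); rewrite rsum //.
exists bb; split.
  move=> m; have [l [N [d [f [Pt et sy bE]]]]] := bP m; exists l, N, d, f; split=> //.
  by rewrite -bE.
have [l [N [d [f [Pt et sy bE]]]]] := bP 1%N.
have [chi [cL cE cb]] := lval 1%N l N d f Pt.
have [rho [rL1 rE1]] := restriction hO j l.
(* The extension vanishes on the zero section because its restriction [y j] does. *)
have [k kE] : exists k, \sum_i oL (j + l) (d i) * oE (j + l) (f i) = oE (j + l) 'x_tt * k.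
  apply: (augmentation_dvd hO) => z z1 z2; have [zj [zj1 zj2]] := zero_section hO j.
  have -> : z (\sum_i oL _ (d i) * oE _ (f i)) = (zj \o rho) (\sum_i oL _ (d i) * oE _ (f i)).
    by apply: (ohom_uniq hO) => [c|g] /=; rewrite ?rL1 ?rE1 ?z1 ?z2 ?zj1 ?zj2.
  rewrite /= rsum // sy; exact: gen_zero hy _ _ j0 zj1 zj2.
have [k' k'E] := qpi_surj (chi k); exists k'.
apply/(idl_pow1 _ (ca_idealP A)); apply: (ideal_trans (HP 1%N)) (bbE 1%N) _.
by apply/(qpi_eq (HP 1%N)); rewrite bE -cb kE !rmorphM cE k'E.
Qed.
End Point.
End Values.

(** * Cocones under the defining colimit as systems of points *)

Section Data.
Context (S : lts).
Notation p := (st_p S).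
Notation F := (st_F S).
Notation L := (st_L S).
Notation E := (LTring (st_n S) (st_W S)).
Notation iota := (st_iota S).
Notation t := (st_t S).
Notation I := (Lt_ideal (st_p S) (st_t S) (st_iota S)).
Notation h := (st_n S - st_t S)%N.
Notation EqA := (mps ('I_h + 'I_h)%type E).
Notation qv i := (@q_ (st_n S) (st_t S) (st_W S) i).
Notation Av i := (@A_ (st_n S) (st_t S) (st_W S) i).
Notation tor j := (nseries F (p ^ j)).
Let n0 := nseries_at0 (st_fgl S).

Lemma q_at0 i : qv i 0 = 0. Proof. exact: var0. Qed.
Lemma A_at0 i : Av i 0 = 0. Proof. exact: var0. Qed.

Lemma scomp_q (f : mps unit E) i : scomp f (qv i) = msubst (scomp f 'x_i) (fun i => qv i).
Proof.
by rewrite (scompA f (var0 E i) q_at0); congr scomp; apply/esym/(msubst_var q_at0).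
Qed.

Section Ring.
Context (A : calg I) (Lam : {rmorphism mps 'I_h L -> A}) (Alp : nat -> {rmorphism EqA -> A}).
Hypothesis coc : B_cocone p F iota Lam Alp.
Hypothesis Lc : forall c, Lam (mps_const _ c) = ca_map A c.
Let HP m := idl_pow_ideal (ca_ideal A) m.

Lemma cocone_const k c : Alp k (mps_const _ c) = ca_map A (iota c).
Proof.
have [_ H _ _] := coc; have := H k (mps_const _ c).
by rewrite msubst_const ?map_mps_const ?Lc // => i; apply: q_at0.
Qed.

Lemma cocone_q k f i : Alp k (scomp f (qv i)) = Lam (scomp (map_mps iota f) 'x_i).
Proof. by have [_ H _ _] := coc; rewrite scomp_q H map_scomp map_mps_var. Qed.

Definition evals (s : sys A) := (forall i f, Lam (scomp f 'x_i) = sq s i f) /\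
  forall k i f, Alp k (scomp f (Av i)) = sa s k i f.

(** With [q_i] in the ideal, [[p^m](q_i)] tends to zero. The torsion condition for [A_i^(k)] then
    follows from [[p^(m+k)](A_i^(k)) = [p^m](q_i)]. *)
Lemma cocone_sys : (forall i, ca_ideal A (Lam 'x_i)) -> exists s : sys A, evals s.
Proof.
move=> Lx; pose Lq i : {rmorphism mps unit L -> A} := Lam \o scomp_rm (var0 L i).
have Lqc i c : Lq i (mps_const _ c) = rL (caL A) c by rewrite /= /subst_fun msubst_const ?Lc // => _; apply: var0.
have Lqx i : Lq i 'x_tt = Lam 'x_i by rewrite /= /subst_fun msubst_var // => _; apply: var0.
have Lt0 i : t = 0%N -> Lq i 'x_tt = 0.
  by move=> t0; have [H _ _ _] := coc; rewrite Lqx H.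
have small i m : idl_pow (ca_ideal A) m (Lq i (nseries (map_mps iota F) (p ^ m))).
  apply: (@small_tors S (cc A) (caL A) (@caI S A) (Lq i) (Lqc i) _ (Lt0 i)).
  by rewrite Lqx; apply: Lx.
have Lqt i m : exists j, idl_pow (cJ (c := cc A)) m (Lq i (nseries (fgF (GL S)) (fgp (GL S) ^ j))).
  by exists m; apply: small.
pose q i : PL A := @Gpt (GL S) (cc A) (rL (caL A)) (Lq i) (Lqc i) (Lqt i).
pose Aq k i : {rmorphism mps unit E -> A} := Alp k \o scomp_rm (A_at0 i).
have Ac k i c : Aq k i (mps_const _ c) = rE (caL A) c.
  by rewrite /= /subst_fun msubst_const ?cocone_const // => _; apply: A_at0.
have At k i m : exists j, idl_pow (cJ (c := cc A)) m (Aq k i (nseries (fgF (GE S)) (fgp (GE S) ^ j))).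
  exists (m + k)%N; rewrite expnD (nseriesM (st_fgl S)) /= -[subst_fun _ _]/(scomp _ (Av i)).
  rewrite scomp_scomp ?n0 ?A_at0 //.
  have b0 : scomp (tor k) (Av i) 0 = 0 by rewrite scomp0 ?n0 ?A_at0.
  have [k' E1] := scomp_sub_dvd (tor m) b0 (q_at0 i).
  have -> : Alp k (scomp (tor m) (scomp (tor k) (Av i))) = Alp k (scomp (tor m) (qv i)).
    apply/eqP; rewrite -subr_eq0 -rmorphB E1 rmorphM rmorphB.
    by have [_ _ H _] := coc; rewrite H subrr mul0r.
  by rewrite cocone_q map_nseries; apply: small.
pose a k i : PE A := @Gpt (GE S) (cc A) (rE (caL A)) (Aq k i) (Ac k i) (At k i).
have a0 i : a 0%N i = gincl (q i).
  apply: gpt_ext; rewrite incl_x [RHS]Lqx [LHS]/(Alp 0%N (scomp 'x_tt (Av i))).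
  have [_ _ /(_ 0%N i) H _] := coc; rewrite expn0 (nseries1 (st_fgl S)) in H.
  transitivity (Alp 0%N (qv i)); first exact: H.
  by rewrite -{1}(scompx (q_at0 i)) cocone_q map_mps_var scompx ?var0.
have aS k i : a k.+1 i *+ p = a k i.
  apply: gpt_ext; rewrite gptMnx [RHS]/(Alp k (scomp 'x_tt (Av i))) scompx ?A_at0 //.
  have [_ _ _ /(_ k (Av i)) H] := coc; apply: etrans H; congr (Alp _ _).
  rewrite msubst_var // => -[i'|i']; first exact: q_at0.
  by rewrite scomp0 ?n0 ?A_at0.
by exists (Sys a0 aS).
Qed.

Lemma A_sum_spt (s : sys A) k (c : 'I_h -> nat) : evals s ->
  forall f, Alp k (scomp f (A_sum F c)) = spt s k c f.
Proof.
move=> [_ Ea]; suff [] : A_sum F c 0 = 0 /\ forall f, spt s k c f = Alp k (scomp f (A_sum F c)) by [].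
rewrite /A_sum /spt; elim/big_rec2: _ => [|i a P _ [a0 aE]].
  by split=> // f; rewrite gpt0E scomp_zero cocone_const.
have b0 : scomp (nseries F (c i)) (Av i) 0 = 0 by rewrite scomp0 ?n0 ?A_at0.
split; first by apply: (fadd_at0 (st_fgl S)).
apply: (@gpt_addE (GE S) (cc A) (rE (caL A)) _ (Alp k) _ _ _ _ (cocone_const k) b0 a0 _ aE) => f.
by rewrite gptMn -scomp_scomp ?n0 ?A_at0 // Ea.
Qed.
End Ring.

(** Points assemble to maps out of the power series rings, and the identities between such maps are
    checked on variables by [hom_uniq]. *)
Lemma cocone_ex (A : calg I) (s : sys A) : exists (Lam : {rmorphism mps 'I_h L -> A})
  (Alp : nat -> {rmorphism EqA -> A}), [/\ B_cocone p F iota Lam Alp,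
    forall c, Lam (mps_const _ c) = ca_map A c & evals Lam Alp s].
Proof.
have [Lam [Lc LE]] := @point_assembly (GL S) (cc A) (rL (caL A)) _ (sq s).
pose pt k (z : 'I_h + 'I_h) : PE A :=
  match z with inl i => gincl (sq s i) | inr i => sa s k i end.
have ex k := @point_assembly (GE S) (cc A) (rE (caL A)) _ (pt k).
pose Alp k := projT1 (cid (ex k)).
have Ac k c : Alp k (mps_const _ c) = ca_map A (iota c) by rewrite (projT2 (cid (ex k))).1.
have AE k z f : Alp k (scomp f 'x_z) = pt k z f by rewrite (projT2 (cid (ex k))).2.
have g0 (z : 'I_h + 'I_h) : (match z with inl i => qv i
    | inr i => scomp (nseries F p) (Av i) end) 0 = 0.
  by case: z => i; [apply: q_at0|rewrite scomp0 ?n0 ?A_at0].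
have tc k m := @tors_common (GE S) (cc A) (rE (caL A)) _ (pt k) m.
have iE i f : pt 0%N (inl i) f = Lam (scomp (map_mps iota f) 'x_i) by rewrite LE.
exists Lam, Alp; split=> //; last by split=> // k i f; apply: AE.
split.
- move=> t0 i; rewrite -(scompx (var0 L i)) LE; exact: (@gpt_t0 S (cc A) (caL A) (sq s i) t0).
- move=> k; have q0 i : qv i 0 = 0 by apply: q_at0.
  apply: (@hom_uniq (GE S) (cc A) _ (Alp k \o subst_rm q0) (Lam \o map_mps iota)) => [c|i|m|m].
  + by rewrite /= /subst_fun msubst_const // map_mps_const Ac Lc.
  + rewrite /= /subst_fun msubst_var // map_mps_var -(scompx (q0 i)) AE.
    by rewrite -[pt k _]/(pt 0%N (inl i)) iE map_mps_var scompx ?var0.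
  + have [j jP] := tc k m; exists j => i; rewrite /= /subst_fun -scomp_q AE.
    exact: (jP (inl i)).
  + have [j jP] := tc k m; exists j => i; rewrite /= map_scomp map_mps_var -iE.
    exact: (jP (inl i)).
- move=> k i; rewrite AE -(scompx (q_at0 i)) AE -(gptMnx (sa s k i)) -{1}[k]add0n saX sys0.
  by [].
- move=> k; apply: (@hom_uniq (GE S) (cc A) _ (Alp k.+1 \o subst_rm g0) (Alp k)) => [c|z|m|m].
  + by rewrite /= /subst_fun msubst_const // !Ac.
  + rewrite /= /subst_fun msubst_var // -[in RHS](scompx (var0 _ z)) AE; case: z => i.
      by rewrite -(scompx (q_at0 i)) AE.
    by rewrite AE -gptMnx [_ *+ _](sysS s).
  + have [j jP] := tc k m; exists j => z; rewrite /= /subst_fun scompA ?var0 // msubst_var //.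
    have := jP z; case: z => i; first by rewrite AE.
    by rewrite -scomp_scomp ?n0 ?A_at0 // AE -gptMn [_ *+ _](sysS s).
  + by have [j jP] := tc k m; exists j => z; rewrite AE.
Qed.

Lemma cocone_uniq (A : calg I) (s : sys A) (Lam Lam' : {rmorphism mps 'I_h L -> A})
  (Alp Alp' : nat -> {rmorphism EqA -> A}) :
  B_cocone p F iota Lam Alp -> (forall c, Lam (mps_const _ c) = ca_map A c) -> evals Lam Alp s ->
  B_cocone p F iota Lam' Alp' -> (forall c, Lam' (mps_const _ c) = ca_map A c) ->
  evals Lam' Alp' s -> Lam =1 Lam' /\ forall k, Alp k =1 Alp' k.
Proof.
move=> co Lc [Lx Ax] co' Lc' [Lx' Ax'].
have EL : Lam =1 Lam'.
  apply: (@hom_uniq (GL S) (cc A)) => [c|i|m|m]; first by rewrite Lc Lc'.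
  - by rewrite -(scompx (var0 L i)) Lx Lx'.
  - have [j jP] := @tors_common (GL S) (cc A) _ _ (sq s) m.
    by exists j => i; rewrite Lx.
  - have [j jP] := @tors_common (GL S) (cc A) _ _ (sq s) m.
    by exists j => i; rewrite Lx'.
split=> // k; pose pt (z : 'I_h + 'I_h) : PE A :=
  match z with inl i => gincl (sq s i) | inr i => sa s k i end.
have H (La : {rmorphism mps 'I_h L -> A}) (Al : nat -> {rmorphism EqA -> A}) :
    B_cocone p F iota La Al -> (forall c, La (mps_const _ c) = ca_map A c) -> evals La Al s ->
    forall z f, Al k (scomp f 'x_z) = pt z f.
  move=> c1 c2 [Ex Ea] [i|i] f; last exact: Ea.
  by rewrite [LHS](cocone_q c1) Ex.
have [H1 H2] := (H _ _ co Lc (conj Lx Ax), H _ _ co' Lc' (conj Lx' Ax')).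
have tc1 := @tors_common (GE S) (cc A) (rE (caL A)) _ pt.
apply: (@hom_uniq (GE S) (cc A) _ (Alp k) (Alp' k)) => [c|z|m|m].
- by rewrite (cocone_const co Lc) (cocone_const co' Lc').
- by rewrite -(scompx (var0 _ z)) H1 H2.
- by have [j jP] := tc1 m; exists j => z; rewrite H1.
- by have [j jP] := tc1 m; exists j => z; rewrite H2.
Qed.
End Data.

Section Representing.
Context (S : lts).
Notation p := (st_p S).
Notation F := (st_F S).
Notation L := (st_L S).
Notation E := (LTring (st_n S) (st_W S)).
Notation iota := (st_iota S).
Notation t := (st_t S).
Notation I := (Lt_ideal (st_p S) (st_t S) (st_iota S)).
Notation h := (st_n S - st_t S)%N.
Context (O : nat -> comPzRingType) (oL : forall j, {rmorphism L -> O j})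
  (oE : forall j, {rmorphism mps unit E -> O j}).
Hypothesis hO : forall j, is_torsion_ring p F iota j (oL j) (oE j).
Context (y : forall j, O j).
Hypothesis hy : forall j, (0 < j)%N -> et_generator p F iota oL oE (y j).

Lemma spt_tor_incl (A : calg I) (s : sys A) j c :
  spt s j c *+ (p ^ j) = @gincl S (cc A) (caL A) (\sum_i sq s i *+ c i).
Proof.
rewrite spt_tor (big_morph _ (@inclD _ _ _) (incl0 _)).
by apply: eq_bigr => i _; rewrite inclMn.
Qed.

Theorem Bt_universal (B : calg I) : is_Bt F oL oE y B -> exists sB : sys B, [/\ nondeg sB,
  forall (A : calg I) (s : sys A), nondeg s -> exists phi : chom B A, sysmap phi sB = s
  & forall (A : calg I) (phi psi : chom B A), sysmap phi sB = sysmap psi sB -> phi =1 psi].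
Proof.
move=> [X [B' [M [lam [alp [cX [e [cM]]]]]]]].
set Iq := Iq_ideal p iota; set JX := idl (lam @` Iq)%classic.
set J' := idl (cX @` JX)%classic; set JM := idl (e @` J')%classic => /=.
set R := (X in is_localization X e) => -[[[co Xuniv] hcX] hloc hcM JB BL].
pose mapB : {rmorphism L -> B'} := cX \o (lam \o @mps_const 'I_h L).
have IqC c : I c -> Iq (mps_const _ c) by move=> Ic; apply: sub_idl; left; exists c.
have JXl f : Iq f -> JX (lam f) by move=> If; apply: sub_idl; exists f.
have J'c x : JX x -> J' (cX x) by move=> Jx; apply: sub_idl; exists x.
have subB c : I c -> J' (mapB c) by move=> Ic; apply/J'c/JXl/IqC.
have [CB _ _] := hcX.
pose Bc : calg I := @CAlg _ _ B' mapB J' (idl_is_ideal _) subB CB.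
pose lam' : {rmorphism mps 'I_h L -> Bc} := cX \o lam.
pose alp' k : {rmorphism mps ('I_h + 'I_h)%type E -> Bc} := cX \o alp k.
have co' : B_cocone p F iota lam' alp'.
  have [c1 c2 c3 c4] := co; split=> [t0 i|m f|m i|m f] /=.
  - by rewrite c1 ?rmorph0.
  - by rewrite c2.
  - by rewrite c3.
  - by rewrite c4.
have Lc' c : lam' (mps_const _ c) = ca_map Bc c by [].
have [|s' ev'] := cocone_sys co' Lc'.
  by move=> i; apply/J'c/JXl/sub_idl; right; exists i.
pose we : {rmorphism Bc -> B} := cM \o e.
have wl c : we (ca_map Bc c) = ca_map B c by rewrite BL.
have wJ x : J' x -> ca_ideal B (we x).
  by move=> Jx; rewrite JB; apply: sub_idl; exists (e x) => //; apply: sub_idl; exists x.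
have wc : exists a, forall x, idl_pow (ca_ideal Bc) a x -> ca_ideal B (we x).
  by exists 1%N => x /(idl_pow1 _ (ca_idealP Bc)); apply: wJ.
pose w : chom Bc B := CHom wl wc.
have RE b : R b <-> exists j (c : 'I_h -> 'I_(p ^ j)), [/\ (0 < j)%N,
    exists i, c i != 0%N :> nat & value_of oL oE y (spt s' j c) j b].
  have PE j (c : 'I_h -> 'I_(p ^ j)) f : cX (alp j (scomp f (A_sum F c))) = spt s' j c f.
    exact: (A_sum_spt co' Lc' _ _ ev').
  have PS j (c : 'I_h -> 'I_(p ^ j)) N (d : 'I_N -> L) f :
      \sum_i cX (lam (mps_const _ (d i))) * cX (alp j (scomp (f i) (A_sum F c))) =
      \sum_i ca_map Bc (d i) * spt s' j c (f i).
    by apply: eq_bigr => i _; rewrite PE.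
  split=> -[j [c [j0 c0 v]]]; exists j, c; split=> //.
    move=> m; have [l [N [d [f [v1 v2 v3 v4]]]]] := v m; exists l, N, d, f.
    by split=> //; rewrite -?PS -?PE.
  move=> m; have [l [N [d [f [v1 v2 v3 v4]]]]] := v m; exists l, N, d, f.
  by split=> //; rewrite /= ?PS ?PE.
exists (sysmap w s'); split.
(* The inverted value is divisible by the coordinate modulo the ideal, so the coordinate becomes a
   unit too. *)
- move=> j c j0 c0; rewrite -spt_res resEE.
  have [b [bv [k bk]]] := value_ex hO hy j0 (spt_tor_incl s' j c).
  have [v bvE] : exists v, e b * v = 1.
    have [inv _ _] := hloc; apply: inv; exists [:: b]; last by rewrite big_seq1.
    by move=> x; rewrite inE => /eqP ->; apply/RE; exists j, c.
  apply: (complete_unit (ca_idealP B) (ca_complete B) (y := w k * cM v)).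
  have -> : w (spt s' j c 'x_tt) * (w k * cM v) - 1 = - (w (b - spt s' j c 'x_tt * k) * cM v).
    have E1 : w b * cM v = 1 by rewrite -[w b]/(cM (e b)) -rmorphM bvE rmorph1.
    by rewrite rmorphB rmorphM mulrBl E1; ring.
  by apply: idealN (ca_idealP B) _ _; apply: idealMr (ca_idealP B) _ _ _; apply: wJ.
- move=> A s sn; have HJ := ca_idealP A; have CJ := ca_complete A.
  have [Lam [Alp [coA LcA evA]]] := cocone_ex s.
  have [chiX [chiL chiA] _] := Xuniv A Lam Alp coA.
  (* The ideal [I_t + (q)] goes only into the ideal of [A] enlarged by the coordinates of the [q_i];
     the exponent [a] brings powers of it back. *)
  pose qs := [seq sq s i 'x_tt | i <- enum 'I_h].
  have qsN x : x \in qs -> exists N, ca_ideal A (x ^+ N).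
    by move=> /mapP[i _ ->]; apply: gpt_nil (@caI S A) _.
  have [a Ka] := add_gens_pow HJ qsN.
  have HK := add_gens_ideal qs HJ.
  have chiJ x : idl_pow JX 1 x -> add_gens (ca_ideal A) qs (chiX x).
    move=> /(idl_pow1 _ (idl_is_ideal _)) Jx; apply/(idl_pow1 _ HK).
    apply: (@idl_image_pow _ _ Iq lam A chiX _ 1%N (idl_pow_ideal _ _)) => [f|]; last exact/(idl_pow1 _ (idl_is_ideal _)).
    move=> /(idl_pow1 _ (idl_is_ideal _)) If; apply/(idl_pow1 _ HK).
    rewrite -[chiX _]/((chiX \o lam) f) chiL.
    have HIf : is_ideal (fun f => add_gens (ca_ideal A) qs (Lam f)).
      split=> [|u v Hu Hv|u v Hv]; first by rewrite rmorph0; apply: ideal0.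
        by rewrite rmorphD; apply: idealD.
      by rewrite rmorphM; apply: idealMl.
    apply: (idl_sub HIf _ If) => _ [[c Ic ->]|[i ->]].
      by rewrite LcA; apply: add_gens_sub => //; apply: ca_sub.
    have [EvL _] := evA; rewrite -(scompx (var0 L i)) EvL.
    by apply: add_gens_mem => //; apply: map_f; rewrite mem_enum.
  have chia x : idl_pow JX a x -> ca_ideal A (chiX x).
    by move=> Jx; apply: Ka; apply: (idl_pow_morph chiJ); rewrite mul1n.
  have [chi' [chi'X chi'J]] := completion_ext HJ CJ hcX chia.
  have cl c : chi' (ca_map Bc c) = ca_map A c.
    by rewrite [LHS]chi'X -[LHS]/((chiX \o lam) _) chiL LcA.
  pose ch : chom Bc A := @CHom _ _ Bc A chi' cl (ex_intro _ a chi'J).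
  have chs : sysmap ch s' = s.
    apply: sys_eq => k i; apply: gpt_eq => f; have [_ EvA] := evA; have [_ Ev'] := ev'.
    apply: etrans (congr1 chi' (esym (Ev' k i f))) (etrans _ (EvA k i f)).
    by rewrite [LHS]chi'X -[LHS]/((chiX \o alp k) _) chiA.
  (* Nondegeneracy of [s] inverts the coordinates, hence the values of [y], so the map extends to
     the localization. *)
  have chR b : R b -> exists v, chi' b * v = 1.
    move=> /RE[j [c [j0 c0 bv]]].
    apply: (value_unit hO hy j0 (spt_tor_incl s' j c) (u := ch) bv).
    by rewrite -resEE spt_res chs; apply: sn.
  have [chM chME] := loc_ext hloc chR.
  have chMJ x : idl_pow JM a x -> ca_ideal A (chM x).
    by apply: idl_image_pow HJ _ _ => x' Jx'; rewrite chME; exact: (chi'J x' Jx').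
  have [ph [phM phJ]] := completion_ext HJ CJ hcM chMJ.
  have pl c : ph (ca_map B c) = ca_map A c by rewrite BL phM chME; exact: (cl c).
  have pc : exists a, forall x, idl_pow (ca_ideal B) a x -> ca_ideal A (ph x).
    by exists a; rewrite JB.
  exists (CHom pl pc); rewrite -chs; apply: sys_eq => k i; apply: gpt_eq => f.
  by rewrite [LHS]phM chME.
- move=> A phi psi E12; have HJ := ca_idealP A; have CJ := ca_complete A.
  have contB (u : chom B A) : exists a, forall x, idl_pow (idl (cM @` JM)%classic) a x -> ca_ideal A (u x).
    by rewrite -JB; apply: ch_cont.
  apply: (completion_uniq CJ hcM (contB phi) (contB psi)).
  apply: (loc_uniq hloc (g1 := phi \o cM) (g2 := psi \o cM)).
  have cont' (u : chom B A) : exists a, forall x, idl_pow J' a x -> ca_ideal A ((u \o cM \o e) x).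
    exact: ch_cont (ch_comp u w).
  apply: (completion_uniq CJ hcX (cont' phi) (cont' psi)).
  have evC (u : chom B A) : evals (u \o cM \o e \o cX \o lam)
      (fun k => u \o cM \o e \o cX \o alp k) (sysmap (ch_comp u w) s').
    have [EvL EvA] := ev'; split=> [i f|k i f].
      by rewrite -[RHS]/(u (w (sq s' i f))) -EvL.
    by rewrite -[RHS]/(u (w (sa s' k i f))) -EvA.
  have coC (u : chom B A) : B_cocone p F iota (u \o cM \o e \o cX \o lam)
      (fun k => u \o cM \o e \o cX \o alp k).
    have [c1 c2 c3 c4] := co; split=> [t0 i|m f|m i|m f] /=.
    - by rewrite c1 ?rmorph0.
    - by rewrite c2.
    - by rewrite c3.
    - by rewrite c4.
  have LC (u : chom B A) c : (u \o cM \o e \o cX \o lam) (mps_const _ c) = ca_map A c.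
    by rewrite -(ch_lin u) BL.
  have Es : sysmap (ch_comp psi w) s' = sysmap (ch_comp phi w) s'.
    have SC u : sysmap (ch_comp u w) s' = sysmap u (sysmap w s').
      by apply/esym; apply: sysmap_comp.
    by rewrite !SC E12.
  have evP := evC psi; rewrite Es in evP.
  have [U1 U2] := cocone_uniq (coC phi) (LC phi) (evC phi) (coC psi) (LC psi) evP.
  have [chi _ chiU] := Xuniv A _ _ (coC phi).
  move=> x; rewrite -[LHS]/((phi \o cM \o e \o cX) x) (chiU (phi \o cM \o e \o cX)) //.
  rewrite -(chiU (psi \o cM \o e \o cX)) //; split=> [f|k f]; apply/esym; [apply: U1|apply: U2].
Qed.
End Representing.

(** * Pushouts come from nondegenerate systems *)

Section Primes.
Context (R : comPzRingType).

Definition prime_ideal (P : set R) : Prop :=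
  [/\ is_ideal P, ~ P 1 & forall x y, P (x * y) -> P x \/ P y].

Lemma prime_exp (P : set R) x m : prime_ideal P -> P (x ^+ m) -> P x.
Proof.
move=> [HP P1 PM]; elim: m => [//|m IHm]; rewrite exprS => /PM[//|]; exact: IHm.
Qed.

Lemma prime_avoid (J M : set R) : is_ideal J -> M 1 -> (forall x y, M x -> M y -> M (x * y)) ->
  (forall x, J x -> ~ M x) ->
  exists P, [/\ prime_ideal P, forall x, J x -> P x & forall x, P x -> ~ M x].
Proof.
move=> HJ M1 MM JM.
pose good X := [/\ is_ideal X, forall x, J x -> X x & forall x, X x -> ~ M x].
pose P X := (forall x, ~ X x) \/ good X.
have [F FP Ftot|A [AP Amax]] := @Zorn_bigcup R P.
  have [[X0 [FX0 X0g]]|none] := pselect (exists X, F X /\ good X); last first.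
    left=> x [X FX Xx]; have [X0|Xg] := FP X FX; first exact: X0 Xx.
    by apply: none; exists X.
  have big X : F X -> exists Y, [/\ F Y, good Y & forall x, X x -> Y x].
    by move=> FX; have [X_0|Xg] := FP X FX; [exists X0; split=> // x /X_0|exists X].
  right; split=> [|x Jx|x [X FX Xx] Mx]; last 2 first.
  - by exists X0 => //; have [_ H _] := X0g; apply: H.
  - by have [Y [_ [_ _ YM] XY]] := big X FX; apply: YM (XY _ Xx) Mx.
  split.
  - by exists X0 => //; have [H _ _] := X0g; apply: ideal0.
  - move=> x y [X /big[X' [FX' [HX' _ _] XX']] Xx] [Y /big[Y' [FY' [HY' _ _] YY']] Yy].
    have [X'Y'|Y'X'] := Ftot _ _ FX' FY'.
      by exists Y' => //; apply: idealD => //; [apply/X'Y'/XX'|apply: YY'].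
    by exists X' => //; apply: idealD => //; [apply: XX'|apply/Y'X'/YY'].
  - move=> r x [X /big[X' [FX' [HX' _ _] XX']] Xx]; exists X' => //.
    by apply: idealMl => //; apply: XX'.
have Ag : good A.
  case: AP => // A0; case: (Amax J); last by right; split.
  split=> [x /A0 //|JA]; exact: (A0 0 (JA _ (ideal0 HJ))).
have [HA JA AM] := Ag; exists A; split=> //; split=> //.
  by move=> A1; apply: AM A1 M1.
move=> x y Axy; have [Ax|nAx] := pselect (A x); first by left.
right; apply: contrapT => nAy.
have meet z : ~ A z -> exists a w, A a /\ M (a + z * w).
  move=> nAz; apply: contrapT => no; case: (Amax (add_gen A z)).
    split=> [u Au|sub]; first by exists u, 0; rewrite mulr0 addr0.
    by apply: nAz; apply: sub; exists 0, 1; rewrite mulr1 add0r; split=> //; apply: ideal0.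
  right; split=> [|u Ju|u [a [w [Aa ->]]] Mu]; first exact: add_gen_ideal.
    by exists u, 0; rewrite mulr0 addr0; split=> //; apply: JA.
  by apply: no; exists a, w.
have [[a [w [Aa Mx]]] [b [v [Ab My]]]] := (meet x nAx, meet y nAy).
apply: AM (MM _ _ Mx My).
have -> : (a + x * w) * (b + y * v) = a * (b + y * v) + (x * w * b + x * y * (w * v)) by ring.
apply: (idealD HA); first exact: (idealMr HA).
by apply: (idealD HA); [apply: (idealMl HA)|apply: (idealMr HA)].
Qed.

Lemma prime_ex (J : set R) : is_ideal J -> ~ J 1 -> exists P, prime_ideal P /\ forall x, J x -> P x.
Proof.
move=> HJ J1; have [|x y -> ->|x Jx E|P [PP JP _]] := @prime_avoid J (fun x => x = 1) HJ; first by [].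
- by rewrite mulr1.
- by rewrite E in Jx.
by exists P.
Qed.
End Primes.

Section ResidueField.
Context (R : comPzRingType) (P : set R) (HP : prime_ideal P).
Let HI : is_ideal P. Proof. by case: HP. Qed.
Let D0 : comPzRingType := quot HI.
Let D1 : (1 : D0) != 0.
Proof. by apply/eqP; rewrite -(rmorph1 (qpi HI)) => /qpi0; case: HP. Qed.
Let D : comNzRingType := nz_ring D1.
Let unitD (x : D) : bool := `[< exists y, y * x = 1 >].
Let invD (x : D) : D := if pselect (exists y, y * x = 1) is left e then projT1 (cid e) else x.
Let mulVx : {in unitD, left_inverse 1 invD *%R}.
Proof.
move=> x /asboolP xU; rewrite /invD; case: pselect => // e; by case: cid.
Qed.
Let unitPl (x y : D) : y * x = 1 -> unitD x.
Proof. by move=> yx; apply/asboolP; exists y. Qed.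
Let invr_out : {in [predC unitD], invD =1 id}.
Proof.
move=> x; rewrite inE => /asboolP xU; rewrite /invD; by case: pselect.
Qed.
Let Du : comUnitRingType := HB.pack_for comUnitRingType (GRing.ComNzRing.sort D)
  (GRing.ComNzRing_hasMulInverse.Build D mulVx unitPl invr_out).
Let idomD (x y : Du) : x * y = 0 -> (x == 0) || (y == 0).
Proof.
have [[a ->] [b ->]] := (@qpi_surj _ _ HI x, @qpi_surj _ _ HI y).
move=> E; have {E} : qpi HI (a * b) = 0 by rewrite rmorphM.
case: HP => _ _ PM /qpi0/PM[/qpi0 ->|/qpi0 ->]; first by rewrite eqxx.
by rewrite eqxx orbT.
Qed.
Let Di : idomainType := HB.pack_for idomainType (GRing.ComUnitRing.sort Du)
  (GRing.ComUnitRing_isIntegral.Build Du idomD).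

Lemma residue_field : exists (K : fieldType) (f : {rmorphism R -> K}), forall x, f x = 0 <-> P x.
Proof.
pose pi : {rmorphism R -> Di} := qpi HI.
exists {fraction Di}, (@tofrac Di \o pi) => x /=.
split=> [/eqP|Px]; first by rewrite tofrac_eq0 => /eqP/qpi0.
have -> : pi x = 0 by apply/qpi0.
exact: rmorph0.
Qed.
End ResidueField.

(** * A nonzero common algebra of two fields over a ring *)

Section Amalgam.
Context (A : comPzRingType) (K1 K2 : fieldType) (f1 : {rmorphism A -> K1}) (f2 : {rmorphism A -> K2}).
Hypothesis f12 : forall a, f1 a = 0 <-> f2 a = 0.

Definition subspace (H : set K1) := [/\ H 0, forall x y, H x -> H y -> H (x + y)
  & forall a b x, H x -> f1 b != 0 -> H (f1 a / f1 b * x)].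

(** A subspace over the fraction field of the image of [A] that is maximal among those avoiding [1]
    is a complement of the line through [1]. *)
Lemma hyperplane : exists H, [/\ subspace H, ~ H 1
  & forall x, exists a b, f1 b != 0 /\ H (x - f1 a / f1 b)].
Proof.
pose good X := subspace X /\ ~ X 1.
have [F FP Ftot|H [HP Hmax]] := @Zorn_bigcup K1 (fun X => (forall x, ~ X x) \/ good X).
  have [[X0 [FX0 X0g]]|none] := pselect (exists X, F X /\ good X); last first.
    left=> x [X FX Xx]; have [X0|Xg] := FP X FX; first exact: X0 Xx.
    by apply: none; exists X.
  have big X : F X -> exists Y, [/\ F Y, good Y & forall x, X x -> Y x].
    by move=> FX; have [X_0|Xg] := FP X FX; [exists X0; split=> // x /X_0|exists X].
  right; split; last first.
    by move=> [X /big[Y [_ [_ Y1] XY]] X1]; apply/Y1/XY.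
  split.
  - by exists X0 => //; case: X0g => [[]].
  - move=> x y [X /big[X' [FX' [[_ HD _] _] XX']] Xx] [Y /big[Y' [FY' [[_ HD' _] _] YY']] Yy].
    have [X'Y'|Y'X'] := Ftot _ _ FX' FY'.
      by exists Y' => //; apply: HD'; [apply/X'Y'/XX'|apply: YY'].
    by exists X' => //; apply: HD; [apply: XX'|apply/Y'X'/YY'].
  - move=> a b x [X /big[X' [FX' [[_ _ HM] _] XX']] Xx] b0; exists X' => //.
    by apply: HM => //; apply: XX'.
have zg : good [set 0]%classic.
  split; last by move=> /eqP; rewrite oner_eq0.
  by split=> [//|x y -> ->|a b x -> _]; rewrite ?addr0 ?mulr0.
have [[H0 HD HM] H1] : good H.
  case: HP => // E0; case: (Hmax [set 0]%classic); last by right.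
  by split=> [x /E0 //|sub]; apply: (E0 0 (sub _ erefl)).
exists H; split=> // x; have [Hx|nHx] := pselect (H x).
  by exists 0, 1; rewrite rmorph0 mul0r subr0 rmorph1 oner_eq0.
pose X : set K1 := fun y => exists z a b, [/\ H z, f1 b != 0 & y = z + f1 a / f1 b * x].
have HX : subspace X.
  split.
  - by exists 0, 0, 1; rewrite rmorph0 rmorph1 oner_eq0 !mul0r addr0.
  - move=> y y' [z [a [b [Hz b0 ->]]]] [z' [a' [b' [Hz' b0' ->]]]].
    exists (z + z'), (a * b' + a' * b), (b * b'); rewrite rmorphM mulf_neq0 //; split=> //.
      exact: HD.
    by rewrite rmorphD !rmorphM; field; rewrite b0 b0'.
  - move=> a' b' y [z [a [b [Hz b0 ->]]]] b0'.
    exists (f1 a' / f1 b' * z), (a' * a), (b' * b); rewrite rmorphM mulf_neq0 //; split=> //.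
      exact: HM.
    by rewrite rmorphM mulrDr mulrA mulf_div.
have [z [a [b [Hz b0 E]]]] : X 1.
  apply: contrapT => X1; case: (Hmax X); last by right.
  split=> [y Hy|sub]; first by exists y, 0, 1; rewrite rmorph0 rmorph1 oner_eq0 !mul0r addr0.
  by apply: nHx; apply: sub; exists 0, 1, 1; rewrite rmorph1 oner_eq0 divr1 mul1r add0r.
have a0 : f1 a != 0.
  by apply: contra_notN H1 => /eqP a0; rewrite E a0 !mul0r addr0.
exists b, a; split=> //; have -> : x - f1 b / f1 a = f1 (- b) / f1 a * z.
  have -> : z = 1 - f1 a / f1 b * x by rewrite E addrK.
  by rewrite rmorphN; field; rewrite a0 b0.
exact: HM.
Qed.

(** Projection onto the line of [1] along the hyperplane, read in [K2]: both fields contain the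
    fraction field of [A] modulo the common kernel. *)
Lemma functional : exists l : K1 -> K2, [/\ l 1 = 1, forall x y, l (x + y) = l x + l y
  & forall a x, l (f1 a * x) = f2 a * l x].
Proof.
have [H [[H0 HD HM] H1 dec]] := hyperplane.
have f20 b : f1 b != 0 -> f2 b != 0 by apply: contra_neq => /f12.
have HN x : H x -> H (- x).
  by move=> /(HM (-1) 1); rewrite rmorphN rmorph1 divr1 mulN1r; apply; rewrite oner_eq0.
pose rel x z := exists a b, [/\ f1 b != 0, H (x - f1 a / f1 b) & z = f2 a / f2 b].
have uniq x z z' : rel x z -> rel x z' -> z = z'.
  move=> [a [b [b0 Hx ->]]] [a' [b' [b0' Hx' ->]]].
  have Hd : H (f1 (a * b' - a' * b) / f1 (b * b')).
    have := HD _ _ Hx' (HN _ Hx); congr H.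
    by rewrite rmorphB !rmorphM; field; rewrite b0 b0'.
  have [e|e] := eqVneq (f1 (a * b' - a' * b)) 0; last first.
    case: H1; have := HM (b * b') _ _ Hd e; congr H.
    by rewrite mulf_div [X in X / _]mulrC divff // mulf_neq0 // rmorphM mulf_neq0.
  have /f12 := e; rewrite rmorphB !rmorphM => /eqP; rewrite subr_eq0 => /eqP e2.
  by apply/eqP; rewrite eqr_div ?f20 // e2.
have [l lP] : exists l, forall x, rel x (l x).
  have tot x : exists z, rel x z.
    by have [a [b [b0 Hx]]] := dec x; exists (f2 a / f2 b), a, b.
  by have [l lP] := choice tot; exists l.
exists l; split=> [|x y|a x].
- apply: (uniq 1) (lP 1) _; exists 1, 1; rewrite !rmorph1 !divr1 subrr oner_eq0.
  by split.
- have [[a [b [b0 Hx ->]]] [a' [b' [b0' Hy ->]]]] := (lP x, lP y).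
  apply: (uniq (x + y)) (lP _) _; exists (a * b' + a' * b), (b * b').
  rewrite !rmorphM mulf_neq0 //; split=> //; last by rewrite rmorphD !rmorphM addf_div ?f20.
  by have := HD _ _ Hx Hy; rewrite rmorphD !rmorphM -addf_div // opprD addrACA.
- have [c [b [b0 Hx ->]]] := lP x; apply: (uniq (f1 a * x)) (lP _) _.
  exists (a * c), b; split=> //; last by rewrite rmorphM mulrA.
  have := HM a 1 _ Hx; rewrite rmorph1 oner_eq0 divr1 mulrBr mulrA rmorphM; exact.
Qed.
End Amalgam.

Section Operators.
Context (K1 K2 : fieldType).

(** The action of a sum of tensors [b (x) a] on functions from [K1] to [K2]. Such operators stand in
    for the tensor product, whose nontriviality is then seen on a single functional. *)
Definition opf (s : seq (K2 * K1)) (phi : K1 -> K2) : K1 -> K2 :=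
  fun x => \sum_(u <- s) u.1 * phi (u.2 * x).

Record oper := Oper { ofn : (K1 -> K2) -> K1 -> K2; ofnP : exists s, ofn = opf s }.

Lemma oper_eq (T U : oper) : (forall phi x, ofn T phi x = ofn U phi x) -> T = U.
Proof.
case: T U => [f fP] [g gP] /= fg.
have e : f = g by apply/funext => phi; apply/funext => x.
by subst g; rewrite (Prop_irrelevance fP gP).
Qed.

HB.instance Definition _ := gen_eqMixin oper.
HB.instance Definition _ := gen_choiceMixin oper.

Lemma oadd_subproof (T U : oper) : exists s, (fun phi x => ofn T phi x + ofn U phi x) = opf s.
Proof.
have [[s sE] [s' sE']] := (ofnP T, ofnP U); exists (s ++ s').
by apply/funext => phi; apply/funext => x; rewrite sE sE' /opf big_cat.
Qed.
Definition oadd T U := Oper (oadd_subproof T U).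
Lemma oopp_subproof (T : oper) : exists s, (fun phi x => - ofn T phi x) = opf s.
Proof.
have [s sE] := ofnP T; exists [seq (- u.1, u.2) | u <- s].
apply/funext => phi; apply/funext => x; rewrite sE /opf big_map -sumrN.
by apply: eq_bigr => u _; rewrite mulNr.
Qed.
Definition oopp T := Oper (oopp_subproof T).
Lemma ozero_subproof : exists s, (fun (phi : K1 -> K2) (x : K1) => 0) = opf s.
Proof. by exists [::]; apply/funext => phi; apply/funext => x; rewrite /opf big_nil. Qed.
Definition ozero := Oper ozero_subproof.
Lemma omul_subproof (T U : oper) : exists s, (fun phi => ofn T (ofn U phi)) = opf s.
Proof.
have [[s sE] [s' sE']] := (ofnP T, ofnP U).
exists [seq (u.1 * v.1, v.2 * u.2) | u <- s, v <- s'].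
apply/funext => phi; apply/funext => x; rewrite sE sE' /opf big_allpairs_dep.
apply: eq_bigr => u _; rewrite mulr_sumr; apply: eq_bigr => v _ /=.
by rewrite !mulrA.
Qed.
Definition omul T U := Oper (omul_subproof T U).
Lemma oone_subproof : exists s, (fun phi : K1 -> K2 => phi) = opf s.
Proof.
exists [:: (1, 1)]; apply/funext => phi; apply/funext => x.
by rewrite /opf big_seq1 /= !mul1r.
Qed.
Definition oone := Oper oone_subproof.

Lemma oaddA : associative oadd. Proof. by move=> T U V; apply: oper_eq => phi x; apply: addrA. Qed.
Lemma oaddC : commutative oadd. Proof. by move=> T U; apply: oper_eq => phi x; apply: addrC. Qed.
Lemma oadd0 : left_id ozero oadd. Proof. by move=> T; apply: oper_eq => phi x; apply: add0r. Qed.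
Lemma oaddN : left_inverse ozero oopp oadd.
Proof. by move=> T; apply: oper_eq => phi x; apply: addNr. Qed.
Lemma omulA : associative omul. Proof. by move=> T U V; apply: oper_eq. Qed.
Lemma omul1 : left_id oone omul. Proof. by move=> T; apply: oper_eq. Qed.
Lemma omulC : commutative omul.
Proof.
move=> T U; apply: oper_eq => phi x /=; have [[s ->] [s' ->]] := (ofnP T, ofnP U).
rewrite /opf; under eq_bigr do rewrite mulr_sumr.
rewrite exchange_big; apply: eq_bigr => v _; rewrite mulr_sumr; apply: eq_bigr => u _.
by rewrite mulrCA; congr (_ * (_ * phi _)); rewrite mulrCA.
Qed.
Lemma omulDl : left_distributive omul oadd. Proof. by move=> T U V; apply: oper_eq. Qed.

HB.instance Definition _ := GRing.isZmodule.Build oper oaddA oaddC oadd0 oaddN.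
HB.instance Definition _ := GRing.Zmodule_isComPzRing.Build oper omulA omulC omul1 omulDl.

Context (A : comPzRingType) (f1 : {rmorphism A -> K1}) (f2 : {rmorphism A -> K2}).
Hypothesis f12 : forall a, f1 a = 0 <-> f2 a = 0.

(* The ring generated by K1 and K2 acting on the translates of a linear functional. *)
Lemma field_amalgam : exists (C : comPzRingType) (g1 : {rmorphism K1 -> C}) (g2 : {rmorphism K2 -> C}),
  (forall a, g1 (f1 a) = g2 (f2 a)) /\ (1 : C) != 0.
Proof.
have [l [l1 lD lA]] := functional f12.
have lB x y : l (x - y) = l x - l y.
  by apply/eqP; rewrite eq_sym subr_eq -lD subrK.
(* The annihilator of [l]. Modulo it [f1 a] and [f2 a] act alike by linearity, while [1] survives
   because [l 1 = 1]. *)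
pose J : set oper := fun T => forall x, ofn T l x = 0.
have HJ : is_ideal J.
  split=> [//|T U JT JU x|T U JU x]; first by rewrite /= JT JU addr0.
  have U0 : ofn U l = fun=> 0 by apply/funext.
  rewrite /= U0; have [s ->] := ofnP T; rewrite /opf big1 // => u _; exact: mulr0.
pose C : comPzRingType := quot HJ.
pose o1 (a : K1) : oper := Oper (ex_intro _ [:: (1, a)] erefl).
pose o2 (b : K2) : oper := Oper (ex_intro _ [:: (b, 1)] erefl).
have o1E a phi x : ofn (o1 a) phi x = phi (a * x) by rewrite /= /opf big_seq1 mul1r.
have o2E b phi x : ofn (o2 b) phi x = b * phi x by rewrite /= /opf big_seq1 /= mul1r.
have BE (T U V : oper) x : ofn (T - (U - V)) l x = ofn T l x - (ofn U l x - ofn V l x) by [].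
have z1 : zmod_morphism (fun a => qpi HJ (o1 a) : C).
  move=> a b; rewrite -rmorphB; apply/(qpi_eq HJ) => x; rewrite BE !o1E mulrBl lB subrr //.
have z2 : zmod_morphism (fun a => qpi HJ (o2 a) : C).
  move=> a b; rewrite -rmorphB; apply/(qpi_eq HJ) => x; rewrite BE !o2E mulrBl subrr //.
have m1 : monoid_morphism (fun a => qpi HJ (o1 a) : C).
  split=> [|a b]; first by congr qpi; apply: oper_eq => phi x; rewrite o1E mul1r.
  rewrite -rmorphM; congr qpi; apply: oper_eq => phi x.
  by rewrite o1E [RHS]o1E o1E mulrA [b * a]mulrC.
have m2 : monoid_morphism (fun a => qpi HJ (o2 a) : C).
  split=> [|a b]; first by congr qpi; apply: oper_eq => phi x; rewrite o2E mul1r.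
  rewrite -rmorphM; congr qpi; apply: oper_eq => phi x.
  by rewrite o2E [RHS]o2E o2E mulrA.
exists C, (HB.pack_for {rmorphism K1 -> C} (fun a => qpi HJ (o1 a) : C)
    (GRing.isZmodMorphism.Build K1 C _ z1) (GRing.isMonoidMorphism.Build K1 C _ m1)).
exists (HB.pack_for {rmorphism K2 -> C} (fun a => qpi HJ (o2 a) : C)
    (GRing.isZmodMorphism.Build K2 C _ z2) (GRing.isMonoidMorphism.Build K2 C _ m2)).
split=> [a /=|]; first by apply/(qpi_eq HJ) => x; rewrite -[LHS]/(ofn (o1 _) l x - ofn (o2 _) l x) o1E o2E lA subrr.
apply/eqP; rewrite -(rmorph1 (qpi HJ)) => /qpi0 /(_ 1); rewrite -[LHS]/(l 1) l1.
by move/eqP; rewrite oner_eq0.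
Qed.
End Operators.

Lemma prime_amalgam (A B1 B2 : comPzRingType) (v1 : {rmorphism A -> B1}) (v2 : {rmorphism A -> B2})
    (Q1 : set B1) (Q2 : set B2) : prime_ideal Q1 -> prime_ideal Q2 ->
  (forall a, Q1 (v1 a) <-> Q2 (v2 a)) ->
  exists (C : comPzRingType) (g1 : {rmorphism B1 -> C}) (g2 : {rmorphism B2 -> C}) (T : set C),
  [/\ prime_ideal T, forall a, g1 (v1 a) = g2 (v2 a),
      (forall b, Q1 b -> g1 b = 0) /\ (forall b, Q2 b -> g2 b = 0)
    & (forall b, T (g1 b) -> Q1 b) /\ (forall b, T (g2 b) -> Q2 b)].
Proof.
move=> pQ1 pQ2 Q12; have [K1 [h1 h1E]] := residue_field pQ1.
have [K2 [h2 h2E]] := residue_field pQ2.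
have [|C [g1 [g2 [gv C1]]]] := @field_amalgam K1 K2 A (h1 \o v1) (h2 \o v2).
  by move=> a /=; rewrite h1E h2E.
have [|T [pT _]] := prime_ex (zero_ideal C); first by move/eqP: C1.
have [HT T1 _] := pT.
have unit (K : fieldType) (g : {rmorphism K -> C}) x : T (g x) -> x = 0.
  move=> Tx; apply: contrapT => /eqP x0; apply: T1.
  by rewrite -(rmorph1 g) -(divff x0) rmorphM; apply: idealMr.
exists C, (g1 \o h1), (g2 \o h2), T; split=> //; split=> b /=.
- by move=> /h1E ->; rewrite rmorph0.
- by move=> /h2E ->; rewrite rmorph0.
- by move=> /unit/h1E.
- by move=> /unit/h2E.
Qed.

(** Some piece does not see [P] generate the unit ideal. By flatness no element outside [P] maps
    into the extended ideal there, so a prime above that ideal avoiding these images contracts to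
    [P]; it contains the ideal of definition because the cover is adic. *)
Lemma cover_prime (L : comPzRingType) (I : set L) (A : calg I) N (B : 'I_N -> calg I)
    (v : forall i, chom A (B i)) (P : set A) : fppf_cover v -> prime_ideal P ->
  (forall x, ca_ideal A x -> P x) -> exists i (Q : set (B i)),
  [/\ prime_ideal Q, forall x, ca_ideal (B i) x -> Q x & forall a, Q (v i a) <-> P a].
Proof.
move=> [adic flat _ ff] pP JP; have [HP P1 PM] := pP; have HJ := ca_idealP A.
have JP1 : (idl_pow (ca_ideal A) 1 `<=` P)%classic by move=> x /(idl_pow1 _ HJ)/JP.
have [i nI] := ff P 1%N HP JP1 P1; exists i; set I0 := idl (v i @` P)%classic in nI.
have HI0 : is_ideal I0 by apply: idl_is_ideal.
have ext0 y : idl (v i @` idl_pow (ca_ideal A) 1)%classic y -> I0 y.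
  have sub : (v i @` idl_pow (ca_ideal A) 1 `<=` I0)%classic.
    by move=> _ [x /JP1 Px <-]; apply: sub_idl; exists x.
  exact: (idl_sub HI0 sub).
have [|x y [a [Pa ->]] [b [Pb ->]]|x I0x [a [nPa xE]]|Q [pQ I0Q QM]] :=
    @prime_avoid (B i) I0 (fun y => exists a, ~ P a /\ y = v i a) HI0.
- by exists 1; rewrite rmorph1.
- by exists (a * b); rewrite rmorphM; split=> //; case/PM.
- have [M [r [g [gP E]]]] := I0x.
  have gP' k : exists x, P x /\ g k = v i x by have [z Pz <-] := gP k; exists z.
  have [q qP] := choice gP'.
  (* The relation between [a], at index zero with coefficient [1], and the [q_k] in [P]. The
     equational criterion writes [1] through coefficients [c] with [a c] in [P], so [c] lies in
     [P]. *)
  pose aa (k : 'I_M.+1) := oapp (fun k => - q k) a (unlift ord0 k).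
  pose bb (k : 'I_M.+1) := oapp r 1 (unlift ord0 k).
  have [|M' [c [d [H1 H2]]]] := flat i 1%N M.+1 aa bb.
    rewrite big_ord_recl /aa /bb unlift_none /= mulr1 -xE E -big_split big1.
      exact: (ideal0 (idl_is_ideal _)).
    move=> k _; rewrite liftK /= rmorphN mulNr; have [_ ->] := qP k.
    by rewrite [r k * _]mulrC subrr.
  have c0 k : P (c ord0 k).
    have [//|//] : P a \/ P (c ord0 k); apply: PM.
    have := JP1 _ (H2 k); rewrite big_ord_recl /aa unlift_none /= => Ps.
    rewrite -[a * _](addrK (\sum_(l < M) oapp (fun k => - q k) a (unlift ord0 (lift ord0 l)) * c (lift ord0 l) k)).
    apply: (idealB HP) => //; apply: (ideal_sum HP) => l _; rewrite liftK /=.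
    by rewrite mulNr; apply: (idealN HP); apply: (idealMr HP); have [] := qP l.
  apply: nI; have := ext0 _ (H1 ord0); rewrite /bb unlift_none /= => I1.
  rewrite -[1](subrK (\sum_k v i (c ord0 k) * d k)); apply: (idealD HI0) => //.
  apply: (ideal_sum HI0) => k _; apply: (idealMr HI0); apply: sub_idl.
  by exists (c ord0 k).
exists Q; split=> // [x Jx|a].
  have [a aE] := adic i; apply: (prime_exp (m := a) pQ); apply/I0Q/ext0/aE; exact: idl_powX.
split=> [Qa|Pa]; last by apply: I0Q; apply: sub_idl; exists a.
by apply: contrapT => nPa; apply: QM Qa _; exists a.
Qed.

Record submodule (R : comPzRingType) (V : lmodType R) := Submodule {
  sm_set :> set V;
  sm0 : sm_set 0;
  smD : forall x y, sm_set x -> sm_set y -> sm_set (x + y);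
  smZ : forall c x, sm_set x -> sm_set (c *: x) }.

Section QuotientModule.
Context (R : comPzRingType) (V : lmodType R) (Ns : submodule V).
Notation N := (sm_set Ns).
Let N0 : N 0 := sm0 Ns.
Let ND := @smD R V Ns.
Let NZ := @smZ R V Ns.

Let NN x : N x -> N (- x). Proof. by move=> Nx; rewrite -scaleN1r; apply: NZ. Qed.
(** A representative chosen by a predicate that depends only on the coset; the quotient module
    consists of these representatives. *)
Definition ncan (x : V) : V := xget 0 [set y | N (x - y)]%classic.

Lemma ncanP x : N (x - ncan x).
Proof. by rewrite /ncan; case: xgetP => [y -> //|/(_ x)[]]; rewrite /= subrr. Qed.

Lemma ncan_eq x y : ncan x = ncan y <-> N (x - y).
Proof.
split=> [e|Nxy].
  have -> : x - y = (x - ncan x) - (y - ncan y) by rewrite e opprB addrA subrK.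
  by apply: ND (ncanP x) (NN (ncanP y)).
congr xget; apply/funext => z; apply/propext; split=> /= H.
  by have -> : y - z = - (x - y) + (x - z) by [rewrite opprB addrA subrK]; apply: ND => //; apply: NN.
by have -> : x - z = (x - y) + (y - z) by [rewrite addrA subrK]; apply: ND.
Qed.

Record qmod := QMod { qm : V; qmP : ncan qm = qm }.
Definition qmk x := QMod ((ncan_eq (ncan x) x).2
  (eq_ind _ N (NN (ncanP x)) _ (opprB x (ncan x)))).

Lemma qm_inj : injective qm.
Proof. by case=> x xP [y yP] /= e; subst y; rewrite (Prop_irrelevance xP yP). Qed.
Lemma qmkE x y : qmk x = qmk y <-> N (x - y).
Proof. by rewrite -ncan_eq; split=> [[]|e]; [|apply: qm_inj]. Qed.
Lemma qmkK p : qmk (qm p) = p. Proof. by apply: qm_inj; apply: qmP. Qed.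
Lemma qmN x : N (qm (qmk x) - x). Proof. by rewrite -opprB; apply/NN/ncanP. Qed.

HB.instance Definition _ := gen_eqMixin qmod.
HB.instance Definition _ := gen_choiceMixin qmod.

Let add p q := qmk (qm p + qm q).
Let opp p := qmk (- qm p).
Let scale c p := qmk (c *: qm p).
Let addE x y : add (qmk x) (qmk y) = qmk (x + y).
Proof. by apply/qmkE; rewrite opprD addrACA; apply: ND; apply: qmN. Qed.
Let oppE x : opp (qmk x) = qmk (- x).
Proof. by apply/qmkE; rewrite -opprD; apply/NN/qmN. Qed.
Let scaleE c x : scale c (qmk x) = qmk (c *: x).
Proof. by apply/qmkE; rewrite -scalerBr; apply/NZ/qmN. Qed.
Let addA : associative add.
Proof. by move=> p q r; rewrite -(qmkK p) -(qmkK q) -(qmkK r) !addE addrA. Qed.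
Let addC : commutative add.
Proof. by move=> p q; rewrite -(qmkK p) -(qmkK q) !addE addrC. Qed.
Let add0 : left_id (qmk 0) add. Proof. by move=> p; rewrite -(qmkK p) addE add0r. Qed.
Let addN : left_inverse (qmk 0) opp add.
Proof. by move=> p; rewrite -(qmkK p) oppE addE addNr. Qed.
HB.instance Definition _ := GRing.isZmodule.Build qmod addA addC add0 addN.

Let scA a b p : scale a (scale b p) = scale (a * b) p.
Proof. by rewrite -(qmkK p) !scaleE scalerA. Qed.
Let sc1 : left_id 1 scale. Proof. by move=> p; rewrite -(qmkK p) scaleE scale1r. Qed.
Let scDr : right_distributive scale +%R.
Proof. by move=> c p q; rewrite -(qmkK p) -(qmkK q) [_ + _]addE !scaleE [RHS]addE scalerDr. Qed.
Let scDl p : {morph scale^~ p : a b / a + b}.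
Proof. by move=> a b; rewrite -(qmkK p) !scaleE [RHS]addE scalerDl. Qed.
HB.instance Definition _ := GRing.Zmodule_isLmodule.Build R qmod scA sc1 scDr scDl.

Lemma qmkD x y : qmk (x + y) = qmk x + qmk y. Proof. exact/esym/addE. Qed.
Lemma qmkZ c x : qmk (c *: x) = c *: qmk x. Proof. exact/esym/scaleE. Qed.
Lemma qmk0 x : qmk x = 0 <-> N x. Proof. by rewrite -[0]/(qmk 0) qmkE subr0. Qed.
End QuotientModule.

From mathcomp Require Import functions.

Module ScaledRow.
Section ScaledRows.
Context (Z Qp : comPzRingType) (iQ : {rmorphism Z -> Qp}) (h : nat).
(** [Q_p^h] as a [Z]-module through [iQ], on a separate type because rows already carry their
    scaling by [Qp]. *)
Definition scaled_row : Type := 'rV[Qp]_h.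
HB.instance Definition _ := GRing.Zmodule.on scaled_row.
Let sc (z : Z) (w : scaled_row) : scaled_row := iQ z *: (w : 'rV[Qp]_h).
Let scA a b w : sc a (sc b w) = sc (a * b) w.
Proof. by rewrite /sc scalerA rmorphM. Qed.
Let sc1 : left_id 1 sc. Proof. by move=> w; rewrite /sc rmorph1 scale1r. Qed.
Let scDr : right_distributive sc +%R. Proof. by move=> c w w'; apply: scalerDr. Qed.
Let scDl w : {morph sc^~ w : a b / a + b}.
Proof. by move=> a b; rewrite /sc rmorphD scalerDl. Qed.
HB.instance Definition _ := GRing.Zmodule_isLmodule.Build Z scaled_row scA sc1 scDr scDl.

Definition lattice : set scaled_row := fun w => exists v, w = map_mx iQ v.
Lemma lattice0 : lattice 0. Proof. by exists 0; rewrite map_mx0. Qed.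
Lemma latticeD x y : lattice x -> lattice y -> lattice (x + y).
Proof. by move=> [v ->] [w ->]; exists (v + w); rewrite map_mxD. Qed.
Lemma latticeZ c x : lattice x -> lattice (c *: x).
Proof. by move=> [v ->]; exists (c *: v); rewrite map_mxZ. Qed.
End ScaledRows.
End ScaledRow.
Import ScaledRow.

(** * The sheaf of functions on primes *)

Section TestSheaf.
Context (L : comPzRingType) (I : set L) (R0 : calg I) (Z : comPzRingType) (M : lmodType Z).

Definition spec (A : calg I) := {P : set A | prime_ideal P /\ forall x, ca_ideal A x -> P x}.

Lemma spec_eq (A : calg I) (P Q : spec A) : (forall a, sval P a <-> sval Q a) -> P = Q.
Proof.
case: P Q => [P HP] [Q HQ] /= E; have e : P = Q by apply/funext => a; apply/propext.
by subst Q; rewrite (Prop_irrelevance HP HQ).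
Qed.

Lemma pull_subproof (A B : calg I) (u : chom A B) (Q : spec B) :
  prime_ideal (fun a => sval Q (u a)) /\ forall x, ca_ideal A x -> sval Q (u x).
Proof.
case: Q => Q [pQ QJ] /=; have [HQ Q1 QM] := pQ; split; first split.
- split=> [|x y Qx Qy|r x Qx]; first by rewrite rmorph0; apply: ideal0.
    by rewrite rmorphD; apply: idealD.
  by rewrite rmorphM; apply: idealMl.
- by rewrite rmorph1.
- by move=> x y; rewrite rmorphM; apply: QM.
move=> x Jx; have [a ua] := ch_cont u; apply: (prime_exp (m := a) pQ).
by rewrite -rmorphXn; apply/QJ/ua/idl_powX.
Qed.
Definition pull (A B : calg I) (u : chom A B) (Q : spec B) : spec A :=
  exist _ _ (pull_subproof u Q).

Definition tsec (A : Defs.over R0) : lmodType Z := (spec A -> M)%type.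
Section Res.
Context (A B : Defs.over R0) (u : ohom A B).
Definition tres (t : tsec A) : tsec B := fun Q => t (pull u Q).
Lemma tres_linear : linear tres. Proof. by []. Qed.
HB.instance Definition _ := GRing.isLinear.Build Z (tsec A) (tsec B) *:%R tres tres_linear.
Definition tresl : {linear tsec A -> tsec B} := tres.
End Res.

Lemma tres_id (A : Defs.over R0) (u : ohom A A) : u =1 id -> tresl u =1 id.
Proof.
move=> ui t; apply/funext => Q; congr (t _); apply: spec_eq => a /=.
by rewrite ui.
Qed.

Lemma tres_comp (A B C : Defs.over R0) (u : ohom A B) (v : ohom B C) (w : ohom A C) :
  w =1 v \o u -> tresl w =1 tresl v \o tresl u.
Proof.
move=> wE t; apply/funext => Q; congr (t _); apply: spec_eq => a /=.
by rewrite wE.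
Qed.

Lemma tglue (A : Defs.over R0) N (B : 'I_N -> Defs.over R0) (v : forall i, ohom A (B i)) :
  fppf_cover v -> forall x : forall i, tsec (B i),
  (forall i j (C : Defs.over R0) (g : ohom (B i) C) (h : ohom (B j) C),
     (forall a, g (v i a) = h (v j a)) -> tresl g (x i) = tresl h (x j)) ->
  exists! y : tsec A, forall i, tresl (v i) y = x i.
Proof.
move=> cov x xx.
have lift (P : spec A) : exists iQ : {i & spec (B i)}, pull (v _) (projT2 iQ) = P.
  have [pP PJ] := svalP P.
  have [i [Q [pQ QJ QP]]] := cover_prime cov pP PJ.
  by exists (existT _ i (exist _ Q (conj pQ QJ))); apply: spec_eq.
have [l lP] := choice lift.
(* Primes over the same prime of [A] are pulled back from one prime of a discrete common algebra,
   where the given sections agree. *)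
have key i j (Q : spec (B i)) (Q' : spec (B j)) : pull (v i) Q = pull (v j) Q' -> x i Q = x j Q'.
  move=> E; have [[pQ QJ] [pQ' QJ']] := (svalP Q, svalP Q').
  have QQ a : sval Q (v i a) <-> sval Q' (v j a).
    by rewrite -[sval Q _]/(sval (pull (v i) Q) a) E.
  have [C [g [g' [T [pT gv [g0 g0'] [gT gT']]]]]] := prime_amalgam pQ pQ' QQ.
  have gI c : I c -> (g \o ca_map (B i)) c = 0.
    by move=> Ic; apply/g0/QJ/ca_sub.
  pose Cc : calg I := @CAlg _ _ C (g \o ca_map (B i)) _ (zero_ideal C) gI (zero_complete C).
  have gc : exists a, forall y, idl_pow (ca_ideal (B i)) a y -> ca_ideal Cc (g y).
    by exists 1%N => y /(idl_pow1 _ (ca_idealP (B i)))/QJ/g0.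
  have gc' : exists a, forall y, idl_pow (ca_ideal (B j)) a y -> ca_ideal Cc (g' y).
    by exists 1%N => y /(idl_pow1 _ (ca_idealP (B j)))/QJ'/g0'.
  have gl' c : g' (ca_map (B j) c) = ca_map Cc c.
    by rewrite /= -(ch_lin (v j)) -gv ch_lin.
  pose gC : chom (B i) Cc := @CHom _ _ (B i) Cc g (fun c => erefl) gc.
  pose gC' : chom (B j) Cc := @CHom _ _ (B j) Cc g' gl' gc'.
  pose Co : Defs.over R0 := Over (ch_comp gC (ov_map (B i))).
  have oc' s : gC' (ov_map (B j) s) = ov_map Co s.
    by rewrite /= -!(oh_comm (v _)) gv.
  pose go : ohom (B i) Co := @OHom _ _ _ (B i) Co gC (fun s => erefl).
  pose go' : ohom (B j) Co := @OHom _ _ _ (B j) Co gC' oc'.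
  have [HT _ _] := pT.
  have TJ (y : Cc) : ca_ideal Cc y -> T y by move=> ->; apply: ideal0.
  pose Ts : spec Co := exist _ T (conj pT TJ).
  have := congr1 (fun f => f Ts) (xx i j Co go go' gv).
  rewrite /= /tres (_ : pull go Ts = Q); last first.
    by apply: spec_eq => a; split=> [/gT|Qa] //; exact (TJ _ (g0 a Qa)).
  rewrite (_ : pull go' Ts = Q') //.
  by apply: spec_eq => a; split=> [/gT'|Qa] //; exact (TJ _ (g0' a Qa)).
exists (fun P => x _ (projT2 (l P))); split.
  by move=> i; apply/funext => Q; apply: key; rewrite lP.
by move=> y yE; apply/funext => P; rewrite -yE /= /tres lP.
Qed.

Definition test_sheaf : zp_sheaf Z R0 := ZpSheaf tres_id tres_comp tglue.
End TestSheaf.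

Section Converse.
Context (S : lts) (Z : zpring (st_p S)).
Notation p := (st_p S).
Notation L := (st_L S).
Notation iota := (st_iota S).
Notation F := (st_F S).
Notation I := (Lt_ideal (st_p S) (st_t S) (st_iota S)).
Notation h := (st_n S - st_t S)%N.
Context (Qp : comPzRingType) (iQ : {rmorphism Z -> Qp}).
Hypothesis hQp : is_localization [set (p%:R : Z)]%classic iQ.
Context (R0 : calg I) (s : sys R0).

(** The digits are compared modulo [p^(m+j)], the extra [m] absorbing a possible kernel of [iQ]. *)
Lemma lattice_frac j (c : 'I_h -> 'I_(p ^ j)) (w : 'rV[Qp]_h) :
  p%:R ^+ j *: w = map_mx iQ (\row_i (c i : nat)%:R) -> lattice iQ w -> forall i, c i = 0%N :> nat.
Proof.
move=> wc [v wv] i; have p0 : (0 < p)%N by rewrite prime_gt0 ?st_prime.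
have /(Qp_tor hQp)[m mE] : iQ ((c i : nat)%:R - p%:R ^+ j * v 0 i) = 0.
  have := congr1 (fun x : 'rV_h => x 0 i) wc; rewrite wv !mxE rmorphB rmorphM rmorphXn.
  by rewrite !rmorph_nat => ->; rewrite subrr.
have : (p ^ m * c i = 0 %[mod p ^ (m + j)])%N.
  apply: (@zp_inj p Z _ _ _ (v 0 i)); rewrite add0r natrM natrX exprD -mulrA.
  by apply/eqP; rewrite -subr_eq0 -mulrBr mE.
rewrite mod0n => /eqP; rewrite -/(dvdn _ _) expnD dvdn_pmul2l ?expn_gt0 ?p0 //.
by move=> /eqP; rewrite modn_small.
Qed.

Lemma pushout_nondeg : sheaf_pushout (fpm Z s) (gpm hQp s) (fun _ v => map_mx iQ v)
  (fun (A : Defs.over R0) => @G0_incl p _ L I iota F A) -> nondeg s.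
Proof.
move=> [_ univ] j c j0 [i0 ci0]; set P := spt s j c.
have HJ := ca_idealP R0; pose B1 : comPzRingType := quot HJ.
pose f : {rmorphism R0 -> B1} := qpi HJ.
have fJ x : ca_ideal R0 x -> f x = 0 by move=> Jx; apply/qpi0.
have [k Pk] := gp_tors P 1%N; have fk := red_tor fJ Pk.
(* [ev] is delta of [P] modulo [J]. If [1 - ev] is a unit modulo [J], so is the coordinate, which
   divides it there. Otherwise the quotient of [R0] by [J] and [1 - ev] is nonzero, and [P] lies in
   [GG_0] over it. *)
pose ev := pev (ca_map R0) (P 'x_tt) (dpoly S k).
have HK := add_gen_ideal (1 - ev) HJ.
have [|K1] := pselect (add_gen (ca_ideal R0) (1 - ev) 1).
  move=> [a [w [Ja E1]]]; have [x xE] := del_compl k (red fJ P).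
  have [x' x'E] := qpi_surj x; apply: (complete_unit HJ (ca_complete R0) (y := x' * w)).
  apply/(qpi_eq HJ); rewrite -/f [in RHS]E1 rmorphD (fJ a Ja) add0r !rmorphM rmorphB rmorph1.
  by rewrite /ev -(red_del fJ) xE x'E mulrA.
pose C : comPzRingType := quot HK; pose g : {rmorphism R0 -> C} := qpi HK.
have gJ x : ca_ideal R0 x -> g x = 0.
  by move=> Jx; apply/qpi0; exists x, 0; rewrite mulr0 addr0.
have gI x : I x -> (g \o ca_map R0) x = 0 by move=> Ix; apply/gJ/ca_sub.
pose A0 : calg I := @CAlg _ _ C (g \o ca_map R0) _ (zero_ideal C) gI (zero_complete C).
have gc : exists a, forall x, idl_pow (ca_ideal R0) a x -> ca_ideal A0 (g x).
  by exists 1%N => x /(idl_pow1 _ HJ)/gJ.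
pose u : chom R0 A0 := @CHom _ _ R0 A0 g (fun x => erefl) gc.
pose Ao : Defs.over R0 := Over u.
have Pk' : red gJ P *+ (p ^ k) = 0 by apply: red_tor.
have [|Q [QP _]] := del1_incl (j := k) Pk'.
  rewrite red_del -/ev; apply/esym/eqP; rewrite -(rmorph1 g) -subr_eq0 -rmorphB.
  apply/eqP/qpi0; exists 0, 1; rewrite mulr1 add0r; split=> //; exact: ideal0.
pose Q0 : PL Ao := Q.
have QE : gincl Q0 = resE u P by apply: gpt_eq => x; rewrite -[LHS]/(gincl Q x) QP.
have [v vE] := Qp_inv hQp.
pose w : 'rV[Qp]_h := v ^+ j *: map_mx iQ (\row_i (c i : nat)%:R).
have wE : p%:R ^+ j *: w = map_mx iQ (\row_i (c i : nat)%:R).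
  by rewrite scalerA -exprMn vE expr1n scale1r.
pose Ns := Submodule (lattice0 iQ h) (@latticeD _ _ iQ h) (@latticeZ _ _ iQ h).
pose M := qmod Ns.
pose T := @test_sheaf L I R0 Z M.
pose mk (x : 'rV[Qp]_h) : M := qmk Ns x.
have a_add (A : Defs.over R0) (x y : sec (G0_psh p Z iota F R0) A) :
    0 = padd (p := sheaf_psh T) 0 0 :> sec (sheaf_psh T) A by rewrite [RHS]addr0.
have a_sc (A : Defs.over R0) (z : Z) (x : sec (G0_psh p Z iota F R0) A) :
    0 = Defs.pscale (p := sheaf_psh T) z 0 :> sec (sheaf_psh T) A by rewrite [RHS]scaler0.
(* Zero on [GG_0] and the class modulo the lattice on [Q_p^h] agree on [Z_p^h], so the pushout
   property forces the class of [c/p^j] to vanish. *)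
pose a : pmor (G0_psh p Z iota F R0) (sheaf_psh T) :=
  @PMor _ _ _ _ (G0_psh p Z iota F R0) (sheaf_psh T)
    (fun (A : Defs.over R0) _ => 0 : sec (sheaf_psh T) A) a_add a_sc (fun A B w x => erefl).
have b_add (A : Defs.over R0) (x y : sec (QpH_psh iQ h R0) A) :
    (fun=> mk (x + y)) = padd (p := sheaf_psh T) (fun=> mk x) (fun=> mk y) :> sec (sheaf_psh T) A.
  by apply/funext => q; apply: qmkD.
have b_sc (A : Defs.over R0) (z : Z) (x : sec (QpH_psh iQ h R0) A) :
    (fun=> mk (iQ z *: x)) = Defs.pscale (p := sheaf_psh T) z (fun=> mk x) :> sec (sheaf_psh T) A.
  by apply/funext => q; apply: (@qmkZ Z _ Ns).
pose b : pmor (QpH_psh iQ h R0) (sheaf_psh T) :=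
  @PMor _ _ _ _ (QpH_psh iQ h R0) (sheaf_psh T)
    (fun (A : Defs.over R0) (x : sec (QpH_psh iQ h R0) A) => (fun=> mk x) : sec (sheaf_psh T) A) b_add b_sc (fun A B w x => erefl).
have [|d [da db] _] := univ T a b.
  by move=> A x; apply/funext => q; apply/esym/qmk0; exists x.
have E : b Ao w = a Ao (ofL Q0).
  rewrite -db -da; congr (d Ao _); apply: toE_inj; rewrite toE_incl ofLK ofEK QE.
  by rewrite (sg_spt hQp _ wE) spt_res.
have [|q [pq _]] := prime_ex (zero_ideal C); first by move=> C1; apply: K1; apply/(qpi0 HK); rewrite rmorph1.
have qJ x : ca_ideal A0 x -> q x by case: pq => Hq _ _ ->; apply: ideal0.
have /qmk0 := congr1 (fun t => t (exist _ q (conj pq qJ) : spec A0)) E.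
by move=> /(lattice_frac wE)/(_ i0) c0; rewrite c0 in ci0.
Qed.
End Converse.

Lemma pmor_eq (L : comPzRingType) (I : set L) (Z : comPzRingType) (R0 : calg I)
  (P Q : psh Z R0) (f g : pmor P Q) : (forall A x, f A x = g A x) -> f = g.
Proof.
case: f g => [f f1 f2 f3] [g g1 g2 g3] /= fg.
have e : f = g by apply: functional_extensionality_dep => A; apply/funext => x.
by subst g; rewrite (Prop_irrelevance f1 g1) (Prop_irrelevance f2 g2) (Prop_irrelevance f3 g3).
Qed.

Lemma chom_eq (L : comPzRingType) (I : set L) (A B : calg I) (u v : chom A B) : u =1 v -> u = v.
Proof.
case: u v => [u u1 u2] [v v1 v2] /= /rmorph_eq e; subst v.
by rewrite (Prop_irrelevance u1 v1) (Prop_irrelevance u2 v2).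
Qed.

(** * Representability *)

Section Classification.
Context (S : lts) (Z : zpring (st_p S)).
Notation p := (st_p S).
Notation L := (st_L S).
Notation iota := (st_iota S).
Notation F := (st_F S).
Notation I := (Lt_ideal (st_p S) (st_t S) (st_iota S)).
Notation h := (st_n S - st_t S)%N.
Context (Qp : comPzRingType) (iQ : {rmorphism Z -> Qp}).
Hypothesis hQp : is_localization [set (p%:R : Z)]%classic iQ.
Notation iso R0 := (@iso_under p Z Qp iQ h _ L I iota F R0).

Lemma iso_eq (R0 : calg I) (x y : iso R0) : iu_f x = iu_f y -> iu_g x = iu_g y -> x = y.
Proof.
case: x y => [f g H] [f' g' H'] /= ef eg; subst f' g'.
by rewrite (Prop_irrelevance H H').
Qed.

Let pV : exists v : Qp, p%:R * v = 1 := Qp_inv hQp.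
Let v : Qp := projT1 (cid pV).
Let vE : p%:R * v = 1 := projT2 (cid pV).
Notation wv k i := (v ^+ k *: delta_mx 0 i : 'rV[Qp]_h).

Lemma wv_lattice k i : p%:R ^+ k *: wv k i = map_mx iQ (delta_mx 0 i).
Proof. by rewrite scalerA -exprMn vE expr1n scale1r map_delta_mx. Qed.

Lemma sg_basis (A : calg I) (s : sys A) k i : sg hQp s (wv k i) = sa s k i.
Proof.
rewrite (sgE hQp s (wv_lattice k i)) /sg_at (bigD1 i) //= mxE !eqxx zscale1.
rewrite big1 ?addr0 // => l li; rewrite mxE (negPf li) andbF.
exact: (@zscale_nat (GE S) Z (cc A) _ 0).
Qed.

Section One.
Context (R0 : calg I) (th : iso R0).
Let f := iu_f th.
Let g := iu_g th.
(** [R0] is initial among its algebras, so maps from constant presheaves are determined by their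
    values there. *)
Let O0 : Defs.over R0 := Over (cid_hom R0).
Let uA (A : Defs.over R0) : ohom O0 A := @OHom _ _ _ O0 A (ov_map A) (fun x => erefl).
Let ff (A : Defs.over R0) (x : 'rV[Z]_h) : PL A := toL (f A x).
Let gg (A : Defs.over R0) (w : 'rV[Qp]_h) : PE A := toE (g A w).

Let ffD A x y : ff A (x + y) = ff A x + ff A y.
Proof. by rewrite /ff -toL_add; congr toL; apply: (pm_add f). Qed.
Let ggD A x y : gg A (x + y) = gg A x + gg A y.
Proof. by rewrite /gg -toE_add; congr toE; apply: (pm_add g). Qed.
Let ffZ A (z : Z) x : ff A (z *: x) = @zscale (GL S) Z _ _ z (ff A x).
Proof. by rewrite /ff -toL_scale; congr toL; apply: (pm_scale f). Qed.
Let ggZ A (z : Z) x : gg A (iQ z *: x) = @zscale (GE S) Z _ _ z (gg A x).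
Proof. by rewrite /gg -toE_scale; congr toE; apply: (pm_scale g). Qed.
Let ff0 A : ff A 0 = 0. Proof. by apply: (addrI (ff A 0)); rewrite -ffD !addr0. Qed.
Let gg0 A : gg A 0 = 0. Proof. by apply: (addrI (gg A 0)); rewrite -ggD !addr0. Qed.
Let ff_res A x : ff A x = resL (ov_map A) (ff O0 x).
Proof. by rewrite /ff -toL_res; congr toL; apply: (pm_res f (uA A)). Qed.
Let gg_res A x : gg A x = resE (ov_map A) (gg O0 x).
Proof. by rewrite /gg -toE_res; congr toE; apply: (pm_res g (uA A)). Qed.
Let fg x : gincl (ff O0 x) = gg O0 (map_mx iQ x).
Proof. by rewrite /ff -toE_incl; congr toE; have [H _] := iu_pushout th; apply: H. Qed.

Let q i : PL R0 := ff O0 (delta_mx 0 i).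
Let a k i : PE R0 := gg O0 (wv k i).
Let a0 i : a 0 i = gincl (q i).
Proof. by rewrite /q [RHS]fg map_delta_mx /a expr0 scale1r. Qed.
Let aS k i : a k.+1 i *+ p = a k i.
Proof.
apply: etrans (esym (@zscale_nat (GE S) Z (cc R0) (rE (caL R0)) p (a k.+1 i))) _.
apply: etrans (esym (ggZ O0 p%:R (wv k.+1 i))) _.
by congr (gg O0 _); rewrite rmorph_nat scalerA exprS mulrA vE mul1r.
Qed.
Definition iso_sys : sys R0 := Sys a0 aS.

(** Every row is a combination of the [b_i / p^k] with coefficients from [Z], so linearity recovers
    both maps from the values that define the system. *)
Lemma iso_sysE : iu_f th = fpm Z iso_sys /\ iu_g th = gpm hQp iso_sys.
Proof.
split; apply: pmor_eq => A x.
  apply: toL_inj; rewrite ofLK -[LHS]/(ff A x) {1}[x in ff A x](row_sum_delta (x : 'rV[Z]_h)).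
  rewrite (big_morph _ (ffD A) (ff0 A)); apply: eq_bigr => i _.
  by rewrite ffZ; congr zscale; apply: ff_res.
apply: toE_inj; rewrite ofEK -[LHS]/(gg A x).
have [k [u wu]] := Qp_denom hQp (x : 'rV[Qp]_h).
rewrite (sgE hQp _ wu) /sg_at.
have {1}-> : x = \sum_i iQ (u 0 i) *: wv k i :> 'rV[Qp]_h.
  apply: (Qp_inj hQp (k := k)); rewrite wu scaler_sumr [in LHS](row_sum_delta u).
  rewrite raddf_sum; apply: eq_bigr => i _ /=.
  by rewrite map_mxZ -(wv_lattice k i) [RHS]scalerA [_ * iQ _]mulrC -scalerA.
rewrite (big_morph _ (ggD A) (gg0 A)); apply: eq_bigr => i _.
by rewrite ggZ; congr zscale; apply: gg_res.
Qed.

Lemma iso_sys_nondeg : nondeg iso_sys.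
Proof.
by have [ef eg] := iso_sysE; apply: (@pushout_nondeg S Z Qp iQ hQp); rewrite -ef -eg; apply: iu_pushout.
Qed.
End One.

Lemma gpm_inj (R0 : calg I) (s s' : sys R0) : gpm hQp s = gpm hQp s' -> s = s'.
Proof.
move=> E; apply: sys_eq => k i; pose O0 : Defs.over R0 := Over (cid_hom R0).
have H := congr1 (fun g : pmor (QpH_psh iQ h R0) (G_psh p Z iota F R0) => toE (g O0 (wv k i))) E.
rewrite !ofEK !sg_basis in H.
by apply: gpt_eq => x; have := congr1 (fun P : PE R0 => P x) H.
Qed.

Theorem represents (B : calg I) (sB : sys B) : nondeg sB ->
  (forall (A : calg I) (s : sys A), nondeg s -> exists phi : chom B A, sysmap phi sB = s) ->
  (forall (A : calg I) (phi psi : chom B A), sysmap phi sB = sysmap psi sB -> phi =1 psi) ->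
  represents_iso p iQ h iota F B.
Proof.
move=> nB exB unB.
pose eta (A : calg I) (phi : chom B A) : iso A :=
  IsoUnder (nondeg_pushout hQp (nondeg_res phi nB)).
exists eta; split=> [A|A A' psi phi C]; last first.
  have E : sysmap (ov_map C) (sysmap (ch_comp psi phi) sB) =
           sysmap (ov_map (push psi C)) (sysmap phi sB).
    by apply: sys_eq => k i; apply: gpt_eq.
  by split=> x; [rewrite /= /fval E|rewrite /= /gval E].
have inj : injective (@eta A).
  by move=> phi psi E; apply/chom_eq/unB/gpm_inj; exact: (congr1 (@iu_g _ _ _ _ _ _ _ _ _ _ _) E).
(* The pushout property is a proposition, so an isomorphism is determined by its two maps, which the
   system of [th] recovers. *)
have surj (th : iso A) : exists phi, eta A phi = th.
  have [phi E] := exB A _ (iso_sys_nondeg th); exists phi.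
  by have [ef eg] := iso_sysE th; apply: iso_eq; rewrite /= E.
have [inv invP] := choice surj.
exists inv => [phi|th]; last exact: invP.
by apply: inj; rewrite invP.
Qed.
End Classification.

Theorem proposition3p3 (p n t : nat) (p_prime : prime p) (tn : (t < n)%N)
    (k : fieldType) (W : comPzRingType) (pi : {rmorphism W -> k})
    (F : mps bool (LTring n W)) (EF : morava_E_theory p pi F)
    (L : comNzRingType) (iota : {rmorphism LTring n W -> L})
    (hL : is_Lt p t iota)
    (Zp : comPzRingType)
    (hZp : is_completion (idl [set (p%:Z : int)]%classic) (intr : int -> Zp))
    (Qp : comPzRingType) (iQ : {rmorphism Zp -> Qp})
    (hQp : is_localization [set (p%:R : Zp)]%classic iQ)
    (O : nat -> comPzRingType) (oL : forall j, {rmorphism L -> O j})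
    (oE : forall j, {rmorphism mps unit (LTring n W) -> O j})
    (hO : forall j, is_torsion_ring p F iota j (oL j) (oE j))
    (y : forall j, O j)
    (hy : forall j, (0 < j)%N -> et_generator p F iota oL oE (y j))
    (B : calg (Lt_ideal p t iota)) (hB : is_Bt F oL oE y B) :
  represents_iso p iQ (n - t) iota F B.
Proof.
have n0 : (0 < n)%N := leq_ltn_trans (leq0n t) tn.
pose S : lts := @Lts p n t W F L iota p_prime tn (met_fgl EF) (morava_wdiv EF n0)
  (morava_wprep EF n0) (local_wdiv EF tn hL) (local_wprep EF tn hL)
  (local_coef EF tn hL) (local_lead EF tn hL).
have [sB [nB exB unB]] := @Bt_universal S O oL oE hO y hy B hB.
exact: (@represents S (padic p_prime hZp) Qp iQ hQp B sB nB exB unB).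
Qed.
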